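(* For any $s\in\mathbb{R}$, $p,q\in[1,+\infty]$, the formula $$(u,v)\longmapsto\langle u,v\rangle:=\sum_{|j-j'|\leqslant1}\big\langle\dot{\Delta}_ju,\dot{\Delta}_{j'}v\big\rangle_{\mathbb{R}^n}$$ defines a continuous bilinear functional on $\dot{\mathrm{B}}^{s}_{p,q}(\mathbb{R}^n)\times\dot{\mathrm{B}}^{-s}_{p',q'}(\mathbb{R}^n)$. Let $\mathcal{Q}^{-s}_{p',q'}$ be the set of $v\in\mathcal{S}(\mathbb{R}^n)\cap\dot{\mathrm{B}}^{-s}_{p',q'}(\mathbb{R}^n)$ with $\lVert v\rVert_{\dot{\mathrm{B}}^{-s}_{p',q'}(\mathbb{R}^n)}\leqslant1$. If $u\in\mathcal{S}'_h(\mathbb{R}^n)$, then $$\lVert u\rVert_{\dot{\mathrm{B}}^{s}_{p,q}(\mathbb{R}^n)}\sim_{s,p,q}\sup_{v\in\mathcal{Q}^{-s}_{p',q'}}\big|\langle u,v\rangle_{\mathbb{R}^n}\big|.$$ Moreover, the following duality identities hold (on $\mathbb{R}^n$): (i) $\dot{\mathrm{B}}^{s}_{p,q}=(\dot{\mathrm{B}}^{-s}_{p',q'})'$ for $p,q\in(1,+\infty]$, $s<n/p$; (ii) $\dot{\mathrm{B}}^{s}_{p,1}=(\dot{\mathcal{B}}^{-s}_{p',\infty})'$ for $p\in(1,+\infty]$, $s\leqslant n/p$; (iii) $\dot{\mathrm{B}}^{s}_{1,q}=(\dot{\mathrm{B}}^{-s,0}_{\infty,q'})'$ for $q\in(1,+\infty]$,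 $s<n$; (iv) $\dot{\mathrm{B}}^{s}_{1,1}=(\dot{\mathcal{B}}^{-s,0}_{\infty,\infty})'$ for $s\leqslant n$.
   Context: $n\geqslant2$; $p',q'$ are Hölder conjugates. Littlewood–Paley family: fix $\varphi\in\mathrm{C}_c^\infty(\mathbb{R}^n)$ radial, real, non-negative, $\operatorname{supp}\varphi\subset B(0,4/3)$, $\varphi=1$ on $B(0,3/4)$; $\varphi_j(\xi)=\varphi(2^{-j}\xi)$, $\psi_j(\xi)=\varphi_j(\xi/2)-\varphi_j(\xi)$, $\dot{\Delta}_j=\mathcal{F}^{-1}\psi_j\mathcal{F}$, $j\in\mathbb{Z}$. $\mathcal{S}'_h(\mathbb{R}^n)$ is the set of $u\in\mathcal{S}'(\mathbb{R}^n)$ such that for all $\Theta\in\mathrm{C}_c^\infty(\mathbb{R}^n)$, $\lVert\mathcal{F}^{-1}\Theta(\lambda\cdot)\mathcal{F}u\rVert_{\mathrm{L}^\infty}\to0$ as $\lambda\to+\infty$. $\dot{\mathrm{B}}^s_{p,q}(\mathbb{R}^n)$ is the normed space of $u\in\mathcal{S}'_h(\mathbb{R}^n)$ with $\lVert u\rVert_{\dot{\mathrm{B}}^s_{p,q}}=\lVert(2^{js}\lVert\dot{\Delta}_ju\rVert_{\mathrm{L}^p})_{j\in\mathbb{Z}}\rVert_{\ell^q(\mathbb{Z})}<\infty$; $\dot{\mathcal{B}}^{s}_{p,\infty}=\{u\in\dot{\mathrm{B}}^s_{p,\infty}: 2^{js}\lVert\dot{\Delta}_ju\rVert_{\mathrm{L}^p}\to0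 \text{ as }|j|\to\infty\}$; $\dot{\mathrm{B}}^{s,0}_{\infty,q}=\{u\in\dot{\mathrm{B}}^s_{\infty,q}:\dot{\Delta}_ju\in\mathrm{C}^0_0(\mathbb{R}^n)\ \forall j\}$ with $\mathrm{C}^0_0$ the continuous functions vanishing at infinity; $\dot{\mathcal{B}}^{s,0}_{\infty,\infty}=\dot{\mathcal{B}}^{s}_{\infty,\infty}\cap\dot{\mathrm{B}}^{s,0}_{\infty,\infty}$; these subspaces carry the induced norm. $\langle f,g\rangle_{\mathbb{R}^n}=\int fg$ is the (bilinear) distributional pairing. A duality identity $\mathrm{Y}=(\mathrm{X})'$ means that $u\mapsto[v\mapsto\langle u,v\rangle]$, with the pairing of the statement, is a bijection from $\mathrm{Y}$ onto the topological dual of $\mathrm{X}$, with equivalence of norms. $A\sim_{s,p,q}B$ means two-sided inequality up to constants depending only on $s,p,q$ (and $n$). *)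

(* Defs.v *)
From HB Require Import structures.
From mathcomp Require Import all_boot all_order all_algebra.
From mathcomp Require Import complex.
From mathcomp Require Import all_classical all_reals all_analysis.
From mathcomp Require Import measurable_realfun.

Set Implicit Arguments.
Unset Strict Implicit.
Unset Printing Implicit Defensive.

Import Order.TTheory GRing.Theory Num.Theory.
Import numFieldNormedType.Exports.

Local Open Scope classical_set_scope.
Local Open Scope ring_scope.
Local Open Scope complex_scope.

Notation normc := ComplexField.Normc.normc.

(* Built on n-tuples as an iterated product, then transported to row vectors. *)
Section lebesgue_tuple.
Context {R : realType}.
Local Notation mR := (measurableTypeR R).

Definition cons_pair n (x : mR * n.-tuple mR) : n.+1.-tuple mR :=
  [tuple of x.1 :: x.2].

Lemma measurable_cons_pair n : measurable_fun setT (@cons_pair n).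
Proof. exact: measurable_cons. Qed.

Section step.
Context n (mu : {sigma_finite_measure set (n.-tuple mR) -> \bar R}).

Definition lebesgue_cons : set (n.+1.-tuple mR) -> \bar R :=
  pushforward (@lebesgue_measure R \x mu)%E (@cons_pair n).

Let lebesgue_cons0 : lebesgue_cons set0 = 0%E.
Proof. by rewrite /lebesgue_cons /pushforward preimage_set0 measure0. Qed.

Let lebesgue_cons_ge0 A : (0 <= lebesgue_cons A)%E.
Proof. exact: (@measure_ge0 _ _ _ (@lebesgue_measure R \x mu)%E). Qed.

Let lebesgue_cons_sigma_additive : semi_sigma_additive lebesgue_cons.
Proof.
apply: measure_semi_sigma_additive.
exact: measurable_cons_pair.
Qed.

HB.instance Definition _ := isMeasure.Build _ _ _ lebesgue_cons
  lebesgue_cons0 lebesgue_cons_ge0 lebesgue_cons_sigma_additive.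

Let lebesgue_cons_sigma_finite : sigma_finite setT lebesgue_cons.
Proof.
have /sigma_finiteP[G [GT ndG Gm]] := sigma_finiteT mu.
have /sigma_finiteP[F [FT ndF Fm]] := sigma_finiteT (@lebesgue_measure R).
pose g (t : n.+1.-tuple mR) : mR * n.-tuple mR :=
  (thead t, [tuple of behead t]).
have gK t : cons_pair (g t) = t by rewrite /cons_pair /= -tuple_eta.
have Kg x : g (cons_pair x) = x.
  by case: x => x t; congr pair; apply: val_inj.
have mg : measurable_fun setT g.
  by apply/measurable_fun_pair; [exact: measurable_tnth|
                                 exact: measurable_behead].
exists (fun i => g @^-1` (F i `*` G i)).
  rewrite -preimage_bigcup (_ : \bigcup_i _ = setT) ?preimage_setT//.
  rewrite -setXTT FT GT; apply/seteqP; split=> -[x y] /=.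
    by move=> [i _ [? ?]]; split; exists i.
  move=> [[i _ Fx] [j _ Gy]]; exists (maxn i j) => //; split.
    by move: x Fx; exact/subsetPset/ndF/leq_maxl.
  by move: y Gy; exact/subsetPset/ndG/leq_maxr.
move=> i; have [mF Fy] := Fm i; have [mG Gy] := Gm i; split.
  by rewrite -[X in measurable X]setTI; apply: mg => //; exact: measurableX.
rewrite /lebesgue_cons /pushforward -comp_preimage.
rewrite (_ : g \o _ = id); last by apply/funext => x; exact: Kg.
by rewrite preimage_id product_measure1E// lte_mul_pinfty// ge0_fin_numE.
Qed.

HB.instance Definition _ := @Measure_isSigmaFinite.Build _ _ _ lebesgue_cons
  lebesgue_cons_sigma_finite.

End step.

Fixpoint lebesgue_tuple n : {sigma_finite_measure set (n.-tuple mR) -> \bar R} :=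
  match n with
  | 0 => \d_([tuple] : 0.-tuple mR)
  | n'.+1 => lebesgue_cons (lebesgue_tuple n')
  end.

End lebesgue_tuple.

Definition rV_display : measure_display.
Proof. exact: default_measure_display. Qed.

(* The sigma-algebra on R^n is generated by the coordinates; it is the Borel
   one. *)
Section measurable_rV.
Context {R : realType} {n : nat}.

Definition coor_rV (i : 'I_n) (x : 'rV[R]_n) : measurableTypeR R := x ord0 i.

Let rV0 : g_sigma_preimage coor_rV set0.
Proof. exact: sigma_algebra0. Qed.

Let rVC A : g_sigma_preimage coor_rV A -> g_sigma_preimage coor_rV (~` A).
Proof. exact: sigma_algebraC. Qed.

Let rV_bigcup (F : (set 'rV[R]_n)^nat) :
  (forall i, g_sigma_preimage coor_rV (F i)) ->
  g_sigma_preimage coor_rV (\bigcup_i (F i)).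
Proof. exact: sigma_algebra_bigcup. Qed.

HB.instance Definition _ := @isMeasurable.Build rV_display 'rV[R]_n
  (g_sigma_preimage coor_rV) rV0 rVC rV_bigcup.

End measurable_rV.

Section lebesgue_rV.
Context {R : realType} {n : nat}.

Definition rV_of_tuple (t : n.-tuple (measurableTypeR R)) : 'rV[R]_n :=
  \row_i tnth t i.

Lemma measurable_rV_of_tuple : measurable_fun setT rV_of_tuple.
Proof.
move=> _ A mA; rewrite setTI.
have : preimage_set_system setT rV_of_tuple
    (g_sigma_preimage (@coor_rV R n)) (rV_of_tuple @^-1` A).
  by exists A => //; rewrite setTI.
rewrite -g_sigma_preimage_comp.
rewrite (_ : (fun i => _) = fun i t => tnth t i)//.
by apply/funext => i; apply/funext => t; rewrite /= /coor_rV mxE.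
Qed.

Definition lebesgue_rV : set 'rV[R]_n -> \bar R :=
  pushforward (lebesgue_tuple n) rV_of_tuple.

Let lebesgue_rV0 : lebesgue_rV set0 = 0%E.
Proof. by rewrite /lebesgue_rV /pushforward preimage_set0 measure0. Qed.

Let lebesgue_rV_ge0 A : (0 <= lebesgue_rV A)%E.
Proof. exact: (@measure_ge0 _ _ _ (lebesgue_tuple n)). Qed.

Let lebesgue_rV_sigma_additive : semi_sigma_additive lebesgue_rV.
Proof.
by apply: measure_semi_sigma_additive; exact: measurable_rV_of_tuple.
Qed.

HB.instance Definition _ := isMeasure.Build _ _ _ lebesgue_rV
  lebesgue_rV0 lebesgue_rV_ge0 lebesgue_rV_sigma_additive.

End lebesgue_rV.

Section complex_integral.
Context {R : realType} {n : nat}.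
Implicit Types f : 'rV[R]_n -> R[i].

Definition cmeasurable f :=
  measurable_fun setT (fun x => (complex.Re (f x))%:E) /\
  measurable_fun setT (fun x => (complex.Im (f x))%:E).

Definition cintegrable f :=
  lebesgue_rV.-integrable setT (fun x => (complex.Re (f x))%:E) /\
  lebesgue_rV.-integrable setT (fun x => (complex.Im (f x))%:E).

Definition cintegral f : R[i] :=
  (\int[lebesgue_rV]_x complex.Re (f x)) +i*
  (\int[lebesgue_rV]_x complex.Im (f x)).

End complex_integral.

Section complex_sum.
Context {R : realType} {I : choiceType}.
Local Open Scope ereal_scope.

(* Meaningful for absolutely summable families only. *)
Definition rsum (D : set I) (a : I -> R) : R :=
  (fine (\esum_(i in D) maxe (a i)%:E 0) -
   fine (\esum_(i in D) maxe (- a i)%:E 0))%R.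

Definition csum (D : set I) (a : I -> R[i]) : R[i] :=
  (rsum D (fun i => complex.Re (a i))) +i* (rsum D (fun i => complex.Im (a i))).

Definition csummable (D : set I) (a : I -> R[i]) : Prop :=
  \esum_(i in D) (normc (a i))%:E < +oo.

End complex_sum.

(* Meaningful for 1 <= q <= +oo only. *)
Definition lq_norm {R : realType} (q : \bar R) (a : int -> \bar R) : \bar R :=
  match q with
  | r%:E => ((\esum_(j in setT) (a j `^ r)) `^ r^-1)%E
  | +oo%E => ereal_sup (range a)
  | -oo%E => 0%E
  end.

Section schwartz.
Context {R : realType} {n : nat}.
Local Notation C := (R[i]).
Local Notation E := ('rV[R]_n).
Local Notation fn := (E -> C).
Implicit Types (f v w : fn) (x y xi : E).

Definition dotp x y : R := \sum_(i < n) x ord0 i * y ord0 i.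

(* The norm of the library on row vectors is the sup norm. *)
Definition enorm x : R := Num.sqrt (dotp x x).

Definition partial (i : 'I_n) f : fn := fun x =>
  ('D_(delta_mx ord0 i) (fun y => complex.Re (f y)) x) +i*
  ('D_(delta_mx ord0 i) (fun y => complex.Im (f y)) x).

Definition partials (s : seq 'I_n) f : fn := foldr partial f s.

Definition smooth f := forall (s : seq 'I_n) x,
  differentiable (fun y => complex.Re (partials s f y)) x /\
  differentiable (fun y => complex.Im (partials s f y)) x.

Definition test_function f :=
  smooth f /\ compact (closure [set x | f x != 0]).

Definition seminorm (k : nat) f : \bar R :=
  ereal_sup [set ((1 + enorm z.2) ^+ k * normc (partials z.1 f z.2))%:E |
             z in [set z : seq 'I_n * E | (size z.1 <= k)%N]].

Definition schwartz : set fn :=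
  [set f | smooth f /\ forall k, (seminorm k f < +oo)%E].

Definition cis (t : R) : C := cos t +i* sin t.

(* Convention: \int f(x) exp(-i x.xi) dx, the inverse carrying (2 pi)^-n. *)
Definition fourier f : fn := fun xi =>
  cintegral (fun x => f x * cis (- dotp x xi)).

Definition ifourier f : fn := fun x =>
  ((2 * pi) ^- n)%:C * cintegral (fun xi => f xi * cis (dotp x xi)).

(* A distribution is a functional on all functions, of which only the values on
   Schwartz functions are meaningful: equality of distributions is [eqD], not
   Leibniz equality. *)
Definition distrib := fn -> C.
Implicit Types T U : distrib.

Definition eqD T U := forall v, schwartz v -> T v = U v.

Definition tempered : set distrib :=
  [set T | (forall (a : C) v w, schwartz v -> schwartz w ->
              T (a \*o v \+ w) = a * T v + T w) /\
           exists k (M : R), forall v, schwartz v ->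
              ((normc (T v))%:E <= M%:E * seminorm k v)%E].

Definition fourierD T : distrib := fun v => T (fourier v).
Definition ifourierD T : distrib := fun v => T (ifourier v).
Definition mulD (m : fn) T : distrib := fun v => T (m \* v).

Definition multiplier (m : fn) T : distrib :=
  ifourierD (mulD m (fourierD T)).

Definition represents f T := cmeasurable f /\
  forall v, schwartz v -> cintegrable (f \* v) /\ T v = cintegral (f \* v).

Definition distr_of f : distrib := fun v => cintegral (f \* v).

(* The infimum over the representatives of T, which agree almost everywhere;
   +oo if there is none. *)
Definition Lp_norm (p : \bar R) T : \bar R :=
  ereal_inf [set Lnorm lebesgue_rV p (fun x => (normc (f x))%:E) |
             f in [set f | represents f T]].

Definition density T : fn := xget (fun=> 0) [set f | represents f T].

(* Definedness and value of <T, U> = \int T U for functions T and U. *)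
Definition paired T U := cintegrable (density T \* density U).
Definition pairing T U : C := cintegral (density T \* density U).

Definition C0 : set fn :=
  [set f | [/\ continuous (fun x => complex.Re (f x)),
               continuous (fun x => complex.Im (f x)) &
               forall e : R, 0 < e ->
                 exists M : R, forall x, M <= enorm x -> normc (f x) < e]].

End schwartz.

Section besov.
Context {R : realType} {n : nat}.
Local Notation E := ('rV[R]_n).
Local Notation dist := (@distrib R n).

Definition cutoff (phi : E -> R) :=
  [/\ test_function (fun x => (phi x)%:C),
      forall x y, enorm x = enorm y -> phi x = phi y,
      forall x, 0 <= phi x,
      closure [set x | phi x != 0] `<=` [set x | enorm x < 4 / 3] &
      forall x, enorm x < 3 / 4 -> phi x = 1].

Definition Sh' : set dist :=
  [set u | tempered u /\
     forall Theta : E -> R[i], test_function Theta ->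
       Lp_norm +oo (multiplier (fun xi => Theta (lambda *: xi)) u)
         @[lambda --> +oo] --> 0%E].

Variable phi : E -> R.
Implicit Types (s : R) (p q : \bar R) (u v : dist) (j : int).

Definition phij j : E -> R := fun xi => phi (2 ^ (- j) *: xi).
Definition psij j : E -> R := fun xi => phij j (2^-1 *: xi) - phij j xi.

Definition Delta j u : dist := multiplier (fun xi => (psij j xi)%:C) u.

Definition besov_coef s p u j : \bar R :=
  ((2 `^ (j%:~R * s))%:E * Lp_norm p (Delta j u))%E.

Definition besov_norm s p q u : \bar R := lq_norm q (besov_coef s p u).

Definition besov s p q : set dist :=
  [set u | Sh' u /\ (besov_norm s p q u < +oo)%E].

Definition besov_c s p : set dist :=
  [set u | besov s p +oo u /\
     forall e : R, 0 < e -> exists N : nat, forall j,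
       (N <= `|j|)%N -> (besov_coef s p u j < e%:E)%E].

Definition besov_0 s q : set dist :=
  [set u | besov s +oo q u /\
     forall j, exists2 f, C0 f & represents f (Delta j u)].

Definition near_diag : set (int * int) := [set k | `|k.1 - k.2| <= 1].

Definition block_pairing u v (k : int * int) : R[i] :=
  pairing (Delta k.1 u) (Delta k.2 v).

Definition besov_pairing u v : R[i] := csum near_diag (block_pairing u v).

Definition pairable u v :=
  (forall k, near_diag k -> paired (Delta k.1 u) (Delta k.2 v)) /\
  csummable near_diag (block_pairing u v).

Definition Qset s p q : set (E -> R[i]) :=
  [set v | [/\ schwartz v, besov s p q (distr_of v) &
               (besov_norm s p q (distr_of v) <= 1)%E]].

End besov.

Section duality.
Context {R : realType} {n : nat}.
Local Notation dist := (@distrib R n).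
Implicit Types (X Y : set dist) (N NX NY : dist -> \bar R).
Implicit Types (l : dist -> R[i]) (b : dist -> dist -> R[i]).

Definition linear_on X l := forall (a : R[i]) u v, X u -> X v ->
  l (a \*o u \+ v) = a * l u + l v.

Definition continuous_on X N l := forall u, X u ->
  forall e : R, 0 < e -> exists2 d : R, 0 < d &
    forall v, X v -> (N (v \- u)%R < d%:E)%E -> normc (l v - l u) < e.

Definition top_dual X N : set (dist -> R[i]) :=
  [set l | linear_on X l /\ continuous_on X N l].

Definition dual_norm X N l : \bar R :=
  ereal_sup [set (normc (l v))%:E | v in [set v | X v /\ (N v <= 1)%E]].

(* The map u |-> b u is a bijection from Y onto the dual of X, with equivalence of
   norms. *)
Definition is_dual_of Y NY X NX b :=
  [/\ forall u, Y u -> top_dual X NX (b u),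
      forall u1 u2, Y u1 -> Y u2 ->
        (forall v, X v -> b u1 v = b u2 v) -> eqD u1 u2,
      forall l, top_dual X NX l ->
        exists2 u, Y u & forall v, X v -> b u v = l v &
      exists2 c : R, 0 < c & forall u, Y u ->
        (NY u <= c%:E * dual_norm X NX (b u) /\
         dual_norm X NX (b u) <= c%:E * NY u)%E].

Definition bilinear_on Y X b :=
  (forall (a : R[i]) u1 u2 v, Y u1 -> Y u2 -> X v ->
     b (a \*o u1 \+ u2) v = a * b u1 v + b u2 v) /\
  (forall (a : R[i]) u v1 v2, Y u -> X v1 -> X v2 ->
     b u (a \*o v1 \+ v2) = a * b u v1 + b u v2).

Definition bicontinuous_on Y NY X NX b := forall u0 v0, Y u0 -> X v0 ->
  forall e : R, 0 < e -> exists2 d : R, 0 < d &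
    forall u v, Y u -> X v ->
      (NY (u \- u0)%R < d%:E)%E -> (NX (v \- v0)%R < d%:E)%E ->
      normc (b u v - b u0 v0) < e.

End duality.

(* Main.v *)
From HB Require Import structures.
Require Import Defs.
From mathcomp Require Import all_boot all_order all_algebra.
From mathcomp Require Import complex.
From mathcomp Require Import all_classical all_reals all_analysis.
From mathcomp Require Import measurable_realfun ess_sup_inf.
From mathcomp Require Import ring lra zify.

(* A multiplier by a Schwartz symbol acts on a tempered distribution as a
   convolution with a Schwartz kernel, so the blocks Delta_j u are continuous
   functions and Lp_norm is an actual Lebesgue norm.  Hoelder's inequality in
   x and in j bounds the pairing.  Conversely, choosing near-extremal functions
   w_j for the norm of each block and summing the convolutions of the w_j with
   the kernels of the blocks gives a Schwartz function v with spectrum in an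
   annulus, of bounded norm, on which u is comparable to the norm of u: this
   gives the supremum formula, injectivity and the equivalence of norms.

   A bounded functional l defines u by u(v) = sum_j l(Delta_j v).  The terms
   with j >= 0 are summable because v is smooth; for j < 0 Bernstein's
   inequality gives a factor 2^(j(n/p - s)), which lies in l^q' exactly when
   s < n/p, or s = n/p and q = 1.  The same factor and Hoelder's inequality in j
   make the low frequencies of u tend to 0 uniformly, so that u lies in Sh'.
   Finally l and the pairing with u agree because functions with spectrum in an
   annulus are dense in each of the four predual spaces: truncate the sequence
   of blocks in j and each block in x. *)

Set Implicit Arguments.
Unset Strict Implicit.
Unset Printing Implicit Defensive.

Import Order.TTheory GRing.Theory Num.Theory.
Import numFieldNormedType.Exports.

Local Notation Re := complex.Re.
Local Notation Im := complex.Im.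

(** * Change of variables for the measure on R^n *)

(** Distributions are compared on Schwartz functions only, so every object is handled through its
    values on convolutions. Near-extremal weights are bounded and measurable but not smooth; the
    exchange of a tempered distribution with the integral defining a convolution is therefore proved
    for all densities with finite weighted moments ([wint]), by cutting space into small cubes.

    Test functions and approximants come from one device ([synth]): arbitrary functions W_j are sent
    through enlarged blocks and summed. The norm of the result is controlled by the norms of the
    W_j, and the norm of its difference with u by those of Delta_j u - W_j. The extremal functions,
    the absolute convergence of the representing series and the density of functions with annular
    spectrum are three uses of this estimate ([besov_approx]).

    The four identities are instances of one theorem ([is_dual_of_space]) about a space X that lies
    between the functions with annular spectrum and the Besov space, and in which the former are
    dense. The restrictions on the exponents enter through the summability of the low-frequency
    factor and through this density. *)

Section affine_change_of_variable.
Context {R : realType}.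
Local Open Scope classical_set_scope.
Local Open Scope ring_scope.
Local Notation mu := (@lebesgue_measure R).
Local Notation mR := (measurableTypeR R).

Lemma measurable_affine (a b : R) :
  measurable_fun setT ((fun x => a * x + b) : mR -> mR).
Proof. by apply: measurable_funD => //; exact: measurable_funM. Qed.

Let affine_measure (a b : R) (a0 : 0 <= a) : {measure set mR -> \bar R}.
Proof.
refine (mscale (NngNum a0) (pushforward mu ((fun x => a * x + b) : mR -> mR))).
exact: measurable_affine.
Defined.

(** Both sides are measures in [A], and Lebesgue measure is determined by its values on half-open
    intervals. *)
Lemma lebesgue_measure_affine (a b : R) : 0 < a ->
  forall A, measurable A ->
  (a%:E * mu ((fun x => (a * x + b)%R : mR) @^-1` A) = mu A)%E.
Proof.
move=> a0 A mA; apply/esym.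
apply: (@lebesgue_measure_unique R (affine_measure b (ltW a0))) => // _ [[c d]] _ <-.
rewrite -[RHS]/(a%:E * mu ((fun x => (a * x + b)%R : mR) @^-1` `]c, d]))%E.
rewrite (_ : _ @^-1` _ = `](c - b) / a, (d - b) / a]%classic); last first.
  apply/seteqP; split=> x /=; rewrite !in_itv/= ltr_pdivrMr// ler_pdivlMr//.
    by rewrite ltrBlDr lerBrDr mulrC.
  by rewrite ltrBlDr lerBrDr mulrC.
rewrite !lebesgue_measure_itv/= !lte_fin ltr_pM2r ?invr_gt0// ltrD2r.
case: ifPn => _; last by rewrite mule0.
by rewrite -!EFinD -EFinM; congr EFin; field; rewrite gt_eqF.
Qed.

Lemma ge0_integral_affine (a b : R) (f : mR -> \bar R) : 0 < a ->
  measurable_fun setT f -> (forall x, (0 <= f x)%E) ->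
  (\int[mu]_x f (a * x + b)%R = a^-1%:E * \int[mu]_x f x)%E.
Proof.
move=> a0 mf f0.
pose phi : mR -> mR := fun x => a * x + b.
have mphi : measurable_fun setT phi by exact: measurable_affine.
have -> : (\int[mu]_x f x = \int[affine_measure b (ltW a0)]_x f x)%E.
  by apply: eq_measure_integral => A mA _; exact/esym/(lebesgue_measure_affine b a0 mA).
rewrite ge0_integral_mscale//= muleA -EFinM mulVf ?gt_eqF// mul1e.
by rewrite ge0_integral_pushforward// preimage_setT.
Qed.

Lemma ge0_integral_oppr (f : mR -> \bar R) :
  measurable_fun setT f -> (forall x, (0 <= f x)%E) ->
  (\int[mu]_x f (- x)%R = \int[mu]_x f x)%E.
Proof.
move=> mf f0; rewrite -[LHS](_ : \int[pushforward mu (-%R : mR -> mR)]_x f x = _)%E.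
  by apply: eq_measure_integral => A mA _; exact: lebesgue_measureN.
by rewrite ge0_integral_pushforward// preimage_setT.
Qed.

End affine_change_of_variable.

Section lebesgue_tuple_integral.
Context {R : realType}.
Local Open Scope classical_set_scope.
Local Open Scope ring_scope.
Local Notation mu := (@lebesgue_measure R).
Local Notation mR := (measurableTypeR R).

Lemma ge0_integral_cons n (F : n.+1.-tuple mR -> \bar R) :
  measurable_fun setT F -> (forall t, (0 <= F t)%E) ->
  (\int[lebesgue_tuple n.+1]_t F t =
   \int[mu]_x \int[lebesgue_tuple n]_t F (cons_pair (x, t)))%E.
Proof.
move=> mF F0.
rewrite [LHS]ge0_integral_pushforward//; last exact: measurable_cons_pair.
rewrite preimage_setT fubini_tonelli1//; last by move=> x; exact: F0.
exact: (measurableT_comp mF (@measurable_cons_pair R n)).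
Qed.

Definition affine_tuple n (a : R) (h t : n.-tuple mR) : n.-tuple mR :=
  [tuple a * tnth t i + tnth h i | i < n].

Lemma measurable_affine_tuple n a (h : n.-tuple mR) :
  measurable_fun setT (affine_tuple a h).
Proof.
apply/measurable_fun_tnthP => i.
rewrite (_ : _ \o _ = fun t => a * tnth t i + tnth h i).
  apply: measurable_funD => //; apply: measurable_funM => //.
  exact: measurable_tnth.
by apply/funext => t /=; rewrite tnth_mktuple.
Qed.

(** Induction on the dimension: Tonelli splits off the first coordinate, which contributes one
    factor [a^-1]. *)
Lemma ge0_integral_affine_tuple n (a : R) (h : n.-tuple mR)
    (F : n.-tuple mR -> \bar R) : 0 < a ->
  measurable_fun setT F -> (forall t, (0 <= F t)%E) ->
  (\int[lebesgue_tuple n]_t F (affine_tuple a h t) =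
   (a ^- n)%:E * \int[lebesgue_tuple n]_t F t)%E.
Proof.
move=> a0; elim: n h F => [|n ih] h F mF F0.
  rewrite expr0 invr1 mul1e; apply: eq_integral => t _; congr F.
  by apply: eq_from_tnth => -[].
have mFc x : measurable_fun setT (fun t => F (cons_pair (x, t))).
  apply: (measurableT_comp mF).
  exact: (measurableT_comp (@measurable_cons_pair R n) (measurable_pair1 x)).
rewrite ge0_integral_cons//; last first.
  exact: (measurableT_comp mF (measurable_affine_tuple a h)).
rewrite ge0_integral_cons//.
pose h' : n.-tuple mR := [tuple of behead h].
under eq_integral => x _.
  under eq_integral => t _.
    rewrite (_ : affine_tuple _ _ _ =
      cons_pair (a * x + thead h, affine_tuple a h' t)); last first.
      apply: eq_from_tnth => i; rewrite tnth_mktuple.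
      case: (unliftP ord0 i) => [j ->|->]; last by rewrite /cons_pair !tnth0.
      rewrite /cons_pair/= !tnthS tnth_mktuple; congr (_ + _).
      by rewrite [h in LHS]tuple_eta tnthS.
    over.
  rewrite (ih h' (fun t => F (cons_pair (a * x + thead h, t))))//.
  over.
rewrite /=.
pose G (x : mR) := (\int[lebesgue_tuple n]_t F (cons_pair (x, t)))%E.
have mG : measurable_fun setT G.
  apply: (measurable_fun_fubini_tonelli_F (F \o @cons_pair R n)) => //.
    exact: (measurableT_comp mF (@measurable_cons_pair R n)).
  by move=> x; exact: F0.
have G0 x : (0 <= G x)%E by exact: integral_ge0.
rewrite (@ge0_integral_affine _ a (thead h) (fun x => (a ^- n)%:E * G x)%E)//.
- rewrite ge0_integralZl//; last by rewrite lee_fin invr_ge0 exprn_ge0// ltW.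
  by rewrite muleA -EFinM -invfM exprS.
- exact: measurable_funeM.
- by move=> x; rewrite mule_ge0// lee_fin invr_ge0 exprn_ge0// ltW.
Qed.

Definition opp_tuple n (t : n.-tuple mR) : n.-tuple mR :=
  [tuple - tnth t i | i < n].

Lemma measurable_opp_tuple n : measurable_fun setT (@opp_tuple n).
Proof.
apply/measurable_fun_tnthP => i.
rewrite (_ : _ \o _ = fun t => - tnth t i).
  by apply: measurableT_comp => //; exact: measurable_tnth.
by apply/funext => t /=; rewrite tnth_mktuple.
Qed.

Lemma ge0_integral_opp_tuple n (F : n.-tuple mR -> \bar R) :
  measurable_fun setT F -> (forall t, (0 <= F t)%E) ->
  (\int[lebesgue_tuple n]_t F (opp_tuple t) =
   \int[lebesgue_tuple n]_t F t)%E.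
Proof.
elim: n F => [|n ih] F mF F0.
  by apply: eq_integral => t _; congr F; apply: eq_from_tnth => -[].
have mFc x : measurable_fun setT (fun t => F (cons_pair (x, t))).
  apply: (measurableT_comp mF).
  exact: (measurableT_comp (@measurable_cons_pair R n) (measurable_pair1 x)).
rewrite ge0_integral_cons//; last first.
  exact: (measurableT_comp mF (@measurable_opp_tuple _)).
rewrite ge0_integral_cons//.
under eq_integral => x _.
  under eq_integral => t _.
    rewrite (_ : opp_tuple _ = cons_pair (- x, opp_tuple t)); last first.
      apply: eq_from_tnth => i; rewrite tnth_mktuple.
      case: (unliftP ord0 i) => [j ->|->]; last by rewrite /cons_pair !tnth0.
      by rewrite /cons_pair/= !tnthS tnth_mktuple.
    over.
  rewrite (ih (fun t => F (cons_pair (- x, t))))//.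
  over.
rewrite /=.
apply: (@ge0_integral_oppr _ (fun x => (\int[lebesgue_tuple n]_t F (cons_pair (x, t)))%E)).
  apply: (measurable_fun_fubini_tonelli_F (F \o @cons_pair R n)) => //.
    exact: (measurableT_comp mF (@measurable_cons_pair R n)).
  by move=> x; exact: F0.
by move=> x; exact: integral_ge0.
Qed.

(** Reduces volumes of cubes, the integrability of powers of the weight and the integrals of the
    Laplace and Poisson products to dimension one. *)
Lemma ge0_integral_prod_tuple n (g : mR -> R) :
  measurable_fun setT g -> (forall x, 0 <= g x) ->
  (\int[lebesgue_tuple n]_t (\prod_(i < n) g (tnth t i))%:E =
   (\int[mu]_x (g x)%:E) ^+ n)%E.
Proof.
move=> mg g0.
have mP m : measurable_fun setT
    (fun t : m.-tuple mR => (\prod_(i < m) g (tnth t i))%:E).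
  apply/measurable_EFinP; apply: measurable_prod => i _.
  exact: (measurableT_comp mg (measurable_tnth i)).
elim: n => [|n ih].
  under eq_integral do rewrite big_ord0.
  by rewrite integral_cst// mul1e expe0 /= diracT.
rewrite ge0_integral_cons//; last first.
  by move=> t; rewrite lee_fin prodr_ge0.
have step x : (\int[lebesgue_tuple n]_t
    (\prod_(i < n.+1) g (tnth (cons_pair (x, t)) i))%:E =
    (g x)%:E * (\int[mu]_x (g x)%:E) ^+ n)%E.
  rewrite -ih -ge0_integralZl//; last by rewrite lee_fin.
    apply: eq_integral => t _; rewrite big_ord_recl /cons_pair tnth0 EFinM.
    by congr (_ * _%:E)%E; apply: eq_bigr => i _; rewrite tnthS.
    exact: mP.
  by move=> t _; rewrite lee_fin prodr_ge0.
under eq_integral do rewrite step.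
rewrite expeS ge0_integralZr//.
- exact/measurable_EFinP.
- by move=> x _; rewrite lee_fin.
- by apply: expe_ge0; apply: integral_ge0 => x _; rewrite lee_fin.
Qed.

End lebesgue_tuple_integral.

Section measurable_rV.
Context {R : realType} {n : nat}.
Local Open Scope classical_set_scope.
Local Open Scope ring_scope.
Local Notation E := ('rV[R]_n).

Lemma measurable_coor (i : 'I_n) : measurable_fun setT (fun x : E => x ord0 i).
Proof.
move=> _ A mA; rewrite setTI.
have n0 : (0 < n)%N by rewrite (leq_ltn_trans _ (ltn_ord i)).
have : g_sigma_preimage (@coor_rV R n) ((fun x : E => x ord0 i) @^-1` A).
  apply: sub_sigma_algebra.
  case: n i {n0} => [[]//|m] i.
  rewrite -bigcup_mkord_ord; exists i; first exact: ltn_ord.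
  by exists A => //; rewrite setTI inord_val.
by [].
Qed.

Lemma measurable_rVP d (T : measurableType d) (f : T -> E) :
  (forall i, measurable_fun setT (fun t => f t ord0 i)) ->
  measurable_fun setT f.
Proof.
move=> mf _ A mA; rewrite setTI.
have : preimage_set_system setT f
    (g_sigma_preimage (@coor_rV R n)) (f @^-1` A).
  by exists A => //; rewrite setTI.
rewrite -g_sigma_preimage_comp; apply: smallest_sub.
  exact: sigma_algebra_measurable.
case: n f mf {A mA} => [|m] f mf; first by rewrite big_ord0.
rewrite -bigcup_mkord_ord; apply: bigcup_sub => i Ii.
by move=> A [B mB <-]; exact: mf.
Qed.

Lemma measurable_addrV (h : E) : measurable_fun setT (fun x : E => x + h).
Proof.
apply: measurable_rVP => i; under eq_fun do rewrite !mxE.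
by apply: measurable_funD => //; exact: measurable_coor.
Qed.

Lemma measurable_opprV : measurable_fun setT (fun x : E => - x).
Proof.
apply: measurable_rVP => i; under eq_fun do rewrite !mxE.
by apply: measurableT_comp => //; exact: measurable_coor.
Qed.

Lemma measurable_scalerV (a : R) : measurable_fun setT (fun x : E => a *: x).
Proof.
apply: measurable_rVP => i; under eq_fun do rewrite !mxE.
by apply: measurable_funM => //; exact: measurable_coor.
Qed.

(** The sigma-algebra is generated by the coordinates, so it has to be related to the topology: an
    open set is the union of the countably many boxes with rational centre and radius [1/(k+1)] that
    it contains. *)
Lemma measurable_open_rV (U : set E) : open U -> measurable U.
Proof.
move=> oU.
pose box (qk : {ffun 'I_n -> rat} * nat) :=
  [set x : E | forall i, `|x ord0 i - ratr (qk.1 i)| < qk.2.+1%:R^-1].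
have mbox qk : measurable (box qk).
  rewrite (_ : box qk = \bigcap_(i in [set: 'I_n])
     ((fun x : E => `|x ord0 i - ratr (qk.1 i)|) @^-1` `]-oo, qk.2.+1%:R^-1[)); last first.
    by apply/seteqP; split=> x /= h i; [move=> _|]; have := h i; rewrite /= in_itv/=; apply.
  apply: fin_bigcap_measurable => //= i _; rewrite -[X in measurable X]setTI.
  have mg : measurable_fun setT (fun x : E => `|x ord0 i - ratr (qk.1 i)|).
    apply: measurableT_comp => //; apply: measurable_funB => //.
    exact: measurable_coor.
  by apply: mg => //; exact: measurable_itv.
rewrite (_ : U = \bigcup_qk (if `[< box qk `<=` U >] then box qk else set0)); last first.
  apply/seteqP; split=> [x Ux|x [qk _]]; last first.
    by case: asboolP => // sU /sU.
  have := oU; rewrite openE => /(_ _ Ux) /nbhs_ballP[e /= e0 eU].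
  have [k ke] : exists k : nat, k.+1%:R^-1 < e / 2.
    have e20 : 0 < e / 2 by rewrite divr_gt0.
    have := @near_infty_natSinv_lt R (PosNum e20).
    by move=> [k _ /(_ k (leqnn k))] ?; exists k.
  have qP i : exists q : rat, `|x ord0 i - ratr q| < k.+1%:R^-1.
    have k0 : 0 < k.+1%:R^-1 :> R by rewrite invr_gt0.
    have [|q] := @rat_in_itvoo R (x ord0 i - k.+1%:R^-1) (x ord0 i + k.+1%:R^-1).
      by rewrite ltrBlDr -addrA ltrDl addr_gt0.
    rewrite in_itv/= => /andP[]; move: k.+1%:R^-1 => c h1 h2; exists q.
    by rewrite ltr_norml; apply/andP; split; lra.
  have [q qx] := choice qP.
  exists ([ffun i => q i], k) => //.
  case: asboolP => [_|]; first by move=> i /=; rewrite ffunE.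
  apply; move=> y /= yq; apply: eU; split => // i j; rewrite ord1.
  have := yq j; have := qx j; rewrite /= ffunE => h1 h2.
  rewrite /ball/= (_ : x ord0 j - y ord0 j = (x ord0 j - ratr (q j)) -
     (y ord0 j - ratr (q j))); last by ring.
  by rewrite (le_lt_trans (ler_normB _ _))// (splitr e) ltrD// (lt_trans _ ke).
by apply: countable_bigcupT_measurable => // qk; case: ifPn.
Qed.

End measurable_rV.

Section lebesgue_rV_integral.
Context {R : realType} {n : nat}.
Local Open Scope classical_set_scope.
Local Open Scope ring_scope.
Local Notation E := ('rV[R]_n).
Local Notation mu := (@lebesgue_rV R n).
Local Notation mR := (measurableTypeR R).

Lemma continuous_measurable_rV (f : E -> R) : continuous f -> measurable_fun setT f.
Proof.
move=> /continuousP cf; apply: (measurability _ (RGenOpens.measurableE R)).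
move=> _ [_ [a [b ->] <-]]; rewrite setTI; apply: measurable_open_rV.
exact/cf/interval_open.
Qed.

Lemma ge0_integral_rV (f : E -> \bar R) :
  measurable_fun setT f -> (forall x, (0 <= f x)%E) ->
  (\int[mu]_x f x = \int[lebesgue_tuple n]_t f (rV_of_tuple t))%E.
Proof.
move=> mf f0; rewrite [LHS]ge0_integral_pushforward//.
exact: measurable_rV_of_tuple.
Qed.

Lemma ge0_integral_affine_rV (a : R) (h : E) (f : E -> \bar R) : 0 < a ->
  measurable_fun setT f -> (forall x, (0 <= f x)%E) ->
  (\int[mu]_x f (a *: x + h)%R = (a ^- n)%:E * \int[mu]_x f x)%E.
Proof.
move=> a0 mf f0.
pose h' : n.-tuple mR := [tuple h ord0 i | i < n].
have hE t : a *: rV_of_tuple t + h = rV_of_tuple (affine_tuple a h' t).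
  by apply/rowP => i; rewrite !mxE !tnth_mktuple.
rewrite !ge0_integral_rV//; last first.
  apply: (measurableT_comp mf).
  exact: (measurableT_comp (measurable_addrV h) (measurable_scalerV a)).
under eq_integral do rewrite hE.
rewrite (@ge0_integral_affine_tuple _ _ a h' (f \o rV_of_tuple))//.
  exact: (measurableT_comp mf measurable_rV_of_tuple).
by move=> t; exact: f0.
Qed.

Lemma ge0_integral_translate (h : E) (f : E -> \bar R) :
  measurable_fun setT f -> (forall x, (0 <= f x)%E) ->
  (\int[mu]_x f (x + h)%R = \int[mu]_x f x)%E.
Proof.
move=> mf f0; have := ge0_integral_affine_rV h ltr01 mf f0.
rewrite expr1n invr1 mul1e => <-; apply: eq_integral => x _.
by rewrite scale1r.
Qed.

Lemma ge0_integral_opprV (f : E -> \bar R) :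
  measurable_fun setT f -> (forall x, (0 <= f x)%E) ->
  (\int[mu]_x f (- x)%R = \int[mu]_x f x)%E.
Proof.
move=> mf f0.
have hE (t : n.-tuple mR) : - rV_of_tuple t = rV_of_tuple (opp_tuple t).
  by apply/rowP => i; rewrite !mxE !tnth_mktuple.
rewrite !ge0_integral_rV//; last first.
  by apply: (measurableT_comp mf); exact: measurable_opprV.
under eq_integral do rewrite hE.
rewrite (@ge0_integral_opp_tuple _ _ (f \o rV_of_tuple))//.
  exact: (measurableT_comp mf measurable_rV_of_tuple).
by move=> t; exact: f0.
Qed.

Lemma ge0_integral_reflect (h : E) (f : E -> \bar R) :
  measurable_fun setT f -> (forall x, (0 <= f x)%E) ->
  (\int[mu]_x f (h - x)%R = \int[mu]_x f x)%E.
Proof.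
move=> mf f0; rewrite -(ge0_integral_opprV mf)//.
rewrite -[RHS](@ge0_integral_translate (- h) (fun x => f (- x)%R))//.
  by apply: eq_integral => x _; rewrite opprD opprK addrC.
by apply: (measurableT_comp mf); exact: measurable_opprV.
Qed.

Lemma ge0_integral_prod_rV (g : mR -> R) :
  measurable_fun setT g -> (forall x, 0 <= g x) ->
  (\int[mu]_x (\prod_(i < n) g (x ord0 i))%:E =
   (\int[@lebesgue_measure R]_x (g x)%:E) ^+ n)%E.
Proof.
move=> mg g0; rewrite ge0_integral_rV//.
- rewrite -ge0_integral_prod_tuple//; apply: eq_integral => t _.
  by congr EFin; apply: eq_bigr => i _; rewrite mxE.
- apply/measurable_EFinP; apply: measurable_prod => i _.
  exact: (measurableT_comp mg (measurable_coor i)).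
- by move=> x; rewrite lee_fin prodr_ge0.
Qed.

(** The cubes [F k] exhaust the space, and the indicator of a cube is a product of one-dimensional
    indicators, so its integral is a finite power. *)
Let lebesgue_rV_sigma_finite : sigma_finite setT mu.
Proof.
pose F (k : nat) := [set x : E | forall i, `|x ord0 i| <= k%:R].
exists F.
  apply/seteqP; split=> // x _; exists (Num.truncn (\sum_i `|x ord0 i|)).+1 => // i.
  rewrite ltW// (le_lt_trans _ (truncnS_gt _))//.
  by rewrite (bigD1 i)//= lerDl sumr_ge0.
move=> k.
pose g : mR -> R := \1_(`[- k%:R, k%:R]%classic).
have g0 x : 0 <= g x by rewrite /g indicE.
have mg : measurable_fun setT g by exact: measurable_indic.
have gE (x : E) : \prod_(i < n) g (x ord0 i) = \1_(F k) x.
  have [xF|xF] := pselect (F k x).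
    rewrite indicE mem_set// big1// => i _.
    by rewrite /g indicE mem_set//= in_itv/= -ler_norml; exact: xF.
  rewrite indicE memNset//; apply/eqP; rewrite prodf_seq_eq0.
  have [i /negP xi] : exists i, ~ (`|x ord0 i| <= k%:R).
    by apply: contrapT => h; apply: xF => i; apply: contrapT => ?; apply: h; exists i.
  apply/hasP; exists i; first by rewrite mem_index_enum.
  by rewrite /g indicE memNset//= in_itv/= -ler_norml; apply/negP.
have mF : measurable (F k).
  rewrite (_ : F k = (fun x => \prod_(i < n) g (x ord0 i)) @^-1` [set 1]).
    rewrite -[X in measurable X]setTI; apply: measurable_prod => //.
    by move=> i _; exact: (measurableT_comp mg (measurable_coor i)).
  apply/seteqP; split=> x /=; rewrite gE indicE.
    by move=> xF; rewrite mem_set.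
  by case: (boolP (x \in F k)) => [/set_mem//|_ /eqP]; rewrite eq_sym oner_eq0.
split => //.
have := @integral_indic _ _ _ mu _ measurableT _ mF; rewrite setIT => <-.
under eq_integral do rewrite -gE.
rewrite ge0_integral_prod_rV//.
rewrite (@integral_indic _ _ _ (@lebesgue_measure R) _ measurableT
  `[- k%:R, k%:R]%classic (measurable_itv _)).
rewrite setIT.
have : @lebesgue_measure R `[- k%:R, k%:R]%classic \is a fin_num.
  by rewrite lebesgue_measure_itv/= -EFinB; case: ifPn.
have ey (x : \bar R) : (x \is a fin_num -> x ^+ n < +oo)%E.
  by move=> /fineK <-; rewrite -EFin_expe ltry.
by move=> h; apply: ey; exact: h.
Qed.

HB.instance Definition _ :=
  @Measure_isSigmaFinite.Build _ _ _ mu lebesgue_rV_sigma_finite.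

End lebesgue_rV_integral.

(** * Integrals of complex functions *)

Section normc_theory.
Context {R : realType}.
Local Open Scope ring_scope.
Local Open Scope complex_scope.
Implicit Types z w : R[i].

Lemma normc_ge0 z : 0 <= normc z.
Proof. by case: z => a b; exact: sqrtr_ge0. Qed.

Lemma normcM z w : normc (z * w) = normc z * normc w.
Proof. exact: ComplexField.Normc.normcM. Qed.

Lemma normcD z w : normc (z + w) <= normc z + normc w.
Proof. exact: le_normcD. Qed.

Lemma normcN z : normc (- z) = normc z.
Proof. exact: normcN. Qed.

Lemma normcB z w : normc (z - w) <= normc z + normc w.
Proof. by rewrite (le_trans (normcD _ _))// normcN. Qed.

Lemma normc_distC z w : normc (z - w) = normc (w - z).
Proof. by rewrite -normcN opprB. Qed.

Lemma normc0 : normc (0 : R[i]) = 0.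
Proof. by apply: ComplexField.Normc.normc0. Qed.

Lemma normc1 : normc (1 : R[i]) = 1.
Proof. by apply: ComplexField.Normc.normc1. Qed.

Lemma normc_eq0 z : normc z = 0 -> z = 0.
Proof. exact: ComplexField.Normc.eq0_normc. Qed.

Lemma normcR (a : R) : normc a%:C = `|a|.
Proof. by rewrite /= expr0n/= addr0 sqrtr_sqr. Qed.

Lemma normc_ReIm (a b : R) : normc (a +i* b) = Num.sqrt (a ^+ 2 + b ^+ 2).
Proof. by []. Qed.

Lemma le_Re_normc z : `|Re z| <= normc z.
Proof.
case: z => a b /=; rewrite -(sqrtr_sqr a) ler_sqrt ?lerDl ?sqr_ge0//.
by rewrite addr_ge0// sqr_ge0.
Qed.

Lemma le_Im_normc z : `|Im z| <= normc z.
Proof.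
case: z => a b /=; rewrite -(sqrtr_sqr b) ler_sqrt ?lerDr ?sqr_ge0//.
by rewrite addr_ge0// sqr_ge0.
Qed.

Lemma normc_le_ReIm z : normc z <= `|Re z| + `|Im z|.
Proof.
case: z => a b /=; rewrite -[leRHS]ger0_norm ?addr_ge0// -sqrtr_sqr ler_sqrt ?sqr_ge0//.
by rewrite sqrrD !real_normK ?num_real// lerD2r lerDl mulrn_wge0// mulr_ge0.
Qed.

Lemma normc_conj z : normc (z^*)%C = normc z.
Proof. by case: z => a b /=; rewrite sqrrN. Qed.

Lemma mulc_conj z : z * (z^*)%C = (normc z ^+ 2)%:C.
Proof.
case: z => a b /=; rewrite sqr_sqrtr ?addr_ge0 ?sqr_ge0//.
by apply/eqP; rewrite eq_complex /=; apply/andP; split; apply/eqP; ring.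
Qed.

Lemma normc_sum (I : Type) (s : seq I) (P : pred I) (F : I -> R[i]) :
  normc (\sum_(i <- s | P i) F i) <= \sum_(i <- s | P i) normc (F i).
Proof.
elim/big_ind2 : _ => //; first by rewrite normc0.
by move=> x a y b xa yb; rewrite (le_trans (normcD _ _))// lerD.
Qed.

Lemma ReD z w : Re (z + w) = Re z + Re w. Proof. by case: z w => ? ? []. Qed.
Lemma ImD z w : Im (z + w) = Im z + Im w. Proof. by case: z w => ? ? []. Qed.
Lemma ReN z : Re (- z) = - Re z. Proof. by case: z. Qed.
Lemma ImN z : Im (- z) = - Im z. Proof. by case: z. Qed.
Lemma ReM z w : Re (z * w) = Re z * Re w - Im z * Im w.
Proof. by case: z w => ? ? []. Qed.
Lemma ImM z w : Im (z * w) = Re z * Im w + Im z * Re w.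
Proof. by case: z w => ? ? [? ?] /=. Qed.

Lemma Re_sum (I : Type) (s : seq I) (P : pred I) (F : I -> R[i]) :
  Re (\sum_(i <- s | P i) F i) = \sum_(i <- s | P i) Re (F i).
Proof. by apply: (big_morph _ ReD). Qed.

Lemma Im_sum (I : Type) (s : seq I) (P : pred I) (F : I -> R[i]) :
  Im (\sum_(i <- s | P i) F i) = \sum_(i <- s | P i) Im (F i).
Proof. by apply: (big_morph _ ImD). Qed.

Lemma EFin_normc_ge0 z : (0 <= (normc z)%:E)%E.
Proof. by rewrite lee_fin normc_ge0. Qed.

End normc_theory.
#[global] Arguments ComplexField.Normc.normc : simpl never.
#[global] Hint Extern 0 (is_true (@Order.le _ _ _ (@ComplexField.Normc.normc _ _))) =>
  solve [apply: normc_ge0] : core.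
#[global] Hint Extern 0 (is_true (_ <= (normc _)%:E)%E) =>
  solve [apply: EFin_normc_ge0] : core.

Section complex_measurable.
Context {R : realType} d (T : measurableType d).
Local Open Scope classical_set_scope.
Local Open Scope ring_scope.
Local Open Scope complex_scope.
Implicit Types f g : T -> R[i].

Definition cmfun f := measurable_fun setT (fun x => Re (f x)) /\
  measurable_fun setT (fun x => Im (f x)).

Lemma cmfun_cst c : cmfun (fun=> c).
Proof. by split; exact: measurable_cst. Qed.

Lemma cmfunD f g : cmfun f -> cmfun g -> cmfun (fun x => f x + g x).
Proof.
move=> [rf imf] [rg img]; split.
  by under eq_fun do rewrite ReD; exact: measurable_funD.
by under eq_fun do rewrite ImD; exact: measurable_funD.
Qed.

Lemma cmfunN f : cmfun f -> cmfun (fun x => - f x).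
Proof.
move=> [rf imf]; split.
  by under eq_fun do rewrite ReN; exact: measurableT_comp.
by under eq_fun do rewrite ImN; exact: measurableT_comp.
Qed.

Lemma cmfunB f g : cmfun f -> cmfun g -> cmfun (fun x => f x - g x).
Proof. by move=> mf mg; apply: cmfunD => //; exact: cmfunN. Qed.

Lemma cmfunM f g : cmfun f -> cmfun g -> cmfun (fun x => f x * g x).
Proof.
move=> [rf imf] [rg img]; split.
  under eq_fun do rewrite ReM.
  by apply: measurable_funB; exact: measurable_funM.
under eq_fun do rewrite ImM.
by apply: measurable_funD; exact: measurable_funM.
Qed.

Lemma cmfunR (h : T -> R) : measurable_fun setT h -> cmfun (fun x => (h x)%:C).
Proof. by move=> mh; split => //=; exact: measurable_cst. Qed.

Lemma cmfun_conj f : cmfun f -> cmfun (fun x => (f x)^*%C).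
Proof.
move=> [rf imf]; split.
  by rewrite (_ : (fun _ => _) = (fun x => Re (f x)))//; apply/funext => x; case: (f x).
rewrite (_ : (fun _ => _) = (fun x => - Im (f x)))//.
  exact: measurableT_comp.
by apply/funext => x; case: (f x).
Qed.

Lemma cmfun_sum (I : Type) (s : seq I) (F : I -> T -> R[i]) :
  (forall i, cmfun (F i)) -> cmfun (fun x => \sum_(i <- s) F i x).
Proof.
move=> mF; elim: s => [|i s ih].
  by under eq_fun do rewrite big_nil; exact: cmfun_cst.
by under eq_fun do rewrite big_cons; exact: cmfunD.
Qed.

Lemma cmfun_prod (I : Type) (s : seq I) (F : I -> T -> R[i]) :
  (forall i, cmfun (F i)) -> cmfun (fun x => \prod_(i <- s) F i x).
Proof.
move=> mF; elim: s => [|i s ih].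
  by under eq_fun do rewrite big_nil; exact: cmfun_cst.
by under eq_fun do rewrite big_cons; exact: cmfunM.
Qed.

Lemma measurable_normc f : cmfun f -> measurable_fun setT (fun x => normc (f x)).
Proof.
move=> [rf imf].
rewrite (_ : (fun _ => _) = (fun x => Num.sqrt (Re (f x) ^+ 2 + Im (f x) ^+ 2))).
  apply: (measurableT_comp (continuous_measurable_fun (@sqrt_continuous R))).
  by apply: measurable_funD; exact: measurable_funX.
by apply/funext => x; case: (f x).
Qed.

Lemma measurable_EFin_normc f : cmfun f ->
  measurable_fun setT (fun x => (normc (f x))%:E).
Proof. by move=> mf; apply/measurable_EFinP; exact: measurable_normc. Qed.

End complex_measurable.

Lemma cmfun_comp {R : realType} d1 d2 (T1 : measurableType d1)
    (T2 : measurableType d2) (f : T2 -> R[i]) (h : T1 -> T2) :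
  cmfun f -> measurable_fun setT h -> cmfun (fun x => f (h x)).
Proof. by move=> [rf imf] mh; split; [exact: (measurableT_comp rf)|exact: (measurableT_comp imf)]. Qed.

Section complex_integral_theory.
Local Open Scope classical_set_scope.
Local Open Scope ring_scope.
Context {R : realType} d (T : measurableType d) (mu : {measure set T -> \bar R}).
Local Open Scope complex_scope.
Implicit Types f g : T -> R[i].

(** Integrability through the modulus, which suits domination arguments; [cintableP] relates it to
    the integrability of the real and imaginary parts used in [cintegrable]. *)
Definition cintable f := cmfun f /\ (\int[mu]_x (normc (f x))%:E < +oo)%E.

Definition cint f : R[i] := (\int[mu]_x Re (f x)) +i* (\int[mu]_x Im (f x)).

Lemma eq_cint f g : f =1 g -> cint f = cint g.
Proof. by move=> /funext ->. Qed.

Lemma cintable_Re f : cintable f -> mu.-integrable setT (fun x => (Re (f x))%:E).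
Proof.
move=> [[rf imf] fy]; apply/integrableP; split; first exact/measurable_EFinP.
apply: le_lt_trans fy; apply: ge0_le_integral => //.
- by apply/measurable_EFinP; exact: measurableT_comp.
- exact: measurable_EFin_normc.
- by move=> x _ /=; rewrite lee_fin le_Re_normc.
Qed.

Lemma cintable_Im f : cintable f -> mu.-integrable setT (fun x => (Im (f x))%:E).
Proof.
move=> [[rf imf] fy]; apply/integrableP; split; first exact/measurable_EFinP.
apply: le_lt_trans fy; apply: ge0_le_integral => //.
- by apply/measurable_EFinP; exact: measurableT_comp.
- exact: measurable_EFin_normc.
- by move=> x _ /=; rewrite lee_fin le_Im_normc.
Qed.

Lemma cintableP f : cintable f <->
  mu.-integrable setT (fun x => (Re (f x))%:E) /\
  mu.-integrable setT (fun x => (Im (f x))%:E).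
Proof.
split=> [fi|[rfi ifi]]; first by split; [exact: cintable_Re|exact: cintable_Im].
have mf : cmfun f.
  by split; apply/measurable_EFinP; [exact: measurable_int rfi|exact: measurable_int ifi].
split=> //.
have /integrableP[_] := integrableD measurableT (integrable_abse rfi) (integrable_abse ifi).
apply: le_lt_trans; apply: ge0_le_integral => //.
- exact: measurable_EFin_normc.
- apply/measurable_EFinP => /=; case: mf => mf1 mf2.
  by apply: measurableT_comp => //; apply: measurable_funD; apply: measurableT_comp.
- move=> x _ /=; rewrite lee_fin.
  by rewrite ger0_norm ?addr_ge0// normc_le_ReIm.
Qed.

Lemma cintable_norm f : cintable f -> mu.-integrable setT (fun x => (normc (f x))%:E).
Proof.
move=> [mf fy]; apply/integrableP; split; first exact: measurable_EFin_normc.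
by under eq_integral do rewrite /= ger0_norm ?normc_ge0//.
Qed.

Lemma le_cintable f (g : T -> R) : cmfun f ->
  (forall x, normc (f x) <= g x) -> measurable_fun setT g ->
  (\int[mu]_x (g x)%:E < +oo)%E -> cintable f.
Proof.
move=> mf fg mg gy; split=> //; apply: le_lt_trans gy.
apply: ge0_le_integral => //.
- exact: measurable_EFin_normc.
- exact/measurable_EFinP.
- by move=> x _; rewrite lee_fin.
Qed.

Lemma cintable0 : cintable (fun=> 0).
Proof.
split; first exact: cmfun_cst.
by under eq_integral do rewrite normc0; rewrite integral0.
Qed.

Lemma cintableD f g : cintable f -> cintable g -> cintable (fun x => f x + g x).
Proof.
move=> /cintableP[rf imf] /cintableP[rg img]; apply/cintableP; split.
  by under eq_fun do rewrite ReD EFinD; exact: integrableD.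
by under eq_fun do rewrite ImD EFinD; exact: integrableD.
Qed.

Lemma cintableZ (c : R[i]) f : cintable f -> cintable (fun x => c * f x).
Proof.
move=> [mf fy]; split; first by apply: cmfunM => //; exact: cmfun_cst.
under eq_integral do rewrite normcM EFinM.
rewrite ge0_integralZl//.
  by rewrite lte_mul_pinfty.
exact: measurable_EFin_normc.
Qed.

Lemma cintableN f : cintable f -> cintable (fun x => - f x).
Proof. by move=> /(cintableZ (-1)); under eq_fun do rewrite mulN1r. Qed.

Lemma cintableB f g : cintable f -> cintable g -> cintable (fun x => f x - g x).
Proof. by move=> fi gi; apply: cintableD => //; exact: cintableN. Qed.

Lemma cintable_sum (I : Type) (s : seq I) (F : I -> T -> R[i]) :
  (forall i, cintable (F i)) -> cintable (fun x => \sum_(i <- s) F i x).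
Proof.
move=> mF; elim: s => [|i s ih].
  by under eq_fun do rewrite big_nil; exact: cintable0.
by under eq_fun do rewrite big_cons; exact: cintableD.
Qed.

Lemma cint0 : cint (fun=> 0) = 0.
Proof. by rewrite /cint /= Rintegral_cst// mul0r. Qed.

Lemma cintD f g : cintable f -> cintable g ->
  cint (fun x => f x + g x) = cint f + cint g.
Proof.
move=> /cintableP[rf imf] /cintableP[rg img]; rewrite /cint.
under eq_Rintegral do rewrite ReD.
under [in X in _ +i* X]eq_Rintegral do rewrite ImD.
by rewrite !RintegralD.
Qed.

Lemma cintZ (c : R[i]) f : cintable f -> cint (fun x => c * f x) = c * cint f.
Proof.
move=> /cintableP[rf imf]; rewrite /cint.
under eq_Rintegral do rewrite ReM.
under [in X in _ +i* X]eq_Rintegral do rewrite ImM.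
have Zi (a : R) (h : T -> R) : mu.-integrable setT (EFin \o h) ->
    mu.-integrable setT (EFin \o (fun x => a * h x)).
  by move=> hi; apply: (integrableZl measurableT a) hi.
rewrite RintegralB//; [|exact: Zi|exact: Zi].
rewrite RintegralD//; [|exact: Zi|exact: Zi].
by rewrite !RintegralZl//; case: c.
Qed.

Lemma cintN f : cintable f -> cint (fun x => - f x) = - cint f.
Proof.
by move=> /(cintZ (-1)); rewrite mulN1r => <-; apply: eq_cint => x; rewrite mulN1r.
Qed.

Lemma cintB f g : cintable f -> cintable g ->
  cint (fun x => f x - g x) = cint f - cint g.
Proof. by move=> fi gi; rewrite cintD ?cintN//; exact: cintableN. Qed.

Lemma cint_sum (I : Type) (s : seq I) (F : I -> T -> R[i]) :
  (forall i, cintable (F i)) ->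
  cint (fun x => \sum_(i <- s) F i x) = \sum_(i <- s) cint (F i).
Proof.
move=> mF; elim: s => [|i s ih].
  by rewrite big_nil; under eq_cint do rewrite big_nil; exact: cint0.
rewrite big_cons -ih -cintD//; last exact: cintable_sum.
by apply: eq_cint => x; rewrite big_cons.
Qed.

Lemma cintR (h : T -> R) : cint (fun x => (h x)%:C) = (\int[mu]_x h x)%:C.
Proof. by rewrite /cint /= Rintegral_cst// mul0r. Qed.

(** Multiplication by the unit number [c] rotates the integral onto the positive real axis, which
    reduces the claim to the bound of a real part by the modulus. *)
Lemma le_normc_cint f : cintable f ->
  ((normc (cint f))%:E <= \int[mu]_x (normc (f x))%:E)%E.
Proof.
move=> fi; set z := cint f.
have [z0|z0] := eqVneq (normc z) 0.
  by rewrite z0 integral_ge0// => x _; rewrite lee_fin normc_ge0.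
pose c := (z^*)%C * (normc z)^-1%:C.
have c1 : normc c = 1.
  by rewrite /c normcM normc_conj normcR ger0_norm ?invr_ge0 ?normc_ge0// divff.
have cz : Re (c * z) = normc z.
  rewrite /c mulrAC (mulrC _ z) mulc_conj -rmorphM/=.
  by rewrite expr2 -mulrA divff// mulr1.
have gi := cintableZ c fi.
rewrite -cz -(cintZ c fi) /= /Rintegral fineK; last first.
  by apply: integrable_fin_num => //; exact: cintable_Re.
have -> : (\int[mu]_x (normc (f x))%:E = \int[mu]_x (normc (c * f x))%:E)%E.
  by apply: eq_integral => x _; rewrite normcM c1 mul1r.
apply: le_integral => //; first exact: cintable_Re.
  exact: cintable_norm.
by move=> x _; rewrite lee_fin (le_trans (ler_norm _))// le_Re_normc.
Qed.

Lemma cintable_fin f : cintable f -> (\int[mu]_x (normc (f x))%:E)%E \is a fin_num.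
Proof.
move=> [mf fy]; rewrite ge0_fin_numE//.
by apply: integral_ge0 => x _; rewrite lee_fin normc_ge0.
Qed.

Lemma cint_dominated (f_ : nat -> T -> R[i]) f (g : T -> R) :
  (forall k, cmfun (f_ k)) -> cmfun f ->
  (forall x, normc (f_ k x - f x) @[k --> \oo] --> (0 : R)) ->
  measurable_fun setT g -> (\int[mu]_x (g x)%:E < +oo)%E ->
  (forall k x, normc (f_ k x) <= g x) -> (forall x, normc (f x) <= g x) ->
  normc (cint (f_ k) - cint f) @[k --> \oo] --> (0 : R).
Proof.
move=> mf_ mf cf mg gy fg f0g.
have g0 x : 0 <= g x by rewrite (le_trans (normc_ge0 _) (f0g x)).
have gi : mu.-integrable setT (EFin \o g).
  apply/integrableP; split; first exact/measurable_EFinP.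
  by under eq_integral do rewrite /= ger0_norm//.
have fi_ k : cintable (f_ k) by exact: le_cintable (fg k) _ _.
have fi : cintable f by exact: le_cintable f0g _ _.
have mD k : cmfun (fun x => f_ k x - f x) by exact: cmfunB.
have [|||||_ _ h] := @dominated_convergence _ T R mu setT measurableT
  (fun k x => (normc (f_ k x - f x))%:E) (cst 0%E) (fun x => 2%:E * (g x)%:E)%E.
- by move=> k; exact: measurable_EFin_normc.
- exact: measurable_cst.
- by apply: aeW => x _; apply/cvg_EFin; [exact: nearW|exact: cf].
- exact: (integrableZl measurableT 2 gi).
- apply: aeW => x k _; rewrite /= -EFinM lee_fin ger0_norm ?normc_ge0//.
  by rewrite mulr_natl mulr2n (le_trans (normcB _ _))// lerD.
have hE : (fun k => (normc (cint (f_ k) - cint f))%:E) @ \oo --> 0%E.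
  rewrite integral0 in h.
  apply: (squeeze_cvge _ (cvg_cst 0%E) h).
  apply: nearW => k; rewrite EFin_normc_ge0 -cintB//.
  exact/le_normc_cint/cintableB.
by move/fine_cvg : hE.
Qed.

End complex_integral_theory.

Section complex_fubini.
Local Open Scope classical_set_scope.
Local Open Scope ring_scope.
Local Open Scope complex_scope.
Context {R : realType} d1 d2 (T1 : measurableType d1) (T2 : measurableType d2).
Variables (m1 : {sigma_finite_measure set T1 -> \bar R})
  (m2 : {sigma_finite_measure set T2 -> \bar R}).
Variable f : T1 * T2 -> R[i].
Hypothesis mf : cmfun f.
Hypothesis fy : (\int[m1]_x \int[m2]_y (normc (f (x, y)))%:E < +oo)%E.
Hypothesis f1 : forall x, cintable m2 (fun y => f (x, y)).
Hypothesis f2 : forall y, cintable m1 (fun x => f (x, y)).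

Let prod_integrable (h : T1 * T2 -> R) : measurable_fun setT h ->
  (forall z, `|h z| <= normc (f z)) -> (m1 \x m2)%E.-integrable setT (EFin \o h).
Proof.
move=> mh hf; apply/integrable12ltyP; first exact/measurable_EFinP.
apply: le_lt_trans fy; apply: ge0_le_integral => //.
- by move=> x _; apply: integral_ge0.
- apply: (@measurable_fun_fubini_tonelli_F _ _ _ _ _ m2 (fun z => `|(h z)%:E|%E)) => //.
  by apply/measurable_EFinP; exact: measurableT_comp.
- apply: (@measurable_fun_fubini_tonelli_F _ _ _ _ _ m2 (fun z => (normc (f z))%:E)) => //.
  exact: measurable_EFin_normc.
- move=> x _; apply: ge0_le_integral => //.
  + apply/measurable_EFinP; apply: measurableT_comp => //.
    exact: (measurableT_comp mh (measurable_pair1 x)).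
  + apply: measurable_EFin_normc.
    exact: (cmfun_comp mf (measurable_pair1 x)).
  + by move=> y _; rewrite lee_fin hf.
Qed.

Let real_fubini (h : T1 * T2 -> R) : measurable_fun setT h ->
  (forall z, `|h z| <= normc (f z)) ->
  (forall x, m2.-integrable setT (fun y => (h (x, y))%:E)) ->
  (forall y, m1.-integrable setT (fun x => (h (x, y))%:E)) ->
  [/\ m1.-integrable setT (fun x => (\int[m2]_y h (x, y))%:E),
      m2.-integrable setT (fun y => (\int[m1]_x h (x, y))%:E) &
      \int[m1]_x (\int[m2]_y h (x, y)) = \int[m2]_y (\int[m1]_x h (x, y))].
Proof.
move=> mh hf h1 h2; have hi := prod_integrable mh hf.
have F1 : fubini_F m2 (EFin \o h) = (fun x => (\int[m2]_y h (x, y))%:E).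
  apply/funext => x; rewrite /fubini_F /Rintegral fineK//.
  by apply: integrable_fin_num => //; exact: h1.
have F2 : fubini_G m1 (EFin \o h) = (fun y => (\int[m1]_x h (x, y))%:E).
  apply/funext => y; rewrite /fubini_G /Rintegral fineK//.
  by apply: integrable_fin_num => //; exact: h2.
split.
- by rewrite -F1; exact: integrable_fubini_F.
- rewrite -F2; apply/integrableP; split; first exact: (measurable_fubini_G hi).
  have hy := (@integrable21ltyP _ _ _ _ _ m1 m2 _ (measurable_int _ hi)).1 hi.
  apply: le_lt_trans hy.
  apply: ge0_le_integral => //.
  + by apply: measurableT_comp => //; exact: (measurable_fubini_G hi).
  + apply: (@measurable_fun_fubini_tonelli_G _ _ _ _ _ m1 (fun z => `|(h z)%:E|%E)) => //.
    by apply/measurable_EFinP; exact: measurableT_comp.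
  + by move=> y _; apply: le_abse_integral => //; exact: measurable_int (h2 y).
- rewrite /Rintegral; congr fine; have := Fubini hi.
  by rewrite -/(fubini_F m2 (EFin \o h)) -/(fubini_G m1 (EFin \o h)) F1 F2.
Qed.

(** Fubini's theorem for the real and imaginary parts. Integrability is asked of every section, not
    of almost every one, so that the inner real-valued integrals coincide everywhere with the
    extended ones. *)
Lemma complex_fubini :
  [/\ cintable m1 (fun x => cint m2 (fun y => f (x, y))),
      cintable m2 (fun y => cint m1 (fun x => f (x, y))) &
      cint m1 (fun x => cint m2 (fun y => f (x, y))) =
      cint m2 (fun y => cint m1 (fun x => f (x, y)))].
Proof.
have [i1 i2 e] := real_fubini mf.1 (fun z => le_Re_normc (f z))
  (fun x => cintable_Re (f1 x)) (fun y => cintable_Re (f2 y)).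
have [j1 j2 e'] := real_fubini mf.2 (fun z => le_Im_normc (f z))
  (fun x => cintable_Im (f1 x)) (fun y => cintable_Im (f2 y)).
by split; [exact/cintableP|exact/cintableP|rewrite /cint /= e e'].
Qed.

End complex_fubini.

Section complex_change_of_variable.
Local Open Scope classical_set_scope.
Local Open Scope ring_scope.
Local Open Scope complex_scope.
Context {R : realType} d1 d2 (T1 : measurableType d1) (T2 : measurableType d2).
Variables (m1 : {measure set T1 -> \bar R}) (m2 : {measure set T2 -> \bar R}).
Variables (phi : T1 -> T2) (c : R).
Hypothesis mphi : measurable_fun setT phi.
Hypothesis phiE : forall F : T2 -> \bar R, measurable_fun setT F ->
  (forall y, (0 <= F y)%E) ->
  (\int[m1]_x F (phi x) = c%:E * \int[m2]_y F y)%E.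

Lemma cintable_comp (f : T2 -> R[i]) : cintable m2 f -> cintable m1 (fun x => f (phi x)).
Proof.
move=> [mf fy]; split; first exact: (cmfun_comp mf).
have := @phiE (fun y => (normc (f y))%:E); rewrite /= => -> //; last first.
  exact: measurable_EFin_normc.
have : (\int[m2]_y (normc (f y))%:E \is a fin_num)%E.
  by rewrite ge0_fin_numE// integral_ge0.
by move=> /fineK <-; rewrite -EFinM ltry.
Qed.

(** The rule [phiE] for nonnegative functions is applied to the positive and negative parts of the
    real and imaginary parts; [c] plays the role of the Jacobian. *)
Lemma cint_comp (f : T2 -> R[i]) : cintable m2 f ->
  cint m1 (fun x => f (phi x)) = c%:C * cint m2 f.
Proof.
move=> fi.
have H (h : T2 -> R) : m2.-integrable setT (EFin \o h) ->
    \int[m1]_x h (phi x) = c * \int[m2]_y h y.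
  move=> hi; rewrite /Rintegral.
  have mh := measurable_int _ hi.
  rewrite integralE [in RHS]integralE.
  have pE := phiE (measurable_funepos mh) (fun y => funepos_ge0 (EFin \o h) y).
  have nE := phiE (measurable_funeneg mh) (fun y => funeneg_ge0 (EFin \o h) y).
  have pf : (\int[m2]_x (EFin \o h)^\+ x)%E \is a fin_num.
    by apply: integrable_pos_fin_num.
  have nf : (\int[m2]_x (EFin \o h)^\- x)%E \is a fin_num.
    by apply: integrable_neg_fin_num.
  transitivity (fine (c%:E * \int[m2]_x (EFin \o h)^\+ x - c%:E * \int[m2]_x (EFin \o h)^\- x)%E).
    rewrite -pE -nE; congr (fine (_ - _)); apply: eq_integral => x _.
      by rewrite !funeposE.
    by rewrite !funenegE.
  by rewrite -(fineK pf) -(fineK nf) -!EFinM -!EFinB /= mulrBr.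
rewrite /cint (H (fun y => Re (f y)) (cintable_Re fi))
  (H (fun y => Im (f y)) (cintable_Im fi)).
by apply/eqP; rewrite eq_complex /= !mul0r subr0 addr0 !eqxx.
Qed.

End complex_change_of_variable.

Section cint_rV.
Local Open Scope classical_set_scope.
Local Open Scope ring_scope.
Local Open Scope complex_scope.
Context {R : realType} {n : nat}.
Local Notation E := ('rV[R]_n).
Local Notation mu := (@lebesgue_rV R n).
Implicit Types (f : E -> R[i]) (h : E).

Lemma cintegrableE f : cintegrable f <-> cintable mu f.
Proof. exact: iff_sym (cintableP _ _). Qed.

Lemma cmeasurableE f : cmeasurable f <-> cmfun f.
Proof. by split=> -[? ?]; split; exact/measurable_EFinP. Qed.

Lemma cintable_translate f h : cintable mu f -> cintable mu (fun x => f (x + h)).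
Proof.
apply: (@cintable_comp _ _ _ _ _ mu mu (fun x => x + h) 1).
  exact: measurable_addrV.
by move=> F mF F0; rewrite mul1e; exact: ge0_integral_translate.
Qed.

Lemma cint_translate f h : cintable mu f ->
  cint mu (fun x => f (x + h)) = cint mu f.
Proof.
move=> fi; rewrite (@cint_comp _ _ _ _ _ mu mu (fun x => x + h) 1)// ?mul1r//.
by move=> F mF F0; rewrite mul1e; exact: ge0_integral_translate.
Qed.

Lemma cintable_reflect f h : cintable mu f -> cintable mu (fun x => f (h - x)).
Proof.
apply: (@cintable_comp _ _ _ _ _ mu mu (fun x => h - x) 1).
  rewrite (_ : (fun x : E => h - x) = (fun x : E => - x + h)).
    exact: (measurableT_comp (measurable_addrV h) measurable_opprV).
  by apply/funext => x; rewrite addrC.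
by move=> F mF F0; rewrite mul1e; exact: ge0_integral_reflect.
Qed.

Lemma cint_reflect f h : cintable mu f ->
  cint mu (fun x => f (h - x)) = cint mu f.
Proof.
move=> fi; rewrite (@cint_comp _ _ _ _ _ mu mu (fun x => h - x) 1)// ?mul1r//.
by move=> F mF F0; rewrite mul1e; exact: ge0_integral_reflect.
Qed.

Let scale_integral (a : R) (a0 : 0 < a) (F : E -> \bar R) :
  measurable_fun setT F -> (forall x, (0 <= F x)%E) ->
  (\int[mu]_x F (a *: x)%R = (a ^- n)%:E * \int[mu]_x F x)%E.
Proof.
move=> mF F0; rewrite -(ge0_integral_affine_rV 0 a0 mF F0).
by apply: eq_integral => x _; rewrite addr0.
Qed.

Lemma cintable_scale f (a : R) : 0 < a -> cintable mu f ->
  cintable mu (fun x => f (a *: x)).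
Proof.
move=> a0; apply: (cintable_comp (measurable_scalerV a)).
exact: scale_integral.
Qed.

Lemma cint_scale f (a : R) : 0 < a -> cintable mu f ->
  cint mu (fun x => f (a *: x)) = (a ^- n)%:C * cint mu f.
Proof.
move=> a0 fi; apply: (@cint_comp _ _ _ _ _ mu mu (fun x => a *: x)) => //.
exact: scale_integral.
Qed.

End cint_rV.

(** * Schwartz functions *)

Section enorm_theory.
Local Open Scope classical_set_scope.
Local Open Scope ring_scope.
Context {R : realType} {n : nat}.
Local Notation E := ('rV[R]_n).
Local Notation mu := (@lebesgue_rV R n).
Implicit Types (x y h : E).

Lemma dotpDl x y h : dotp (x + y) h = dotp x h + dotp y h.
Proof. by rewrite /dotp -big_split; apply: eq_bigr => i _; rewrite mxE mulrDl. Qed.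

Lemma dotpC x y : dotp x y = dotp y x.
Proof. by apply: eq_bigr => i _; rewrite mulrC. Qed.

Lemma dotpDr x y h : dotp h (x + y) = dotp h x + dotp h y.
Proof. by rewrite dotpC dotpDl !(dotpC h). Qed.

Lemma dotpZl a x y : dotp (a *: x) y = a * dotp x y.
Proof. by rewrite /dotp mulr_sumr; apply: eq_bigr => i _; rewrite mxE mulrA. Qed.

Lemma dotpZr a x y : dotp x (a *: y) = a * dotp x y.
Proof. by rewrite dotpC dotpZl dotpC. Qed.

Lemma dotpNl x y : dotp (- x) y = - dotp x y.
Proof. by rewrite -scaleN1r dotpZl mulN1r. Qed.

Lemma dotpNr x y : dotp x (- y) = - dotp x y.
Proof. by rewrite dotpC dotpNl dotpC. Qed.

Lemma dotp0l y : dotp 0 y = 0.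
Proof. by rewrite -(scale0r (0 : E)) dotpZl mul0r. Qed.

Lemma dotpp_ge0 x : 0 <= dotp x x.
Proof. by apply: sumr_ge0 => i _; rewrite -expr2 sqr_ge0. Qed.

Lemma enorm_ge0 x : 0 <= enorm x.
Proof. exact: sqrtr_ge0. Qed.

Lemma sqr_enorm x : enorm x ^+ 2 = dotp x x.
Proof. by rewrite sqr_sqrtr// dotpp_ge0. Qed.

Lemma coor_le_enorm x i : `|x ord0 i| <= enorm x.
Proof.
rewrite -sqrtr_sqr /enorm ler_sqrt ?dotpp_ge0//.
rewrite /dotp (bigD1 i)//= -expr2 lerDl sumr_ge0// => j _.
by rewrite -expr2 sqr_ge0.
Qed.

Lemma cauchy_schwarz x y : `|dotp x y| <= enorm x * enorm y.
Proof.
have key : dotp x y ^+ 2 <= dotp x x * dotp y y.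
  have [y0|y0] := eqVneq (dotp y y) 0.
    rewrite y0 mulr0 (_ : dotp x y = 0) ?expr0n//.
    apply: big1 => i _; have := coor_le_enorm y i.
    rewrite /enorm y0 sqrtr0 normr_le0 => /eqP ->.
    by rewrite mulr0.
  have yy : 0 < dotp y y by rewrite lt_neqAle eq_sym y0 dotpp_ge0.
  have := dotpp_ge0 (x - (dotp x y / dotp y y) *: y).
  rewrite dotpDl !dotpDr !dotpNl !dotpNr !dotpZl !dotpZr (dotpC y x).
  rewrite -(pmulr_rge0 _ yy).
  set a := dotp x y; set b := dotp y y; set c := dotp x x.
  rewrite (_ : b * _ = c * b - a ^+ 2) ?subr_ge0//.
  by field.
rewrite -(ler_pXn2r (n := 2))// ?nnegrE ?mulr_ge0 ?enorm_ge0//.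
by rewrite real_normK ?num_real// exprMn !sqr_enorm.
Qed.

Lemma enormD x y : enorm (x + y) <= enorm x + enorm y.
Proof.
rewrite -(ler_pXn2r (n := 2))// ?nnegrE ?addr_ge0 ?enorm_ge0//.
rewrite sqr_enorm sqrrD !sqr_enorm dotpDl !dotpDr (dotpC y x).
rewrite (_ : _ + (_ + _) = dotp x x + dotp x y *+ 2 + dotp y y); last by ring.
by rewrite lerD2r lerD2l lerMn2r/= (le_trans (ler_norm _))// cauchy_schwarz.
Qed.

Lemma enormZ a x : enorm (a *: x) = `|a| * enorm x.
Proof.
by rewrite /enorm dotpZl dotpZr mulrA -expr2 sqrtrM ?sqr_ge0// sqrtr_sqr.
Qed.

Lemma enormN x : enorm (- x) = enorm x.
Proof. by rewrite -scaleN1r enormZ normrN normr1 mul1r. Qed.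

Lemma enorm0 : enorm (0 : E) = 0.
Proof. by rewrite /enorm dotp0l sqrtr0. Qed.

Lemma enorm_le_sum x : enorm x <= \sum_i `|x ord0 i|.
Proof.
rewrite -(ler_pXn2r (n := 2))// ?nnegrE ?enorm_ge0 ?sumr_ge0//.
rewrite sqr_enorm expr2 mulr_suml /dotp; apply: ler_sum => i _.
rewrite -expr2 -real_normK ?num_real// expr2 ler_wpM2l//.
by rewrite (bigD1 i)//= lerDl sumr_ge0.
Qed.

Lemma enorm_le_mx_norm x : enorm x <= n%:R * `|x|.
Proof.
rewrite (le_trans (enorm_le_sum x))// mulr_natl -[X in _ *+ X]card_ord -sumr_const.
apply: ler_sum => i _; rewrite -[leRHS]/(mx_norm x) mx_normrE.
exact: (le_bigmax _ (fun ij : 'I_1 * 'I_n => `|x ij.1 ij.2|) (ord0, i)).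
Qed.

Lemma enorm_delta (i : 'I_n) (a : R) : enorm (a *: delta_mx ord0 i) = `|a|.
Proof.
rewrite enormZ /enorm /dotp (bigD1 i)//= !mxE !eqxx/= mulr1 big1 ?addr0 ?sqrtr1 ?mulr1//.
by move=> j ji; rewrite !mxE (negPf ji) mul0r.
Qed.

Lemma measurable_enorm : measurable_fun setT (@enorm R n).
Proof.
apply: (measurableT_comp (continuous_measurable_fun (@sqrt_continuous R))).
apply: (@measurable_sum _ _ _ _ _ _ (fun i (x : E) => x ord0 i * x ord0 i)) => i.
by apply: measurable_funM; exact: measurable_coor.
Qed.

(** The weight occurring in [seminorm]. It is submultiplicative ([wtD]), which is how translates and
    convolutions are estimated. *)
Definition wt x : R := 1 + enorm x.

Lemma wt_ge1 x : 1 <= wt x. Proof. by rewrite lerDl enorm_ge0. Qed.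
Lemma wt_gt0 x : 0 < wt x. Proof. exact: lt_le_trans (wt_ge1 x). Qed.
Lemma wt_ge0 x : 0 <= wt x. Proof. exact: ltW (wt_gt0 x). Qed.
Lemma wtN x : wt (- x) = wt x. Proof. by rewrite /wt enormN. Qed.
Lemma wtX_ge1 x k : 1 <= wt x ^+ k. Proof. by rewrite exprn_ege1// wt_ge1. Qed.
Lemma wtX_gt0 x k : 0 < wt x ^+ k. Proof. by rewrite exprn_gt0// wt_gt0. Qed.
Lemma wtX_ge0 x k : 0 <= wt x ^+ k. Proof. exact: ltW (wtX_gt0 _ _). Qed.

Lemma wtX_le x k l : (k <= l)%N -> wt x ^+ k <= wt x ^+ l.
Proof. by move=> kl; rewrite ler_weXn2l// wt_ge1. Qed.

Lemma wtD x y : wt (x + y) <= wt x * wt y.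
Proof.
rewrite /wt mulrDl mul1r mulrDr mulr1 -addrA lerD2l.
have := enormD x y; have := mulr_ge0 (enorm_ge0 x) (enorm_ge0 y); lra.
Qed.

Lemma measurable_wtX k : measurable_fun setT (fun x => wt x ^+ k).
Proof. by apply: measurable_funX; apply: measurable_funD => //; exact: measurable_enorm. Qed.

Lemma measurable_wtXV k : measurable_fun setT (fun x => wt x ^- k).
Proof.
under eq_fun do rewrite -exprVn; apply: measurable_funX.
apply: (@measurable_funTS _ _ _ _ setT (fun x => (wt x)^-1)).
have -> : (fun x => (wt x)^-1) = (fun x => expR (- ln (wt x))).
  by apply/funext => x; rewrite expRN lnK// posrE wt_gt0.
apply: measurableT_comp => //; apply: measurableT_comp => //.
apply: measurableT_comp => //; apply: measurable_funD => //; exact: measurable_enorm.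
Qed.

Lemma wtXV_gt0 x k : 0 < wt x ^- k.
Proof. by rewrite invr_gt0 wtX_gt0. Qed.

Let g (t : measurableTypeR R) : R := (1 + t ^+ 2)^-1.

Lemma integral_oneDsqrV : (\int[@lebesgue_measure R]_t (g t)%:E = pi%:E)%E.
Proof.
have g0 t : 0 <= g t by rewrite invr_ge0 addr_ge0// sqr_ge0.
rewrite (@ge0_symfun_integralT _ g)//; last 2 first.
- exact: continuous_oneDsqrV.
- by move=> t; rewrite /g /= sqrrN.
have := @integral0y_oneDsqr R; rewrite (_ : [set x : R | 0 <= x] = `[0, +oo[%classic).
  by move=> ->; rewrite -EFinM; congr EFin; field.
by apply/seteqP; split=> x /=; rewrite in_itv/= andbT.
Qed.

Lemma integral_prod_oneDsqrV :
  (\int[mu]_x (\prod_(i < n) g (x ord0 i))%:E = (pi ^+ n)%:E)%E.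
Proof.
rewrite ge0_integral_prod_rV.
- by rewrite integral_oneDsqrV EFin_expe.
- by apply: continuous_measurable_fun; exact: continuous_oneDsqrV.
- by move=> t; rewrite invr_ge0 addr_ge0// sqr_ge0.
Qed.

(** Each factor [1 + x_i^2] is at most the square of the weight, so the integrand is dominated by a
    product of [n] one-dimensional Cauchy densities. This fixes the exponent [2 * n] used
    throughout. *)
Lemma integral_wt_lty : (\int[mu]_x (wt x ^- (2 * n))%:E < +oo)%E.
Proof.
apply: le_lt_trans (ltry (pi ^+ n)); rewrite -integral_prod_oneDsqrV.
apply: ge0_le_integral => //.
- by move=> x _; rewrite lee_fin ltW// wtXV_gt0.
- by apply/measurable_EFinP; exact: measurable_wtXV.
- apply/measurable_EFinP; apply: measurable_prod => i _.
  apply: (measurableT_comp (_ : measurable_fun setT g) (measurable_coor i)).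
  by apply: continuous_measurable_fun; exact: continuous_oneDsqrV.
- move=> x _; rewrite lee_fin /g prodfV lef_pV2 ?posrE ?wtX_gt0//; last first.
    by apply: prodr_gt0 => i _; rewrite ltr_pwDl// sqr_ge0.
  rewrite exprM -[X in _ ^+ X](card_ord n) -prodr_const; apply: ler_prod => i _.
  rewrite addr_ge0 ?sqr_ge0//= /wt sqrrD expr1n -addrA lerD2l.
  rewrite -real_normK ?num_real// ler_wpDl ?mulrn_wge0 ?mulr_ge0 ?enorm_ge0//.
  by rewrite lerXn2r ?nnegrE ?enorm_ge0 ?coor_le_enorm.
Qed.

End enorm_theory.

Lemma littleo_differentiable (R : realType) (V W : normedModType R) (f : V -> W)
    (L : {linear V -> W}) (x : V) : continuous L ->
  (forall e : R, (0 < e)%R ->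
    \forall h \near (0%R : V), (`|f (h + x) - (f x + L h)| <= e * `|h|)%R) ->
  differentiable f x /\ 'd f x = L :> (V -> W).
Proof.
move=> cL fL.
have dE : (f \o shift x = cst (f x) + L +o_ (0 : V) id)%R by apply/eqaddoP.
have dL := diff_unique cL dE.
by split => //; apply/diff_locallyP; rewrite dL.
Qed.

Section real_taylor.
Local Open Scope classical_set_scope.
Local Open Scope ring_scope.
Context {R : realType} {n : nat}.
Local Notation E := ('rV[R]_n).
Implicit Types (x h : E) (f : E -> R).

Definition linform (a : 'I_n -> R) (h : E) : R := \sum_i h ord0 i * a i.

Fact linform_is_linear a : linear (linform a : E -> R^o).
Proof.
move=> c u v; rewrite /linform scaler_sumr -big_split; apply: eq_bigr => i _.
by rewrite /GRing.scale/= !mxE mulrDl mulrA.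
Qed.
HB.instance Definition _ a :=
  GRing.isLinear.Build R E R^o *:%R (linform a) (linform_is_linear a).

Lemma linform_le a M h : (forall i, `|a i| <= M) ->
  `|linform a h| <= n%:R * M * enorm h.
Proof.
move=> aM; rewrite (le_trans (ler_norm_sum _ _ _))//.
rewrite -mulrA mulr_natl -[X in _ *+ X]card_ord -sumr_const; apply: ler_sum => i _.
by rewrite normrM mulrC ler_pM// coor_le_enorm.
Qed.

Lemma linform_continuous a : continuous (linform a : E -> R^o).
Proof.
apply: bounded_linear_continuous; apply/linear_boundedP.
exists (n%:R * (\sum_i `|a i|) * n%:R); split; first exact: num_real.
move=> M Mgt h.
have aM i : `|a i| <= \sum_i `|a i| by rewrite (bigD1 i)//= lerDl sumr_ge0.
rewrite (le_trans (linform_le h aM))//.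
rewrite (@le_trans _ _ (n%:R * (\sum_i `|a i|) * (n%:R * `|h|)))//.
  by rewrite ler_wpM2l ?mulr_ge0 ?sumr_ge0// enorm_le_mx_norm.
by rewrite mulrA ler_wpM2r// ltW.
Qed.

Lemma quad_differentiable f a x C :
  (forall h, enorm h <= 1 ->
    `|f (x + h) - f x - linform a h| <= C * enorm h ^+ 2) ->
  differentiable f x /\ forall h, 'D_h f x = linform a h.
Proof.
move=> fC.
have C0 : 0 <= `|C| by [].
have [|df dL] := @littleo_differentiable R E R^o f (linform a) x (linform_continuous (a := a)).
  move=> e e0.
  (* The topology is that of the sup norm, and [n^2] is the price of passing from the Euclidean
     norm; the summand 1 keeps the constant positive. *)
  have K0 : 0 < `|C| * n%:R ^+ 2 + 1 by rewrite ltr_pwDr// mulr_ge0 ?exprn_ge0.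
  have H := @nbhs0_le R E _ (mulr_gt0 (_ : 0 < (`|C| * n%:R ^+ 2 + 1)^-1) e0).
  rewrite invr_gt0 in H; have {}H := H K0.
  have n1 : 0 < (n%:R + 1)^-1 :> R by rewrite invr_gt0 ltr_pwDr.
  have H1 := @nbhs0_le R E _ n1.
  near=> h.
  have h1 : enorm h <= 1.
    rewrite (le_trans (enorm_le_mx_norm h))//.
    rewrite (@le_trans _ _ ((n%:R + 1) * `|h|)) ?ler_wpM2r ?lerDl//.
    by rewrite -ler_pdivlMl ?ltr_pwDr// mulr1; near: h; exact: H1.
  rewrite (addrC h) opprD addrA; apply: (le_trans (fC h h1)).
  rewrite (@le_trans _ _ (`|C| * (n%:R * `|h|) ^+ 2))//.
    rewrite (@le_trans _ _ (`|C| * enorm h ^+ 2)) ?ler_wpM2r ?sqr_ge0 ?ler_norm//.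
    rewrite ler_wpM2l// lerXn2r ?nnegrE ?mulr_ge0 ?enorm_ge0//.
    exact: enorm_le_mx_norm.
  rewrite exprMn (expr2 `|h|) !mulrA ler_wpM2r//.
  rewrite (@le_trans _ _ ((`|C| * n%:R ^+ 2 + 1) * `|h|))//.
    by rewrite -(mulrA `|C|) -expr2 ler_wpM2r// lerDl.
  by rewrite -ler_pdivlMl//; near: h; exact: H.
by split => // h; rewrite deriveE// dL.
Unshelve. all: by end_near. Qed.

Lemma derive_line f x h t : differentiable f (x + t *: h) ->
  is_derive t 1 (fun s : R => f (x + s *: h)) ('D_h f (x + t *: h)).
Proof.
move=> df.
have E0 : (fun s : R => s^-1 *: (((fun s : R => f (x + s *: h)) \o shift t) (s *: 1) - f (x + t *: h)))
    = (fun s : R => s^-1 *: ((f \o shift (x + t *: h)) (s *: h) - f (x + t *: h))).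
  apply/funext => s /=; congr (_ *: (f _ - _)).
  by rewrite -[s%:A]/(s * 1) mulr1 scalerDl addrCA.
have dv := diff_derivable (v := h) df.
by split; rewrite /derivable /derive E0.
Qed.

Lemma derive_coor f x h : differentiable f x ->
  'D_h f x = linform (fun i => 'D_(delta_mx ord0 i) f x) h.
Proof.
move=> df; rewrite deriveE// [in LHS](row_sum_delta h) linear_sum; apply: eq_bigr => i _.
by rewrite linearZ/= deriveE.
Qed.

Lemma mean_value f x h : (forall t, 0 <= t <= 1 -> differentiable f (x + t *: h)) ->
  exists2 t, 0 <= t <= 1 &
    f (x + h) - f x = linform (fun i => 'D_(delta_mx ord0 i) f (x + t *: h)) h.
Proof.
move=> df.
have [||t] := @MVT_segment R (fun s => f (x + s *: h)) (fun s => 'D_h f (x + s *: h)) 0 1 ler01.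
- move=> t /[!in_itv]/= /andP[t0 t1]; apply: derive_line; apply: df.
  by rewrite !ltW.
- apply: derivable_within_continuous => t /[!in_itv]/= t01.
  by have [] := derive_line (df _ t01).
rewrite in_itv/= => t01; rewrite scale1r scale0r addr0 subr0 mulr1 => ->.
by exists t => //; rewrite derive_coor//; exact: df.
Qed.

End real_taylor.

Section complex_calculus.
Local Open Scope classical_set_scope.
Local Open Scope ring_scope.
Local Open Scope complex_scope.
Context {R : realType} {n : nat}.
Local Notation E := ('rV[R]_n).
Local Notation C := (R[i]).
Implicit Types (x h : E) (f g : E -> C) (s : seq 'I_n).

Definition clin (g : 'I_n -> C) (h : E) : C := \sum_i (h ord0 i)%:C * g i.

Lemma Re_clin (g : 'I_n -> C) h : Re (clin g h) = linform (fun i => Re (g i)) h.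
Proof. by rewrite Re_sum; apply: eq_bigr => i _; rewrite ReM/= mul0r subr0. Qed.

Lemma Im_clin (g : 'I_n -> C) h : Im (clin g h) = linform (fun i => Im (g i)) h.
Proof. by rewrite Im_sum; apply: eq_bigr => i _; rewrite ImM/= mul0r addr0. Qed.

Lemma clinZ (c : C) (g : 'I_n -> C) h : clin (fun i => c * g i) h = c * clin g h.
Proof. by rewrite /clin mulr_sumr; apply: eq_bigr => i _; rewrite mulrCA. Qed.

Lemma clinD (g1 g2 : 'I_n -> C) h :
  clin (fun i => g1 i + g2 i) h = clin g1 h + clin g2 h.
Proof. by rewrite /clin -big_split; apply: eq_bigr => i _; rewrite mulrDr. Qed.

Lemma clin_scale (g : 'I_n -> C) (a : R) h : clin g (a *: h) = a%:C * clin g h.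
Proof.
by rewrite /clin mulr_sumr; apply: eq_bigr => i _; rewrite mxE rmorphM mulrA.
Qed.

Lemma clin_delta (g : 'I_n -> C) (a : R) i : clin g (a *: delta_mx ord0 i) = a%:C * g i.
Proof.
rewrite clin_scale /clin (bigD1 i)//= mxE !eqxx mul1r big1 ?addr0// => j ji.
by rewrite mxE (negPf ji) andbF mul0r.
Qed.

Definition cdiff f x := differentiable (fun y => Re (f y)) x /\
  differentiable (fun y => Im (f y)) x.

Lemma quad_partial f (g : 'I_n -> C) x M :
  (forall h, enorm h <= 1 ->
    normc (f (x + h) - f x - clin g h) <= M * enorm h ^+ 2) ->
  cdiff f x /\ forall i, partial i f x = g i.
Proof.
move=> fM.
have [|dR eR] := @quad_differentiable R n (fun y => Re (f y)) (fun i => Re (g i)) x M.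
  move=> h h1; apply: le_trans (fM h h1); rewrite -Re_clin -!ReN -!ReD.
  exact: le_Re_normc.
have [|dI eI] := @quad_differentiable R n (fun y => Im (f y)) (fun i => Im (g i)) x M.
  move=> h h1; apply: le_trans (fM h h1); rewrite -Im_clin -!ImN -!ImD.
  exact: le_Im_normc.
split=> // i; rewrite /partial eR eI.
have e (a : 'I_n -> R) : linform a (delta_mx ord0 i) = a i.
  rewrite /linform (bigD1 i)//= mxE !eqxx mul1r big1 ?addr0// => j ji.
  by rewrite mxE (negPf ji) andbF mul0r.
by rewrite !e; case: (g i).
Qed.

(** First-order expansion with a quadratic remainder. Unlike mere differentiability it passes
    through integrals, which replaces differentiation under the integral sign for convolutions and
    Fourier transforms. *)
Definition quad f (g : 'I_n -> E -> C) := forall x, exists M, forall h,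
  enorm h <= 1 -> normc (f (x + h) - f x - clin (g ^~ x) h) <= M * enorm h ^+ 2.

(** Candidates for all iterated derivatives are supplied at once, indexed by sequences of
    directions; the expansions identify them one by one by induction on the sequence. *)
Lemma smooth_family (G : seq 'I_n -> E -> C) :
  (forall s, quad (G s) (fun i => G (i :: s))) ->
  smooth (G [::]) /\ forall s, partials s (G [::]) = G s.
Proof.
move=> qG.
have pG s : partials s (G [::]) = G s.
  elim: s => [//|i s ih]; rewrite /= -/(partials s (G [::])) ih.
  apply/funext => x; have [M GM] := qG s x.
  by have [_ ->] := quad_partial GM.
split=> // s x; rewrite pG; have [M GM] := qG s x.
by have [] := quad_partial GM.
Qed.

Lemma partials_cat s1 s2 f : partials (s1 ++ s2) f = partials s1 (partials s2 f).
Proof. by rewrite /partials foldr_cat. Qed.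

Lemma smooth_partials s f : smooth f -> smooth (partials s f).
Proof. by move=> sf t x; rewrite -partials_cat. Qed.

(** The mean value theorem gives different intermediate points for the real and the imaginary part,
    hence the factor 2. *)
Lemma cmean_value f x h M : (forall t, 0 <= t <= 1 -> cdiff f (x + t *: h)) ->
  (forall t i, 0 <= t <= 1 -> normc (partial i f (x + t *: h)) <= M) ->
  normc (f (x + h) - f x) <= 2 * n%:R * M * enorm h.
Proof.
move=> df fM; rewrite (le_trans (normc_le_ReIm _))//.
rewrite (_ : 2 * _ * _ * _ = n%:R * M * enorm h + n%:R * M * enorm h); last by ring.
apply: lerD.
  rewrite ReD ReN; have [t t01 ->] := mean_value (fun t t01 => (df t t01).1).
  apply: linform_le => i; apply: le_trans (fM t i t01).
  exact: (le_Re_normc (partial i f (x + t *: h))).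
rewrite ImD ImN; have [t t01 ->] := mean_value (fun t t01 => (df t t01).2).
apply: linform_le => i; apply: le_trans (fM t i t01).
exact: (le_Im_normc (partial i f (x + t *: h))).
Qed.

Lemma linformB (a b : 'I_n -> R) h :
  linform a h - linform b h = linform (fun i => a i - b i) h.
Proof. by rewrite /linform -sumrB; apply: eq_bigr => i _; rewrite mulrBr. Qed.

(** The mean value theorem is applied to [f] and then to its partial derivatives; each use treats
    the real and imaginary parts separately, hence the factor 4, and sums over [n] directions. *)
Lemma ctaylor f x h M : smooth f ->
  (forall t i j, 0 <= t <= 1 -> normc (partials [:: j; i] f (x + t *: h)) <= M) ->
  normc (f (x + h) - f x - clin (fun i => partial i f x) h) <=
  4 * n%:R ^+ 2 * M * enorm h ^+ 2.
Proof.
move=> sf fM.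
have d1 t i : 0 <= t <= 1 ->
    normc (partial i f (x + t *: h) - partial i f x) <= 2 * n%:R * M * enorm h.
  move=> /andP[t0 t1].
  have M0 : 0 <= M.
    by apply: le_trans (fM 0 i i _); rewrite ?normc_ge0// lexx ler01.
  rewrite (@le_trans _ _ (2 * n%:R * M * enorm (t *: h)))//.
    apply: cmean_value => [r _|r j /andP[r0 r1]].
      exact: (sf [:: i]).
    by rewrite scalerA; apply: fM; rewrite mulr_ge0//= mulr_ile1.
  rewrite ler_wpM2l ?mulr_ge0// enormZ ger0_norm// ler_piMl// enorm_ge0//.
rewrite (le_trans (normc_le_ReIm _))// !ReD !ImD !ReN !ImN Re_clin Im_clin.
rewrite (_ : 4 * _ * _ * _ = n%:R * (2 * n%:R * M * enorm h) * enorm h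
  + n%:R * (2 * n%:R * M * enorm h) * enorm h); last by ring.
have df t : cdiff f (x + t *: h) by exact: (sf [::]).
apply: lerD.
  have [t t01 ->] := mean_value (fun t (_ : 0 <= t <= 1) => (df t).1).
  rewrite linformB; apply: linform_le => i.
  apply: le_trans (d1 t i t01).
  by have := le_Re_normc (partial i f (x + t *: h) - partial i f x); rewrite ReD ReN.
have [t t01 ->] := mean_value (fun t (_ : 0 <= t <= 1) => (df t).2).
rewrite linformB; apply: linform_le => i.
apply: le_trans (d1 t i t01).
by have := le_Im_normc (partial i f (x + t *: h) - partial i f x); rewrite ImD ImN.
Qed.

Lemma smooth_cmfun f : smooth f -> cmfun f.
Proof.
move=> sf; split; apply: continuous_measurable_rV => x;
  apply: differentiable_continuous; have [] := sf [::] x => //.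
Qed.

End complex_calculus.

Section schwartz_theory.
Local Open Scope classical_set_scope.
Local Open Scope ring_scope.
Local Open Scope complex_scope.
Context {R : realType} {n : nat}.
Local Notation E := ('rV[R]_n).
Local Notation C := (R[i]).
Implicit Types (x h : E) (f g : E -> C) (s : seq 'I_n).

Lemma le_seminorm k f s x : (size s <= k)%N ->
  ((wt x ^+ k * normc (partials s f x))%:E <= seminorm k f)%E.
Proof. by move=> sk; apply: ereal_sup_ubound; exists (s, x). Qed.

Lemma seminorm_le k f (M : \bar R) :
  (forall s x, (size s <= k)%N -> ((wt x ^+ k * normc (partials s f x))%:E <= M)%E) ->
  (seminorm k f <= M)%E.
Proof. by move=> fM; apply: ge_ereal_sup => _ [[s x] /= sk <-]; exact: fM. Qed.

Definition snorm k f : R := fine (seminorm k f).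

Lemma seminorm_ge0 k f : (0 <= seminorm k f)%E.
Proof.
apply: le_trans (@le_seminorm k f [::] 0 isT).
by rewrite lee_fin; apply: mulr_ge0; [exact: wtX_ge0|exact: normc_ge0].
Qed.

Lemma snorm_ge0 k f : 0 <= snorm k f.
Proof. by rewrite fine_ge0// seminorm_ge0. Qed.

Lemma seminormE k f : schwartz f -> seminorm k f = (snorm k f)%:E.
Proof. by move=> [_ /(_ k) fk]; rewrite fineK// ge0_fin_numE// seminorm_ge0. Qed.

Lemma le_snorm k f s x : schwartz f -> (size s <= k)%N ->
  wt x ^+ k * normc (partials s f x) <= snorm k f.
Proof. by move=> Sf sk; rewrite -lee_fin -seminormE// le_seminorm. Qed.

Lemma le_snormV k f s x : schwartz f -> (size s <= k)%N ->
  normc (partials s f x) <= snorm k f * wt x ^- k.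
Proof. by move=> Sf sk; rewrite ler_pdivlMr ?wtX_gt0// mulrC le_snorm. Qed.

Lemma snorm_le k f M : schwartz f ->
  (forall s x, (size s <= k)%N -> wt x ^+ k * normc (partials s f x) <= M) ->
  snorm k f <= M.
Proof.
move=> Sf fM; rewrite -lee_fin -seminormE//; apply: seminorm_le => s x sk.
by rewrite lee_fin fM.
Qed.

Lemma schwartz_family (G : seq 'I_n -> E -> C) :
  (forall s, quad (G s) (fun i => G (i :: s))) ->
  (forall k, exists M, forall s x, (size s <= k)%N -> wt x ^+ k * normc (G s x) <= M) ->
  schwartz (G [::]) /\ forall s, partials s (G [::]) = G s.
Proof.
move=> qG bG; have [sG pG] := smooth_family qG; split=> //; split=> // k.
have [M GM] := bG k; apply: le_lt_trans (ltry M).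
by apply: seminorm_le => s x sk; rewrite lee_fin pG GM.
Qed.

Lemma schwartz_smooth f : schwartz f -> smooth f. Proof. by case. Qed.

Lemma schwartz_taylor f s x h : schwartz f ->
  normc (partials s f (x + h) - partials s f x -
    clin (fun i => partials (i :: s) f x) h) <=
  4 * n%:R ^+ 2 * snorm (size s).+2 f * enorm h ^+ 2.
Proof.
move=> Sf; apply: ctaylor.
  exact/smooth_partials/schwartz_smooth.
move=> t i j t01; rewrite -partials_cat/=.
apply: le_trans (@le_snorm (size s).+2 f [:: j, i & s] (x + t *: h) Sf _) => //.
rewrite -[leLHS]mul1r; apply: ler_wpM2r; first exact: normc_ge0.
exact: wtX_ge1.
Qed.

Lemma schwartz0 : schwartz ((fun=> 0) : E -> C).
Proof.
have [||//] := @schwartz_family (fun s x => 0).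
- move=> s x; exists 0 => h _; rewrite /clin big1; last by move=> i _; rewrite mulr0.
  by rewrite !subr0 normc0 mul0r.
- by move=> k; exists 0 => s x _; rewrite normc0 mulr0.
Qed.

Lemma schwartz_lin (a : C) f g : schwartz f -> schwartz g ->
  schwartz (fun x => a * f x + g x) /\
  forall s, partials s (fun x => a * f x + g x) =
    (fun x => a * partials s f x + partials s g x).
Proof.
move=> Sf Sg.
apply: (@schwartz_family (fun s x => a * partials s f x + partials s g x)).
- move=> s x; exists (normc a * (4 * n%:R ^+ 2 * snorm (size s).+2 f) +
    4 * n%:R ^+ 2 * snorm (size s).+2 g) => h _.
  have := schwartz_taylor s x h Sf; have := schwartz_taylor s x h Sg.
  set F := (X in normc X <= _ -> _ -> _); set G := (X in _ -> normc X <= _ -> _) => hF hG.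
  rewrite clinD clinZ.
  rewrite [X in normc X](_ : _ = a * G + F); last by rewrite /F /G; ring.
  apply: (le_trans (normcD _ _)); rewrite mulrDl; apply: lerD => //.
  rewrite normcM -(mulrA (normc a)).
  apply: ler_wpM2l; first exact: normc_ge0.
  exact: hG.
- move=> k; exists (normc a * snorm k f + snorm k g) => s x sk.
  rewrite (@le_trans _ _ (normc a * (wt x ^+ k * normc (partials s f x)) +
     wt x ^+ k * normc (partials s g x)))//.
    rewrite mulrCA -mulrDr ler_wpM2l ?wtX_ge0// (le_trans (normcD _ _))//.
    by rewrite normcM.
  by rewrite lerD// ?ler_wpM2l// le_snorm.
Qed.

Lemma schwartzZ (a : C) f : schwartz f -> schwartz (fun x => a * f x).
Proof.
move=> Sf; have [+ _] := schwartz_lin a Sf schwartz0.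
by under eq_fun do rewrite addr0.
Qed.

Lemma schwartzD f g : schwartz f -> schwartz g -> schwartz (fun x => f x + g x).
Proof.
move=> Sf Sg; have [+ _] := schwartz_lin 1 Sf Sg.
by under eq_fun do rewrite mul1r.
Qed.

Lemma schwartzB f g : schwartz f -> schwartz g -> schwartz (fun x => f x - g x).
Proof.
move=> Sf Sg; have [+ _] := schwartz_lin (-1) Sg Sf.
by under eq_fun do rewrite mulN1r addrC.
Qed.

Lemma schwartz_sum (I : Type) (r : seq I) (P : pred I) (F : I -> E -> C) :
  (forall i, P i -> schwartz (F i)) -> schwartz (fun x => \sum_(i <- r | P i) F i x).
Proof.
move=> SF; elim: r => [|i r ih].
  by under eq_fun do rewrite big_nil; exact: schwartz0.
under eq_fun do rewrite big_cons.
by case: (boolP (P i)) => // Pi; apply: schwartzD => //; exact: SF.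
Qed.

Lemma schwartz_affine (a : R) (h0 : E) f : a != 0 -> schwartz f ->
  schwartz (fun x => f (a *: x + h0)) /\
  forall s, partials s (fun x => f (a *: x + h0)) =
    (fun x => (a ^+ size s)%:C * partials s f (a *: x + h0)).
Proof.
move=> a0 Sf.
have [] := @schwartz_family (fun s x => (a ^+ size s)%:C * partials s f (a *: x + h0)).
- move=> s x; exists (normc (a ^+ size s)%:C *
    (4 * n%:R ^+ 2 * snorm (size s).+2 f) * a ^+ 2) => h _.
  have := schwartz_taylor s (a *: x + h0) (a *: h) Sf; rewrite clin_scale => H.
  rewrite (_ : a *: (x + h) + h0 = a *: x + h0 + a *: h); last first.
    by rewrite scalerDr addrAC.
  rewrite [X in clin X](_ : _ = (fun i => (a ^+ size s)%:C *
      (a%:C * partials (i :: s) f (a *: x + h0)))); last first.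
    by apply/funext => i; rewrite mulrA -rmorphM -exprSr.
  rewrite clinZ clinZ -!mulrBr normcM -!mulrA ler_wpM2l//.
  move: H; rewrite enormZ exprMn real_normK ?num_real// mulrA.
  by rewrite -!mulrA.
- move=> k; exists ((1 + `|a|) ^+ k * (1 + `|a|^-1) ^+ k * wt h0 ^+ k * snorm k f) => s x sk.
  (* [x] is recovered from its image by the inverse affine map, so its weight is bounded by that of
     the image. *)
  have w1 : wt x <= (1 + `|a|^-1) * wt h0 * wt (a *: x + h0).
    have : x = a^-1 *: ((a *: x + h0) - h0) by rewrite addrK scalerA mulVf// scale1r.
    move: (a *: x + h0) => y ->.
    have ia : 0 <= `|a|^-1 by rewrite invr_ge0.
    rewrite (@le_trans _ _ ((1 + `|a|^-1) * wt (y - h0)))//.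
      rewrite /wt enormZ normfV mulrDl mul1r mulrDr mulr1 -addrA lerD2l.
      have := enorm_ge0 (y - h0); have := mulr_ge0 ia (enorm_ge0 (y - h0)); lra.
    by rewrite -mulrA ler_wpM2l ?addr_ge0// mulrC (le_trans (wtD _ _))// wtN.
  rewrite normcM normcR (@le_trans _ _ (((1 + `|a|^-1) * wt h0 * wt (a *: x + h0)) ^+ k *
     ((1 + `|a|) ^+ k * normc (partials s f (a *: x + h0)))))//.
    apply: ler_pM; first exact: wtX_ge0.
    - exact: mulr_ge0.
    - by rewrite lerXn2r ?nnegrE ?mulr_ge0 ?wt_ge0 ?addr_ge0 ?invr_ge0.
    - rewrite ler_wpM2r// normrX (@le_trans _ _ ((1 + `|a|) ^+ size s))//.
        by rewrite lerXn2r ?nnegrE ?addr_ge0// lerDr.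
      by rewrite ler_weXn2l// lerDl.
  rewrite !exprMn [leLHS](_ : _ = (1 + `|a|) ^+ k * (1 + `|a|^-1) ^+ k * wt h0 ^+ k *
    (wt (a *: x + h0) ^+ k * normc (partials s f (a *: x + h0)))); last by ring.
  rewrite ler_wpM2l ?le_snorm// !mulr_ge0 ?wtX_ge0 ?exprn_ge0 ?addr_ge0 ?invr_ge0//.
- rewrite [X in schwartz X](_ : _ = (fun x => f (a *: x + h0))); last first.
    by apply/funext => x; rewrite expr0 mul1r.
  move=> S1 S2; split=> // s; rewrite -S2; congr partials.
  by apply/funext => x; rewrite expr0 mul1r.
Qed.

(** The seminorm of order [k + 2 * n] leaves the integrable weight to the power [-2n] after [k]
    powers have been spent. *)
Lemma schwartz_cintable f k : schwartz f ->
  cintable (@lebesgue_rV R n) (fun x => (wt x ^+ k)%:C * f x).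
Proof.
move=> Sf.
apply: (@le_cintable _ _ _ _ _ (fun x => snorm (k + 2 * n) f * wt x ^- (2 * n))).
- apply: cmfunM; first by apply: cmfunR; exact: measurable_wtX.
  by apply: smooth_cmfun; exact: schwartz_smooth.
- move=> x; rewrite normcM normcR ger0_norm ?wtX_ge0//.
  rewrite ler_pdivlMr ?wtX_gt0// mulrAC -exprD.
  exact: (@le_snorm (k + 2 * n) f [::] x Sf isT).
- by apply: measurable_funM => //; exact: measurable_wtXV.
- under eq_integral do rewrite EFinM.
  rewrite ge0_integralZl_EFin//; last 3 first.
  + by move=> x _; rewrite lee_fin ltW// wtXV_gt0.
  + by apply/measurable_EFinP; exact: measurable_wtXV.
  + exact: snorm_ge0.
  by rewrite lte_mul_pinfty ?lee_fin ?snorm_ge0// integral_wt_lty.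
Qed.

Lemma schwartz_integrable f : schwartz f -> cintable (@lebesgue_rV R n) f.
Proof.
move=> /(schwartz_cintable 0); under eq_fun do rewrite expr0 mul1r.
by [].
Qed.

End schwartz_theory.

Section schwartz_closure.
Local Open Scope classical_set_scope.
Local Open Scope ring_scope.
Local Open Scope complex_scope.
Context {R : realType} {n : nat}.
Local Notation E := ('rV[R]_n).
Local Notation C := (R[i]).
Local Notation mu := (@lebesgue_rV R n).
Implicit Types (x y h : E) (f g K w : E -> C) (s t : seq 'I_n).

Lemma schwartz_partials t f : schwartz f -> schwartz (partials t f).
Proof.
move=> Sf; split; first exact/smooth_partials/schwartz_smooth.
move=> k; apply: le_lt_trans (ltry (snorm (k + size t) f)).
apply: seminorm_le => s x sk; rewrite lee_fin -partials_cat.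
apply: le_trans (@le_snorm _ _ (k + size t) f (s ++ t) x Sf _).
  by rewrite ler_wpM2r// wtX_le// leq_addr.
by rewrite size_cat leq_add2r.
Qed.

Fixpoint rems (i : 'I_n) s : seq (seq 'I_n) :=
  if s is j :: t then (if i == j then [:: t] else [::]) ++ [seq j :: u | u <- rems i t]
  else [::].

Lemma size_rems i s u : u \in rems i s -> (size u <= size s)%N.
Proof.
elim: s u => [//|j s ih] u /=; rewrite mem_cat => /orP[|/mapP[v vs ->]].
  by case: ifP => // _; rewrite inE => /eqP ->.
by rewrite /= ltnS ih.
Qed.

Lemma count_rems i s : (size (rems i s) <= size s)%N.
Proof.
elim: s => [//|j s ih] /=; rewrite size_cat size_map.
by case: ifP => _; rewrite ?add1n ?ltnS// add0n (leq_trans ih).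
Qed.

(* Leibniz' rule for the product with a coordinate: [rems i s] lists the
   sequences obtained from [s] by dropping one occurrence of [i]. *)
Lemma schwartz_coorM i f : schwartz f -> schwartz (fun x => (x ord0 i)%:C * f x).
Proof.
move=> Sf; pose G s x := (x ord0 i)%:C * partials s f x +
  \sum_(u <- rems i s) partials u f x.
have [] := @schwartz_family R n G.
- move=> s x.
  pose D (u : seq 'I_n) := 4 * n%:R ^+ 2 * snorm (size u).+2 f.
  exists (`|x ord0 i| * D s + (2 * n%:R * snorm (size s).+1 f) + \sum_(u <- rems i s) D u) => h _.
  have T u : normc (partials u f (x + h) - partials u f x -
      clin (fun j => partials (j :: u) f x) h) <= D u * enorm h ^+ 2.
    exact: schwartz_taylor.
  have M : normc (partials s f (x + h) - partials s f x) <=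
      2 * n%:R * snorm (size s).+1 f * enorm h.
    apply: cmean_value => [r _|r j _].
      by apply: (schwartz_smooth Sf).
    apply: le_trans (@le_snorm _ _ (size s).+1 f (j :: s) (x + r *: h) Sf _) => //.
    by rewrite ler_peMl// wtX_ge1.
  rewrite [X in normc X](_ : _ = (x ord0 i)%:C * (partials s f (x + h) -
      partials s f x - clin (fun j => partials (j :: s) f x) h) +
    (h ord0 i)%:C * (partials s f (x + h) - partials s f x) +
    \sum_(u <- rems i s) (partials u f (x + h) - partials u f x -
      clin (fun j => partials (j :: u) f x) h)); last first.
    have -> : clin (fun j => G (j :: s) x) h =
        (x ord0 i)%:C * clin (fun j => partials (j :: s) f x) h +
        (h ord0 i)%:C * partials s f x +
        \sum_(u <- rems i s) clin (fun j => partials (j :: u) f x) h.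
      have -> : (h ord0 i)%:C * partials s f x =
          clin (fun j => if i == j then partials s f x else 0) h.
        rewrite /clin (bigD1 i)//= eqxx big1 ?addr0// => j.
        by rewrite eq_sym => /negPf ->; rewrite mulr0.
      have -> : \sum_(u <- rems i s) clin (fun j => partials (j :: u) f x) h =
          clin (fun j => \sum_(u <- rems i s) partials (j :: u) f x) h.
        by rewrite /clin exchange_big; apply: eq_bigr => j _; rewrite mulr_sumr.
      rewrite -clinZ -!clinD.
      apply: eq_bigr => j _; congr (_ * _); rewrite /G /= big_cat/= big_map -addrA.
      by congr (_ + (_ + _)); case: ifP => _; rewrite ?big_seq1 ?big_nil.
    rewrite /G !sumrB mxE rmorphD/=.
    set S1 := \sum_(u <- _) partials u f (x + h).
    set S2 := \sum_(u <- _) partials u f x.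
    set S3 := \sum_(u <- _) clin _ _; set c := clin _ _.
    by ring.
  rewrite [leRHS]mulrDl [X in _ <= X + _]mulrDl.
  apply: le_trans (normcD _ _) _; apply: lerD.
    apply: le_trans (normcD _ _) _; apply: lerD; rewrite normcM normcR.
      by rewrite -mulrA ler_wpM2l.
    rewrite expr2 mulrA [leRHS]mulrC; apply: ler_pM => //.
    exact: coor_le_enorm.
  apply: le_trans (normc_sum _ _ _) _; rewrite mulr_suml.
  by apply: ler_sum => u _; exact: T.
- move=> k; exists (snorm k.+1 f + k%:R * snorm k f) => s x sk.
  rewrite (@le_trans _ _ (wt x ^+ k * (`|x ord0 i| * normc (partials s f x) +
      \sum_(u <- rems i s) normc (partials u f x))))//.
    rewrite ler_wpM2l ?wtX_ge0// (le_trans (normcD _ _))// normcM normcR.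
    by rewrite lerD2l normc_sum.
  rewrite mulrDr lerD//.
    apply: le_trans (@le_snorm _ _ k.+1 f s x Sf (leqW sk)).
    rewrite mulrA ler_wpM2r// exprSr ler_wpM2l ?wtX_ge0//.
    by rewrite (le_trans (coor_le_enorm x i))// lerDr.
  rewrite (@le_trans _ _ ((size (rems i s))%:R * snorm k f))//.
    rewrite mulr_sumr (@le_trans _ _ (\sum_(u <- rems i s) snorm k f))//.
      rewrite big_seq [leRHS]big_seq; apply: ler_sum => u us.
      by apply: le_snorm => //; rewrite (leq_trans (size_rems us)).
    by rewrite big_const_seq count_predT iter_addr_0 mulr_natl.
  by rewrite ler_wpM2r ?snorm_ge0// ler_nat (leq_trans (count_rems i s)).
- move=> S _; move: S; rewrite [X in schwartz X](_ : _ = (fun x => (x ord0 i)%:C * f x))//.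
  by apply/funext => x; rewrite /G/= big_nil addr0.
Qed.

Lemma test_support f : test_function f ->
  exists2 A : R, 0 <= A & forall x, A < enorm x -> f x = 0.
Proof.
move=> [_ cf]; have [M [_ fM]] := compact_bounded cf.
exists (n%:R * (`|M| + 1)); first by rewrite mulr_ge0// addr_ge0.
move=> x Ax; apply: contrapT => /eqP fx.
have := fM (`|M| + 1) _ x (@subset_closure _ _ x fx).
rewrite ltr_pwDr ?ler_norm// => /(_ isT) xM.
move: Ax; rewrite ltNge => /negP; apply.
by rewrite (le_trans (enorm_le_mx_norm x))// ler_wpM2l.
Qed.

(** All derivatives vanish outside the ball that contains the support, and each is bounded by
    continuity on a compact cube. The bound is made uniform over the derivatives of order at most
    [l] by induction on [l], for all functions supported in the same ball. *)
Lemma test_schwartz f : test_function f -> schwartz f.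
Proof.
move=> tf; have [A A0 fA] := test_support tf; have [sf cf] := tf.
suff H k : forall g, smooth g -> (forall x, A < enorm x -> g x = 0) ->
    exists M, forall s x, (size s <= k)%N -> wt x ^+ k * normc (partials s g x) <= M.
  split=> // k; have [M fM] := H k f sf fA.
  by apply: le_lt_trans (ltry M); apply: seminorm_le => s x sk; rewrite lee_fin fM.
have bd g : smooth g -> (forall x, A < enorm x -> g x = 0) ->
    exists M, forall x, normc (g x) <= M.
  move=> sg gA.
  have cpt : compact [set v : E | forall i, `[- A, A]%classic (v ord0 i)].
    by apply: (@rV_compact _ _ (fun=> `[- A, A]%classic)) => i; exact: segment_compact.
  have bdr (q : E -> R) : (forall x, differentiable q x) -> (forall x, A < enorm x -> q x = 0) ->
      exists M, forall x, `|q x| <= M.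
    move=> dq qA.
    have /compact_bounded [M [_ qM]] : compact (q @` [set v : E | forall i, `[- A, A]%classic (v ord0 i)]).
      apply: continuous_compact cpt; apply: continuous_subspaceT => x.
      exact: differentiable_continuous.
    exists (`|M| + 1) => x; have [xA|xA] := ltP A (enorm x).
      by rewrite qA// normr0 addr_ge0.
    apply: qM; first by rewrite ltr_pwDr ?ler_norm.
    exists x => // i /=; rewrite in_itv/= -ler_norml.
    by rewrite (le_trans (coor_le_enorm x i)).
  have [M1 h1] := bdr (fun x => Re (g x)) (fun x => (sg [::] x).1)
    (fun x Ax => congr1 (@complex.Re R) (gA x Ax)).
  have [M2 h2] := bdr (fun x => Im (g x)) (fun x => (sg [::] x).2)
    (fun x Ax => congr1 (@complex.Im R) (gA x Ax)).
  by exists (M1 + M2) => x; rewrite (le_trans (normc_le_ReIm _))// lerD.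
have wbd k' g : smooth g -> (forall x, A < enorm x -> g x = 0) ->
    exists M, forall x, wt x ^+ k' * normc (g x) <= M.
  move=> sg gA; have [M gM] := bd g sg gA.
  exists ((1 + A) ^+ k' * M) => x; have [xA|xA] := ltP A (enorm x).
    rewrite gA// normc0 mulr0 mulr_ge0 ?exprn_ge0 ?addr_ge0//.
    by apply: le_trans (gM x).
  by rewrite ler_pM ?wtX_ge0// lerXn2r ?nnegrE ?wt_ge0 ?addr_ge0// lerD2l.
have dA g i : smooth g -> (forall x, A < enorm x -> g x = 0) ->
    forall x, A < enorm x -> partial i g x = 0.
  move=> sg gA x xA.
  have dx0 (q : E -> R) : (forall x, A < enorm x -> q x = 0) -> 'D_(delta_mx ord0 i) q x = 0.
    move=> qA.
    have n1 : 0 < n%:R + 1 :> R by rewrite ltr_pwDr.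
    have e0 : 0 < (enorm x - A) / (n%:R + 1) by rewrite divr_gt0 ?subr_gt0.
    have -> : 'D_(delta_mx ord0 i) q x = 'D_(delta_mx ord0 i) (cst 0) x; last first.
      exact: derive_cst.
    apply: near_eq_derive; near=> y; apply: qA.
    have : `|x - y| < (enorm x - A) / (n%:R + 1).
      by near: y; exact: (@cvgr_dist_lt _ _ _ _ _ _ _ cvg_id).
    rewrite (ltr_pdivlMr _ _ n1) => xy.
    have := enormD (x - y) y; rewrite subrK => h1.
    have h2 := enorm_le_mx_norm (x - y).
    have h3 : 0 <= `|x - y| by [].
    by move: xy h1 h2 h3; lra.
  by rewrite /partial !dx0// => y /gA ->.
move: k; suff H k l : forall g, smooth g -> (forall x, A < enorm x -> g x = 0) ->
    exists M, forall s x, (size s <= l)%N -> wt x ^+ k * normc (partials s g x) <= M.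
  by move=> k; exact: H.
elim: l => [|l ih] g sg gA.
  have [M gM] := wbd k g sg gA; exists M => s x.
  by rewrite leqn0 size_eq0 => /eqP ->; exact: gM.
have [M0 hM0] := wbd k g sg gA.
have /choice[M hM] : forall i, exists M, forall s x, (size s <= l)%N ->
    wt x ^+ k * normc (partials s (partial i g) x) <= M.
  by move=> i; apply: ih; [exact: (@smooth_partials _ _ [:: i])|exact: dA].
exists (`|M0| + \sum_i `|M i|) => s x sl.
(* The last entry of the sequence is the derivative applied first; splitting it off allows the
   induction hypothesis to be used for [partial i g]. *)
case/lastP: s sl => [_|s i].
  by rewrite (le_trans (hM0 x))// (le_trans (ler_norm _))// lerDl sumr_ge0.
rewrite size_rcons ltnS -cats1 partials_cat/= => sl.
rewrite (le_trans (hM i s x sl))// (le_trans (ler_norm _))//.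
by rewrite (bigD1 i)//= addrCA lerDl addr_ge0// sumr_ge0.
Unshelve. all: by end_near. Qed.

End schwartz_closure.

(** * Convolution with Schwartz kernels *)

Section weighted_integrable.
Local Open Scope classical_set_scope.
Local Open Scope ring_scope.
Local Open Scope complex_scope.
Context {R : realType} {n : nat}.
Local Notation E := ('rV[R]_n).
Local Notation C := (R[i]).
Local Notation mu := (@lebesgue_rV R n).
Implicit Types (x y h : E) (f g K w : E -> C) (s t : seq 'I_n) (k : nat).

Definition wnorm k w : R := fine (\int[mu]_y (wt y ^+ k * normc (w y))%:E)%E.

(** All weighted moments are finite. The class contains the Schwartz functions and the bounded
    measurable functions of bounded support, and convolving a member with a Schwartz kernel gives a
    Schwartz function. *)
Definition wint w := cmfun w /\ forall k,
  (\int[mu]_y (wt y ^+ k * normc (w y))%:E < +oo)%E.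

Lemma wint_ge0 w k y : 0 <= wt y ^+ k * normc (w y).
Proof. by rewrite mulr_ge0// wtX_ge0. Qed.

Lemma measurable_wnorm k w : cmfun w ->
  measurable_fun setT (fun y => wt y ^+ k * normc (w y)).
Proof.
by move=> mw; apply: measurable_funM; [exact: measurable_wtX|exact: measurable_normc].
Qed.

Lemma wnorm_ge0 k w : 0 <= wnorm k w.
Proof. by apply: fine_ge0; apply: integral_ge0 => y _; rewrite lee_fin wint_ge0. Qed.

Lemma wnormE k w : wint w ->
  (\int[mu]_y (wt y ^+ k * normc (w y))%:E)%E = (wnorm k w)%:E.
Proof.
move=> [_ /(_ k) wy]; rewrite fineK// ge0_fin_numE//.
by apply: integral_ge0 => y _; rewrite lee_fin wint_ge0.
Qed.

Lemma schwartz_wint w : schwartz w -> wint w.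
Proof.
move=> Sw; split; first exact/smooth_cmfun/schwartz_smooth.
move=> k; have [_] := schwartz_cintable k Sw.
under eq_integral do rewrite normcM normcR ger0_norm ?wtX_ge0//.
by [].
Qed.

Lemma wint_mul_supp k M g w : 0 <= M -> wint w -> cmfun g ->
  (forall y, w y != 0 -> normc (g y) <= M * wt y ^+ k) ->
  cintable mu (fun y => g y * w y) /\
  normc (cint mu (fun y => g y * w y)) <= M * wnorm k w.
Proof.
move=> M0 [mw wy] mg gM.
have gw y : normc (g y * w y) <= M * (wt y ^+ k * normc (w y)).
  have [->|wy0] := eqVneq (w y) 0; first by rewrite mulr0 normc0 !mulr0.
  by rewrite normcM mulrA ler_wpM2r// gM.
have IE : (\int[mu]_y (M * (wt y ^+ k * normc (w y)))%:E)%E = (M * wnorm k w)%:E.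
  under eq_integral do rewrite EFinM.
  rewrite ge0_integralZl_EFin//; last 2 first.
  - by move=> y _; rewrite lee_fin wint_ge0.
  - by apply/measurable_EFinP; exact: measurable_wnorm.
  by rewrite wnormE.
have mW : measurable_fun setT (fun y => M * (wt y ^+ k * normc (w y))).
  by apply: measurable_funM => //; exact: measurable_wnorm.
have gwi : cintable mu (fun y => g y * w y).
  by apply: le_cintable gw mW _; [exact: cmfunM|rewrite IE ltry].
split=> //; rewrite -lee_fin -IE; apply: le_trans (le_normc_cint gwi) _.
apply: ge0_le_integral => //.
- by apply: measurable_EFin_normc; exact: cmfunM.
- exact/measurable_EFinP.
- by move=> y _; rewrite lee_fin.
Qed.

Lemma wint_mul k M g w : wint w -> cmfun g ->
  (forall y, normc (g y) <= M * wt y ^+ k) ->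
  cintable mu (fun y => g y * w y) /\
  normc (cint mu (fun y => g y * w y)) <= M * wnorm k w.
Proof.
move=> ww mg gM; apply: wint_mul_supp => //.
by have := le_trans (normc_ge0 _) (gM 0); rewrite pmulr_lge0// wtX_gt0.
Qed.

Lemma wint_le w (u : E -> C) : wint w -> cmfun u ->
  (forall y, normc (u y) <= normc (w y)) -> wint u /\ forall k, wnorm k u <= wnorm k w.
Proof.
move=> [mw wy] mu' uw.
have le k : (\int[mu]_y (wt y ^+ k * normc (u y))%:E <=
    \int[mu]_y (wt y ^+ k * normc (w y))%:E)%E.
  apply: ge0_le_integral => //.
  - by move=> y _; rewrite lee_fin wint_ge0.
  - by apply/measurable_EFinP; exact: measurable_wnorm.
  - by apply/measurable_EFinP; exact: measurable_wnorm.
  - by move=> y _; rewrite lee_fin ler_wpM2l// wtX_ge0.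
have wu : wint u by split=> // k; exact: le_lt_trans (le k) (wy k).
by split=> // k; rewrite -lee_fin -!wnormE.
Qed.

Lemma wint_indic w (A : set E) : wint w -> measurable A ->
  wint (fun y => (\1_A y)%:C * w y) /\ forall k, wnorm k (fun y => (\1_A y)%:C * w y) <= wnorm k w.
Proof.
move=> ww mA; apply: wint_le => //.
  by apply: cmfunM; [apply: cmfunR; exact: measurable_indic|case: ww].
move=> y; rewrite normcM normcR indicE.
by case: (y \in A); rewrite ?normr1 ?mul1r// normr0 mul0r.
Qed.

Lemma wint_cintable w : wint w -> cintable mu w.
Proof.
move=> ww; have [||+ _] := @wint_mul 0 1 (fun=> 1) w ww.
- exact: cmfun_cst.
- by move=> y; rewrite expr0 mulr1 normc1.
- by under eq_fun do rewrite mul1r.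
Qed.

Lemma wint_cst0 : wint (fun=> 0).
Proof.
split; first exact: cmfun_cst.
by move=> k; under eq_integral do rewrite normc0 mulr0; rewrite integral0.
Qed.

Lemma wintZ (c : C) w : wint w -> wint (fun y => c * w y).
Proof.
move=> [mw wy]; split; first by apply: cmfunM => //; exact: cmfun_cst.
move=> k; under eq_integral do rewrite normcM mulrCA EFinM.
rewrite ge0_integralZl_EFin//.
- by rewrite lte_mul_pinfty// wnormE// ltry.
- by move=> y _; rewrite lee_fin wint_ge0.
- by apply/measurable_EFinP; exact: measurable_wnorm.
Qed.

End weighted_integrable.

Section convolution.
Local Open Scope classical_set_scope.
Local Open Scope ring_scope.
Local Open Scope complex_scope.
Context {R : realType} {n : nat}.
Local Notation E := ('rV[R]_n).
Local Notation C := (R[i]).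
Local Notation mu := (@lebesgue_rV R n).
Implicit Types (x y h : E) (f g K w : E -> C) (s t : seq 'I_n) (k : nat).

Definition convol K w x : C := cint mu (fun y => K (x - y) * w y).

Definition trans K y x : C := K (x - y).

Lemma measurable_subl x : measurable_fun setT (fun y : E => x - y).
Proof.
rewrite (_ : (fun y : E => x - y) = (fun y : E => - y + x)).
  exact: (measurableT_comp (measurable_addrV x) measurable_opprV).
by apply/funext => y; rewrite addrC.
Qed.

Lemma schwartz_cmfun K : schwartz K -> cmfun K.
Proof. by move=> SK; exact/smooth_cmfun/schwartz_smooth. Qed.

Lemma schwartz_bound K x : schwartz K -> normc (K x) <= snorm 0 K.
Proof.
by move=> SK; have := @le_snorm _ _ 0 K [::] x SK isT; rewrite expr0 mul1r.
Qed.

Lemma convol_cintable K w x : schwartz K -> wint w ->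
  cintable mu (fun y => K (x - y) * w y).
Proof.
move=> SK ww; have [] := @wint_mul _ _ 0 (snorm 0 K) (fun y => K (x - y)) w ww _ _ => //.
  exact: (cmfun_comp (schwartz_cmfun SK) (measurable_subl x)).
by move=> y; rewrite expr0 mulr1 schwartz_bound.
Qed.

Lemma wt_le_sub x y : wt x <= wt (x - y) * wt y.
Proof. by rewrite -{1}(subrK y x) wtD. Qed.

Lemma wtX_le_sub x y k : wt x ^+ k <= wt (x - y) ^+ k * wt y ^+ k.
Proof. by rewrite -exprMn lerXn2r ?nnegrE ?mulr_ge0 ?wt_ge0// wt_le_sub. Qed.

Lemma convol_wt_le K w x k : schwartz K -> wint w ->
  forall s, (size s <= k)%N ->
  wt x ^+ k * normc (convol (partials s K) w x) <= snorm k K * wnorm k w.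
Proof.
move=> SK ww s sk.
have SsK := schwartz_partials s SK.
have [] := @wint_mul _ _ k (snorm k K) (fun y => (wt x ^+ k)%:C * partials s K (x - y)) w ww.
- apply: cmfunM; first exact: cmfun_cst.
  exact: (cmfun_comp (schwartz_cmfun SsK) (measurable_subl x)).
- move=> y; rewrite normcM normcR ger0_norm ?wtX_ge0//.
  rewrite (@le_trans _ _ (wt (x - y) ^+ k * wt y ^+ k * normc (partials s K (x - y))))//.
    by rewrite ler_wpM2r// wtX_le_sub.
  by rewrite mulrAC ler_wpM2r ?wtX_ge0// le_snorm.
- move=> _; apply: le_trans.
  rewrite -[X in X * _]ger0_norm ?wtX_ge0// -normcR -normcM -cintZ; last exact: convol_cintable.
  by rewrite (_ : (fun y => _) = (fun y => (wt x ^+ k)%:C * (partials s K (x - y) * w y)))//;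
    apply/funext => y; rewrite mulrA.
Qed.

(** Taylor's estimate for the kernel, integrated against [w], gives the quadratic expansions
    required by [schwartz_family], with the convolutions by the derivatives of [K] as candidates. *)
Lemma schwartz_convol K w : schwartz K -> wint w ->
  schwartz (convol K w) /\ forall s, partials s (convol K w) = convol (partials s K) w.
Proof.
move=> SK ww.
apply: (@schwartz_family R n (fun s => convol (partials s K) w)).
- move=> s x; exists (4 * n%:R ^+ 2 * snorm (size s).+2 K * wnorm 0 w) => h _.
  have SsK := schwartz_partials s SK.
  have cl : clin (fun i => convol (partials (i :: s) K) w x) h =
      cint mu (fun y => clin (fun i => partials (i :: s) K (x - y)) h * w y).
    rewrite /clin [RHS](_ : _ = cint mu (fun y => \sum_i ((h ord0 i)%:C *
        (partials (i :: s) K (x - y) * w y)))); last first.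
      by apply: eq_cint => y; rewrite mulr_suml; apply: eq_bigr => i _; rewrite mulrA.
    rewrite cint_sum; last first.
      by move=> i; apply: cintableZ; apply: convol_cintable => //; exact: schwartz_partials.
    apply: eq_bigr => i _; rewrite cintZ//.
    by apply: convol_cintable => //; exact: schwartz_partials.
  have cli : cintable mu (fun y => clin (fun i => partials (i :: s) K (x - y)) h * w y).
    rewrite (_ : (fun y => _) = (fun y => \sum_i ((h ord0 i)%:C *
        (partials (i :: s) K (x - y) * w y)))); last first.
      by apply/funext => y; rewrite mulr_suml; apply: eq_bigr => i _; rewrite mulrA.
    apply: cintable_sum => i; apply: cintableZ; apply: convol_cintable => //.
    exact: schwartz_partials.
  rewrite cl -cintB; [|exact: convol_cintable|exact: convol_cintable].
  rewrite -cintB//; last by apply: cintableB; exact: convol_cintable.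
  rewrite (_ : (fun y => _) = (fun y => (partials s K (x + h - y) - partials s K (x - y)
      - clin (fun i => partials (i :: s) K (x - y)) h) * w y)); last first.
    by apply/funext => y; ring.
  rewrite mulrAC.
  have [||_] := @wint_mul _ _ 0 (4 * n%:R ^+ 2 * snorm (size s).+2 K * enorm h ^+ 2)
    (fun y => partials s K (x + h - y) - partials s K (x - y)
      - clin (fun i => partials (i :: s) K (x - y)) h) w ww => //.
  + apply: cmfunB.
      by apply: cmfunB; exact: (cmfun_comp (schwartz_cmfun SsK) (measurable_subl _)).
    apply: cmfun_sum => i; apply: cmfunM; first exact: cmfun_cst.
    exact: (cmfun_comp (schwartz_cmfun (schwartz_partials (i :: s) SK)) (measurable_subl _)).
  + move=> y; rewrite expr0 mulr1 (_ : x + h - y = x - y + h); last by rewrite addrAC.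
    exact: schwartz_taylor.
- move=> k; exists (snorm k K * wnorm k w) => s x sk; exact: convol_wt_le.
Qed.

Lemma snorm_convol K w k : schwartz K -> wint w ->
  snorm k (convol K w) <= snorm k K * wnorm k w.
Proof.
move=> SK ww; have [S1 S2] := schwartz_convol SK ww.
by apply: snorm_le => // s x sk; rewrite S2 convol_wt_le.
Qed.

Lemma schwartz_trans K y : schwartz K -> schwartz (trans K y) /\
  forall s, partials s (trans K y) = trans (partials s K) y.
Proof.
move=> SK; have [] := schwartz_affine (- y) (oner_neq0 R) SK.
rewrite (_ : (fun x => K _) = trans K y); last first.
  by apply/funext => x; rewrite scale1r.
move=> S1 S2; split=> // s; rewrite S2; apply/funext => x.
by rewrite expr1n mul1r scale1r.
Qed.

Lemma snorm_trans K y k : schwartz K -> snorm k (trans K y) <= snorm k K * wt y ^+ k.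
Proof.
move=> SK; have [S1 S2] := schwartz_trans y SK.
apply: snorm_le => // s x sk; rewrite S2 /trans.
rewrite (@le_trans _ _ (wt (x - y) ^+ k * wt y ^+ k * normc (partials s K (x - y))))//.
  by rewrite ler_wpM2r// wtX_le_sub.
by rewrite mulrAC ler_wpM2r ?wtX_ge0// le_snorm.
Qed.

Lemma schwartz_mean_value K s x h k : schwartz K -> (size s <= k)%N ->
  wt x ^+ k * normc (partials s K (x + h) - partials s K x) <=
  2 * n%:R * snorm k.+1 K * enorm h * wt h ^+ k.
Proof.
move=> SK sk; have SsK := schwartz_partials s SK.
rewrite mulrC -ler_pdivlMr ?wtX_gt0//.
rewrite (_ : _ / _ = 2 * n%:R * (snorm k.+1 K * (wt h ^+ k / wt x ^+ k)) * enorm h); last by ring.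
apply: cmean_value => [t _|t i /andP[t0 t1]]; first exact: (schwartz_smooth SsK [::]).
rewrite mulrA ler_pdivlMr ?wtX_gt0//.
have Sk1 := @le_snorm _ _ k.+1 K (i :: s) (x + t *: h) SK sk.
have wx : wt x ^+ k <= wt (x + t *: h) ^+ k * wt h ^+ k.
  rewrite -exprMn lerXn2r ?nnegrE ?mulr_ge0 ?wt_ge0//.
  have := wtD (x + t *: h) (- (t *: h)); rewrite addrK wtN => /le_trans; apply.
  rewrite ler_wpM2l ?wt_ge0// /wt lerD2l enormZ ger0_norm// ler_piMl// enorm_ge0//.
rewrite (@le_trans _ _ (normc (partials (i :: s) K (x + t *: h)) *
    (wt (x + t *: h) ^+ k * wt h ^+ k)))//; first by rewrite ler_wpM2l.
rewrite mulrA (mulrC (normc _)) ler_wpM2r ?wtX_ge0//.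
by apply: le_trans Sk1; rewrite ler_wpM2r// wtX_le.
Qed.

Lemma snorm_transB K y k : schwartz K ->
  snorm k (fun x => trans K y x - K x) <=
  2 * n%:R * snorm k.+1 K * enorm y * wt y ^+ k.
Proof.
move=> SK; have [S1 S2] := schwartz_trans y SK.
have [S3 S4] := schwartz_lin (-1) SK S1.
have -> : (fun x => trans K y x - K x) = (fun x => -1 * K x + trans K y x).
  by apply/funext => x; rewrite mulN1r addrC.
apply: snorm_le => // s x sk; rewrite S4 S2 mulN1r addrC.
by have := schwartz_mean_value x (- y) SK sk; rewrite enormN wtN.
Qed.

End convolution.

(** * Tempered distributions *)

Section tempered_theory.
Local Open Scope classical_set_scope.
Local Open Scope ring_scope.
Local Open Scope complex_scope.
Context {R : realType} {n : nat}.
Local Notation E := ('rV[R]_n).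
Local Notation C := (R[i]).
Local Notation mu := (@lebesgue_rV R n).
Implicit Types (x y h a : E) (f g K w v : E -> C) (k : nat) (T : @distrib R n).

Lemma lipschitz_continuous (f : E -> C) :
  (forall a, exists L, forall h, enorm h <= 1 -> normc (f (a + h) - f a) <= L * enorm h) ->
  continuous (fun x => Re (f x)) /\ continuous (fun x => Im (f x)).
Proof.
move=> fL.
have H (q : E -> R) : (forall a h, `|q (a + h) - q a| <= normc (f (a + h) - f a)) -> continuous q.
  move=> qf a; have [L La] := fL a.
  apply/(@cvgrPdist_le R R^o _ (nbhs (a : E))) => e e0.
  have L1 : 0 < `|L| + 1 by rewrite ltr_pwDr.
  have n1 : 0 < n%:R + 1 :> R by rewrite ltr_pwDr.
  have d0 : 0 < Num.min 1 (e / (`|L| + 1)) / (n%:R + 1).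
    by rewrite divr_gt0// lt_min ltr01 divr_gt0.
  near=> y.
  have : `|a - y| < Num.min 1 (e / (`|L| + 1)) / (n%:R + 1).
    by near: y; exact: (@cvgr_dist_lt _ _ _ _ _ _ _ cvg_id).
  rewrite (ltr_pdivlMr _ _ n1) lt_min => /andP[h1 h2].
  have ya : enorm (y - a) <= `|a - y| * (n%:R + 1).
    rewrite -opprB enormN (le_trans (enorm_le_mx_norm _))// mulrC ler_wpM2l//.
    by rewrite lerDl.
  have := qf a (y - a); rewrite (addrC a) subrK distrC => /le_trans; apply.
  have := La (y - a); rewrite (addrC a) subrK => /(_ (le_trans ya (ltW h1))) /le_trans; apply.
  rewrite (@le_trans _ _ ((`|L| + 1) * enorm (y - a)))//.
    rewrite ler_wpM2r ?enorm_ge0// (le_trans (ler_norm _))// lerDl//.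
  rewrite mulrC -ler_pdivlMr//; exact: le_trans ya (ltW h2).
split; apply: H => a h.
  by have := le_Re_normc (f (a + h) - f a); rewrite ReD ReN.
by have := le_Im_normc (f (a + h) - f a); rewrite ImD ImN.
Unshelve. all: by end_near. Qed.

Lemma continuous_cmfun f :
  continuous (fun x => Re (f x)) -> continuous (fun x => Im (f x)) -> cmfun f.
Proof. by move=> cR cI; split; exact: continuous_measurable_rV. Qed.

Lemma tempered_lin T (c : C) v w : tempered T -> schwartz v -> schwartz w ->
  T (fun x => c * v x + w x) = c * T v + T w.
Proof. by move=> [+ _] Sv Sw; exact. Qed.

Lemma tempered0 T : tempered T -> T (fun=> 0) = 0.
Proof.
move=> tT; have := tempered_lin 1 tT (@schwartz0 R n) (@schwartz0 R n).
rewrite (_ : (fun x => _) = (fun=> 0)); last first.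
  by apply/funext => x; rewrite mulr0 addr0.
by rewrite mul1r => /eqP; rewrite -subr_eq subrr => /eqP.
Qed.

Lemma temperedZ T (c : C) v : tempered T -> schwartz v -> T (fun x => c * v x) = c * T v.
Proof.
move=> tT Sv; have := tempered_lin c tT Sv (@schwartz0 R n).
by rewrite tempered0// addr0 => <-; congr T; apply/funext => x; rewrite addr0.
Qed.

Lemma temperedD T v w : tempered T -> schwartz v -> schwartz w ->
  T (fun x => v x + w x) = T v + T w.
Proof.
move=> tT Sv Sw; have := tempered_lin 1 tT Sv Sw.
by rewrite mul1r => <-; congr T; apply/funext => x; rewrite mul1r.
Qed.

Lemma temperedB T v w : tempered T -> schwartz v -> schwartz w ->
  T (fun x => v x - w x) = T v - T w.
Proof.
move=> tT Sv Sw; have := tempered_lin (-1) tT Sw Sv.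
rewrite mulN1r addrC => <-; congr T; apply/funext => x.
by rewrite mulN1r addrC.
Qed.

Lemma tempered_sum T (I : Type) (r : seq I) (F : I -> E -> C) : tempered T ->
  (forall i, schwartz (F i)) -> T (fun x => \sum_(i <- r) F i x) = \sum_(i <- r) T (F i).
Proof.
move=> tT SF; elim: r => [|i r ih].
  by under eq_fun do rewrite big_nil; rewrite big_nil tempered0.
rewrite big_cons -ih -temperedD//; last exact: schwartz_sum.
by congr T; apply/funext => x; rewrite big_cons.
Qed.

Lemma tempered_bound T : tempered T -> exists k M, 0 <= M /\
  forall v, schwartz v -> normc (T v) <= M * snorm k v.
Proof.
move=> [_ [k [M TM]]]; exists k, `|M|; split=> // v Sv.
have := TM v Sv; rewrite seminormE// -EFinM lee_fin => /le_trans; apply.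
by rewrite ler_wpM2r ?snorm_ge0// ler_norm.
Qed.

(* The function [y |-> (T * K^)(y)] representing [v |-> T (K * v)]. *)
Definition ptconv T K y : C := T (trans K y).

Section representation.
Variables (T : @distrib R n) (K : E -> C).
Hypotheses (tT : tempered T) (SK : schwartz K).

(** The growth bound, the local Lipschitz bound and the continuity of [T] share one order and one
    constant, since [Dbound] combines all three. *)
Lemma ptconv_bound : exists k M, 0 <= M /\
  (forall y, normc (ptconv T K y) <= M * wt y ^+ k) /\
  (forall a h, enorm h <= 1 ->
    normc (ptconv T K (a + h) - ptconv T K a) <= M * wt a ^+ k * enorm h) /\
  (forall v, schwartz v -> normc (T v) <= M * snorm k v).
Proof.
have [k [M [M0 TM]]] := tempered_bound tT.
pose M1 := M * snorm k K; pose M2 := M * (2 * n%:R * snorm k.+1 K * 2 ^+ k).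
have M10 : 0 <= M1 by rewrite mulr_ge0 ?snorm_ge0.
have M20 : 0 <= M2 by rewrite !mulr_ge0 ?snorm_ge0 ?exprn_ge0.
exists k.+1, (M + M1 + M2); split; first by rewrite !addr_ge0.
split.
  move=> y; have [Sy _] := schwartz_trans y SK.
  apply: le_trans (TM _ Sy) _.
  apply: le_trans (_ : M * (snorm k K * wt y ^+ k) <= _).
    by rewrite ler_wpM2l// snorm_trans.
  rewrite mulrA; apply: ler_pM => //; first exact: wtX_ge0.
    by rewrite addrAC addrC lerDl addr_ge0.
  exact: wtX_le.
split.
  move=> a h h1; have [Sa _] := schwartz_trans a SK.
  have [Sah _] := schwartz_trans (a + h) SK.
  rewrite /ptconv -temperedB//.
  have E1 : (fun x => trans K (a + h) x - trans K a x) =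
      (fun x => trans (trans K a) h x - trans K a x).
    by apply/funext => x; rewrite /trans opprD addrA (addrAC x).
  rewrite E1; apply: le_trans (TM _ _) _.
    by apply: schwartzB => //; exact: (schwartz_trans h Sa).1.
  apply: le_trans (_ : M * (2 * n%:R * (snorm k.+1 K * wt a ^+ k.+1) * enorm h * 2 ^+ k) <= _).
    rewrite ler_wpM2l// (le_trans (snorm_transB h k Sa))//.
    apply: ler_pM; rewrite ?mulr_ge0 ?snorm_ge0 ?enorm_ge0 ?wtX_ge0//.
      by rewrite ler_wpM2r ?enorm_ge0// ler_wpM2l ?mulr_ge0// snorm_trans.
    by rewrite lerXn2r ?nnegrE ?wt_ge0// /wt (_ : 2 = 1 + 1)// lerD2l.
  rewrite (_ : M * _ = M2 * wt a ^+ k.+1 * enorm h); last by rewrite /M2; ring.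
  rewrite ler_wpM2r ?enorm_ge0// ler_wpM2r ?wtX_ge0//.
  by rewrite addrC lerDl addr_ge0.
move=> v Sv; apply: le_trans (TM _ Sv) _.
apply: ler_pM; rewrite ?snorm_ge0//.
  by rewrite -addrA lerDl addr_ge0.
apply: snorm_le => // s x sk; apply: le_trans (@le_snorm _ _ k.+1 v s x Sv (leqW sk)).
by rewrite ler_wpM2r// wtX_le.
Qed.

Lemma ptconv_continuous :
  continuous (fun x => Re (ptconv T K x)) /\ continuous (fun x => Im (ptconv T K x)).
Proof.
apply: lipschitz_continuous => a; have [k [M [_ [_ [H _]]]]] := ptconv_bound.
by exists (M * wt a ^+ k); exact: H.
Qed.

Lemma ptconv_cmfun : cmfun (ptconv T K).
Proof. by have [] := ptconv_continuous; exact: continuous_cmfun. Qed.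

(** The defect that [tempered_convol] shows to be zero. It is additive in [w], bounded by a weighted
    norm of [w], and gains a factor [d] when [w] is carried by a ball of radius [d]. *)
Let D w := T (convol K w) - cint mu (fun y => ptconv T K y * w y).

Lemma ptconv_cintable w : wint w -> cintable mu (fun y => ptconv T K y * w y).
Proof.
move=> ww; have [k [M [M0 [fM _]]]] := ptconv_bound.
by have [] := wint_mul ww ptconv_cmfun fM.
Qed.

Let DD w1 w2 : wint w1 -> wint w2 -> D (fun y => w1 y + w2 y) = D w1 + D w2.
Proof.
move=> h1 h2; rewrite /D.
have -> : convol K (fun y => w1 y + w2 y) = (fun x => convol K w1 x + convol K w2 x).
  apply/funext => x; rewrite /convol -cintD; [|exact: convol_cintable|exact: convol_cintable].
  by apply: eq_cint => y; rewrite mulrDr.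
rewrite temperedD//; [|exact: (schwartz_convol SK h1).1|exact: (schwartz_convol SK h2).1].
rewrite (_ : cint _ _ = cint mu (fun y => ptconv T K y * w1 y) +
  cint mu (fun y => ptconv T K y * w2 y)); first by rewrite opprD addrACA.
rewrite -cintD; [|exact: ptconv_cintable|exact: ptconv_cintable].
by apply: eq_cint => y; rewrite mulrDr.
Qed.

(** On a ball of small radius both terms of the defect are close to the mass of [w] times
    [ptconv T K] at the centre: the first by the mean value estimate for [K], the second by the
    Lipschitz bound for [ptconv]. *)
Let Dbound : exists k M, 0 <= M /\ (forall w, wint w -> normc (D w) <= M * wnorm k w) /\
  (forall w a (d : R), wint w -> d <= 1 -> (forall y, w y != 0 -> enorm (y - a) <= d) ->
    normc (D w) <= M * d * wnorm k w).
Proof.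
have [k [M [M0 [fM [fL TM]]]]] := ptconv_bound.
pose M1 := M * snorm k K + M.
pose M2 := M * (2 * n%:R * snorm k.+1 K * 2 ^+ k * 2 ^+ k.+1) + M * 2 ^+ k.
have M10 : 0 <= M1 by rewrite addr_ge0// mulr_ge0 ?snorm_ge0.
have M20 : 0 <= M2 by rewrite addr_ge0 ?mulr_ge0 ?snorm_ge0 ?exprn_ge0.
exists k.+1, (M1 + M2); split; first by rewrite addr_ge0.
have wk w : wint w -> wnorm k w <= wnorm k.+1 w.
  move=> ww; rewrite -lee_fin -!wnormE//; apply: ge0_le_integral => //.
  - by move=> y _; rewrite lee_fin wint_ge0.
  - by apply/measurable_EFinP; apply: measurable_wnorm; case: ww.
  - by apply/measurable_EFinP; apply: measurable_wnorm; case: ww.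
  - by move=> y _; rewrite lee_fin ler_wpM2r// wtX_le.
split.
  move=> w ww; have [_ h1] := wint_mul ww ptconv_cmfun fM.
  have h2 := TM _ (schwartz_convol SK ww).1.
  apply: le_trans (normcB _ _) _.
  apply: le_trans (_ : M1 * wnorm k w <= _).
    rewrite mulrDl lerD//; apply: le_trans h2 _.
    by rewrite -mulrA ler_wpM2l// snorm_convol.
  by apply: ler_pM; rewrite ?wnorm_ge0 ?wk// lerDl.
move=> w a d ww d1 wd.
(* When [w] vanishes identically nothing forces [d] to be nonnegative, so this case is settled
   apart. *)
have [w0|[y0 wy0]] : (forall y, w y = 0) \/ exists y, w y != 0.
- have [h|/forallNP h] := pselect (exists y, w y != 0); first by right.
  by left => y; apply: contrapT => /eqP; exact: h.
- have -> : D w = 0.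
    rewrite /D (_ : convol K w = fun=> 0) ?tempered0//; last first.
      apply/funext => x; rewrite /convol -[RHS](cint0 mu); apply: eq_cint => y.
      by rewrite w0 mulr0.
    rewrite (_ : cint _ _ = 0) ?subr0// -[RHS](cint0 mu); apply: eq_cint => y.
    by rewrite w0 mulr0.
  have [d0|d0] := leP 0 d; first by rewrite normc0 mulr_ge0 ?wnorm_ge0// mulr_ge0// addr_ge0.
  have -> : wnorm k.+1 w = 0.
    rewrite /wnorm; under eq_integral do rewrite w0 normc0 mulr0.
    by rewrite integral0.
  by rewrite normc0 mulr0.
have d0 : 0 <= d by apply: le_trans (wd _ wy0); rewrite enorm_ge0.
have wta y : w y != 0 -> wt a <= 2 * wt y.
  move=> wy; have := wtD (a - y) y; rewrite subrK => /le_trans; apply.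
  rewrite ler_wpM2r ?wt_ge0// /wt -opprB enormN (_ : 2 = 1 + 1)// lerD2l.
  by rewrite (le_trans (wd _ wy)).
(* Both terms of [D w] are compared with [c * ptconv T K a]. *)
pose c := cint mu w.
have [Sa PSa] := schwartz_trans a SK.
have [Sw PSw] := schwartz_convol SK ww.
have SB : schwartz (fun x => convol K w x - c * trans K a x).
  by apply: schwartzB => //; exact: schwartzZ.
have h1 : normc (T (convol K w) - c * ptconv T K a) <=
    M * (2 * n%:R * snorm k.+1 K * 2 ^+ k * 2 ^+ k.+1 * d * wnorm k.+1 w).
  rewrite /ptconv -temperedZ// -temperedB//; last exact: schwartzZ.
  apply: le_trans (TM _ SB) _; rewrite ler_wpM2l//.
  apply: snorm_le => // s x sk.
  have -> : partials s (fun x => convol K w x - c * trans K a x) x =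
      cint mu (fun y => (partials s K (x - y) - partials s K (x - a)) * w y).
    have [_ P] := schwartz_lin (- c) Sa Sw.
    rewrite (_ : (fun x => _) = (fun x => - c * trans K a x + convol K w x)); last first.
      by apply/funext => z; rewrite mulNr addrC.
    rewrite P PSa PSw /convol /c mulNr addrC mulrC -cintZ; last exact: wint_cintable.
    have SsK := schwartz_partials s SK.
    rewrite -cintB; [|exact: convol_cintable|exact/cintableZ/wint_cintable].
    by apply: eq_cint => y; rewrite mulrBl.
  have SsK := schwartz_partials s SK.
  rewrite -[X in X * _]ger0_norm ?wtX_ge0// -normcR -normcM -cintZ; last first.
    under eq_fun do rewrite mulrBl.
    by apply: cintableB; [exact: convol_cintable|exact/cintableZ/wint_cintable].
  rewrite [X in cint _ X](_ : _ = (fun y => ((wt x ^+ k)%:C *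
      (partials s K (x - y) - partials s K (x - a))) * w y)); last first.
    by apply/funext => y; rewrite mulrA.
  have [|||//] := @wint_mul_supp _ _ k.+1
    (2 * n%:R * snorm k.+1 K * 2 ^+ k * 2 ^+ k.+1 * d) (fun y => (wt x ^+ k)%:C *
      (partials s K (x - y) - partials s K (x - a))) w _ ww.
  - by rewrite !mulr_ge0 ?snorm_ge0 ?exprn_ge0.
  - apply: cmfunM; first exact: cmfun_cst.
    apply: cmfunB; last exact: cmfun_cst.
    exact: (cmfun_comp (schwartz_cmfun SsK) (measurable_subl x)).
  - move=> y wy; rewrite normcM normcR ger0_norm ?wtX_ge0//.
    have ay : enorm (a - y) <= d by rewrite -opprB enormN wd.
    have mv := schwartz_mean_value (x - a) (a - y) SK sk.
    rewrite addrA subrK in mv.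
    have wx : wt x ^+ k <= wt (x - a) ^+ k * (2 ^+ k.+1 * wt y ^+ k.+1).
      apply: le_trans (wtX_le_sub x a k) _; rewrite ler_wpM2l ?wtX_ge0//.
      apply: le_trans (wtX_le a (leqnSn k)) _.
      by rewrite -exprMn lerXn2r ?nnegrE ?mulr_ge0 ?wt_ge0// wta.
    rewrite (@le_trans _ _ (wt (x - a) ^+ k * (2 ^+ k.+1 * wt y ^+ k.+1) *
       normc (partials s K (x - y) - partials s K (x - a))))//.
      by rewrite ler_wpM2r.
    rewrite [leLHS](_ : _ = 2 ^+ k.+1 * wt y ^+ k.+1 * (wt (x - a) ^+ k *
       normc (partials s K (x - y) - partials s K (x - a)))); last by ring.
    rewrite [leRHS](_ : _ = 2 ^+ k.+1 * wt y ^+ k.+1 *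
      (2 * n%:R * snorm k.+1 K * d * 2 ^+ k)); last by ring.
    apply: ler_wpM2l; first by rewrite mulr_ge0 ?exprn_ge0 ?wt_ge0.
    apply: le_trans mv _; apply: ler_pM; rewrite ?mulr_ge0 ?snorm_ge0 ?enorm_ge0 ?wtX_ge0//.
      by rewrite ler_wpM2l ?mulr_ge0 ?snorm_ge0.
    rewrite lerXn2r ?nnegrE ?wt_ge0// /wt (_ : 2 = 1 + 1)// lerD2l.
    exact: le_trans ay d1.
have h2 : normc (c * ptconv T K a - cint mu (fun y => ptconv T K y * w y)) <=
    M * 2 ^+ k * d * wnorm k.+1 w.
  rewrite /c mulrC -cintZ; last exact: wint_cintable.
  rewrite -cintB; [|exact/cintableZ/wint_cintable|exact: ptconv_cintable].
  rewrite (_ : (fun y => _) = (fun y => (ptconv T K a - ptconv T K y) * w y)); last first.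
    by apply/funext => y; rewrite mulrBl.
  have [|||_ hh] := @wint_mul_supp _ _ k (M * 2 ^+ k * d)
    (fun y => ptconv T K a - ptconv T K y) w _ ww.
  - by rewrite !mulr_ge0 ?exprn_ge0.
  - by apply: cmfunB; [exact: cmfun_cst|exact: ptconv_cmfun].
  - move=> y wy; have := fL a (y - a) (le_trans (wd y wy) d1).
    rewrite (addrC a) subrK normc_distC => /le_trans; apply.
    rewrite [leRHS](_ : _ = M * ((2 * wt y) ^+ k) * d); last by rewrite exprMn; ring.
    apply: ler_pM; rewrite ?mulr_ge0 ?wtX_ge0 ?enorm_ge0 ?wd//.
    by rewrite ler_wpM2l// lerXn2r ?nnegrE ?mulr_ge0 ?wt_ge0// wta.
  - apply: (le_trans hh); rewrite ler_wpM2l ?wk//.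
    by rewrite !mulr_ge0 ?exprn_ge0.
rewrite (_ : D w = (T (convol K w) - c * ptconv T K a) +
  (c * ptconv T K a - cint mu (fun y => ptconv T K y * w y))); last by rewrite addrA subrK.
apply: le_trans (normcD _ _) _; apply: le_trans (lerD h1 h2) _.
rewrite [leLHS](_ : _ = M2 * d * wnorm k.+1 w); last by rewrite /M2; ring.
by rewrite ler_wpM2r ?wnorm_ge0// ler_wpM2r// lerDr.
Qed.

(** The cubes of the lattice of mesh [d] are numbered by natural numbers, so that they can be
    removed from [w] one at a time. *)
Let cell (d : R) (y : E) : nat := pickle [ffun i : 'I_n => Num.floor (y ord0 i / d)].

Let measurable_cell d j : 0 < d -> measurable [set y | cell d y = j].
Proof.
move=> d0.
have mz (z : {ffun 'I_n -> int}) :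
    measurable [set y : E | [ffun i : 'I_n => Num.floor (y ord0 i / d)] = z].
  rewrite (_ : mkset _ = \bigcap_(i in [set: 'I_n])
     ((fun y : E => y ord0 i / d) @^-1` `[ (z i)%:~R, (z i + 1)%:~R [)); last first.
    apply/seteqP; split=> y /=.
      move=> <- i _ /=; rewrite in_itv/= ffunE.
      exact: Num.Theory.floor_itv.
    move=> yz; apply/ffunP => i; rewrite ffunE; apply/eqP.
    have := yz i I; rewrite /= in_itv/=.
    by rewrite Num.Theory.floor_eq.
  apply: fin_bigcap_measurable => //= i _; rewrite -[X in measurable X]setTI.
  have mg : measurable_fun setT (fun y : E => y ord0 i / d).
    by apply: measurable_funM => //; exact: measurable_coor.
  by apply: mg => //; exact: measurable_itv.
case e : (unpickle j : option {ffun 'I_n -> int}) => [z|].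
  have [jz|jz] := eqVneq (pickle z) j.
    rewrite (_ : mkset _ = [set y : E | [ffun i : 'I_n => Num.floor (y ord0 i / d)] = z]).
      exact: mz.
    apply/seteqP; split=> y /=; last by rewrite /cell => ->.
    by rewrite /cell => h; move: e; rewrite -h pickleK => -[].
  rewrite (_ : mkset _ = set0)//; apply/seteqP; split=> y //=.
  by rewrite /cell => h; move: e; rewrite -h pickleK => -[zE]; rewrite -h zE eqxx in jz.
rewrite (_ : mkset _ = set0)//; apply/seteqP; split=> y //=.
by rewrite /cell => h; move: e; rewrite -h pickleK.
Qed.

Let cell_dist d y z : 0 < d -> cell d y = cell d z -> enorm (y - z) <= n%:R * d.
Proof.
move=> d0 /(pcan_inj (@pickleK _)) /ffunP yz.
rewrite (le_trans (enorm_le_sum _))// mulr_natl -[X in _ *+ X]card_ord -sumr_const.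
apply: ler_sum => i _; rewrite !mxE.
have := yz i; rewrite !ffunE => e.
have /andP[y1 y2] := Num.Theory.floor_itv (y ord0 i / d).
have /andP[z1 z2] := Num.Theory.floor_itv (z ord0 i / d).
rewrite e in y1 y2; move: y1 y2 z1 z2; rewrite intrD.
move: (Num.floor _)%:~R => c.
rewrite !ler_pdivlMr// !ltr_pdivrMr// => y1 y2 z1 z2.
by rewrite ler_norml; apply/andP; split; lra.
Qed.

(** [w] is cut into small cubes. Each piece has a defect of at most [M * d] times its weighted norm,
    and these norms add up to that of [w]; the part of [w] on the cubes of large number has small
    weighted norm by dominated convergence. Letting [d] tend to 0 kills the defect. *)
Theorem tempered_convol w : wint w ->
  T (convol K w) = cint mu (fun y => ptconv T K y * w y).
Proof.
move=> ww; apply/eqP; rewrite -subr_eq0 -/(D w); apply/eqP/normc_eq0/eqP.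
rewrite eq_le normc_ge0 andbT.
have [k [M [M0 [DM DL]]]] := Dbound.
apply/ler_addgt0Pr => e e0; rewrite add0r.
pose W := M * wnorm k w.
have W0 : 0 <= W by rewrite mulr_ge0 ?wnorm_ge0.
pose d := Num.min 1 (e / 2 / (W + 1)).
have d0 : 0 < d by rewrite lt_min ltr01 divr_gt0 ?divr_gt0 ?ltr_pwDr.
pose d' := d / (n%:R + 1).
have d'0 : 0 < d' by rewrite divr_gt0// ltr_pwDr.
have d'd : n%:R * d' <= d.
  by rewrite /d' mulrCA ger_pMr// ler_pdivrMr ?mul1r ?lerDl ?ltr_pwDr.
pose A j := [set y | cell d' y = j].
pose B L := [set y | (L <= cell d' y)%N].
have mA j : measurable (A j) by exact: measurable_cell.
have mB L : measurable (B L).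
  rewrite (_ : B L = \bigcup_(j in [set j | (L <= j)%N]) A j).
    by apply: bigcup_measurable.
  apply/seteqP; split=> y /=; first by move=> h; exists (cell d' y).
  by move=> [j /= Lj yj]; rewrite /B /= (yj : cell d' y = j).
pose r (S : set E) y := (\1_S y)%:C * w y.
have wr S : measurable S -> wint (r S) by move=> mS; exact: (wint_indic ww mS).1.
have iA L y : \1_(A L) y = (if cell d' y == L then 1 else 0) :> R.
  rewrite indicE (_ : (y \in A L) = (cell d' y == L)); first by case: (_ == _).
  by apply/idP/eqP; rewrite inE.
have iB L y : \1_(B L) y = (if (L <= cell d' y)%N then 1 else 0) :> R.
  rewrite indicE (_ : (y \in B L) = (L <= cell d' y)%N); first by case: (_ <= _)%N.
  by apply/idP/idP; rewrite inE.
have iAB L y : \1_(B L) y = \1_(A L) y + \1_(B L.+1) y :> R.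
  by rewrite iA !iB; case: ltngtP; rewrite ?addr0 ?add0r.
have Bs L : r (B L) = (fun y => r (A L) y + r (B L.+1) y).
  by apply/funext => y; rewrite /r -mulrDl -rmorphD/= iAB.
have wB L : M * d * wnorm k (r (A L)) + M * d * wnorm k (r (B L.+1)) = M * d * wnorm k (r (B L)).
  rewrite -mulrDr; congr (_ * _).
  apply/EFin_inj; rewrite EFinD -!wnormE; [|exact: wr|exact: wr|exact: wr].
  rewrite -ge0_integralD//; last 4 first.
  - by move=> y _; rewrite lee_fin wint_ge0.
  - by apply/measurable_EFinP; apply: measurable_wnorm; have [] := wr _ (mA L).
  - by move=> y _; rewrite lee_fin wint_ge0.
  - by apply/measurable_EFinP; apply: measurable_wnorm; have [] := wr _ (mB L.+1).
  apply: eq_integral => y _; rewrite -EFinD -mulrDr; congr (_ * _)%:E.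
  rewrite /r !normcM !normcR -mulrDl (iAB L); congr (_ * _).
  by rewrite iA iB; case: ifP; case: ifP; rewrite !ger0_norm// addr_ge0.
have DA L : normc (D (r (A L))) <= M * d * wnorm k (r (A L)).
  have [[y0 Ly0]|/forallNP nL] := pselect (exists y, cell d' y = L).
    apply: (DL _ y0) => //; first exact: wr.
      by rewrite ge_min lexx.
    move=> y; rewrite /r iA; case: (eqVneq (cell d' y) L) => [yA _|_]; last by rewrite rmorph0 mul0r eqxx.
    by apply: le_trans d'd; apply: cell_dist => //; rewrite yA.
  apply: (DL _ 0) => //; first exact: wr.
    by rewrite ge_min lexx.
  by move=> y; rewrite /r iA; case: (eqVneq (cell d' y) L) => [/nL//|_]; rewrite rmorph0 mul0r eqxx.
(* The cubes of number below [L] are peeled off by induction; keeping the norm of the remainder on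
   the left makes the norms of the pieces telescope. *)
have DB L : normc (D w) <= M * d * wnorm k w + normc (D (r (B L))).
  have : normc (D w) + M * d * wnorm k (r (B L)) <=
      M * d * wnorm k w + normc (D (r (B L))).
    elim: L => [|L ih].
      have -> : r (B 0%N) = w by apply/funext => y; rewrite /r iB rmorph1 mul1r.
      by rewrite addrC.
    have DE : D (r (B L)) = D (r (A L)) + D (r (B L.+1)).
      by rewrite [in LHS]Bs DD//; exact: wr.
    have := normcD (D (r (A L))) (D (r (B L.+1))); rewrite -DE.
    by have := DA L; have := wB L; move: ih; lra.
  by apply: le_trans; rewrite lerDl mulr_ge0 ?wnorm_ge0// mulr_ge0// ltW.
have cB : (fun L => wnorm k (r (B L))) @ \oo --> (0 : R).
  have cE L : normc (cint mu (fun y => (wt y ^+ k * normc (r (B L) y))%:C) - cint mu (fun=> 0)) =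
      wnorm k (r (B L)).
    rewrite cint0 subr0 cintR normcR /Rintegral ger0_norm//.
    exact: (wnorm_ge0 k (r (B L))).
  rewrite (_ : (fun L => wnorm k (r (B L))) = (fun L => normc (cint mu
    (fun y => (wt y ^+ k * normc (r (B L) y))%:C) - cint mu (fun=> 0)))); last first.
    by apply/funext => L; rewrite cE.
  apply: (@cint_dominated R _ _ mu (fun L y => (wt y ^+ k * normc (r (B L) y))%:C) (fun=> 0)
    (fun y => wt y ^+ k * normc (w y))) => //.
  - by move=> L; apply: cmfunR; apply: measurable_wnorm; have [] := wr _ (mB L).
  - move=> y; apply/cvgrPdist_le => e' e'0; exists (cell d' y).+1 => // L /= Ly.
    by rewrite /r iB leqNgt Ly rmorph0 mul0r normc0 mulr0 subr0 normc0 subr0 normr0 ltW.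
  - by apply: measurable_wnorm; case: ww.
  - by rewrite wnormE// ltry.
  - move=> L y; rewrite normcR ger0_norm ?wint_ge0// ler_wpM2l ?wtX_ge0//.
    rewrite /r normcM normcR iB; case: (_ <= _)%N; rewrite ?normr1 ?mul1r//.
    by rewrite normr0 mul0r.
  - by move=> y; rewrite normc0 wint_ge0.
have [L hL] : exists L, M * wnorm k (r (B L)) <= e / 2.
  have e2 : 0 < e / 2 / (M + 1) by rewrite !divr_gt0 ?ltr_pwDr.
  move/cvgrPdist_le : cB => /(_ _ e2)[L _ /(_ L (leqnn L))].
  rewrite sub0r normrN ger0_norm ?wnorm_ge0// => h; exists L.
  rewrite (@le_trans _ _ ((M + 1) * wnorm k (r (B L))))//.
    by rewrite ler_wpM2r ?wnorm_ge0// lerDl.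
  by rewrite mulrC -ler_pdivlMr ?ltr_pwDr.
apply: le_trans (DB L) _; rewrite (splitr e); apply: lerD.
  rewrite mulrAC -/W (@le_trans _ _ ((W + 1) * d))//.
    by apply: ler_wpM2r; [exact: ltW|rewrite lerDl].
  by rewrite mulrC -ler_pdivlMr ?ltr_pwDr// /d ge_min lexx orbT.
by apply: le_trans hL; apply: DM; exact: wr.
Qed.

End representation.

End tempered_theory.

(** * Fourier transform and inversion *)

Section cis_theory.
Local Open Scope classical_set_scope.
Local Open Scope ring_scope.
Local Open Scope complex_scope.
Context {R : realType}.
Implicit Types a b t : R.

Lemma cisD a b : cis (a + b) = cis a * cis b :> R[i].
Proof.
by apply/eqP; rewrite eq_complex /= cosD sinD eqxx/= (addrC (cos a * _)) eqxx.
Qed.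

Lemma cis0 : cis 0 = 1 :> R[i].
Proof. by rewrite /cis cos0 sin0. Qed.

Lemma normc_cis t : normc (cis t) = 1.
Proof. by rewrite /cis normc_ReIm cos2Dsin2 sqrtr1. Qed.

Lemma cisN t : cis t * cis (- t) = 1 :> R[i].
Proof. by rewrite -cisD subrr cis0. Qed.

Lemma mean_value0 (f f' : R -> R) t : (forall s : R, is_derive s 1 f (f' s)) ->
  exists2 c, `|c| <= `|t| & f t - f 0 = f' c * t.
Proof.
move=> df.
have cf : continuous f.
  by move=> s; apply/differentiable_continuous/derivable1_diffP; have [] := df s.
have [t0|t0] := leP 0 t.
  have [|c] := @MVT_segment R f f' 0 t t0 (fun s _ => df s).
    exact: continuous_subspaceT.
  rewrite in_itv/= subr0 => /andP[c0 ct] ->; exists c => //.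
  by rewrite !ger0_norm.
have [|c] := @MVT_segment R f f' t 0 (ltW t0) (fun s _ => df s).
  exact: continuous_subspaceT.
rewrite in_itv/= sub0r => /andP[tc c0] e; exists c.
  by rewrite !ler0_norm ?lerN2// ltW.
by rewrite -opprB e mulrN opprK.
Qed.

Lemma norm_sin_le t : `|sin t| <= `|t|.
Proof.
have [c _] := @mean_value0 sin cos t (fun s => is_derive_sin s).
rewrite sin0 subr0 => ->; rewrite normrM ler_piMl//.
by rewrite ler_norml cos_geN1 cos_le1.
Qed.

Lemma norm_cosB1_le t : `|cos t - 1| <= t ^+ 2.
Proof.
have [c ct] := @mean_value0 cos (fun s => - sin s) t (fun s => is_derive_cos s).
rewrite cos0 => ->; rewrite normrM normrN -real_normK ?num_real// expr2 ler_wpM2r//.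
exact: le_trans (norm_sin_le c) ct.
Qed.

Lemma norm_sinB_le t : `|sin t - t| <= t ^+ 2.
Proof.
have ds (s : R) : is_derive s 1 (fun x : R => sin x - x) (cos s - 1).
  by apply: is_deriveB.
have [c ct] := @mean_value0 (fun x => sin x - x) (fun s => cos s - 1) t ds.
rewrite sin0 !subr0 => ->; rewrite normrM -real_normK ?num_real// expr2 ler_wpM2r//.
apply: le_trans ct.
have [d _] := @mean_value0 cos (fun s => - sin s) c (fun s => is_derive_cos s).
rewrite cos0 => ->; rewrite normrM normrN ler_piMl//.
by rewrite ler_norml sin_geN1 sin_le1.
Qed.

Lemma cis_taylor t : normc (cis t - 1 - (0 +i* t)) <= 2 * t ^+ 2.
Proof.
rewrite (le_trans (normc_le_ReIm _))//= !oppr0 !addr0.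
by rewrite mulr_natl mulr2n lerD// ?norm_cosB1_le// norm_sinB_le.
Qed.

Lemma continuous_cis_cmfun d (T : measurableType d) (g : T -> R) :
  measurable_fun setT g -> cmfun (fun x => cis (g x)).
Proof.
move=> mg; split => /=.
  exact: (measurableT_comp (continuous_measurable_fun (@continuous_cos R))).
exact: (measurableT_comp (continuous_measurable_fun (@continuous_sin R))).
Qed.

End cis_theory.

Section fourier_schwartz.
Local Open Scope classical_set_scope.
Local Open Scope ring_scope.
Local Open Scope complex_scope.
Context {R : realType} {n : nat}.
Local Notation E := ('rV[R]_n).
Local Notation C := (R[i]).
Local Notation mu := (@lebesgue_rV R n).
Implicit Types (x y h xi : E) (f g : E -> C) (s : seq 'I_n) (k : nat).

Lemma measurable_dotp xi : measurable_fun setT (fun x => dotp x xi).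
Proof.
apply: (@measurable_sum _ _ _ _ _ _ (fun i (x : E) => x ord0 i * xi ord0 i)) => i.
by apply: measurable_funM => //; exact: measurable_coor.
Qed.

Lemma cmfun_cis xi : cmfun (fun x => cis (- dotp x xi)).
Proof. by apply: continuous_cis_cmfun; apply: measurableT_comp => //; exact: measurable_dotp. Qed.

Lemma fourier_cintable f xi : wint f -> cintable mu (fun x => f x * cis (- dotp x xi)).
Proof.
move=> wf; have [||+ _] := @wint_mul _ _ 0 1 (fun x => cis (- dotp x xi)) f wf.
- exact: cmfun_cis.
- by move=> x; rewrite expr0 mulr1 normc_cis.
- by under eq_fun do rewrite mulrC.
Qed.

Lemma fourierE f xi : fourier f xi = cint mu (fun x => f x * cis (- dotp x xi)).
Proof. by []. Qed.

Lemma normc_fourier f xi : wint f -> normc (fourier f xi) <= wnorm 0 f.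
Proof.
move=> wf; have [||_] := @wint_mul _ _ 0 1 (fun x => cis (- dotp x xi)) f wf.
- exact: cmfun_cis.
- by move=> x; rewrite expr0 mulr1 normc_cis.
- by rewrite mul1r fourierE; under eq_fun do rewrite mulrC.
Qed.

Definition negI : C := 0 +i* (-1).

(** Multiplication by [-i x_i], which the Fourier transform turns into the derivative in direction
    [i]. *)
Definition coorI (i : 'I_n) f x := negI * ((x ord0 i)%:C * f x).

Lemma schwartz_coorI i f : schwartz f -> schwartz (coorI i f).
Proof. by move=> Sf; apply/schwartzZ/schwartz_coorM. Qed.

Lemma clin_coorI f x h :
  clin (fun i => coorI i f x) h = (0 +i* (- dotp x h)) * f x.
Proof.
have -> : (0 +i* (- dotp x h)) = negI * (dotp x h)%:C.
  by apply/eqP; rewrite eq_complex /=; apply/andP; split; apply/eqP; ring.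
rewrite clinZ -mulrA; congr (_ * _).
rewrite /dotp rmorph_sum mulr_suml; apply: eq_bigr => i _ /=.
by rewrite rmorphM /= mulrCA mulrA.
Qed.

Lemma fourier_quad f : schwartz f ->
  quad (fourier f) (fun i => fourier (coorI i f)).
Proof.
move=> Sf xi; have wf := schwartz_wint Sf.
exists (2 * wnorm 2 f) => h _.
have -> : clin (fun i => fourier (coorI i f) xi) h =
    cint mu (fun x => (0 +i* (- dotp x h)) * f x * cis (- dotp x xi)).
  rewrite /clin [RHS](_ : _ = cint mu (fun x => \sum_i ((h ord0 i)%:C *
      (coorI i f x * cis (- dotp x xi))))); last first.
    apply: eq_cint => x; rewrite -clin_coorI /clin mulr_suml.
    by apply: eq_bigr => i _; rewrite mulrA.
  have ci i : cintable mu (fun x => coorI i f x * cis (- dotp x xi)).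
    by apply: fourier_cintable; exact/schwartz_wint/schwartz_coorI.
  by rewrite cint_sum => [|i]; [apply: eq_bigr => i _; rewrite cintZ|exact: cintableZ].
have ci : cintable mu (fun x => (0 +i* (- dotp x h)) * f x * cis (- dotp x xi)).
  under eq_fun do rewrite -clin_coorI /clin mulr_suml.
  apply: cintable_sum => i; under eq_fun do rewrite -mulrA.
  by apply/cintableZ/fourier_cintable/schwartz_wint/schwartz_coorI.
rewrite !fourierE -cintB; [|exact: fourier_cintable|exact: fourier_cintable].
rewrite -cintB//; last by apply: cintableB; exact: fourier_cintable.
rewrite (_ : (fun x => _) = (fun x => (cis (- dotp x xi) *
    (cis (- dotp x h) - 1 - (0 +i* (- dotp x h)))) * f x)); last first.
  by apply/funext => x; rewrite dotpDr opprD cisD; ring.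
rewrite mulrAC; have [||_//] := @wint_mul _ _ 2 (2 * enorm h ^+ 2) (fun x => cis (- dotp x xi) *
    (cis (- dotp x h) - 1 - (0 +i* (- dotp x h)))) f wf.
- apply: cmfunM; first exact: cmfun_cis.
  apply: cmfunB; first by apply: cmfunB; [exact: cmfun_cis|exact: cmfun_cst].
  split => /=; first exact: measurable_cst.
  by apply: measurableT_comp => //; exact: measurable_dotp.
- move=> x; rewrite normcM normc_cis mul1r (le_trans (cis_taylor _))//.
  rewrite sqrrN -mulrA ler_wpM2l// -real_normK ?num_real// -exprMn.
  rewrite lerXn2r ?nnegrE ?mulr_ge0 ?enorm_ge0 ?wt_ge0// mulrC.
  by rewrite (le_trans (cauchy_schwarz _ _))// ler_wpM2r ?enorm_ge0// lerDr.
Qed.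

Definition wtW : R := fine (\int[mu]_x (wt x ^- (2 * n))%:E)%E.

Lemma wtWE : (\int[mu]_x (wt x ^- (2 * n))%:E)%E = wtW%:E.
Proof.
rewrite fineK// ge0_fin_numE ?integral_wt_lty//.
by apply: integral_ge0 => x _; rewrite lee_fin ltW// wtXV_gt0.
Qed.

Lemma cint_wt_bound (q : E -> C) A : cmfun q ->
  (forall x, normc (q x) <= A * wt x ^- (2 * n)) ->
  cintable mu q /\ normc (cint mu q) <= A * wtW.
Proof.
move=> mq qA.
have A0 : 0 <= A.
  by have := le_trans (normc_ge0 _) (qA 0); rewrite pmulr_lge0// wtXV_gt0.
have mA : measurable_fun setT (fun x : E => A * wt x ^- (2 * n)).
  by apply: measurable_funM => //; exact: measurable_wtXV.
have IE : (\int[mu]_x (A * wt x ^- (2 * n))%:E)%E = (A * wtW)%:E.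
  under eq_integral do rewrite EFinM.
  rewrite ge0_integralZl_EFin ?wtWE//.
  - by move=> x _; rewrite lee_fin ltW// wtXV_gt0.
  - by apply/measurable_EFinP; exact: measurable_wtXV.
have ci : cintable mu q by apply: le_cintable qA mA _; rewrite ?IE ?ltry.
split=> //; rewrite -lee_fin -IE; apply: le_trans (le_normc_cint ci) _.
apply: ge0_le_integral => //.
- exact: measurable_EFin_normc.
- exact/measurable_EFinP.
- by move=> x _; rewrite lee_fin.
Qed.

(** Difference quotients take the place of integration by parts. Taylor's remainder of [f] for a
    step [t] has an integral of order [t^2]; translation invariance computes the same integral as
    [(cis (t xi_i) - 1)] times the transform of [f], minus [t] times the transform of the
    derivative. Divide by [t] and let it tend to 0. *)
Lemma fourier_partial i f xi : schwartz f ->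
  fourier (partial i f) xi = (0 +i* xi ord0 i) * fourier f xi.
Proof.
move=> Sf; have Si : schwartz (partial i f) := schwartz_partials [:: i] Sf.
have wf := schwartz_wint Sf; have wi := schwartz_wint Si.
(* [A] bounds the integral of Taylor's remainder, the power of 2 comparing weights at points at
   distance at most 1; the second term of [B] comes from the expansion of [cis]. *)
pose A := 4 * n%:R ^+ 2 * (snorm (2 * n).+2 f * 2 ^+ (2 * n)) * wtW.
pose B := A + 2 * xi ord0 i ^+ 2 * normc (fourier f xi).
have W0 : 0 <= wtW.
  by apply: fine_ge0; apply: integral_ge0 => x _; rewrite lee_fin ltW// wtXV_gt0.
have B0 : 0 <= B.
  rewrite /B /A addr_ge0//; last first.
    by apply: mulr_ge0 => //; apply: mulr_ge0 => //; exact: sqr_ge0.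
  by apply: mulr_ge0 => //; apply: mulr_ge0; apply: mulr_ge0; rewrite ?snorm_ge0 ?exprn_ge0//.
have key t : 0 < t -> t <= 1 ->
    normc (fourier (partial i f) xi - (0 +i* xi ord0 i) * fourier f xi) <= B * t.
  move=> t0 t1.
  pose e : E := t *: delta_mx ord0 i.
  have de : dotp e xi = t * xi ord0 i.
    rewrite dotpZl; congr (_ * _); rewrite /dotp (bigD1 i)//= mxE !eqxx mul1r big1 ?addr0//.
    by move=> j ji; rewrite mxE (negPf ji) andbF mul0r.
  have ne : enorm e = t by rewrite enorm_delta gtr0_norm.
  pose q x := (f (x + e) - f x - t%:C * partial i f x) * cis (- dotp x xi).
  have mf : cmfun f by case: wf.
  have mq : cmfun q.
    apply: cmfunM; last exact: cmfun_cis.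
    apply: cmfunB; last by apply: cmfunM; [exact: cmfun_cst|case: wi].
    by apply: cmfunB => //; exact: (cmfun_comp mf (measurable_addrV e)).
  have [|_ qA] := @cint_wt_bound q
    (4 * n%:R ^+ 2 * (snorm (2 * n).+2 f * 2 ^+ (2 * n)) * t ^+ 2) mq.
    move=> x; rewrite /q normcM normc_cis mulr1.
    have := @ctaylor _ _ f x e (snorm (2 * n).+2 f * (2 ^+ (2 * n) / wt x ^+ (2 * n)))
      (schwartz_smooth Sf).
    rewrite ne (clin_delta (fun i => partial i f x)) => H.
    apply: le_trans (H _) _; last first.
      by rewrite le_eqVlt; apply/orP; left; apply/eqP; ring.
    move=> r a b /andP[r0 r1].
    apply: le_trans (@le_snormV _ _ (2 * n).+2 f [:: b; a] (x + r *: e) Sf _) _ => //.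
    rewrite ler_wpM2l ?snorm_ge0// ler_pdivlMr ?wtX_gt0// ler_pdivrMl ?wtX_gt0//.
    have h1 : wt x <= wt (x + r *: e) * 2.
      have := wtD (x + r *: e) (- (r *: e)); rewrite addrK wtN => /le_trans; apply.
      rewrite ler_wpM2l ?wt_ge0// /wt (_ : 2 = 1 + 1)// lerD2l enormZ ne ger0_norm//.
      by rewrite mulr_ile1// ltW.
    apply: (@le_trans _ _ ((wt (x + r *: e) * 2) ^+ (2 * n))).
      by rewrite lerXn2r ?nnegrE ?mulr_ge0 ?wt_ge0.
    by rewrite exprMn ler_wpM2r ?exprn_ge0// wtX_le// ltnW.
  have cq : cint mu q = (cis (t * xi ord0 i) - 1) * fourier f xi - t%:C * fourier (partial i f) xi.
    have ci1 : cintable mu (fun x => f (x + e) * cis (- dotp (x + e) xi)).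
      by apply: (cintable_translate (f := fun x => f x * cis (- dotp x xi)));
        exact: fourier_cintable.
    have -> : cint mu q = cint mu (fun x => cis (t * xi ord0 i) *
        (f (x + e) * cis (- dotp (x + e) xi)) - f x * cis (- dotp x xi) -
        t%:C * (partial i f x * cis (- dotp x xi))).
      apply: eq_cint => x; rewrite /q dotpDl de opprD cisD.
      have := cisN (t * xi ord0 i) => H; rewrite !mulrBl; congr (_ - _ - _); last by rewrite mulrA.
      rewrite [RHS](_ : _ = (f (x + e) * cis (- dotp x xi)) *
        (cis (t * xi ord0 i) * cis (- (t * xi ord0 i)))); last by ring.
      by rewrite H mulr1.
    rewrite cintB; last 2 first.
    - by apply: cintableB; [exact: cintableZ|exact: fourier_cintable].
    - by apply/cintableZ/fourier_cintable.
    rewrite cintB; [|exact: cintableZ|exact: fourier_cintable].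
    rewrite !cintZ//; last exact: fourier_cintable.
    rewrite (cint_translate (f := fun x => f x * cis (- dotp x xi))); last exact: fourier_cintable.
    by rewrite -!fourierE mulrBl mul1r.
  rewrite -(ler_pM2l t0) -{1}(gtr0_norm t0) -normcR -normcM.
  rewrite (_ : _ * _ = (cis (t * xi ord0 i) - 1 - (0 +i* (t * xi ord0 i))) * fourier f xi
     - cint mu q); last first.
    rewrite cq (_ : (0 +i* (t * xi ord0 i)) = t%:C * (0 +i* xi ord0 i)); first by ring.
    by apply/eqP; rewrite eq_complex /=; apply/andP; split; apply/eqP; ring.
  apply: le_trans (normcB _ _) _.
  rewrite [leRHS](_ : _ = 2 * (t * xi ord0 i) ^+ 2 * normc (fourier f xi) +
     4 * n%:R ^+ 2 * (snorm (2 * n).+2 f * 2 ^+ (2 * n)) * t ^+ 2 * wtW); last first.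
    by rewrite /B /A; ring.
  by rewrite lerD// normcM ler_wpM2r// cis_taylor.
apply/eqP; rewrite -subr_eq0; apply/eqP/normc_eq0/eqP; rewrite eq_le normc_ge0 andbT.
apply/ler_addgt0Pr => e e0; rewrite add0r.
pose t := Num.min 1 (e / (B + 1)).
have t0 : 0 < t by rewrite lt_min ltr01 divr_gt0// ltr_pwDr.
apply: le_trans (key t t0 _) _; first by rewrite ge_min lexx.
rewrite (@le_trans _ _ ((B + 1) * t))//.
  by apply: ler_wpM2r; [exact: ltW|rewrite lerDl].
by rewrite mulrC -ler_pdivlMr ?ltr_pwDr// ge_min lexx orbT.
Qed.

(** Each further power of the weight in frequency costs one derivative of [f]. *)
Lemma fourier_decay k f : schwartz f ->
  exists M, forall xi, wt xi ^+ k * normc (fourier f xi) <= M.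
Proof.
elim: k f => [|k ih] f Sf.
  exists (wnorm 0 f) => xi; rewrite expr0 mul1r normc_fourier//.
  exact: schwartz_wint.
have [M0 hM0] := ih f Sf.
have /choice[M hM] : forall i, exists M, forall xi,
    wt xi ^+ k * normc (fourier (partial i f) xi) <= M.
  by move=> i; apply: ih; exact: (schwartz_partials [:: i]).
exists (M0 + \sum_i M i) => xi.
rewrite (@le_trans _ _ (wt xi ^+ k * normc (fourier f xi) +
    \sum_i wt xi ^+ k * normc (fourier (partial i f) xi)))//; last first.
  by rewrite lerD// ler_sum.
rewrite exprSr -mulrA -mulr_sumr -mulrDr ler_wpM2l ?wtX_ge0//.
rewrite mulrDl mul1r lerD2l.
under eq_bigr => i _ do rewrite fourier_partial// normcM normc_ReIm expr0n add0r sqrtr_sqr.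
by rewrite -mulr_suml ler_wpM2r// enorm_le_sum.
Qed.

Lemma schwartz_fourier f : schwartz f -> schwartz (fourier f).
Proof.
move=> Sf; pose m s := foldr coorI f s.
have Sm s : schwartz (m s) by elim: s => // i s ih; exact: schwartz_coorI.
have [] // := @schwartz_family R n (fun s => fourier (m s)).
  by move=> s; exact: fourier_quad.
move=> k.
suff H l : forall g, schwartz g -> exists M, forall s x, (size s <= l)%N ->
    wt x ^+ k * normc (fourier (foldr coorI g s) x) <= M by exact: H.
elim: l => [|l ih] g Sg.
  have [M gM] := fourier_decay k Sg; exists M => s x.
  by rewrite leqn0 size_eq0 => /eqP ->; exact: gM.
have [M0 hM0] := fourier_decay k Sg.
have /choice[M hM] : forall i, exists M, forall s x, (size s <= l)%N ->
    wt x ^+ k * normc (fourier (foldr coorI (coorI i g) s) x) <= M.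
  by move=> i; apply: ih; exact: schwartz_coorI.
exists (`|M0| + \sum_i `|M i|) => s x sl.
case/lastP: s sl => [_|s i].
  by rewrite (le_trans (hM0 x))// (le_trans (ler_norm _))// lerDl sumr_ge0.
rewrite size_rcons ltnS foldr_rcons => sl.
rewrite (le_trans (hM i s x sl))// (le_trans (ler_norm _))//.
by rewrite (bigD1 i)//= addrCA lerDl addr_ge0// sumr_ge0.
Qed.

End fourier_schwartz.

(** * The Fourier transform of exp(-|t|) on the line *)

Section laplace_kernel.
Local Open Scope classical_set_scope.
Local Open Scope ring_scope.
Local Open Scope complex_scope.
Context {R : realType}.
Local Notation leb := (@lebesgue_measure R).

(** The summand 1 makes the integrand nonnegative, as the fundamental theorem of calculus on a
    half-line asks; [laplace_kernel] subtracts its contribution again. [H] below is an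
    antiderivative of [h] for positive [t]. *)
Let h (y t : R) : R := expR (- `|t|) * (1 + cos (t * y)).
Let H (y t : R) : R := (1 + y ^+ 2)^-1 * (expR (- t) * (y * sin (t * y) - cos (t * y)))
  - expR (- t).

Let D0 (y : R) : 0 < 1 + y ^+ 2.
Proof. by rewrite ltr_pwDl// sqr_ge0. Qed.

Let dH (y t : R) : is_derive t 1 (H y) (expR (- t) * (1 + cos (t * y))).
Proof.
rewrite /H; apply: is_derive_eq.
rewrite /GRing.scale /=.
by field; exact: lt0r_neq0 (D0 y).
Qed.

Let continuous_h y : continuous (h y).
Proof.
move=> t; apply: cvgM.
  apply: (continuous_comp (f := fun t : R => - `|t|)); last exact: continuous_expR.
  by apply: cvgN; exact: norm_continuous.
apply: cvgD; first exact: cvg_cst.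
apply: (continuous_comp (f := fun t : R => t * y)); last exact: continuous_cos.
by apply: cvgMl; exact: cvg_id.
Qed.

Let h_ge0 y t : 0 <= h y t.
Proof. by rewrite mulr_ge0 ?expR_ge0// addrC -lerBlDr sub0r cos_geN1. Qed.

Let integral_h y : (\int[leb]_t (h y t)%:E = (2 * (1 + (1 + y ^+ 2)^-1))%:E)%E.
Proof.
rewrite ge0_symfun_integralT//; last first.
  by move=> t; rewrite /h/= normrN mulNr cosN.
rewrite EFinM; congr (_ * _)%E.
rewrite (_ : [set x : R | 0 <= x] = `[0, +oo[%classic); last first.
  by apply/seteqP; split=> x /=; rewrite in_itv/= andbT.
rewrite (@ge0_continuous_FTC2y _ (h y) (H y) 0 0)//.
- by rewrite /H oppr0 expR0 !mul0r sin0 cos0 mulr0 -EFinB; congr EFin; field; exact: lt0r_neq0 (D0 y).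
- by apply: continuous_subspaceT.
- have eN : expR (- t) @[t --> +oo] --> (0 : R).
    exact: cvgr_expR.
  suff c0 : expR (- t) * (y * sin (t * y) - cos (t * y)) @[t --> +oo] --> (0 : R).
    by have := cvgB (cvgMr (a := (1 + y ^+ 2)^-1) c0) eN; rewrite mulr0 subr0; exact.
  apply/cvgr0Pnorm_lt => e e0.
  have B0 : 0 < `|y| + 1 by rewrite ltr_wpDl.
  near=> t.
  rewrite normrM (@le_lt_trans _ _ (`|expR (- t)| * (`|y| + 1)))//.
    rewrite ler_wpM2l// (le_trans (ler_normB _ _))// lerD//.
      by rewrite normrM ler_piMr// ler_norml sin_geN1 sin_le1.
    by rewrite ler_norml cos_geN1 cos_le1.
  rewrite -ltr_pdivlMr//; near: t.
  by apply: cvgr0_norm_lt => //; rewrite divr_gt0.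
- apply: cvg_at_right_filter; apply: differentiable_continuous.
  by apply/derivable1_diffP; have [] := dH y 0.
- move=> t; rewrite in_itv/= andbT => t0.
  by rewrite derive1E; have [_ ->] := dH y t; rewrite /h gtr0_norm.
Unshelve. all: by end_near. Qed.

Lemma integral_expR_norm : (\int[leb]_t (expR (- `|t|))%:E = 2%:E)%E.
Proof.
have c : continuous (fun t : R => expR (- `|t|)).
  move=> t; apply: (continuous_comp (f := fun t : R => - `|t|)); last exact: continuous_expR.
  by apply: cvgN; exact: norm_continuous.
have := integral_h 0; rewrite expr0n addr0 invr1.
under eq_integral => t _ do rewrite /h mulr0 cos0 mulrC EFinM.
rewrite ge0_integralZl//=.
- have p2 : 0 < (1 + 1 : R) by lra.
  move: p2; move: (1 + 1) => a p2; move: (\int[leb]_x _)%E => [r| |].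
  + by rewrite /mule /= => -[e]; congr EFin; apply: (mulfI (lt0r_neq0 p2)); rewrite e mulrC.
  + by rewrite gt0_muley.
  + by rewrite gt0_muleNy.
- by apply/measurable_EFinP; exact: continuous_measurable_fun.
Qed.

Lemma laplace_kernel_cintable y :
  cintable leb (fun t => (expR (- `|t|))%:C * cis (t * y)).
Proof.
have c : continuous (fun t : R => expR (- `|t|)).
  move=> t; apply: (continuous_comp (f := fun t : R => - `|t|)); last exact: continuous_expR.
  by apply: cvgN; exact: norm_continuous.
have mc := continuous_measurable_fun c.
have mf : cmfun (fun t : measurableTypeR R => (expR (- `|t|))%:C * cis (t * y)).
  apply: cmfunM; first exact: cmfunR.
  by apply: continuous_cis_cmfun; exact: measurable_funM.
apply: (le_cintable mf _ mc).
- by move=> t; rewrite normcM normc_cis normcR mulr1 ger0_norm// expR_ge0.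
- by rewrite integral_expR_norm ltry.
Qed.

(** The real part is [integral_h] less the integral of exp(-|t|), and the imaginary part is the
    integral of an odd function. *)
Lemma laplace_kernel y :
  cint leb (fun t => (expR (- `|t|))%:C * cis (t * y)) = (2 / (1 + y ^+ 2))%:C.
Proof.
have ik := laplace_kernel_cintable y.
have i0 := laplace_kernel_cintable 0.
have re : \int[leb]_t expR (- `|t|) = 2 by rewrite /Rintegral integral_expR_norm.
have ie : leb.-integrable setT (fun t => (expR (- `|t|))%:E).
  have := cintable_norm i0; under eq_fun do rewrite normcM normc_cis normcR mulr1 ger0_norm ?expR_ge0//.
  by [].
rewrite /cint; apply/eqP; rewrite eq_complex /=; apply/andP; split; apply/eqP.
  have := cintable_Re ik; under eq_fun do rewrite ReM /= mul0r subr0.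
  move=> iC; under eq_Rintegral do rewrite mul0r subr0.
  have := integral_h y; rewrite /h => e.
  have : \int[leb]_t (expR (- `|t|) + expR (- `|t|) * cos (t * y)) =
      2 * (1 + (1 + y ^+ 2)^-1).
    rewrite /Rintegral -[RHS]/(fine (2 * (1 + (1 + y ^+ 2)^-1))%:E) -e.
    by congr fine; apply: eq_integral => t _; rewrite mulrDr mulr1.
  by rewrite RintegralD// re; lra.
have := cintable_Im ik; under eq_fun do rewrite ImM /= mul0r addr0.
under eq_Rintegral do rewrite mul0r addr0.
set g := fun t : R => expR (- `|t|) * sin (t * y) => ig.
have gC : cintable leb (fun t => (g t)%:C).
  by apply/cintableP; split => //=; exact: integrable0.
have phiE (F : measurableTypeR R -> \bar R) : measurable_fun setT F ->
    (forall t, (0 <= F t)%E) -> (\int[leb]_t F (- t)%R = 1%:E * \int[leb]_t F t)%E.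
  by move=> mF F0; rewrite mul1e ge0_integral_oppr.
have := @cint_comp _ _ _ _ _ leb leb -%R 1 phiE _ gC.
rewrite mul1r !cintR => /(congr1 (@complex.Re _)) /=.
rewrite (_ : (fun t : R => g (- t)) = (fun t => (-1) * g t)); last first.
  by apply/funext => t; rewrite /g normrN (mulNr t) sinN mulrN mulN1r.
by rewrite RintegralZl//; move: (\int[leb]_x g x) => z; lra.
Qed.

End laplace_kernel.

Section complex_product.
Local Open Scope classical_set_scope.
Local Open Scope ring_scope.
Local Open Scope complex_scope.
Context {R : realType}.
Local Notation C := (R[i]).
Local Notation leb := (@lebesgue_measure R).

Lemma cint_prod12 d1 d2 (T1 : measurableType d1) (T2 : measurableType d2)
    (m1 : {sigma_finite_measure set T1 -> \bar R})
    (m2 : {sigma_finite_measure set T2 -> \bar R}) (f : T1 * T2 -> C) :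
  cintable (m1 \x m2)%E f -> (forall x, cintable m2 (fun y => f (x, y))) ->
  cint (m1 \x m2)%E f = cint m1 (fun x => cint m2 (fun y => f (x, y))).
Proof.
move=> fi f1.
have H (h : T1 * T2 -> R) : (m1 \x m2)%E.-integrable setT (EFin \o h) ->
    (forall x, m2.-integrable setT (fun y => (h (x, y))%:E)) ->
    \int[(m1 \x m2)%E]_z h z = \int[m1]_x \int[m2]_y h (x, y).
  move=> hi h1; rewrite /Rintegral -(integral12_prod_meas1 hi).
  congr fine; apply: eq_integral => x _; rewrite /fubini_F fineK//.
  by apply: integrable_fin_num => //; exact: h1.
rewrite /cint /=; congr (_ +i* _).
  by apply: H; [exact: cintable_Re|move=> x; exact: cintable_Re].
by apply: H; [exact: cintable_Im|move=> x; exact: cintable_Im].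
Qed.

Lemma cint_prod_tuple k (g : 'I_k -> measurableTypeR R -> C) :
  (forall i, cintable leb (g i)) ->
  cintable (lebesgue_tuple k) (fun t => \prod_(i < k) g i (tnth t i)) /\
  cint (lebesgue_tuple k) (fun t => \prod_(i < k) g i (tnth t i)) =
    \prod_(i < k) cint leb (g i).
Proof.
elim: k g => [|k ih] g gi.
  have e : (fun t : 0.-tuple (measurableTypeR R) => \prod_(i < 0) g i (tnth t i)) = (fun=> 1).
    by apply/funext => t; rewrite big_ord0.
  rewrite e big_ord0; split.
    split; first exact: cmfun_cst.
    by rewrite integral_cst//= diracT mule1 ltry.
  by rewrite /cint /= !Rintegral_cst//= /dirac indicT /= mulr1 mul0r.
have [Ti Te] := ih (fun i => g (lift ord0 i)) (fun i => gi (lift ord0 i)).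
set G := (fun t : k.-tuple _ => _) in Ti Te.
set F := (fun t => \prod_(i < k.+1) _).
have FE x t : F (cons_pair (x, t)) = g ord0 x * G t.
  rewrite /F big_ord_recl /cons_pair tnth0; congr (_ * _).
  by apply: eq_bigr => i _; rewrite tnthS.
have mF : cmfun F.
  by apply: cmfun_prod => i; apply: (cmfun_comp (gi i).1); exact: measurable_tnth.
have Fi : cintable (lebesgue_tuple k.+1) F.
  split=> //; rewrite ge0_integral_cons//; last exact: measurable_EFin_normc.
  have I0 : (\int[leb]_x (normc (g ord0 x))%:E)%E \is a fin_num.
    exact: (cintable_fin (gi ord0)).
  have IG := cintable_fin Ti.
  rewrite (eq_integral (fun x => (fine (\int[lebesgue_tuple k]_t (normc (G t))%:E)%E)%:E *
      (normc (g ord0 x))%:E)%E).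
    rewrite ge0_integralZl//.
    - by rewrite -(fineK I0) -EFinM ltry.
    - by apply: measurable_EFin_normc; case: (gi ord0).
    - by rewrite lee_fin fine_ge0// integral_ge0.
  move=> x _; under eq_integral do rewrite FE normcM EFinM.
  rewrite ge0_integralZl//; last by apply: measurable_EFin_normc; case: Ti.
  by rewrite fineK// muleC.
split=> //.
have phiE (H : k.+1.-tuple (measurableTypeR R) -> \bar R) : measurable_fun setT H ->
    (forall t, (0 <= H t)%E) ->
    (\int[(leb \x lebesgue_tuple k)%E]_z H (cons_pair z) =
     1%:E * \int[lebesgue_tuple k.+1]_t H t)%E.
  move=> mH H0; rewrite mul1e [RHS]ge0_integral_pushforward ?preimage_setT//.
  exact: measurable_cons_pair.
have := @cint_comp _ _ _ _ _ _ _ _ 1 phiE _ Fi.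
rewrite mul1r => <-.
rewrite cint_prod12.
- rewrite big_ord_recl -Te.
  transitivity (cint leb (fun x => cint (lebesgue_tuple k) G * g ord0 x)).
    apply: eq_cint => x; under eq_cint do rewrite FE.
    by rewrite cintZ// mulrC.
  by rewrite cintZ// mulrC.
- by apply: (cintable_comp (@measurable_cons_pair R k) phiE).
- by move=> x; under eq_fun do rewrite FE; exact: cintableZ.
Qed.

End complex_product.

(** * Inversion by means of a convergence factor *)

Section fourier_inversion.
Local Open Scope classical_set_scope.
Local Open Scope ring_scope.
Local Open Scope complex_scope.
Context {R : realType} {n : nat}.
Local Notation E := ('rV[R]_n).
Local Notation C := (R[i]).
Local Notation mu := (@lebesgue_rV R n).
Implicit Types (x y xi : E) (f g : E -> C).

Lemma cint_rV_prod (g : 'I_n -> measurableTypeR R -> C) :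
  (forall i, cintable (@lebesgue_measure R) (g i)) ->
  cmfun (fun x : E => \prod_(i < n) g i (x ord0 i)) /\
  (cintable mu (fun x : E => \prod_(i < n) g i (x ord0 i)) ->
   cint mu (fun x : E => \prod_(i < n) g i (x ord0 i)) =
    \prod_(i < n) cint (@lebesgue_measure R) (g i)).
Proof.
move=> gi; split.
  by apply: cmfun_prod => i; apply: (cmfun_comp (gi i).1); exact: measurable_coor.
move=> Fi; have [_ <-] := cint_prod_tuple gi.
have phiE (H : E -> \bar R) : measurable_fun setT H -> (forall t, (0 <= H t)%E) ->
    (\int[lebesgue_tuple n]_t H (rV_of_tuple t) = 1%:E * \int[mu]_x H x)%E.
  by move=> mH H0; rewrite mul1e ge0_integral_rV.
have := @cint_comp _ _ _ _ _ _ _ _ 1 phiE _ Fi; rewrite mul1r => <-.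
by apply: eq_cint => t; apply: eq_bigr => i _; rewrite mxE.
Qed.

(** The convergence factor of the inversion formula. Its product form reduces its transform to
    dimension one, where it is the rational function occurring in [poissonV]. *)
Definition laplaceV x : R := \prod_(i < n) expR (- `|x ord0 i|).
Definition poissonV x : R := \prod_(i < n) (2 / (1 + x ord0 i ^+ 2)).

Lemma laplaceVE x : laplaceV x = expR (- \sum_i `|x ord0 i|).
Proof. by rewrite -sumrN expR_sum. Qed.

Lemma laplaceV_ge0 x : 0 <= laplaceV x.
Proof. by rewrite laplaceVE expR_ge0. Qed.

Lemma laplaceV_le1 x : laplaceV x <= 1.
Proof. by rewrite laplaceVE -expR0 ler_expR oppr_le0 sumr_ge0. Qed.

Let mlap : measurable_fun setT (fun t : measurableTypeR R => expR (- `|t|)).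
Proof.
apply: measurableT_comp => //; apply: measurableT_comp => //; exact: normr_measurable.
Qed.

Lemma measurable_laplaceV : measurable_fun setT laplaceV.
Proof.
apply: measurable_prod => i _; exact: (measurableT_comp mlap (measurable_coor i)).
Qed.

Lemma cis_sum (I : Type) (s : seq I) (F : I -> R) :
  cis (\sum_(i <- s) F i) = \prod_(i <- s) cis (F i).
Proof. by apply: (big_morph (@cis R)); [exact: cisD|exact: cis0]. Qed.

Lemma laplaceV_cis y :
  cintable mu (fun xi => (laplaceV xi)%:C * cis (dotp xi y)) /\
  cint mu (fun xi => (laplaceV xi)%:C * cis (dotp xi y)) = (poissonV y)%:C.
Proof.
have e : (fun xi => (laplaceV xi)%:C * cis (dotp xi y)) =
   (fun x : E => \prod_(i < n) ((expR (- `|x ord0 i|))%:C * cis (x ord0 i * y ord0 i))).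
  by apply/funext => x; rewrite big_split /= -cis_sum rmorph_prod.
have [mF FE] := cint_rV_prod (fun i => laplace_kernel_cintable (y ord0 i)).
have Fi : cintable mu (fun xi => (laplaceV xi)%:C * cis (dotp xi y)).
  have mF' : cmfun (fun xi => (laplaceV xi)%:C * cis (dotp xi y)) by rewrite e.
  apply: (le_cintable mF' _ measurable_laplaceV).
    by move=> x; rewrite normcM normc_cis mulr1 normcR ger0_norm// laplaceV_ge0.
  have e1 := @ge0_integral_prod_rV R n _ mlap (fun t => expR_ge0 _).
  move: e1; rewrite integral_expR_norm -EFin_expe => e1.
  by apply: le_lt_trans (ltry ((2 : R) ^+ n)); rewrite -e1.
split=> //; rewrite e FE; last by rewrite -e.
by under eq_bigr do rewrite laplace_kernel; rewrite -rmorph_prod.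
Qed.

Lemma poissonV_ge0 x : 0 <= poissonV x.
Proof. by apply: prodr_ge0 => i _; rewrite divr_ge0// addr_ge0// sqr_ge0. Qed.

Lemma measurable_poissonV : measurable_fun setT poissonV.
Proof.
apply: measurable_prod => i _.
apply: (measurableT_comp (_ : measurable_fun setT (fun t : R => 2 / (1 + t ^+ 2))) (measurable_coor i)).
by apply: measurable_funM => //; apply: continuous_measurable_fun; exact: continuous_oneDsqrV.
Qed.

Lemma integral_poissonV : (\int[mu]_x (poissonV x)%:E = ((2 * pi) ^+ n)%:E)%E.
Proof.
have e x : ((poissonV x)%:E = (2 ^+ n)%:E * (\prod_(i < n) (oneDsqr (x ord0 i))^-1)%:E)%E.
  by rewrite -EFinM /poissonV big_split /= prodr_const card_ord.
under eq_integral do rewrite e.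
rewrite ge0_integralZl//.
- by rewrite integral_prod_oneDsqrV -EFinM exprMn.
- apply/measurable_EFinP; apply: measurable_prod => i _.
  apply: (measurableT_comp (_ : measurable_fun setT (fun t : R => (oneDsqr t)^-1)) (measurable_coor i)).
  by apply: continuous_measurable_fun; exact: continuous_oneDsqrV.
- by move=> x _; rewrite lee_fin prodr_ge0// => i _; rewrite invr_ge0 addr_ge0// sqr_ge0.
Qed.

Lemma normc_cvg_unique (J : nat -> C) (a b : C) :
  normc (J k - a) @[k --> \oo] --> (0 : R) -> normc (J k - b) @[k --> \oo] --> (0 : R) ->
  a = b.
Proof.
move=> Ja Jb; apply/eqP; rewrite -subr_eq0; apply/eqP/normc_eq0/eqP.
rewrite eq_le normc_ge0 andbT.
have l0 : normc (J k - a) + normc (J k - b) @[k --> \oo] --> (0 : R).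
  by rewrite -[X in _ --> X](addr0 0); exact: cvgD.
rewrite -(cvg_lim _ l0)//; apply: limr_ge; first by apply/cvg_ex; exists 0.
apply: nearW => k; rewrite (_ : a - b = (J k - b) - (J k - a)); last by ring.
by rewrite (le_trans (normcB _ _))// addrC.
Qed.

Lemma measurable_dotp2 : measurable_fun setT (fun z : E * E => dotp z.1 z.2).
Proof.
apply: (@measurable_sum _ _ _ _ _ _ (fun i (z : E * E) => z.1 ord0 i * z.2 ord0 i)) => i.
apply: measurable_funM.
  exact: (measurableT_comp (measurable_coor i) measurable_fst).
exact: (measurableT_comp (measurable_coor i) measurable_snd).
Qed.

Let eps k : R := k.+1%:R^-1.
Let eps0 k : 0 < eps k. Proof. by rewrite invr_gt0. Qed.
Let eps1 k : eps k <= 1. Proof. by rewrite invf_le1// ler1n. Qed.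
Let cvg_eps : eps k @[k --> \oo] --> (0 : R).
Proof. exact: cvg_harmonic. Qed.

Variables (m : E -> C) (x0 : E).
Hypothesis Sm : schwartz m.

(** The inversion integral damped by the convergence factor. As [eps k] tends to 0 it converges to
    the undamped integral by domination ([J_cvg1]), and to a multiple of [m x0] because the dilated
    Poisson products form an approximate identity ([J_cvg2]). *)
Let J k := cint mu (fun xi => fourier m xi * ((laplaceV (eps k *: xi))%:C * cis (dotp xi x0))).

Let mG k : cmfun (fun xi => (laplaceV (eps k *: xi))%:C * cis (dotp xi x0)).
Proof.
apply: cmfunM.
  apply: cmfunR; exact: (measurableT_comp measurable_laplaceV (measurable_scalerV (eps k))).
apply: continuous_cis_cmfun; exact: measurable_dotp.
Qed.

Let mFm : cmfun (fourier m).
Proof. exact: (schwartz_cmfun (schwartz_fourier Sm)). Qed.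

Let J_cvg1 :
  normc (J k - cint mu (fun xi => fourier m xi * cis (dotp xi x0))) @[k --> \oo] --> (0 : R).
Proof.
apply: (@cint_dominated _ _ _ _ _ _ (fun xi => normc (fourier m xi))).
- by move=> k; exact: cmfunM.
- by apply: cmfunM => //; apply: continuous_cis_cmfun; exact: measurable_dotp.
- move=> xi.
  have e k : normc (fourier m xi * ((laplaceV (eps k *: xi))%:C * cis (dotp xi x0)) -
      fourier m xi * cis (dotp xi x0)) = normc (fourier m xi) * `|expR (- (eps k * \sum_i `|xi ord0 i|)) - 1|.
    rewrite -mulrBr normcM -{2}(mul1r (cis _)) -mulrBl normcM normc_cis mulr1.
    rewrite -(rmorph1 (real_complex R)) -rmorphB normcR laplaceVE; congr (_ * `|expR (- _) - _|).
    by rewrite mulr_sumr; apply: eq_bigr => i _; rewrite mxE normrM gtr0_norm.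
  rewrite (_ : (fun k => _) = (fun k => normc (fourier m xi) *
    `|expR (- (eps k * \sum_i `|xi ord0 i|)) - 1|)); last exact/funext.
  rewrite -[X in _ --> X](mulr0 (normc (fourier m xi))); apply: cvgMr.
  rewrite -[X in _ --> X](normr0 R); apply: cvg_norm.
  rewrite -[X in _ --> X](subrr 1); apply: cvgB; last exact: cvg_cst.
  have l0 : - (eps k * \sum_i `|xi ord0 i|) @[k --> \oo] --> (0 : R).
    rewrite -[X in _ --> X]oppr0; apply: cvgN.
    by rewrite -[X in _ --> X](mul0r (\sum_i `|xi ord0 i|)); exact: cvgMl.
  by have := cvg_comp _ _ l0 (@continuous_expR R 0); rewrite expR0.
- by apply: measurable_normc.
- by have [] := schwartz_integrable (schwartz_fourier Sm).
- move=> k xi; rewrite normcM normcM normc_cis mulr1 normcR ger0_norm ?laplaceV_ge0//.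
  by rewrite ler_piMr// laplaceV_le1.
- by move=> xi; rewrite normcM normc_cis mulr1.
Qed.

Let laplace_scale k x :
  cintable mu (fun xi => (laplaceV (eps k *: xi))%:C * cis (dotp xi (x0 - x))) /\
  cint mu (fun xi => (laplaceV (eps k *: xi))%:C * cis (dotp xi (x0 - x))) =
  (eps k ^- n * poissonV ((eps k)^-1 *: (x0 - x)))%:C.
Proof.
have [i e] := laplaceV_cis ((eps k)^-1 *: (x0 - x)).
have E1 : (fun xi => (laplaceV (eps k *: xi))%:C * cis (dotp xi (x0 - x))) =
    (fun xi => (fun xi => (laplaceV xi)%:C * cis (dotp xi ((eps k)^-1 *: (x0 - x)))) (eps k *: xi)).
  apply/funext => xi; rewrite dotpZl dotpZr mulrA divff ?mul1r//.
  exact: lt0r_neq0.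
rewrite E1; split; first exact: (cintable_scale (eps0 k) i).
by rewrite (cint_scale (eps0 k) i) e -rmorphM.
Qed.

(** Exchange the integrals over frequency and space, which the damping factor permits, and
    substitute [x = x0 - eps z]. *)
Let JE k : J k = cint mu (fun z => m (x0 - eps k *: z) * (poissonV z)%:C).
Proof.
pose F (z : E * E) := m z.2 * ((laplaceV (eps k *: z.1))%:C * cis (dotp z.1 (x0 - z.2))).
have mm : cmfun m := schwartz_cmfun Sm.
have mF : cmfun F.
  apply: cmfunM; first exact: (cmfun_comp mm measurable_snd).
  apply: cmfunM.
    apply: cmfunR.
    exact: (measurableT_comp (measurableT_comp measurable_laplaceV (measurable_scalerV (eps k))) measurable_fst).
  apply: continuous_cis_cmfun.
  rewrite (_ : (fun z : E * E => _) = (fun z : E * E => dotp z.1 x0 - dotp z.1 z.2)); last first.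
    by apply/funext => z; rewrite dotpDr dotpNr.
  apply: measurable_funB; last exact: measurable_dotp2.
  exact: (measurableT_comp (measurable_dotp x0) measurable_fst).
have nF xi x : normc (F (xi, x)) = laplaceV (eps k *: xi) * normc (m x).
  by rewrite /F !normcM normc_cis mulr1 normcR ger0_norm ?laplaceV_ge0// mulrC.
have Im := schwartz_integrable Sm.
have IG xi : cintable mu (fun x => F (xi, x)).
  have := cintableZ ((laplaceV (eps k *: xi))%:C * cis (dotp xi x0))
    (fourier_cintable xi (schwartz_wint Sm)).
  congr cintable; apply/funext => x; rewrite /F /= dotpDr dotpNr cisD (dotpC x); ring.
have Fe xi : cint mu (fun x => F (xi, x)) =
    fourier m xi * ((laplaceV (eps k *: xi))%:C * cis (dotp xi x0)).
  rewrite fourierE mulrC -cintZ; last exact: (fourier_cintable xi (schwartz_wint Sm)).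
  by apply: eq_cint => x; rewrite /F /= dotpDr dotpNr cisD (dotpC x); ring.
have Fe2 x : cint mu (fun xi => F (xi, x)) =
    m x * (eps k ^- n * poissonV ((eps k)^-1 *: (x0 - x)))%:C.
  by have [i <-] := laplace_scale k x; rewrite -cintZ.
have [||||i1 i2 e] := @complex_fubini _ _ _ _ _ mu mu F.
- exact: mF.
- have [li _] := laplace_scale k x0.
  rewrite (eq_integral (fun xi => (wnorm 0 m)%:E * (laplaceV (eps k *: xi))%:E)%E); last first.
    move=> xi _; under eq_integral do rewrite nF EFinM.
    rewrite ge0_integralZl//; last 2 first.
    - exact: measurable_EFin_normc.
    - by rewrite lee_fin laplaceV_ge0.
    rewrite muleC -(wnormE 0 (schwartz_wint Sm)).
    by congr (_ * _)%E; apply: eq_integral => x _; rewrite expr0 mul1r.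
  rewrite ge0_integralZl//; last 3 first.
  - apply/measurable_EFinP; exact: (measurableT_comp measurable_laplaceV (measurable_scalerV (eps k))).
  - by move=> xi _; rewrite lee_fin laplaceV_ge0.
  - by rewrite lee_fin wnorm_ge0.
  have := cintable_fin li.
  rewrite (eq_integral (fun xi => (laplaceV (eps k *: xi))%:E)); last first.
    by move=> xi _; rewrite normcM normc_cis mulr1 normcR ger0_norm ?laplaceV_ge0.
  by move=> /fineK <-; rewrite -EFinM ltry.
- exact: IG.
- by move=> x; exact: (cintableZ (m x) (laplace_scale k x).1).
have -> : J k = cint mu (fun xi => cint mu (fun x => F (xi, x))).
  by apply: eq_cint => xi; rewrite Fe.
rewrite e; under eq_cint do rewrite Fe2.
pose H' x := m x * (eps k ^- n * poissonV ((eps k)^-1 *: (x0 - x)))%:C.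
pose H z := m (x0 - z) * (eps k ^- n * poissonV ((eps k)^-1 *: z))%:C.
have H2 : cintable mu H'.
  have -> : H' = (fun x => cint mu (fun xi => F (xi, x))) by apply/funext => x; rewrite Fe2.
  exact: i2.
have HE : (fun z => H' (x0 - z)) = H by apply/funext => z; rewrite /H' subKr.
have H1 : cintable mu H by rewrite -HE; exact: cintable_reflect.
rewrite -[LHS](cint_reflect x0 H2) HE.
have ek := lt0r_neq0 (eps0 k); have en0 := expf_neq0 n ek.
have := cint_scale (eps0 k) H1.
move=> /(congr1 (fun z => (eps k ^+ n)%:C * z)); rewrite mulrA -rmorphM (divff en0) mul1r => <-.
rewrite -cintZ; last exact: (cintable_scale (eps0 k) H1).
apply: eq_cint => z; rewrite /H scalerA (mulVf ek) scale1r mulrCA -rmorphM mulrA (divff en0).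
by rewrite mul1r.
Qed.

Let J_cvg2 : normc (J k - ((2 * pi) ^+ n)%:C * m x0) @[k --> \oo] --> (0 : R).
Proof.
have mP : cmfun (fun x => (poissonV x)%:C) by apply: cmfunR; exact: measurable_poissonV.
have Pi : cintable mu (fun x => (poissonV x)%:C).
  apply: (le_cintable mP _ measurable_poissonV).
    by move=> x; rewrite normcR ger0_norm// poissonV_ge0.
  by rewrite integral_poissonV ltry.
have -> : ((2 * pi) ^+ n)%:C * m x0 = cint mu (fun z => m x0 * (poissonV z)%:C).
  rewrite cintZ// mulrC cintR; congr (_ * _%:C).
  by rewrite /Rintegral integral_poissonV.
rewrite (_ : (fun k => _) = (fun k => normc (cint mu (fun z => m (x0 - eps k *: z) * (poissonV z)%:C) -
   cint mu (fun z => m x0 * (poissonV z)%:C)))); last by apply/funext => k; rewrite JE.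
have mm : cmfun m := schwartz_cmfun Sm.
apply: (@cint_dominated _ _ _ _ _ _ (fun z => snorm 0 m * poissonV z)).
- move=> k; apply: cmfunM => //; apply: (cmfun_comp mm).
  exact: (measurableT_comp (measurable_subl x0) (measurable_scalerV (eps k))).
- by apply: cmfunM => //; exact: cmfun_cst.
- move=> z.
  have B k : normc (m (x0 - eps k *: z) * (poissonV z)%:C - m x0 * (poissonV z)%:C) <=
      (2 * n%:R * snorm 1 m * enorm z * poissonV z) * eps k.
    rewrite -mulrBl normcM normcR (ger0_norm (poissonV_ge0 z)).
    rewrite mulrAC ler_wpM2r ?poissonV_ge0//.
    have := @schwartz_mean_value _ _ m [::] x0 (- (eps k *: z)) 0 Sm isT.
    by rewrite !expr0 mul1r mulr1 enormN enormZ gtr0_norm// mulrA (mulrAC _ (eps k)).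
  apply: (squeeze_cvgr (f := fun=> 0) (h := fun k => (2 * n%:R * snorm 1 m * enorm z * poissonV z) * eps k)).
  - by apply: nearW => k; rewrite normc_ge0 B.
  - exact: cvg_cst.
  - by rewrite -[X in _ --> X](mulr0 (2 * n%:R * snorm 1 m * enorm z * poissonV z)); exact: cvgMr.
- by apply: measurable_funM => //; exact: measurable_poissonV.
- under eq_integral do rewrite EFinM.
  rewrite ge0_integralZl//; last 3 first.
  - by apply/measurable_EFinP; exact: measurable_poissonV.
  - by move=> x _; rewrite lee_fin poissonV_ge0.
  - by rewrite lee_fin snorm_ge0.
  by rewrite integral_poissonV -EFinM ltry.
- move=> k z; rewrite normcM normcR (ger0_norm (poissonV_ge0 z)) ler_wpM2r ?poissonV_ge0//.
  exact: schwartz_bound.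
- move=> z; rewrite normcM normcR (ger0_norm (poissonV_ge0 z)) ler_wpM2r ?poissonV_ge0//.
  exact: schwartz_bound.
Qed.

Lemma fourier_inversion :
  cint mu (fun xi => fourier m xi * cis (dotp xi x0)) = ((2 * pi) ^+ n)%:C * m x0.
Proof. exact: normc_cvg_unique J_cvg1 J_cvg2. Qed.

End fourier_inversion.

(** * Fourier multipliers as convolutions *)

Section multipliers.
Local Open Scope classical_set_scope.
Local Open Scope ring_scope.
Local Open Scope complex_scope.
Context {R : realType} {n : nat}.
Local Notation E := ('rV[R]_n).
Local Notation C := (R[i]).
Local Notation mu := (@lebesgue_rV R n).
Implicit Types (x y xi : E) (f g m v w K : E -> C) (T : @distrib R n).

(** The kernel of the multiplier on test functions. By duality [multiplier m T v] is [T] applied to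
    [fourier (m * ifourier v)], which is why the forward transform of [m] appears; for even symbols
    it agrees with the inverse one. *)
Definition kap m x : C := ((2 * pi) ^- n)%:C * fourier m x.

Lemma schwartz_kap m : schwartz m -> schwartz (kap m).
Proof. by move=> Sm; apply: schwartzZ; exact: schwartz_fourier. Qed.

Lemma twopiV : ((2 * pi) ^- n)%:C * ((2 * pi) ^+ n)%:C = 1 :> C.
Proof.
rewrite -rmorphM mulVf// expf_neq0// mulf_neq0//.
exact: lt0r_neq0 (pi_gt0 R).
Qed.

Lemma cintable_le f g : cmfun f -> cintable mu g -> (forall x, normc (f x) <= normc (g x)) ->
  cintable mu f.
Proof.
move=> mf [mg gy] fg; apply: (le_cintable mf fg _ gy).
exact: measurable_normc.
Qed.

Lemma cmfun_subl K x : cmfun K -> cmfun (fun y => K (x - y)).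
Proof. by move=> mK; apply: (cmfun_comp mK); exact: measurable_subl. Qed.

Lemma convolC K w x : schwartz K -> wint w ->
  convol K w x = cint mu (fun y => w (x - y) * K y).
Proof.
move=> SK ww; rewrite /convol -(cint_reflect x (convol_cintable x SK ww)).
by apply: eq_cint => y; rewrite subKr mulrC.
Qed.

Lemma kap0 v : convol (fun=> 0) v = (fun=> 0).
Proof.
by apply/funext => x; rewrite /convol; under eq_cint do rewrite mul0r; exact: cint0.
Qed.

Lemma convol_linl (a : C) K1 K2 w : schwartz K1 -> schwartz K2 -> wint w ->
  convol (fun x => a * K1 x + K2 x) w = (fun x => a * convol K1 w x + convol K2 w x).
Proof.
move=> S1 S2 ww; apply/funext => x; rewrite /convol.
have c1 := convol_cintable x S1 ww; have c2 := convol_cintable x S2 ww.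
rewrite -cintZ// -cintD//; last exact: cintableZ.
by apply: eq_cint => y; rewrite mulrDl mulrA.
Qed.

Lemma convol_linr (a : C) K w1 w2 : schwartz K -> wint w1 -> wint w2 ->
  convol K (fun x => a * w1 x + w2 x) = (fun x => a * convol K w1 x + convol K w2 x).
Proof.
move=> S1 ww1 ww2; apply/funext => x; rewrite /convol.
have c1 := convol_cintable x S1 ww1; have c2 := convol_cintable x S1 ww2.
rewrite -cintZ// -cintD//; last exact: cintableZ.
by apply: eq_cint => y; rewrite mulrDr mulrCA.
Qed.

Lemma convol_trans K1 K2 y x : schwartz K1 -> schwartz K2 ->
  convol K1 (trans K2 y) x = convol K1 K2 (x - y).
Proof.
move=> S1 S2; have S2' := (schwartz_trans y S2).1.
rewrite /convol -(cint_translate y (convol_cintable x S1 (schwartz_wint S2'))).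
by apply: eq_cint => z; rewrite /trans addrK opprD addrA addrAC.
Qed.

Lemma cmfun_sub2 K : cmfun K -> cmfun (fun z : E * E => K (z.1 - z.2)).
Proof.
move=> mK; apply: (cmfun_comp mK); apply/measurable_rVP => i.
rewrite (_ : (fun t : E * E => _) = (fun z : E * E => z.1 ord0 i - z.2 ord0 i)).
  apply: measurable_funB.
    exact: (measurableT_comp (measurable_coor i) measurable_fst).
  exact: (measurableT_comp (measurable_coor i) measurable_snd).
by apply/funext => z /=; rewrite !mxE.
Qed.

Lemma convolA K1 K2 w : schwartz K1 -> schwartz K2 -> wint w ->
  convol K1 (convol K2 w) = convol (convol K1 K2) w.
Proof.
move=> S1 S2 ww; apply/funext => x.
have m1 := schwartz_cmfun S1; have m2 := schwartz_cmfun S2; have mw : cmfun w by case: ww.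
pose F (z : E * E) := K1 (x - z.1) * (K2 (z.1 - z.2) * w z.2).
have mF : cmfun F.
  apply: cmfunM; first exact: (cmfun_comp (cmfun_subl x m1) measurable_fst).
  by apply: cmfunM; [exact: cmfun_sub2|exact: (cmfun_comp mw measurable_snd)].
have w1 := wint_cintable ww.
have K1i : cintable mu (fun y => K1 (x - y)) := cintable_reflect x (schwartz_integrable S1).
have c1 y : cintable mu (fun z => F (y, z)).
  by exact: (cintableZ (K1 (x - y)) (convol_cintable y S2 ww)).
have c2 z : cintable mu (fun y => F (y, z)).
  have mF2 : cmfun (fun y => F (y, z)) := cmfun_comp mF (measurable_pair2 z).
  apply: (cintable_le mF2 (cintableZ ((snorm 0 K2)%:C * w z) K1i)) => y.
  rewrite /F /= !normcM normcR ger0_norm ?snorm_ge0// mulrC ler_wpM2r//.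
  by rewrite ler_wpM2r// schwartz_bound.
have [||||_ _ e] := @complex_fubini _ _ _ _ _ mu mu F.
- exact: mF.
- have b y : (\int[mu]_z (normc (F (y, z)))%:E <=
      (snorm 0 K2 * wnorm 0 w)%:E * (normc (K1 (x - y)))%:E)%E.
    under eq_integral do rewrite /F /= normcM EFinM.
    rewrite ge0_integralZl//; last first.
      by apply: measurable_EFin_normc; apply: cmfunM => //; exact: (cmfun_comp (cmfun_sub2 m2) (measurable_pair1 y)).
    rewrite muleC lee_wpmul2r// EFinM -(wnormE 0 ww) -ge0_integralZl//.
    + apply: ge0_le_integral => //.
      * by apply: measurable_EFin_normc; apply: cmfunM => //; exact: (cmfun_comp (cmfun_sub2 m2) (measurable_pair1 y)).
      * by apply: measurable_funeM; apply/measurable_EFinP; exact: measurable_wnorm.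
      * move=> z _; rewrite -EFinM lee_fin normcM expr0 mul1r ler_wpM2r//.
        exact: schwartz_bound.
    + by apply/measurable_EFinP; exact: measurable_wnorm.
    + by move=> z _; rewrite lee_fin wint_ge0.
    + by rewrite lee_fin snorm_ge0.
  apply: (@le_lt_trans _ _ (\int[mu]_y ((snorm 0 K2 * wnorm 0 w)%:E * (normc (K1 (x - y)))%:E))%E).
    apply: ge0_le_integral => //.
    + by move=> y _; apply: integral_ge0.
    + apply: (@measurable_fun_fubini_tonelli_F _ _ _ _ _ mu (fun z => (normc (F z))%:E)) => //.
      exact: measurable_EFin_normc.
    + by apply: measurable_funeM; apply: measurable_EFin_normc; exact: cmfun_subl.
  rewrite ge0_integralZl//.
  + by have := cintable_fin K1i => /fineK <-; rewrite -EFinM ltry.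
  + by apply: measurable_EFin_normc; exact: cmfun_subl.
  + by rewrite lee_fin mulr_ge0 ?snorm_ge0 ?wnorm_ge0.
- exact: c1.
- exact: c2.
transitivity (cint mu (fun y => cint mu (fun z => F (y, z)))).
  by apply: eq_cint => y; rewrite /convol -(cintZ (K1 (x - y)) (convol_cintable y S2 ww)).
rewrite e; apply: eq_cint => z; rewrite -convol_trans// mulrC.
rewrite /convol -(cintZ (w z) (convol_cintable x S1 (schwartz_wint (schwartz_trans z S2).1))).
by apply: eq_cint => y; rewrite /F /trans /=; ring.
Qed.

Lemma ifourierE f x : ifourier f x = ((2 * pi) ^- n)%:C * cint mu (fun xi => f xi * cis (dotp xi x)).
Proof. by rewrite /ifourier; congr (_ * _); apply: eq_cint => xi; rewrite dotpC. Qed.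

Lemma cintable_cis f xi : cintable mu f -> cintable mu (fun x => f x * cis (dotp x xi)).
Proof.
move=> fi; apply: (cintable_le _ fi).
  by apply: cmfunM; [case: fi|apply: continuous_cis_cmfun; exact: measurable_dotp].
by move=> x; rewrite normcM normc_cis mulr1.
Qed.

Lemma fourier_mult m w : schwartz m -> wint w ->
  fourier (fun xi => m xi * ifourier w xi) = convol (kap m) w.
Proof.
move=> Sm ww; apply/funext => x; rewrite fourierE.
pose c : C := ((2 * pi : R) ^- n)%:C.
have mm := schwartz_cmfun Sm; have mw : cmfun w by case: ww.
have mi := schwartz_integrable Sm; have wi := wint_cintable ww.
pose F (z : E * E) := (c * m z.1 * w z.2) * cis (dotp z.1 (z.2 - x)).
have mF : cmfun F.
  apply: cmfunM.
    apply: cmfunM; last exact: (cmfun_comp mw measurable_snd).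
    by apply: cmfunM; [exact: cmfun_cst|exact: (cmfun_comp mm measurable_fst)].
  apply: continuous_cis_cmfun.
  rewrite (_ : (fun z : E * E => _) = (fun z : E * E => dotp z.1 z.2 - dotp z.1 x)); last first.
    by apply/funext => z; rewrite dotpDr dotpNr.
  apply: measurable_funB; first exact: measurable_dotp2.
  exact: (measurableT_comp (measurable_dotp x) measurable_fst).
have nF xi y : normc (F (xi, y)) = normc (c * m xi) * normc (w y).
  by rewrite /F /= normcM normc_cis mulr1 normcM.
have c1 xi : cintable mu (fun y => F (xi, y)).
  apply: (cintable_le _ (cintableZ (c * m xi) wi)).
    exact: (cmfun_comp mF (measurable_pair1 xi)).
  by move=> y; rewrite nF -normcM.
have c2 y : cintable mu (fun xi => F (xi, y)).
  apply: (cintable_le _ (cintableZ (c * w y) mi)).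
    exact: (cmfun_comp mF (measurable_pair2 y)).
  by move=> xi; rewrite nF !normcM mulrAC.
have [||||_ _ e] := @complex_fubini _ _ _ _ _ mu mu F.
- exact: mF.
- rewrite (eq_integral (fun xi => (wnorm 0 w)%:E * (normc (c * m xi))%:E)%E); last first.
    move=> xi _; under eq_integral do rewrite nF EFinM.
    rewrite ge0_integralZl//; last exact: measurable_EFin_normc.
    rewrite muleC -(wnormE 0 ww).
    by congr (_ * _)%E; apply: eq_integral => y _; rewrite expr0 mul1r.
  have cm := cintableZ c mi.
  rewrite ge0_integralZl//; last 2 first.
  - by apply: measurable_EFin_normc; case: cm.
  - by rewrite lee_fin wnorm_ge0.
  by have := cintable_fin cm => /fineK <-; rewrite -EFinM ltry.
- exact: c1.
- exact: c2.
transitivity (cint mu (fun xi => cint mu (fun y => F (xi, y)))).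
  apply: eq_cint => xi; rewrite ifourierE -/c.
  rewrite (_ : m xi * _ * _ = (c * m xi * cis (- dotp xi x)) *
    cint mu (fun y => w y * cis (dotp y xi))); last by ring.
  rewrite -(cintZ (c * m xi * cis (- dotp xi x)) (cintable_cis xi wi)).
  by apply: eq_cint => y; rewrite /F /= dotpDr dotpNr cisD (dotpC y); ring.
rewrite e; apply: eq_cint => y; rewrite /kap fourierE mulrAC.
rewrite -(cintZ (c * w y) (fourier_cintable (x - y) (schwartz_wint Sm))).
by apply: eq_cint => xi; rewrite /F /= -dotpNr opprB; ring.
Qed.

Lemma multiplierE m T v : schwartz m -> schwartz v -> multiplier m T v = T (convol (kap m) v).
Proof.
by move=> Sm Sv; rewrite -fourier_mult//; exact: schwartz_wint.
Qed.

Lemma ifourier_kap m : schwartz m -> ifourier (kap m) = (fun x => ((2 * pi) ^- n)%:C * m x).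
Proof.
move=> Sm; apply/funext => x; rewrite ifourierE; congr (_ * _).
transitivity (((2 * pi) ^- n)%:C * cint mu (fun xi => fourier m xi * cis (dotp xi x))).
  rewrite -cintZ; last by apply/cintable_cis/schwartz_integrable/schwartz_fourier.
  by apply: eq_cint => xi; rewrite mulrA.
by rewrite fourier_inversion// mulrA twopiV mul1r.
Qed.

(** Fourier inversion enters here: the inverse transform of [kap m2] is a multiple of [m2], so
    [fourier_mult] turns the convolution of kernels into the product of symbols. *)
Lemma convol_kapM m1 m2 : schwartz m1 -> schwartz m2 ->
  convol (kap m1) (kap m2) = kap (fun xi => m1 xi * m2 xi).
Proof.
move=> S1 S2; have S2' := schwartz_kap S2.
rewrite -fourier_mult//; last exact: schwartz_wint.
rewrite ifourier_kap//; apply/funext => x; rewrite /kap !fourierE -cintZ.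
  by apply: eq_cint => xi; ring.
have mm := cmfunM (schwartz_cmfun S1) (schwartz_cmfun S2).
apply: (cintable_le (g := fun xi => (snorm 0 m1)%:C * m2 xi)).
- by apply: cmfunM => //; exact: cmfun_cis.
- exact: (cintableZ _ (schwartz_integrable S2)).
- move=> xi; rewrite !normcM normc_cis mulr1 normcR ger0_norm ?snorm_ge0//.
  by rewrite ler_wpM2r// schwartz_bound.
Qed.

Lemma convol_kap2 m1 m2 w : schwartz m1 -> schwartz m2 -> wint w ->
  convol (kap m1) (convol (kap m2) w) = convol (kap (fun xi => m1 xi * m2 xi)) w.
Proof.
move=> S1 S2 ww; rewrite convolA ?convol_kapM//; exact: schwartz_kap.
Qed.

Lemma kap_lin (a : C) m1 m2 : schwartz m1 -> schwartz m2 ->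
  kap (fun xi => a * m1 xi + m2 xi) = (fun x => a * kap m1 x + kap m2 x).
Proof.
move=> S1 S2; apply/funext => x; rewrite /kap !fourierE.
have c1 := fourier_cintable x (schwartz_wint S1).
have c2 := fourier_cintable x (schwartz_wint S2).
rewrite (_ : cint mu (fun y => (a * m1 y + m2 y) * _) =
  cint mu (fun y => a * (m1 y * cis (- dotp y x)) + m2 y * cis (- dotp y x))).
  by rewrite cintD// ?cintZ//; [ring|exact: cintableZ].
by apply: eq_cint => y; ring.
Qed.

Lemma kap_zero : kap (fun=> 0) = (fun=> 0).
Proof.
apply/funext => x; rewrite /kap fourierE; under eq_cint do rewrite mul0r.
by rewrite cint0 mulr0.
Qed.

Lemma kap_scale m (a : R) x : 0 < a -> schwartz m ->
  kap (fun xi => m (a *: xi)) x = (a ^- n)%:C * kap m (a^-1 *: x).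
Proof.
move=> a0 Sm; rewrite /kap !fourierE mulrCA; congr (_ * _).
rewrite -(cint_scale a0 (fourier_cintable (a^-1 *: x) (schwartz_wint Sm))).
apply: eq_cint => xi; rewrite dotpZl dotpZr mulrA mulfV ?mul1r//.
exact: lt0r_neq0.
Qed.

Lemma kap_even m x : schwartz m -> (forall xi, m (- xi) = m xi) -> kap m (- x) = kap m x.
Proof.
move=> Sm me; rewrite /kap !fourierE; congr (_ * _).
rewrite -(cint_reflect 0 (fourier_cintable x (schwartz_wint Sm))).
by apply: eq_cint => xi; rewrite sub0r me dotpNl dotpNr opprK.
Qed.

Lemma cint_kap m : schwartz m -> cint mu (kap m) = m 0.
Proof.
move=> Sm; rewrite /kap cintZ; last exact/schwartz_integrable/schwartz_fourier.
transitivity (((2 * pi) ^- n)%:C * cint mu (fun xi => fourier m xi * cis (dotp xi 0))).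
  by congr (_ * _); apply: eq_cint => xi; rewrite dotpC dotp0l cis0 mulr1.
by rewrite fourier_inversion// mulrA twopiV mul1r.
Qed.

(** After rescaling, the kernel is concentrated at distance [a], so the factor [enorm y] in the
    moment yields the power of [a]. *)
Lemma kap_scale_moment m (a : R) k : 0 < a -> a <= 1 -> schwartz m ->
  (\int[mu]_y (enorm y * wt y ^+ k * normc (kap (fun xi => m (a *: xi)) y))%:E <=
   (a * wnorm k.+1 (kap m))%:E)%E.
Proof.
move=> a0 a1 Sm; have SK := schwartz_kap Sm; have wK := schwartz_wint SK.
have mK := schwartz_cmfun SK.
pose G z := (enorm (a *: z) * wt (a *: z) ^+ k * normc (kap m z))%:E.
have mG : measurable_fun setT G.
  apply/measurable_EFinP; apply: measurable_funM; last exact: measurable_normc.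
  apply: measurable_funM.
    exact: (measurableT_comp measurable_enorm (measurable_scalerV a)).
  exact: (measurableT_comp (measurable_wtX k) (measurable_scalerV a)).
have G0 z : (0 <= G z)%E by rewrite lee_fin !mulr_ge0 ?enorm_ge0 ?wtX_ge0.
have aV : 0 < a^-1 by rewrite invr_gt0.
have an : 0 <= a ^- n by rewrite invr_ge0 exprn_ge0// ltW.
rewrite (eq_integral (fun y => (a ^- n)%:E * G (a^-1 *: y))%E); last first.
  move=> y _; rewrite /G scalerA mulfV ?scale1r ?lt0r_neq0// -EFinM; congr EFin.
  by rewrite kap_scale// normcM normcR ger0_norm//; ring.
have mG' : measurable_fun setT (fun y => G (a^-1 *: y)).
  exact: (measurableT_comp mG (measurable_scalerV a^-1)).
rewrite ge0_integralZl//.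
have -> : (\int[mu]_y G (a^-1 *: y) = (a^-1 ^- n)%:E * \int[mu]_y G y)%E.
  rewrite -(@ge0_integral_affine_rV R n a^-1 0 G aV mG G0).
  by apply: eq_integral => y _; rewrite addr0.
rewrite muleA -EFinM exprVn invrK mulVf ?expf_neq0 ?lt0r_neq0// mul1e.
rewrite EFinM -(wnormE k.+1 wK) -ge0_integralZl//; last 3 first.
- by apply/measurable_EFinP; exact: measurable_wnorm.
- by move=> z _; rewrite lee_fin wint_ge0.
- by rewrite lee_fin ltW.
apply: ge0_le_integral => //.
- by apply: measurable_funeM; apply/measurable_EFinP; exact: measurable_wnorm.
move=> z _; rewrite -EFinM lee_fin mulrA ler_wpM2r// enormZ gtr0_norm// -mulrA.
rewrite ler_wpM2l ?(ltW a0)// exprS ler_pM ?enorm_ge0 ?wtX_ge0//.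
  by rewrite /wt lerDr.
apply: lerXn2r; rewrite ?nnegrE ?wt_ge0// /wt lerD2l enormZ gtr0_norm//.
by rewrite ler_piMl// enorm_ge0.
Qed.

(** The kernel has integral [m 0], so the difference averages [v (x - y) - v x], which is of order
    [enorm y]. With [m 0 = 1] this gives the convergence of low-pass filters, with [m 0 = 0] the
    decay of high-frequency blocks. *)
Lemma approx_identity m (a : R) k v : 0 < a -> a <= 1 -> schwartz m -> schwartz v ->
  snorm k (fun x => convol (kap (fun xi => m (a *: xi))) v x - m 0 * v x) <=
  2 * n%:R * snorm k.+1 v * (a * wnorm k.+1 (kap m)).
Proof.
move=> a0 a1 Sm Sv.
have Sma : schwartz (fun xi => m (a *: xi)).
  have [+ _] := schwartz_affine 0 (lt0r_neq0 a0) Sm.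
  by under eq_fun do rewrite addr0.
set K := kap _; have SK : schwartz K := schwartz_kap Sma.
have wK := schwartz_wint SK; have Ki := schwartz_integrable SK.
have E1 : (fun x => convol K v x - m 0 * v x) = (fun x => (- m 0) * v x + convol v K x).
  apply/funext => x; rewrite convolC//; last exact: schwartz_wint.
  by rewrite mulNr addrC.
have [SvK pvK] := schwartz_convol Sv wK.
have [SL pL] := schwartz_lin (- m 0) Sv SvK.
rewrite E1; apply: snorm_le => // s x sk.
rewrite pL pvK.
have Sp := schwartz_partials s Sv.
have m0 : m 0 = cint mu K by rewrite cint_kap// scaler0.
have ci := convol_cintable x Sp wK.
have -> : - m 0 * partials s v x + convol (partials s v) K x =
    cint mu (fun y => (partials s v (x - y) - partials s v x) * K y).
  rewrite m0 mulNr mulrC -(cintZ _ Ki) addrC -(cintB ci (cintableZ (partials s v x) Ki)).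
  by apply: eq_cint => y; rewrite mulrBl.
have cD : cintable mu (fun y => (partials s v (x - y) - partials s v x) * K y).
  have := cintableB ci (cintableZ (partials s v x) Ki).
  by under eq_fun do rewrite -mulrBl.
rewrite -lee_fin EFinM.
apply: (@le_trans _ _ ((wt x ^+ k)%:E *
    \int[mu]_y (normc ((partials s v (x - y) - partials s v x) * K y))%:E)%E).
  by rewrite lee_wpmul2l ?lee_fin ?wtX_ge0// le_normc_cint.
have mD : cmfun (fun y => (partials s v (x - y) - partials s v x) * K y) by case: cD.
rewrite -ge0_integralZl//; last 2 first.
- exact: measurable_EFin_normc.
- by rewrite lee_fin wtX_ge0.
apply: (@le_trans _ _ (\int[mu]_y ((2 * n%:R * snorm k.+1 v)%:E *
    (enorm y * wt y ^+ k * normc (K y))%:E))%E).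
  have mM : measurable_fun setT (fun y => (enorm y * wt y ^+ k * normc (K y))%:E).
    apply/measurable_EFinP; apply: measurable_funM.
      by apply: measurable_funM; [exact: measurable_enorm|exact: measurable_wtX].
    by apply: measurable_normc; exact: schwartz_cmfun.
  apply: ge0_le_integral => //.
  - by move=> y _; rewrite -EFinM lee_fin mulr_ge0 ?wtX_ge0.
  - by apply: measurable_funeM; exact: measurable_EFin_normc.
  - exact: measurable_funeM.
  move=> y _; rewrite -!EFinM lee_fin normcM !mulrA ler_wpM2r//.
  have := @schwartz_mean_value _ _ v s x (- y) k Sv sk.
  by rewrite enormN wtN.
rewrite ge0_integralZl//.
- rewrite [leRHS]EFinM; apply: lee_wpmul2l; last exact: kap_scale_moment.
  by rewrite lee_fin !mulr_ge0 ?snorm_ge0.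
- apply/measurable_EFinP; apply: measurable_funM.
    by apply: measurable_funM; [exact: measurable_enorm|exact: measurable_wtX].
  by apply: measurable_normc; exact: schwartz_cmfun.
- by move=> y _; rewrite lee_fin !mulr_ge0 ?enorm_ge0 ?wtX_ge0.
- by rewrite lee_fin !mulr_ge0 ?snorm_ge0.
Qed.

Lemma tempered_distr_of g : schwartz g -> tempered (distr_of g).
Proof.
move=> Sg; have gi := schwartz_integrable Sg; have mg := schwartz_cmfun Sg.
have gv v : schwartz v -> cintable mu (fun x => g x * v x).
  move=> Sv; apply: (cintable_le (g := fun x => (snorm 0 v)%:C * g x)).
  - by apply: cmfunM => //; exact: schwartz_cmfun.
  - exact: cintableZ.
  - move=> x; rewrite !normcM normcR ger0_norm ?snorm_ge0// mulrC ler_wpM2r//.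
    exact: schwartz_bound.
split.
  move=> a v w Sv Sw; rewrite /distr_of -[LHS]/(cint mu _) -[X in a * X]/(cint mu _) -[X in _ + X]/(cint mu _).
  rewrite -(cintZ a (gv v Sv)) -(cintD (cintableZ a (gv v Sv)) (gv w Sw)).
  by apply: eq_cint => x /=; ring.
exists 0%N, (wnorm 0 g) => v Sv; rewrite seminormE// -EFinM lee_fin mulrC.
have [||_] := @wint_mul _ _ 0 (snorm 0 v) v g (schwartz_wint Sg).
- exact: schwartz_cmfun.
- by move=> y; rewrite expr0 mulr1 schwartz_bound.
- by rewrite /distr_of (_ : (g \* v) = (fun x => v x * g x))//; apply/funext => x /=; rewrite mulrC.
Qed.

Lemma ptconv_distr_of g K y : schwartz K -> (forall x, K (- x) = K x) ->
  ptconv (distr_of g) K y = convol K g y.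
Proof.
move=> SK Ke; rewrite /ptconv /distr_of; apply: eq_cint => x /=.
by rewrite /trans mulrC -Ke opprB.
Qed.

Lemma convol_sym K w g : schwartz K -> (forall x, K (- x) = K x) -> wint w -> schwartz g ->
  cint mu (fun x => g x * convol K w x) = cint mu (fun y => convol K g y * w y).
Proof.
move=> SK Ke ww Sg; have := tempered_convol (tempered_distr_of Sg) SK ww.
rewrite {1}/distr_of => e; rewrite -[LHS]/(cintegral (g \* convol K w)) e.
by apply: eq_cint => y; rewrite ptconv_distr_of.
Qed.

End multipliers.

Lemma exp2_gt0 (R : realType) (j : int) : ((0 : R) < 2 ^ j)%R.
Proof. exact: exprz_gt0. Qed.

(** * Dyadic kernels *)

Section dyadic.
Local Open Scope classical_set_scope.
Local Open Scope ring_scope.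
Local Open Scope complex_scope.
Context {R : realType} {n : nat}.
Local Notation E := ('rV[R]_n).
Local Notation C := (R[i]).
Local Notation mu := (@lebesgue_rV R n).
Variable phi : E -> R.
Hypothesis cphi : cutoff phi.
Implicit Types (x y xi : E) (f g m v w : E -> C) (j k a b : int) (u T : @distrib R n).

Lemma exp2_le a b : a <= b -> (2 : R) ^ a <= 2 ^ b.
Proof. by move=> ab; rewrite ler_eXz2l// ltr1n. Qed.

Lemma phi_eq0 xi : 4 / 3 <= enorm xi -> phi xi = 0.
Proof.
move=> h; apply/eqP; apply/negPn/negP => p0.
have [_ _ _ + _] := cphi => /(_ xi); rewrite /= ltNge h => H.
by have := H (@subset_closure _ _ xi p0).
Qed.

Lemma phi_eq1 xi : enorm xi < 3 / 4 -> phi xi = 1.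
Proof. by have [_ _ _ _ +] := cphi; exact. Qed.

Lemma phi0 : phi 0 = 1.
Proof. by apply: phi_eq1; rewrite enorm0; lra. Qed.

Lemma phiN xi : phi (- xi) = phi xi.
Proof. by have [_ + _ _ _] := cphi; apply; rewrite enormN. Qed.

Lemma schwartz_phi : schwartz (fun xi => (phi xi)%:C).
Proof. by apply: test_schwartz; have [] := cphi. Qed.

(* Locked, since comparing [phic a] with [phic b] by unfolding integer powers
   of 2 does not terminate in practice. *)
Fact phic_key : unit. Proof. exact: tt. Qed.
Definition phic : int -> E -> C :=
  locked_with phic_key (fun j xi => (phij phi j xi)%:C).

Lemma phicD j xi : phic j xi = (phi (2 ^ (- j) *: xi))%:C.
Proof. by rewrite /phic unlock. Qed.

(** For [a < b], the symbol of the blocks [a] to [b - 1] together; [ann k (k + 1)] is the symbol of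
    block [k] ([psijE]). *)
Definition ann a b xi : C := phic b xi - phic a xi.

Lemma schwartz_scale (c : R) m : 0 < c -> schwartz m -> schwartz (fun xi => m (c *: xi)).
Proof.
move=> c0 Sm; have [+ _] := schwartz_affine 0 (lt0r_neq0 c0) Sm.
by under eq_fun do rewrite addr0.
Qed.

Lemma schwartz_phic j : schwartz (phic j).
Proof.
rewrite (_ : phic j = (fun xi => (phi (2 ^ (- j) *: xi))%:C)).
  exact: (schwartz_scale (exp2_gt0 R (- j)) schwartz_phi).
by apply/funext => xi; rewrite phicD.
Qed.

Lemma schwartz_ann a b : schwartz (ann a b).
Proof. by apply: schwartzB; exact: schwartz_phic. Qed.

Lemma psijE j xi : (psij phi j xi)%:C = ann j (j + 1) xi.
Proof.
rewrite /psij /ann !phicD -rmorphB; congr (_%:C); rewrite /phij scalerA; congr (phi (_ *: _) - _).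
by rewrite opprD expfzDr ?pnatr_eq0// exprN1.
Qed.

Lemma annN a b xi : ann a b (- xi) = ann a b xi.
Proof. by rewrite /ann !phicD !scalerN !phiN. Qed.

Lemma ann0 a b : ann a b 0 = 0.
Proof. by rewrite /ann !phicD !scaler0 subrr. Qed.

Lemma exp2NK j : (2 : R) ^ (- j) * 2 ^ j = 1.
Proof. by rewrite -expfzDr ?pnatr_eq0// addNr expr0z. Qed.

Lemma phic_eq0 j xi : 4 / 3 * 2 ^ j <= enorm xi -> phic j xi = 0.
Proof.
move=> h; rewrite phicD phi_eq0// enormZ (gtr0_norm (exp2_gt0 R (- j))).
by rewrite -(ler_pM2r (exp2_gt0 R j)) [leRHS]mulrAC exp2NK mul1r.
Qed.

Lemma phic_eq1 j xi : enorm xi < 3 / 4 * 2 ^ j -> phic j xi = 1.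
Proof.
move=> h; rewrite phicD phi_eq1// enormZ (gtr0_norm (exp2_gt0 R (- j))).
by rewrite -(ltr_pM2r (exp2_gt0 R j)) [ltLHS]mulrAC exp2NK mul1r.
Qed.

Lemma psi_out k xi : ann k (k + 1) xi != 0 ->
  3 / 4 * 2 ^ k <= enorm xi /\ enorm xi < 8 / 3 * 2 ^ k.
Proof.
have e1 : (2 : R) ^ (k + 1) = 2 ^ k * 2 by rewrite expfzDr ?pnatr_eq0.
have t0 := exp2_gt0 R k.
move=> h; split; rewrite leNgt || rewrite ltNge; apply: contraNN h => h.
  by rewrite /ann !phic_eq1 ?subrr// e1; lra.
by rewrite /ann !phic_eq0 ?subrr// ?e1; lra.
Qed.

(** Block [k] lives below [8/3 * 2^k], and [phic b] equals 1 below [3/4 * 2^(k+2) = 3 * 2^k]. *)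
Lemma phic_psi1 b k xi : k + 2 <= b -> phic b xi * ann k (k + 1) xi = ann k (k + 1) xi.
Proof.
move=> kb; have [->|h] := eqVneq (ann k (k + 1) xi) 0; first by rewrite mulr0.
have [_ h2] := psi_out h; rewrite phic_eq1 ?mul1r//.
have e2 : (2 : R) ^ (k + 2) = 2 ^ k * 4.
  by rewrite expfzDr ?pnatr_eq0//; congr (_ * _); rewrite -[LHS]/(2 ^+ 2 : R); lra.
by have := exp2_le kb; have := exp2_gt0 R k; rewrite e2; lra.
Qed.

(** Block [k] lives above [3/4 * 2^k], and [phic a] vanishes above [4/3 * 2^(k-1) = 2/3 * 2^k]. *)
Lemma phic_psi0 a k xi : a + 1 <= k -> phic a xi * ann k (k + 1) xi = 0.
Proof.
move=> kb; have [->|h] := eqVneq (ann k (k + 1) xi) 0; first by rewrite mulr0.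
have [h2 _] := psi_out h; rewrite phic_eq0 ?mul0r//.
have e2 : (2 : R) ^ (a + 1) = 2 ^ a * 2 by rewrite expfzDr ?pnatr_eq0.
by have := exp2_le kb; have := exp2_gt0 R a; rewrite e2; lra.
Qed.

Lemma ann_psi1 a b k xi : a + 1 <= k -> k + 2 <= b ->
  ann a b xi * ann k (k + 1) xi = ann k (k + 1) xi.
Proof. by move=> ak kb; rewrite [X in X * _]/ann mulrBl phic_psi1// phic_psi0// subr0. Qed.

Lemma ann_psi0 a b k xi : a <= b -> (k + 2 <= a) || (b + 1 <= k) ->
  ann a b xi * ann k (k + 1) xi = 0.
Proof.
move=> ab /orP[h|h]; rewrite [X in X * _]/ann mulrBl.
  by rewrite !phic_psi1 ?subrr// (le_trans h).
by rewrite !phic_psi0 ?subrr//; apply: le_trans h; rewrite lerD2r.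
Qed.

Definition kapA a b := kap (ann a b).
Definition kapj k := kapA k (k + 1).

Lemma schwartz_kapA a b : schwartz (kapA a b).
Proof. exact/schwartz_kap/schwartz_ann. Qed.

Lemma kapA_even a b x : kapA a b (- x) = kapA a b x.
Proof. by apply: kap_even; [exact: schwartz_ann|exact: annN]. Qed.

Lemma kapA_phic a b x : kapA a b x = kap (phic b) x - kap (phic a) x.
Proof.
rewrite /kapA (_ : ann a b = (fun xi => (-1) * phic a xi + phic b xi)); last first.
  by apply/funext => xi; rewrite /ann; ring.
by rewrite (kap_lin _ (schwartz_phic a) (schwartz_phic b)) mulN1r addrC.
Qed.

Lemma kapA_cat a b c x : kapA a b x + kapA b c x = kapA a c x.
Proof. by rewrite !kapA_phic; ring. Qed.

Lemma convol_kapA w a b x : wint w ->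
  convol (kapA a b) w x = convol (kap (phic b)) w x - convol (kap (phic a)) w x.
Proof.
move=> ww; rewrite (_ : kapA a b = (fun x => (-1) * kap (phic a) x + kap (phic b) x)).
  rewrite (convol_linl _ (schwartz_kap (schwartz_phic a)) (schwartz_kap (schwartz_phic b)) ww).
  by rewrite mulN1r addrC.
by apply/funext => y; rewrite kapA_phic; ring.
Qed.

Lemma convol_ann1 a b k w : a + 1 <= k -> k + 2 <= b -> wint w ->
  convol (kapA a b) (convol (kapj k) w) = convol (kapj k) w.
Proof.
move=> ak kb ww; rewrite /kapj /kapA (convol_kap2 (schwartz_ann a b) (schwartz_ann k (k + 1)) ww).
suff -> : (fun xi => ann a b xi * ann k (k + 1) xi) = ann k (k + 1) by [].
by apply/funext => xi; rewrite ann_psi1.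
Qed.

Lemma convol_ann0 a b k w : a <= b -> (k + 2 <= a) || (b + 1 <= k) -> wint w ->
  convol (kapA a b) (convol (kapj k) w) = (fun=> 0).
Proof.
move=> ab h ww; rewrite /kapj /kapA (convol_kap2 (schwartz_ann a b) (schwartz_ann k (k + 1)) ww).
have -> : (fun xi => ann a b xi * ann k (k + 1) xi) = (fun=> 0).
  by apply/funext => xi; rewrite ann_psi0.
by rewrite kap_zero kap0.
Qed.

Lemma convol_comm a b c d w : wint w ->
  convol (kapA a b) (convol (kapA c d) w) = convol (kapA c d) (convol (kapA a b) w).
Proof.
move=> ww; rewrite /kapA (convol_kap2 (schwartz_ann a b) (schwartz_ann c d) ww).
rewrite (convol_kap2 (schwartz_ann c d) (schwartz_ann a b) ww).
suff -> : (fun xi => ann a b xi * ann c d xi) = (fun xi => ann c d xi * ann a b xi) by [].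
by apply/funext => xi; rewrite mulrC.
Qed.

Lemma DeltaE j u v : schwartz v -> Delta phi j u v = u (convol (kapj j) v).
Proof.
move=> Sv; rewrite /Delta (_ : (fun xi => (psij phi j xi)%:C) = ann j (j + 1)); last first.
  by apply/funext => xi; exact: psijE.
by rewrite multiplierE//; exact: schwartz_ann.
Qed.

(** The L1 norm of the low-pass kernel. It is invariant under dilation, so [2 * C1] bounds the L1
    norms of all annular kernels at once ([wnorm_kapA]). *)
Definition C1 : R := wnorm 0 (kap (phic 0)).

Lemma C1_ge0 : 0 <= C1. Proof. exact: wnorm_ge0. Qed.

Lemma wnorm_kap_scale m (c : R) : 0 < c -> schwartz m ->
  wnorm 0 (kap (fun xi => m (c *: xi))) = wnorm 0 (kap m).
Proof.
move=> c0 Sm; rewrite /wnorm; apply: (congr1 fine).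
have cV : 0 < c^-1 by rewrite invr_gt0.
have mK := schwartz_cmfun (schwartz_kap Sm).
pose G z := (normc (kap m z))%:E.
have mG : measurable_fun setT G by exact: measurable_EFin_normc.
have G0 z : (0 <= G z)%E by rewrite lee_fin.
have mG' : measurable_fun setT (fun y => G (c^-1 *: y)).
  exact: (measurableT_comp mG (measurable_scalerV c^-1)).
have H : (\int[mu]_y G (c^-1 *: y) = (c^-1 ^- n)%:E * \int[mu]_y G y)%E.
  rewrite -(@ge0_integral_affine_rV R n c^-1 0 G cV mG G0).
  by apply: eq_integral => y _; rewrite addr0.
have cn : 0 <= c ^- n by rewrite invr_ge0 exprn_ge0// ltW.
transitivity (\int[mu]_y ((c ^- n)%:E * G (c^-1 *: y)))%E.
  apply: eq_integral => y _; rewrite expr0 mul1r kap_scale// normcM normcR ger0_norm//.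
have cnE : (0 <= (c ^- n)%:E)%E by rewrite lee_fin.
rewrite (ge0_integralZl mu measurableT mG' (fun y _ => G0 (c^-1 *: y)) cnE).
rewrite H muleA -EFinM exprVn invrK mulVf ?expf_neq0 ?lt0r_neq0// mul1e.
by apply: eq_integral => y _; rewrite expr0 mul1r.
Qed.

Lemma phicE j : phic j = (fun xi => phic 0 (2 ^ (- j) *: xi)).
Proof. by apply/funext => xi; rewrite !phicD oppr0 expr0z scale1r. Qed.

Lemma annE a b j : ann (a + j) (b + j) = (fun xi => ann a b (2 ^ (- j) *: xi)).
Proof.
apply/funext => xi; rewrite /ann !phicD !scalerA -!expfzDr ?pnatr_eq0//.
by rewrite -!opprD.
Qed.

Lemma wnorm_kapA a b : wnorm 0 (kapA a b) <= 2 * C1.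
Proof.
have wk j : wnorm 0 (kap (phic j)) = C1.
  by rewrite [X in kap X]phicE (wnorm_kap_scale (exp2_gt0 R (- j)) (schwartz_phic 0)).
have Sk j := schwartz_wint (schwartz_kap (schwartz_phic j)).
have mk j : cmfun (kap (phic j)) by case: (Sk j).
pose g j y := (wt y ^+ 0 * normc (kap (phic j) y))%:E.
have g0 j y : setT y -> (0 <= g j y)%E by rewrite lee_fin wint_ge0.
have mg j : measurable_fun setT (g j) by apply/measurable_EFinP; exact: measurable_wnorm.
have -> : 2 * C1 = wnorm 0 (kap (phic b)) + wnorm 0 (kap (phic a)) by rewrite !wk; ring.
have SA := schwartz_wint (schwartz_kapA a b).
rewrite -lee_fin; apply: (@le_trans _ _ (\int[mu]_y g b y + \int[mu]_y g a y)%E); last first.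
  by rewrite /g (wnormE 0 (Sk b)) (wnormE 0 (Sk a)).
rewrite -[leLHS](wnormE 0 SA).
rewrite -(ge0_integralD mu measurableT (g0 b) (mg b) (g0 a) (mg a)).
apply: ge0_le_integral => //.
- by move=> y _; rewrite lee_fin wint_ge0.
- by apply/measurable_EFinP; apply: measurable_wnorm; exact: (schwartz_cmfun (schwartz_kapA a b)).
- exact: emeasurable_funD.
move=> y _; rewrite /g -EFinD lee_fin !expr0 !mul1r kapA_phic.
exact: normcB.
Qed.

(** The symbol of a block vanishes at the origin, so [approx_identity] at scale [2^-j] gains one
    factor [2^-j]. Since a block is unchanged by the wider annulus from [j - 1] to [j + 2], that
    kernel can be inserted and the gain repeated. *)
Lemma kap_decay (N k : nat) : exists2 A : R, 0 <= A & forall j v, 0 <= j -> schwartz v ->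
  snorm k (convol (kapj j) v) <= A * (2 ^ (- j)) ^+ N.+1 * snorm (k + N.+1) v.
Proof.
have base c d l j v : 0 <= j -> schwartz v -> snorm l (convol (kapA (c + j) (d + j)) v) <=
    (2 * n%:R * wnorm l.+1 (kapA c d)) * 2 ^ (- j) * snorm l.+1 v.
  move=> j0 Sv; have j1 : (2 : R) ^ (- j) <= 1.
    by rewrite -[leRHS](expr0z (2 : R)); apply: exp2_le; rewrite oppr_le0.
  have := @approx_identity R n (ann c d) _ l v (exp2_gt0 R (- j)) j1 (schwartz_ann c d) Sv.
  rewrite -annE ann0; under eq_fun do rewrite mul0r subr0.
  by move=> /le_trans; apply; rewrite le_eqVlt; apply/orP; left; apply/eqP; rewrite /kapA; ring.
elim: N k => [|N ih] k.
  exists (2 * n%:R * wnorm k.+1 (kapj 0)); first by rewrite !mulr_ge0// wnorm_ge0.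
  move=> j v j0 Sv; have := base 0 (0 + 1) k j v j0 Sv.
  by rewrite expr1 addn1 add0r [1 + j]addrC add0r.
have [A A0 hA] := ih k.+1.
exists (2 * n%:R * wnorm k.+1 (kapA (-1) 2) * A); first by rewrite !mulr_ge0// wnorm_ge0.
move=> j v j0 Sv.
have Sk := (schwartz_convol (schwartz_kapA j (j + 1)) (schwartz_wint Sv)).1.
rewrite -(@convol_ann1 (-1 + j) (2 + j)); last 3 first.
- by rewrite addrAC addNr add0r.
- by rewrite addrC.
- exact: schwartz_wint.
apply: le_trans (base _ _ k j _ j0 Sk) _.
have := hA j v j0 Sv; rewrite addSnnS => /(ler_wpM2l (_ : 0 <= 2 * n%:R * wnorm k.+1 (kapA (-1) 2) * 2 ^ (- j))) h.
apply: le_trans (h _) _.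
  by apply: mulr_ge0; [rewrite !mulr_ge0 ?wnorm_ge0|exact: ltW (exp2_gt0 R _)].
by rewrite le_eqVlt; apply/orP; left; apply/eqP; rewrite [in RHS]exprS; ring.
Qed.

Lemma phic_approx (k : nat) : exists2 A : R, 0 <= A & forall j v, 0 <= j -> schwartz v ->
  snorm k (fun x => v x - convol (kap (phic j)) v x) <= A * 2 ^ (- j) * snorm k.+1 v.
Proof.
exists (2 * n%:R * wnorm k.+1 (kap (phic 0))); first by rewrite !mulr_ge0// wnorm_ge0.
move=> j v j0 Sv; have j1 : (2 : R) ^ (- j) <= 1.
  by rewrite -[leRHS](expr0z (2 : R)); apply: exp2_le; rewrite oppr_le0.
have := @approx_identity R n (phic 0) _ k v (exp2_gt0 R (- j)) j1 (schwartz_phic 0) Sv.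
rewrite -phicE phicD scaler0 phi0; under eq_fun do rewrite mul1r.
have Sc := (schwartz_convol (schwartz_kap (schwartz_phic j)) (schwartz_wint Sv)).1.
have SB := schwartzB Sc Sv; have SB' := schwartzB Sv Sc.
move=> h; apply: (@le_trans _ _ (snorm k (fun x => convol (kap (phic j)) v x - v x))).
  apply: snorm_le => // s x sk.
  have [_ p1] := schwartz_lin (-1) SB schwartz0.
  have -> : (fun x => v x - convol (kap (phic j)) v x) =
     (fun x => -1 * (convol (kap (phic j)) v x - v x) + (fun=> 0) x).
    by apply/funext => y; ring.
  rewrite p1 (_ : partials s (fun=> 0) x = 0) ?addr0 ?mulN1r ?normcN; first exact: le_snorm.
  have [_ /(_ s)] := schwartz_lin (-1) (@schwartz0 R n) (@schwartz0 R n).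
  rewrite (_ : (fun x : E => -1 * 0 + 0) = (fun=> 0)); last by apply/funext => y; ring.
  move=> /(congr1 (fun f => f x)) /= {1}->.
  by rewrite mulN1r addNr.
apply: le_trans h _.
by rewrite le_eqVlt; apply/orP; left; apply/eqP; ring.
Qed.

End dyadic.

(** * Uniqueness of the function representing a distribution *)

Section density_measure.
Local Open Scope classical_set_scope.
Local Open Scope ring_scope.
Context {R : realType} d (T : measurableType d) (mu : {measure set T -> \bar R}).
Variable F : T -> R.
Hypotheses (mF : measurable_fun setT F) (F0 : forall x, 0 <= F x).

Definition density_measure (A : set T) : \bar R := (\int[mu]_(x in A) (F x)%:E)%E.

Let dm0 : density_measure set0 = 0%E.
Proof. by rewrite /density_measure integral_set0. Qed.

Let dm_ge0 A : (0 <= density_measure A)%E.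
Proof. by apply: integral_ge0 => x _; rewrite lee_fin. Qed.

Let dm_sigma : semi_sigma_additive density_measure.
Proof.
move=> A mA tA mUA; rewrite /density_measure ge0_integral_bigcup//.
- by apply: is_cvg_nneseries => k _ _; apply: integral_ge0 => x _; rewrite lee_fin.
- by apply/measurable_EFinP; apply: measurable_funTS.
- by move=> x _; rewrite lee_fin.
Qed.

Definition density_measure_measure : {measure set T -> \bar R} :=
  HB.pack density_measure (isMeasure.Build _ _ _ density_measure dm0 dm_ge0 dm_sigma).

End density_measure.

Section boxes.
Local Open Scope classical_set_scope.
Local Open Scope ring_scope.
Local Open Scope complex_scope.
Context {R : realType} {n : nat}.
Local Notation E := ('rV[R]_n).
Local Notation C := (R[i]).
Local Notation mu := (@lebesgue_rV R n).

Definition openbox (a b : 'I_n -> R) : set E := [set x | forall i, a i < x ord0 i < b i].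
Definition boxes : set (set E) := [set A | exists a b, A = openbox a b].
Definition cube (k : nat) : set E := openbox (fun=> - k%:R) (fun=> k%:R).

Lemma norm_lt_nat (x : E) : exists k : nat, enorm x < k%:R.
Proof.
by exists (archimedean.Num.bound (enorm x)); exact: archimedean.Num.Theory.archi_boundP (enorm_ge0 x).
Qed.

Lemma cube_cover : \bigcup_k cube k = setT.
Proof.
apply/seteqP; split=> // x _.
have [k xk] := norm_lt_nat x; exists k => // i.
by have := le_lt_trans (coor_le_enorm x i) xk; rewrite ltr_norml.
Qed.

Lemma boxes_measurable : @measurable _ E = <<s boxes >>.
Proof.
apply/seteqP; split=> A; last first.
  apply: smallest_sub; first exact: sigma_algebra_measurable.
  move=> _ [a [b ->]].
  rewrite (_ : openbox a b = \bigcap_(i in [set: 'I_n])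
      ((fun x : E => x ord0 i) @^-1` `]a i, b i[%classic)); last first.
    apply/seteqP; split=> x /=.
      by move=> h i _ /=; rewrite in_itv/=.
    by move=> h i; have := h i I; rewrite /= in_itv/=.
  apply: fin_bigcap_measurable => // i _.
  by rewrite -[X in measurable X]setTI; apply: measurable_coor => //; exact: measurable_itv.
move=> mA.
have mid : measurable_fun setT (id : g_sigma_algebraType boxes -> E).
  apply: measurable_rVP => i.
  apply: (measurability _ (RGenOpens.measurableE R)).
  move=> _ [_ [a [b ->] <-]]; rewrite setTI.
  rewrite (_ : _ @^-1` _ = \bigcup_k openbox (fun l => if l == i then a else - k%:R)
     (fun l => if l == i then b else k%:R)).
    apply: bigcup_measurable => k _; apply: sub_sigma_algebra.
    by eexists; eexists; reflexivity.
  apply/seteqP; split=> x /=.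
    rewrite in_itv/= => xi; have [k xk] := norm_lt_nat x; exists k => // l.
    have [->//|_] := eqVneq l i.
    by have := le_lt_trans (coor_le_enorm x l) xk; rewrite ltr_norml.
  by move=> [k _ /(_ i)]; rewrite eqxx in_itv.
by have := mid measurableT A mA; rewrite setTI.
Qed.

Lemma boxes_setI : setI_closed boxes.
Proof.
move=> _ _ [a [b ->]] [a' [b' ->]].
exists (fun i => Num.max (a i) (a' i)), (fun i => Num.min (b i) (b' i)).
apply/seteqP; split=> x /=.
  by move=> [h h'] i; rewrite gt_max lt_min; have /andP[-> ->] := h i; have /andP[-> ->] := h' i.
by move=> h; split=> i; have := h i; rewrite gt_max lt_min => /andP[/andP[? ?] /andP[? ?]]; apply/andP.
Qed.

Lemma measurable_openbox a b : measurable (openbox a b).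
Proof. by rewrite boxes_measurable; apply: sub_sigma_algebra; exists a, b. Qed.

(** The positive and negative parts of [h] are densities of two measures that agree on the open
    boxes, a generating class closed under intersection, hence everywhere. On the set where [h] is
    positive the second measure vanishes, on its complement the first, so both are zero. *)
Lemma ae0_of_boxes (h : E -> R) : measurable_fun setT h ->
  (forall a b, mu.-integrable (openbox a b) (EFin \o h)) ->
  (forall a b, (\int[mu]_(x in openbox a b) (h x)%:E)%E = 0%E) ->
  {ae mu, forall x, h x = 0}.
Proof.
move=> mh hi h0.
pose hp x := Num.max (h x) 0; pose hn x := Num.max (- h x) 0.
have mp : measurable_fun setT hp by apply: measurable_maxr.
have mn : measurable_fun setT hn by apply: measurable_maxr => //; exact: measurableT_comp.
have p0 x : 0 <= hp x by rewrite le_max lexx orbT.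
have n0 x : 0 <= hn x by rewrite le_max lexx orbT.
have hE x : h x = hp x - hn x.
  by rewrite /hp /hn; case: (leP (h x) 0) => hx; [rewrite max_l ?oppr_ge0//; lra|rewrite max_r; lra].
pose m1 := density_measure_measure mu mp p0; pose m2 := density_measure_measure mu mn n0.
have pi a b : mu.-integrable (openbox a b) (EFin \o hp).
  apply: le_integrable (hi a b) => //; first exact: measurable_openbox.
    by apply/measurable_EFinP; exact: measurable_funTS.
  move=> x _ /=; rewrite lee_fin ger0_norm// ge_max normr_ge0 andbT.
  exact: ler_norm.
have ni a b : mu.-integrable (openbox a b) (EFin \o hn).
  apply: le_integrable (hi a b) => //; first exact: measurable_openbox.
    by apply/measurable_EFinP; exact: measurable_funTS.
  move=> x _ /=; rewrite lee_fin ger0_norm// ge_max normr_ge0 andbT -normrN.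
  exact: ler_norm.
have m12 A : boxes A -> m1 A = m2 A.
  move=> [a [b ->]].
  have := h0 a b; under eq_integral do rewrite hE EFinB.
  rewrite (integralB_EFin (measurable_openbox a b) (pi a b) (ni a b)).
  have fp := integrable_fin_num (measurable_openbox a b) (pi a b).
  have fn := integrable_fin_num (measurable_openbox a b) (ni a b).
  have key (u v : \bar R) : u \is a fin_num -> v \is a fin_num -> (u - v = 0)%E -> u = v.
    by case: u => [r| |]//; case: v => [t| |]// _ _ [] /eqP; rewrite subr_eq0 => /eqP ->.
  exact: key fp fn.
have m1y k : (m1 (cube k) < +oo)%E.
  have := integrable_fin_num (measurable_openbox (fun=> - k%:R) (fun=> k%:R)) (pi _ _).
  by rewrite ge0_fin_numE// integral_ge0// => x _; rewrite lee_fin.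
have Gc k : boxes (cube k) by eexists; eexists; reflexivity.
have mm A : measurable A -> m1 A = m2 A.
  exact: (measure_unique boxes cube boxes_measurable boxes_setI Gc cube_cover m1 m2 m12 m1y).
have mP : measurable [set x | 0 < h x].
  have := mh measurableT _ (measurable_itv `]0, +oo[); rewrite setTI.
  by congr measurable; apply/seteqP; split=> x /=; rewrite in_itv/= andbT.
have z1 : m1 [set x | 0 < h x] = 0%E.
  rewrite mm//; apply: integral0_eq => x /= hx; congr EFin.
  by rewrite /hn max_r// oppr_le0 ltW.
have z2 : m2 (~` [set x | 0 < h x]) = 0%E.
  rewrite -mm; last exact: measurableC.
  apply: integral0_eq => x /= /negP; rewrite -leNgt => hx; congr EFin.
  by rewrite /hp max_r.
have I0 (F : E -> R) A : measurable_fun setT F -> (forall x, 0 <= F x) -> measurable A ->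
    (\int[mu]_(x in A) (F x)%:E = 0)%E -> {ae mu, forall x, A x -> F x = 0}.
  move=> mF F0 mA; have mFA : measurable_fun A (EFin \o F).
    by apply/measurable_EFinP; exact: measurable_funTS.
  have [H _] := ae_eq_integral_abs mu mA mFA.
  rewrite (eq_integral (fun x => `|(EFin \o F) x|%E)); last first.
    by move=> x _ /=; rewrite ger0_norm.
  by move=> /H; apply: filterS => x Hx Ax; have [] := Hx Ax.
have a1 := I0 _ _ mp p0 mP z1; have a2 := I0 _ _ mn n0 (measurableC mP) z2.
apply: filterS2 a1 a2 => x H1 H2; have [hx|hx] := ltP 0 (h x).
  by have := H1 hx; rewrite /hp max_l ?ltW.
have /H2 : ~ (0 < h x) by apply/negP; rewrite -leNgt.
by rewrite /hn max_l ?oppr_ge0// => /eqP; rewrite oppr_eq0 => /eqP.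
Qed.

End boxes.

Section uniqueness.
Local Open Scope classical_set_scope.
Local Open Scope ring_scope.
Local Open Scope complex_scope.
Context {R : realType} {n : nat}.
Local Notation E := ('rV[R]_n).
Local Notation C := (R[i]).
Local Notation mu := (@lebesgue_rV R n).
Variable phi : E -> R.
Hypothesis cphi : cutoff phi.

Lemma phic_big (r : R) : exists j, forall x, enorm x < r -> phic phi j x = 1.
Proof.
exists (Posz (archimedean.Num.bound (4 / 3 * `|r|))) => x xr; apply: phic_eq1 => //.
have := archimedean.Num.Theory.archi_boundP (_ : 0 <= 4 / 3 * `|r|).
set k := archimedean.Num.bound _ => /(_ _) h.
have h' : 4 / 3 * `|r| < k%:R by apply: h; rewrite mulr_ge0.
have kk : k%:R <= (2 : R) ^ k by rewrite -[leRHS]/(2 ^+ k) -natrX ler_nat ltnW// ltn_expl.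
by have := ler_norm r; lra.
Qed.

Lemma wint_bounded (w : E -> C) (r M : R) : cmfun w -> (forall x, normc (w x) <= M) ->
  (forall x, w x != 0 -> enorm x < r) -> wint w.
Proof.
move=> mw wM wr; have [j jr] := phic_big r.
have wp := schwartz_wint (schwartz_phic cphi j).
have [] // := @wint_le _ _ (fun x => M%:C * phic phi j x) w (wintZ M%:C wp) mw.
move=> x; have [->|w0] := eqVneq (w x) 0; first by rewrite normc0.
by rewrite jr ?wr// mulr1 normcR (le_trans (wM x))// ler_norm.
Qed.

(** The box shrunk by [2e]. The mollifier [Ke e] vanishes from distance [4e/3] on, so the mollified
    indicator of [Q a b e] vanishes outside the original box. *)
Let Q (a b : 'I_n -> R) (e : R) := openbox (fun i => a i + 2 * e) (fun i => b i - 2 * e).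

Let Ke (e : R) x : C := (phi (e^-1 *: x))%:C.

Let SKe e : 0 < e -> schwartz (Ke e).
Proof.
by move=> e0; apply: (schwartz_scale (c := e^-1) _ (schwartz_phi cphi)); rewrite invr_gt0.
Qed.

Let phi_ge0 x : 0 <= phi x. Proof. by have [_ _ + _ _] := cphi; exact. Qed.

Let mphi : measurable_fun setT phi.
Proof. by have [/measurable_EFinP + _] := schwartz_cmfun (schwartz_phi cphi); case: (schwartz_cmfun (schwartz_phi cphi)). Qed.

Let box_wint a b : wint (fun x : E => (\1_(openbox a b) x)%:C).
Proof.
apply: (@wint_bounded _ (1 + \sum_i (`|a i| + `|b i|)) 1).
- by apply: cmfunR; exact: measurable_indic (measurable_openbox a b).
- by move=> x; rewrite normcR indicE; case: (_ \in _); rewrite ?normr1 ?normr0.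
- move=> x; rewrite indicE; case: (boolP (x \in openbox a b)) => [|_]; last by rewrite eqxx.
  rewrite inE => bx _; apply: le_lt_trans (enorm_le_sum x) _.
  rewrite ltr_pwDl//; apply: ler_sum => i _; have /andP[h1 h2] := bx i.
  by rewrite ler_norml; have := ler_norm (b i); have := ler_norm (- a i); rewrite normrN; have := normr_ge0 (a i); have := normr_ge0 (b i); move: h1 h2; lra.
Qed.

Let Ie (e : R) := \int[mu]_x phi (e^-1 *: x).

Let IeE e : 0 < e -> cint mu (Ke e) = (Ie e)%:C.
Proof. by move=> e0; rewrite /Ke cintR. Qed.

Let Ie_gt0 e : 0 < e -> 0 < Ie e.
Proof.
move=> e0; have Ki := schwartz_integrable (SKe e0).
have ii : mu.-integrable setT (fun x => (phi (e^-1 *: x))%:E).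
  by have := cintable_Re Ki.
have fi := integrable_fin_num measurableT ii.
rewrite /Ie /Rintegral fine_gt0//; apply/andP; split; last first.
  by rewrite -ge0_fin_numE// integral_ge0// => x _; rewrite lee_fin.
(* The cube of half-side [c] lies in the ball of radius [e / 2], where the dilated cut-off equals 1,
   so its volume bounds the mass of the mollifier from below. *)
pose c := e / (2 * n.+1%:R).
have c0 : 0 < c by rewrite divr_gt0// mulr_gt0.
have cI : (0 < (\int[@lebesgue_measure R]_t (\1_(`[- c, c]%classic : set R) t)%:E) ^+ n)%E.
  have -> : (\int[@lebesgue_measure R]_t (\1_(`[- c, c]%classic : set R) t)%:E = (2 * c)%:E)%E.
    rewrite (@integral_indic _ _ _ (@lebesgue_measure R) _ measurableT
      `[- c, c]%classic (measurable_itv _)) setIT.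
    transitivity (@lebesgue_measure R `[- c, c]%classic) => //.
    by rewrite lebesgue_measure_itv/= lte_fin ifT; [rewrite -EFinB; congr EFin; ring|lra].
  by rewrite -EFin_expe lte_fin exprn_gt0// mulr_gt0.
apply: lt_le_trans cI _; rewrite -ge0_integral_prod_rV//.
apply: ge0_le_integral => //.
- by move=> x _; rewrite lee_fin prodr_ge0.
- apply/measurable_EFinP; apply: measurable_prod => i _.
  exact: (measurableT_comp (measurable_indic (measurable_itv _)) (measurable_coor i)).
- by case/integrableP: ii.
move=> x _; rewrite lee_fin.
have [xc|[i xi]] : (forall i, x ord0 i \in `[- c, c]) \/ (exists i, x ord0 i \notin `[- c, c]).
  have [|/existsNP[i /negP xi]] := pselect (forall i, x ord0 i \in `[- c, c]); first by left.
  by right; exists i.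
  rewrite phi_eq1//.
    by apply: prodr_ile1 => i; rewrite indicE ler0n/=; case: (_ \in _).
  rewrite enormZ gtr0_norm ?invr_gt0// mulrC ltr_pdivrMr//.
  apply: le_lt_trans (enorm_le_sum x) _.
  have : \sum_i `|x ord0 i| <= \sum_(i < n) c.
    by apply: ler_sum => i _; rewrite ler_norml; have := xc i; rewrite in_itv.
  rewrite sumr_const card_ord => /le_lt_trans; apply; rewrite -[ltLHS]mulr_natr.
  have n1 : n.+1%:R = n%:R + 1 :> R by rewrite -addn1 natrD.
  have -> : e = 2 * (c * n%:R) + 2 * c.
    by rewrite /c n1; field; have := ler0n R n; move=> h; apply/eqP; lra.
  have : 0 <= c * n%:R by rewrite mulr_ge0 ?ler0n// ltW.
  by move: c0; move: (c * n%:R); move: (c) => u v; lra.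
rewrite (bigD1 i)//= indicE; case: (boolP (_ \in _)) => [|_]; last by rewrite mul0r.
by rewrite inE /= (negPf xi).
Qed.

Let vk a b (e : R) x : C := (Ie e)^-1%:C * convol (Ke e) (fun y => (\1_(Q a b e) y)%:C) x.

Let Svk a b e : 0 < e -> schwartz (vk a b e).
Proof.
by move=> e0; apply: schwartzZ; exact: (schwartz_convol (SKe e0) (box_wint _ _)).1.
Qed.

Let vkE a b e x : 0 < e -> vk a b e x =
  ((Ie e)^-1 * \int[mu]_y (phi (e^-1 *: (x - y)) * \1_(Q a b e) y))%:C.
Proof.
by move=> e0; rewrite /vk /convol /Ke; under eq_cint do rewrite -rmorphM; rewrite cintR -rmorphM.
Qed.

Let vk_bound a b e x : 0 < e -> normc (vk a b e x) <= 1.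
Proof.
move=> e0; have I0 := Ie_gt0 e0; rewrite normcM normcR ger0_norm ?invr_ge0 ?(ltW I0)//.
rewrite mulrC ler_pdivrMr// mul1r.
have ci := convol_cintable x (SKe e0) (box_wint (fun i => a i + 2 * e) (fun i => b i - 2 * e)).
have Kx := cintable_reflect x (schwartz_integrable (SKe e0)).
have : (\int[mu]_y (normc (Ke e (x - y)))%:E = (Ie e)%:E)%E.
  have := cint_reflect x (schwartz_integrable (SKe e0)); rewrite IeE// cintR => -[<-].
  rewrite /Rintegral fineK; last exact: (integrable_fin_num measurableT (cintable_Re Kx)).
  by apply: eq_integral => y _; rewrite normcR ger0_norm.
move=> IE; rewrite -lee_fin -IE; apply: le_trans (le_normc_cint ci) _.
apply: ge0_le_integral => //.
- by apply: measurable_EFin_normc; case: ci.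
- by apply: measurable_EFin_normc; case: Kx.
move=> y _; rewrite lee_fin normcM ler_piMr// normcR indicE.
by case: (_ \in _); rewrite ?normr1 ?normr0.
Qed.

Let vk_out a b e x : 0 < e -> ~ openbox a b x -> vk a b e x = 0.
Proof.
move=> e0 xb; rewrite /vk /convol (_ : (fun y => _) = (fun=> 0)) ?cint0 ?mulr0//.
apply/funext => y; rewrite indicE; case: (boolP (y \in Q a b e)) => [|_]; last by rewrite mulr0.
rewrite inE => yQ; rewrite /Ke phi_eq0 ?mul0r//.
move: xb => /existsNP[i xi].
rewrite enormZ gtr0_norm ?invr_gt0// ler_pdivlMl//.
apply: le_trans (coor_le_enorm _ i); rewrite !mxE.
have /andP[y1 y2] := yQ i; move/negP: xi; rewrite negb_and -!leNgt => /orP[h|h].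
  by rewrite distrC (le_trans _ (ler_norm _))//; move: e0 h y1 y2; lra.
by rewrite (le_trans _ (ler_norm _))//; move: e0 h y1 y2; lra.
Qed.

Let vk_in a b x : openbox a b x -> exists2 d, 0 < d & forall e, 0 < e -> e < d -> vk a b e x = 1.
Proof.
move=> bx; pose d := \big[Num.min/1]_i Num.min (x ord0 i - a i) (b i - x ord0 i).
have d0 : 0 < d.
  rewrite /d; elim/big_ind: _ => // [u v u0 v0|i _]; first by rewrite lt_min u0.
  by rewrite lt_min !subr_gt0; have /andP[-> ->] := bx i.
have di i : d <= x ord0 i - a i /\ d <= b i - x ord0 i.
  by have := bigmin_le_cond 1 (fun i => Num.min (x ord0 i - a i) (b i - x ord0 i)) (isT : xpredT i); rewrite le_min => /andP.
(* [4e] exceeds the shrinkage [2e] plus the radius [4e/3] of the mollifier, so for [e < d / 4] the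
   mollifier centred at [x] sees only points of the shrunken box. *)
exists (d / 4); first by rewrite divr_gt0.
move=> e e0 ed; rewrite vkE//.
have -> : \int[mu]_y (phi (e^-1 *: (x - y)) * \1_(Q a b e) y) = Ie e.
  have := cint_reflect x (schwartz_integrable (SKe e0)); rewrite IeE// cintR => -[<-].
  apply: eq_Rintegral => y _; rewrite indicE; case: (boolP (y \in _)) => [_|]; first by rewrite mulr1.
  rewrite notin_setE => yQ; rewrite mulr0 phi_eq0//.
  rewrite enormZ gtr0_norm ?invr_gt0// ler_pdivlMl//.
  move: yQ => /existsNP[i yi]; apply: le_trans (coor_le_enorm _ i); rewrite !mxE.
  have [d1 d2] := di i; move/negP: yi; rewrite negb_and -!leNgt => /orP[h|h].
    by rewrite (le_trans _ (ler_norm _))//; move: e0 ed h d1 d2; lra.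
  by rewrite distrC (le_trans _ (ler_norm _))//; move: e0 ed h d1 d2; lra.
by rewrite mulVf// lt0r_neq0// Ie_gt0.
Qed.

(** The normalised mollified indicators [vk] are Schwartz functions bounded by 1 that converge
    pointwise to the indicator of the box. They are dominated by a cut-off equal to 1 on the box, so
    the integral of [h] over every box vanishes and [ae0_of_boxes] applies. *)
Lemma ae0_of_schwartz (h : E -> C) : cmfun h ->
  (forall v, schwartz v -> cintable mu (fun x => h x * v x) /\ cint mu (fun x => h x * v x) = 0) ->
  {ae mu, forall x, h x = 0}.
Proof.
move=> mh hv.
have hbox a b : cintable mu (fun x => h x * (\1_(openbox a b) x)%:C) /\
    cint mu (fun x => h x * (\1_(openbox a b) x)%:C) = 0.
  have mI : cmfun (fun x : E => (\1_(openbox a b) x : R)%:C).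
    by apply: cmfunR; exact: measurable_indic (measurable_openbox a b).
  have [j jr] := phic_big (1 + \sum_i (`|a i| + `|b i|)).
  have bj x : openbox a b x -> phic phi j x = 1.
    move=> bx; apply: jr; apply: le_lt_trans (enorm_le_sum x) _.
    rewrite ltr_pwDl//; apply: ler_sum => i _; have /andP[h1 h2] := bx i.
    by rewrite ler_norml; have := ler_norm (b i); have := ler_norm (- a i); rewrite normrN; have := normr_ge0 (a i); have := normr_ge0 (b i); move: h1 h2; lra.
  have [ij _] := hv _ (schwartz_phic cphi j).
  have dom (v : E -> C) x : (forall x, ~ openbox a b x -> v x = 0) -> (forall x, normc (v x) <= 1) ->
      normc (h x * v x) <= normc (h x * phic phi j x).
    move=> v0 v1; have [bx|bx] := pselect (openbox a b x); last by rewrite v0// mulr0 normc0.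
    by rewrite bj// mulr1 normcM ler_piMr.
  have dI : forall x, ~ openbox a b x -> ((\1_(openbox a b) x : R)%:C : C) = 0.
    by move=> x bx; rewrite indicE memNset.
  have dI1 x : normc ((\1_(openbox a b) x : R)%:C : C) <= 1.
    by rewrite normcR indicE; case: (_ \in _); rewrite ?normr1 ?normr0.
  have ci : cintable mu (fun x => h x * (\1_(openbox a b) x)%:C).
    by apply: (cintable_le (cmfunM mh mI) ij) => x; exact: (dom _ x dI dI1).
  split=> //.
  have e0 k : 0 < k.+1%:R^-1 :> R by rewrite invr_gt0.
  have cv : normc (cint mu (fun x => h x * vk a b k.+1%:R^-1 x) -
      cint mu (fun x => h x * (\1_(openbox a b) x)%:C)) @[k --> \oo] --> (0 : R).
    apply: (@cint_dominated _ _ _ _ _ _ (fun x => normc (h x * phic phi j x))).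
    - by move=> k; apply: cmfunM => //; exact: schwartz_cmfun (Svk a b (e0 k)).
    - exact: cmfunM.
    - move=> x; have [bx|bx] := pselect (openbox a b x); last first.
        rewrite (_ : (fun k => _) = (fun=> 0)); first exact: cvg_cst.
        by apply/funext => k; rewrite vk_out// dI// subrr normc0.
      have [d d0 dv] := vk_in bx.
      apply: (@cvg_near_cst _ _ _ _ _ _ _).
      have := @cvg_harmonic R => /cvgrPdist_lt /(_ d d0); apply: filterS => k.
      rewrite /harmonic/= sub0r normrN ger0_norm ?invr_ge0// => kd.
      by rewrite dv// indicE mem_set// subrr normc0.
    - by apply: measurable_normc; case: ij.
    - by case: ij.
    - move=> k x; apply: dom; first by move=> y by_; exact: vk_out.
      by move=> y; exact: vk_bound.
    - by move=> x; exact: (dom _ x dI dI1).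
  move: cv; rewrite (_ : (fun k => _) = (fun=> normc (cint mu (fun x => h x * (\1_(openbox a b) x)%:C)))).
    by move=> /cvg_lim => /(_ (@Rhausdorff R)); rewrite lim_cst// => /normc_eq0.
  by apply/funext => k; rewrite (hv _ (Svk a b (e0 k))).2 sub0r normcN.
have main (g : E -> R) : measurable_fun setT g ->
    (forall a b, mu.-integrable setT (fun x => (g x * \1_(openbox a b) x)%:E)) ->
    (forall a b, \int[mu]_x (g x * \1_(openbox a b) x) = 0) -> {ae mu, forall x, g x = 0}.
  move=> mg gi g0; apply: ae0_of_boxes => //.
    move=> a b; apply/(integrable_mkcond _ (measurable_openbox a b)).
    have := gi a b; congr (mu.-integrable _ _); apply/funext => x.
    by rewrite patchE indicE; case: (_ \in _); rewrite ?mulr1 ?mulr0.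
  move=> a b; rewrite integral_mkcond.
  have := integrable_fin_num measurableT (gi a b) => /fineK e.
  transitivity (\int[mu]_x (g x * \1_(openbox a b) x)%:E)%E; last first.
    by rewrite -e; congr EFin; exact: g0.
  by apply: eq_integral => x _; rewrite patchE indicE; case: (_ \in _); rewrite ?mulr1 ?mulr0.
have [mR mI] := mh.
have a1 : {ae mu, forall x, Re (h x) = 0}.
  apply: main => //.
  - move=> a b; have [/cintable_Re + _] := hbox a b.
    by under eq_fun do rewrite ReM /= mulr0 subr0.
  - move=> a b; have [_ /(congr1 (@complex.Re _))] := hbox a b; rewrite /cint /= => <-.
    by apply: eq_Rintegral => x _; rewrite ReM /= mulr0 subr0.
have a2 : {ae mu, forall x, Im (h x) = 0}.
  apply: main => //.
  - move=> a b; have [/cintable_Im + _] := hbox a b.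
    by under eq_fun do rewrite ImM /= mulr0 add0r.
  - move=> a b; have [_ /(congr1 (@complex.Im _))] := hbox a b; rewrite /cint /= => <-.
    by apply: eq_Rintegral => x _; rewrite ImM /= mulr0 add0r.
apply: filterS2 a1 a2 => x; case: (h x) => u v /= -> ->; exact: erefl.
Qed.

Lemma represents_unique T (f g : E -> C) : represents f T -> represents g T ->
  {ae mu, forall x, f x = g x}.
Proof.
move=> [/cmeasurableE mf Tf] [/cmeasurableE mg Tg].
have : {ae mu, forall x, f x - g x = 0}.
  apply: ae0_of_schwartz; first exact: cmfunB.
  move=> v Sv; have [/cintegrableE fi ef] := Tf v Sv; have [/cintegrableE gi eg] := Tg v Sv.
  have e : (fun x => (f x - g x) * v x) = (fun x => f x * v x - g x * v x).
    by apply/funext => x; rewrite mulrBl.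
  rewrite e; split; first exact: cintableB.
  rewrite (cintB fi gi); apply/eqP; rewrite subr_eq0; apply/eqP.
  by transitivity (T v).
by apply: filterS => x /eqP; rewrite subr_eq0 => /eqP.
Qed.

End uniqueness.

(** * Lebesgue norms *)

Section Lp_real.
Local Open Scope classical_set_scope.
Local Open Scope ring_scope.
Context {R : realType} {n : nat}.
Local Notation E := ('rV[R]_n).
Local Notation mu := (@lebesgue_rV R n).
Implicit Types (F G : E -> R) (p : \bar R) (r t : R).

Definition Np p F : \bar R := Lnorm mu p (fun x => (F x)%:E).

Lemma one_le_cases p : (1 <= p)%E ->
  [\/ p = 1%E, exists2 r, p = r%:E & 1 < r | p = +oo%E].
Proof.
case: p => [r| |] //; last by move=> _; apply: Or33.
rewrite lee_fin le_eqVlt => /orP[/eqP <-|r1]; first exact: Or31.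
by apply: Or32; exists r.
Qed.

Lemma conj_real r : 1 < r -> exists s, [/\ hoelder_conjugate r%:E = s%:E, 1 < s,
  r^-1 + s^-1 = 1 & (r - 1) * s = r].
Proof.
move=> r1; have r0 : 0 < r by lra.
have r10 : 0 < r - 1 by lra.
exists (r / (r - 1)); split.
- rewrite /hoelder_conjugate/= gt_eqF ?lte_fin// -EFinB inver gt_eqF//.
- by rewrite ltr_pdivlMr//; lra.
- by field; apply/andP; split; apply/lt0r_neq0.
- by rewrite mulrC divfK// lt0r_neq0.
Qed.

(** The Poisson product is bounded by [2^n] and has positive integral. The norm of exponent [+oo]
    tests whether the whole space has positive measure. *)
Lemma mu_gt0 : (0 < mu setT)%E.
Proof.
have : (\int[mu]_x (poissonV x)%:E <= \int[mu]_(x in setT) (2 ^+ n)%:E)%E.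
  apply: ge0_le_integral => //.
  - by move=> x _; rewrite lee_fin poissonV_ge0.
  - by apply/measurable_EFinP; exact: measurable_poissonV.
  move=> x _; rewrite lee_fin -[X in _ ^+ X](card_ord n) -prodr_const.
  apply: ler_prod => i _; have h := sqr_ge0 (x ord0 i).
  rewrite divr_ge0 ?addr_ge0//= ler_pdivrMr; last by lra.
  by rewrite ler_peMr//; lra.
rewrite integral_poissonV integral_cst// => h.
have {}h : (((2 * pi) ^+ n)%:E <= (2 ^+ n)%:E * mu setT)%E := h.
rewrite lt0e measure_ge0 andbT; apply/eqP => m0.
move: h; rewrite m0 mule0 lee_fin leNgt exprn_gt0//.
by rewrite mulr_gt0// pi_gt0.
Qed.

Lemma Np1 F : (forall x, 0 <= F x) -> Np 1 F = (\int[mu]_x (F x)%:E)%E.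
Proof.
by move=> F0; rewrite /Np Lnorm1; apply: eq_integral => x _; rewrite gee0_abs// lee_fin.
Qed.

Lemma NpE r F : (forall x, 0 <= F x) ->
  Np r%:E F = ((\int[mu]_x (F x `^ r)%:E) `^ r^-1)%E.
Proof.
move=> F0; rewrite /Np unlock; congr (_ `^ _)%E; apply: eq_integral => x _.
by rewrite gee0_abs ?lee_fin// poweR_EFin.
Qed.

Lemma Npy F : (forall x, 0 <= F x) -> Np +oo F = ess_sup mu (fun x => (F x)%:E).
Proof.
move=> F0; rewrite /Np unlock mu_gt0; congr (ess_sup mu _); apply/funext => x /=.
by rewrite ger0_norm.
Qed.

Lemma powR_le (r a b : R) : 0 <= r -> 0 <= a -> a <= b -> a `^ r <= b `^ r.
Proof. by move=> r0 a0 ab; apply: ge0_ler_powR; rewrite ?nnegrE// (le_trans a0). Qed.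

Lemma poweR_le (r : R) (x y : \bar R) : 0 <= r -> (0 <= x)%E -> (x <= y)%E ->
  (x `^ r <= y `^ r)%E.
Proof.
move=> r0 x0 xy; apply: gt0_ler_poweR => //; rewrite in_itv/= leey andbT//.
exact: le_trans xy.
Qed.

Lemma Np_ge0 p F : (0 <= Np p F)%E. Proof. exact: Lnorm_ge0. Qed.

Lemma measurable_powRF r F : measurable_fun setT F -> measurable_fun setT (fun x => F x `^ r).
Proof. by move=> mF; exact: (measurableT_comp (measurable_powR r) mF). Qed.

Lemma le_Np p F G : (1 <= p)%E -> measurable_fun setT F -> measurable_fun setT G ->
  (forall x, 0 <= F x) -> (forall x, 0 <= G x) ->
  {ae mu, forall x, F x <= G x} -> (Np p F <= Np p G)%E.
Proof.
move=> /one_le_cases p1 mF mG F0 G0 FG.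
have powI r : 0 < r -> (\int[mu]_x (F x `^ r)%:E <= \int[mu]_x (G x `^ r)%:E)%E.
  move=> r0; apply: ae_ge0_le_integral => //.
  - by move=> x _; rewrite lee_fin powR_ge0.
  - by apply/measurable_EFinP; exact: measurable_powRF.
  - by move=> x _; rewrite lee_fin powR_ge0.
  - by apply/measurable_EFinP; exact: measurable_powRF.
  - apply: filterS FG => x h _; rewrite lee_fin.
    by apply: powR_le => //; exact: ltW.
have pow0 r (H : E -> R) : (0 <= \int[mu]_x (H x `^ r)%:E)%E.
  by apply: integral_ge0 => x _; rewrite lee_fin powR_ge0.
case: p1 => [->|[r -> r1]|->].
- rewrite !NpE// invr1 !poweRe1//; exact: powI.
- have r0 := lt_trans ltr01 r1.
  by rewrite !NpE//; apply: poweR_le => //; [rewrite invr_ge0 ltW|exact: powI].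
- rewrite !Npy//; apply: le_ess_sup; apply: filterS FG => x; rewrite lee_fin//.
Qed.

Lemma Np_hoelder p F G : (1 <= p)%E -> measurable_fun setT F -> measurable_fun setT G ->
  (forall x, 0 <= F x) -> (forall x, 0 <= G x) ->
  (\int[mu]_x (F x * G x)%:E <= Np p F * Np (hoelder_conjugate p) G)%E.
Proof.
move=> /one_le_cases p1 mF mG F0 G0.
have H1y (A B : E -> R) : measurable_fun setT A -> measurable_fun setT B ->
    (forall x, 0 <= A x) -> (forall x, 0 <= B x) ->
    (\int[mu]_x (A x * B x)%:E <= Np 1 A * Np +oo B)%E.
  move=> mA mB A0 B0; rewrite Np1// muleC.
  have mAE : measurable_fun setT (fun x => (A x)%:E) by exact/measurable_EFinP.
  have A0E x : setT x -> (0 <= (A x)%:E)%E by move=> _; rewrite lee_fin.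
  rewrite -(ge0_integralZl mu measurableT mAE A0E (Np_ge0 _ B)).
  apply: ae_ge0_le_integral => //.
  - by move=> x _; rewrite lee_fin mulr_ge0.
  - by apply/measurable_EFinP; exact: measurable_funM.
  - by move=> x _; rewrite mule_ge0 ?Np_ge0 ?lee_fin.
  - exact: measurable_funeM.
  - have := ess_sup_ge mu (fun x => (B x)%:E); rewrite -Npy//.
    by apply: filterS => x h _; rewrite mulrC EFinM lee_wpmul2r// lee_fin.
case: p1 => [->|[r -> r1]|->].
- by rewrite hoelder_conjugate1; exact: H1y.
- have [s [-> s1 rs _]] := conj_real r1.
  have := @hoelder _ _ _ mu F G r s mF mG; rewrite Lnorm1.
  move=> /(_ (lt_trans ltr01 r1) (lt_trans ltr01 s1) rs); apply: le_trans.
  by rewrite le_eqVlt; apply/orP; left; apply/eqP; apply: eq_integral => x _; rewrite gee0_abs// lee_fin mulr_ge0.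
- rewrite hoelder_conjugatey muleC; under eq_integral do rewrite mulrC; exact: H1y.
Qed.

Lemma ball_wt (k : nat) (x : E) : enorm x < k%:R -> 1 <= (1 + k%:R) ^+ (2 * n) * wt x ^- (2 * n).
Proof.
move=> xk; rewrite ler_pdivlMr ?wtX_gt0// mul1r lerXn2r ?nnegrE ?wt_ge0// ?addr_ge0//.
by rewrite /wt lerD2l ltW.
Qed.

Lemma integral_ball_lty (h : E -> R) (c : R) (k : nat) : measurable_fun setT h ->
  (forall x, 0 <= h x) -> (forall x, h x <= c) -> (forall x, h x != 0 -> enorm x < k%:R) ->
  (\int[mu]_x (h x)%:E < +oo)%E.
Proof.
move=> mh h0 hc hk.
have c0 : 0 <= c by exact: le_trans (h0 0) (hc 0).
apply: (@le_lt_trans _ _ (\int[mu]_x ((c * (1 + k%:R) ^+ (2 * n))%:E * (wt x ^- (2 * n))%:E))%E).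
  apply: ge0_le_integral => //.
  - by move=> x _; rewrite lee_fin.
  - exact/measurable_EFinP.
  - by apply: measurable_funeM; apply/measurable_EFinP; exact: measurable_wtXV.
  move=> x _; rewrite -EFinM lee_fin -mulrA.
  have [->|hx] := eqVneq (h x) 0.
    by rewrite mulr_ge0// mulr_ge0// ?exprn_ge0 ?addr_ge0// ltW ?wtXV_gt0.
  by rewrite (le_trans (hc x))// ler_peMr// ball_wt// hk.
rewrite ge0_integralZl//.
- by rewrite lte_mul_pinfty ?integral_wt_lty// lee_fin mulr_ge0// exprn_ge0// addr_ge0.
- by apply/measurable_EFinP; exact: measurable_wtXV.
- by move=> x _; rewrite lee_fin ltW// wtXV_gt0.
- by rewrite lee_fin mulr_ge0// exprn_ge0// addr_ge0.
Qed.

(** Truncation in height and in space: weights carried by this set are bounded with bounded support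
    even if [F] has infinite norm. *)
Definition trunc_set F (k : nat) : set E := [set x | F x <= k%:R /\ enorm x < k%:R].

Lemma measurable_trunc_set F k : measurable_fun setT F -> measurable (trunc_set F k).
Proof.
move=> mF; apply: measurableI.
  have := mF measurableT _ (measurable_itv `]-oo, (k%:R : R)]); rewrite setTI.
  by congr measurable; apply/seteqP; split=> x /=; rewrite in_itv.
have := @measurable_enorm R n measurableT _ (measurable_itv `]-oo, (k%:R : R)[); rewrite setTI.
by congr measurable; apply/seteqP; split=> x /=; rewrite in_itv.
Qed.

Lemma integral_trunc F (H : E -> R) t : measurable_fun setT F -> measurable_fun setT H ->
  (forall x, 0 <= H x) -> (t%:E < \int[mu]_x (H x)%:E)%E ->
  exists k, (t%:E < \int[mu]_x (H x * \1_(trunc_set F k) x)%:E)%E.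
Proof.
move=> mF mH H0 tH; apply: contrapT => /forallNP nk.
have cover : \bigcup_k trunc_set F k = setT.
  apply/seteqP; split=> // x _.
  have [k1 h1] := norm_lt_nat x.
  have h2 := archimedean.Num.Theory.archi_boundP (normr_ge0 (F x)).
  exists (maxn k1 (archimedean.Num.bound `|F x|)) => //; split.
    rewrite (le_trans (ler_norm _))// (le_trans (ltW h2))// ler_nat leq_maxr//.
  by rewrite (lt_le_trans h1)// ler_nat leq_maxl.
have nd : {homo trunc_set F : k l / (k <= l)%N >-> (k <= l)%O}.
  move=> k l kl; apply/subsetPset => x [h1 h2]; split.
    by rewrite (le_trans h1)// ler_nat.
  by rewrite (lt_le_trans h2)// ler_nat.
have mT k := measurable_trunc_set k mF.
have mHT k : measurable_fun (trunc_set F k) (fun x => (H x)%:E).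
  by apply/measurable_EFinP; exact: measurable_funTS.
have H0T k x : trunc_set F k x -> (0 <= (H x)%:E)%E by rewrite lee_fin.
have cv := @ge0_nondecreasing_set_cvg_integral _ _ R _ _ mu nd mT mHT H0T.
rewrite cover in cv.
have : (\int[mu]_x (H x)%:E <= t%:E)%E.
  rewrite -(cvg_lim _ cv)//; apply: lime_le; first by apply/cvg_ex; eexists; exact: cv.
  apply: nearW => k; move: (nk k) => /negP; rewrite -leNgt; apply: le_trans.
  rewrite integral_mkcond le_eqVlt; apply/orP; left; apply/eqP; apply: eq_integral => x _.
  by rewrite patchE indicE; case: (_ \in _); rewrite ?mulr1 ?mulr0.
by rewrite leNgt tH.
Qed.

Lemma ereal_mid t (x : \bar R) : (t%:E < x)%E -> exists2 t', t < t' & (t'%:E < x)%E.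
Proof.
case: x => [r| |] //; rewrite ?lte_fin => h.
  by exists ((t + r) / 2); rewrite ?lte_fin; lra.
by exists (t + 1); rewrite ?ltry//; lra.
Qed.

(** The converse of Hoelder's inequality. The weight is the indicator of a truncation set for
    [p = 1], the normalised power [F^(r-1)] on such a set for finite [r > 1], and the normalised
    indicator of part of the set where [F] exceeds [t] for [p = +oo]. *)
Lemma Np_converse p F t : (1 <= p)%E -> measurable_fun setT F -> (forall x, 0 <= F x) ->
  0 <= t -> (t%:E < Np p F)%E ->
  exists w : E -> R, exists M : R, exists k : nat,
    [/\ measurable_fun setT w, forall x, 0 <= w x <= M,
        forall x, w x != 0 -> F x <= k%:R /\ enorm x < k%:R,
        (Np (hoelder_conjugate p) w <= 1)%E &
        (t%:E <= \int[mu]_x (F x * w x)%:E)%E].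
Proof.
move=> /one_le_cases p1 mF F0 t0 tF.
have mI k : measurable_fun setT (\1_(trunc_set F k) : E -> R).
  exact: measurable_indic (measurable_trunc_set k mF).
have I0 k x : 0 <= (\1_(trunc_set F k) x : R) by rewrite indicE ler0n.
have I1 k x : (\1_(trunc_set F k) x : R) <= 1 by rewrite indicE; case: (_ \in _).
have Isupp k x : (\1_(trunc_set F k) x : R) != 0 -> F x <= k%:R /\ enorm x < k%:R.
  by rewrite indicE; case: (boolP (x \in trunc_set F k)) => [|]; rewrite ?eqxx// inE.
case: p1 tF => [->|[r -> r1]|->] tF.
- rewrite Np1// in tF; have [k tk] := integral_trunc mF mF F0 tF.
  exists (\1_(trunc_set F k)), 1, k; split=> //.
  + by move=> x; rewrite I0 I1.
  + exact: Isupp.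
  + rewrite hoelder_conjugate1 Npy//; apply/ess_supP; apply: aeW => x.
    by rewrite lee_fin I1.
  + exact: ltW.
- have [s [-> s1 rs rs1]] := conj_real r1.
  have r0 := lt_trans ltr01 r1; have s0 := lt_trans ltr01 s1.
  have r10 : 0 <= r - 1 by rewrite subr_ge0 ltW.
  have tr : ((t `^ r)%:E < \int[mu]_x (F x `^ r)%:E)%E.
    rewrite ltNge; apply/negP => h; move: tF; rewrite NpE// ltNge => /negP; apply.
    have h0 : (0 <= \int[mu]_x (F x `^ r)%:E)%E.
      by apply: integral_ge0 => x _; rewrite lee_fin powR_ge0.
    have := poweR_le (_ : 0 <= r^-1) h0 h; rewrite poweR_EFin -powRrM mulfV ?lt0r_neq0// powRr1//.
    by apply; rewrite invr_ge0 ltW.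
  have [k tk] := integral_trunc mF (measurable_powRF r mF) (fun x => powR_ge0 _ _) tr.
  set h := fun x => F x `^ r * \1_(trunc_set F k) x in tk.
  have h0 x : 0 <= h x by rewrite mulr_ge0 ?powR_ge0.
  have mh : measurable_fun setT h by apply: measurable_funM => //; exact: measurable_powRF.
  have hc x : h x <= k%:R `^ r.
    rewrite /h indicE; case: (boolP (x \in trunc_set F k)) => [|_]; last by rewrite mulr0 powR_ge0.
    by rewrite inE => -[Fk _]; rewrite mulr1; apply: powR_le => //; exact: ltW.
  have hk x : h x != 0 -> enorm x < k%:R.
    move=> hx; apply: (Isupp k x _).2; apply: contraNneq hx => e; by rewrite /h e mulr0.
  have hy := integral_ball_lty mh h0 hc hk.
  have Ifin : (\int[mu]_x (h x)%:E)%E \is a fin_num.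
    by rewrite ge0_fin_numE// integral_ge0// => x _; rewrite lee_fin.
  set I := fine (\int[mu]_x (h x)%:E)%E.
  have IE : (\int[mu]_x (h x)%:E)%E = I%:E by rewrite fineK.
  have tI : t `^ r < I by rewrite -lte_fin -IE.
  have Ip : 0 < I by exact: le_lt_trans (powR_ge0 _ _) tI.
  have Is0 : 0 < I `^ s^-1 by rewrite powR_gt0.
  pose w x := F x `^ (r - 1) * \1_(trunc_set F k) x / I `^ s^-1.
  have w0 x : 0 <= w x by rewrite divr_ge0 ?mulr_ge0 ?powR_ge0.
  exists w, (k%:R `^ (r - 1) / I `^ s^-1), k; split.
  + apply: measurable_funM => //; apply: measurable_funM => //; exact: measurable_powRF.
  + move=> x; rewrite w0 /= ler_pM2r ?invr_gt0// indicE.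
    case: (boolP (x \in trunc_set F k)) => [|_]; last by rewrite mulr0 powR_ge0.
    by rewrite inE => -[Fk _]; rewrite mulr1; apply: powR_le.
  + move=> x wx; apply: Isupp; apply: contraNneq wx => e; by rewrite /w e mulr0 mul0r.
  + rewrite NpE//.
    have -> : (\int[mu]_x (w x `^ s)%:E)%E = 1%E.
      transitivity (\int[mu]_x (I^-1%:E * (h x)%:E))%E.
        apply: eq_integral => x _; rewrite -EFinM; congr EFin; rewrite /w.
        have a0 := powR_ge0 (F x) (r - 1); have b0 := I0 k x.
        have c0 : 0 <= (I `^ s^-1)^-1 by rewrite invr_ge0 ltW.
        rewrite (@powRM _ _ _ s (mulr_ge0 a0 b0) c0) (@powRM _ _ _ s a0 b0).
        have -> : (I `^ s^-1)^-1 `^ s = I^-1.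
          rewrite -(powR_inv1 (ltW Is0)) -!powRrM [X in I `^ X](_ : _ = -1).
            by rewrite powR_inv1// ltW.
          by field; exact: lt0r_neq0.
        rewrite -powRrM rs1 mulrC /h indicE; case: (_ \in _); rewrite ?powR1 ?powR0 ?lt0r_neq0//.
      rewrite ge0_integralZl//.
      * by rewrite IE -EFinM mulVf// lt0r_neq0.
      * exact/measurable_EFinP.
      * by move=> x _; rewrite lee_fin.
      * by rewrite lee_fin invr_ge0 ltW.
    by rewrite poweR1r.
  + have -> : (\int[mu]_x (F x * w x)%:E = (I `^ r^-1)%:E)%E.
      transitivity (\int[mu]_x ((I `^ s^-1)^-1%:E * (h x)%:E))%E.
        apply: eq_integral => x _; rewrite -EFinM; congr EFin; rewrite /w /h.
        by rewrite -(mulr_powRB1 (F0 x) r0); ring.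
      rewrite ge0_integralZl//.
      * rewrite IE -EFinM; congr EFin.
        have -> : r^-1 = 1 - s^-1 by rewrite -rs addrK.
        rewrite powRD; last by rewrite (gt_eqF Ip) implybT.
        by rewrite powRr1 ?ltW// powRN mulrC.
      * exact/measurable_EFinP.
      * by move=> x _; rewrite lee_fin.
      * by rewrite lee_fin invr_ge0 ltW.
    rewrite lee_fin -[leLHS]powRr1// -(@mulfV _ r) ?lt0r_neq0// powRrM.
    by apply: powR_le; rewrite ?invr_ge0 ?powR_ge0 ?ltW.
- rewrite Npy// in tF.
  pose A := [set x | t < F x].
  have mA : measurable A.
    have := mF measurableT _ (measurable_itv `]t, +oo[); rewrite setTI.
    by congr measurable; apply/seteqP; split=> x /=; rewrite in_itv/= andbT.
  have mIA : measurable_fun setT (\1_A : E -> R) by exact: measurable_indic.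
  have A0 : (0%:E < \int[mu]_x (\1_A x)%:E)%E.
    rewrite (@integral_indic _ _ _ mu _ measurableT _ mA) setIT lt0e measure_ge0 andbT.
    apply/eqP => mA0; move: tF; rewrite ltNge => /negP; apply; apply/ess_supP.
    exists A; split=> // x /= /negP; rewrite lee_fin -ltNge; exact.
  have IA0 (x : E) : 0 <= (\1_A x : R) by rewrite indicE ler0n.
  have [k tk] := integral_trunc mF mIA IA0 A0.
  pose h (x : E) : R := \1_A x * \1_(trunc_set F k) x.
  have {}tk : (0%:E < \int[mu]_x (h x)%:E)%E := tk.
  have h0 x : 0 <= h x by rewrite mulr_ge0.
  have mh : measurable_fun setT h by exact: measurable_funM.
  have hc x : h x <= 1 by rewrite /h !indicE; case: (_ \in _); case: (_ \in _); rewrite ?mulr1 ?mulr0.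
  have hk x : h x != 0 -> F x <= k%:R /\ enorm x < k%:R.
    by move=> hx; apply: Isupp; apply: contraNneq hx => e; rewrite /h e mulr0.
  have hy := integral_ball_lty mh h0 hc (fun x hx => (hk x hx).2).
  have Ifin : (\int[mu]_x (h x)%:E)%E \is a fin_num.
    by rewrite ge0_fin_numE// integral_ge0// => x _; rewrite lee_fin.
  set I := fine (\int[mu]_x (h x)%:E)%E.
  have IE : (\int[mu]_x (h x)%:E)%E = I%:E by rewrite fineK.
  have Ip : 0 < I by rewrite -lte_fin -IE.
  have mhE : measurable_fun setT (fun x => (h x)%:E) by exact/measurable_EFinP.
  have h0E x : setT x -> (0 <= (h x)%:E)%E by rewrite lee_fin.
  have cE (c : R) : 0 <= c -> (\int[mu]_x (c * h x)%:E = (c * I)%:E)%E.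
    move=> c0; under eq_integral do rewrite EFinM.
    by rewrite (ge0_integralZl mu measurableT mhE h0E) ?IE// lee_fin.
  exists (fun x => I^-1 * h x), I^-1, k; split.
  + exact: measurable_funM.
  + move=> x; rewrite mulr_ge0 ?invr_ge0 ?(ltW Ip)//=.
    by rewrite ler_piMr// invr_ge0 ltW.
  + by move=> x; rewrite mulf_eq0 negb_or => /andP[_]; exact: hk.
  + rewrite hoelder_conjugatey Np1; last by move=> x; rewrite mulr_ge0// invr_ge0 ltW.
    by rewrite cE ?invr_ge0 ?(ltW Ip)// mulVf// lt0r_neq0.
  + have -> : t%:E = (\int[mu]_x (t / I * h x)%:E)%E.
      by rewrite cE ?divr_ge0 ?(ltW Ip)// divfK// lt0r_neq0.
    apply: ge0_le_integral => //.
    * by move=> x _; rewrite lee_fin mulr_ge0// divr_ge0// ltW.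
    * by apply/measurable_EFinP; exact: measurable_funM.
    * by apply/measurable_EFinP; apply: measurable_funM => //; exact: measurable_funM.
    move=> x _; rewrite lee_fin -mulrA.
    have [->|hx] := eqVneq (h x) 0; first by rewrite !mulr0.
    rewrite ler_wpM2r ?mulr_ge0 ?invr_ge0 ?(ltW Ip)// ltW//.
    by move: hx; rewrite /h indicE; case: (boolP (x \in A)); [rewrite inE|rewrite mul0r eqxx].
Qed.

End Lp_real.

Section Lp_complex.
Local Open Scope classical_set_scope.
Local Open Scope ring_scope.
Local Open Scope complex_scope.
Context {R : realType} {n : nat}.
Local Notation E := ('rV[R]_n).
Local Notation C := (R[i]).
Local Notation mu := (@lebesgue_rV R n).
Local Notation conj := (@hoelder_conjugate R).
Implicit Types (f g w a b c : E -> C) (p : \bar R) (r t : R) (T U : @distrib R n).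

Definition Lp p f : \bar R := Np p (fun x => normc (f x)).

Lemma Lp_ge0 p f : (0 <= Lp p f)%E. Proof. exact: Np_ge0. Qed.

Lemma Lp_ae_le p f g : (1 <= p)%E -> cmfun f -> cmfun g ->
  {ae mu, forall x, normc (f x) <= normc (g x)} -> (Lp p f <= Lp p g)%E.
Proof. by move=> p1 mf mg fg; apply: le_Np => //; exact: measurable_normc. Qed.

Lemma Lp_le p f g : (1 <= p)%E -> cmfun f -> cmfun g ->
  (forall x, normc (f x) <= normc (g x)) -> (Lp p f <= Lp p g)%E.
Proof. by move=> p1 mf mg fg; apply: Lp_ae_le => //; exact: aeW. Qed.

Lemma Lp_ae_eq p f g : (1 <= p)%E -> cmfun f -> cmfun g ->
  {ae mu, forall x, f x = g x} -> Lp p f = Lp p g.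
Proof.
move=> p1 mf mg fg; apply/eqP; rewrite eq_le !Lp_ae_le//.
  by apply: filterS fg => x ->.
by apply: filterS fg => x ->.
Qed.

Lemma Lp_hoelder p f g : (1 <= p)%E -> cmfun f -> cmfun g ->
  (\int[mu]_x (normc (f x * g x))%:E <= Lp p f * Lp (conj p) g)%E.
Proof.
move=> p1 mf mg; under eq_integral do rewrite normcM.
by apply: Np_hoelder => //; exact: measurable_normc.
Qed.

Lemma Lp_zero p : (1 <= p)%E -> Lp p (fun=> 0) = 0%E.
Proof.
move=> p1; rewrite /Lp /Np (_ : (fun x => _) = cst 0%E).
  by apply: Lnorm0; apply/eqP => p0; move: p1; rewrite p0 lee_fin ler10.
by apply/funext => x; rewrite normc0.
Qed.

Lemma Lp_triangle p f g : (1 <= p)%E -> cmfun f -> cmfun g ->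
  (Lp p (fun x => f x + g x)%R <= Lp p f + Lp p g)%E.
Proof.
move=> p1 mf mg.
have mF := measurable_normc mf; have mG := measurable_normc mg.
apply: (@le_trans _ _ (Np p ((fun x => normc (f x)) \+ (fun x => normc (g x))))).
  apply: le_Np => //.
  - by apply: measurable_normc; exact: cmfunD.
  - exact: measurable_funD.
  - by move=> x; rewrite addr_ge0.
  - by apply: aeW => x; exact: normcD.
exact: (@eminkowski _ _ _ mu _ _ p mF mG p1).
Qed.

Lemma Lp_sum p (I : Type) (s : seq I) (F : I -> E -> C) : (1 <= p)%E ->
  (forall i, cmfun (F i)) ->
  (Lp p (fun x => \sum_(i <- s) F i x)%R <= \sum_(i <- s) Lp p (F i))%E.
Proof.
move=> p1 mF; elim: s => [|i s ih].
  rewrite big_nil (_ : (fun x => _) = (fun=> 0)) ?Lp_zero//.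
  by apply/funext => x; rewrite big_nil.
rewrite big_cons (_ : (fun x => _) = (fun x => F i x + \sum_(j <- s) F j x)).
  apply: le_trans (Lp_triangle p1 (mF i) (cmfun_sum s mF)) _.
  by rewrite leeD2l.
by apply/funext => x; rewrite big_cons.
Qed.

Lemma LpZ p (z : C) f : (1 <= p)%E -> cmfun f ->
  Lp p (fun x => z * f x) = ((normc z)%:E * Lp p f)%E.
Proof.
move=> p1 mf; have zf0 x : 0 <= normc (z * f x) by [].
have mF := measurable_normc mf.
have z0 := normc_ge0 z.
have [->|[r -> r1]|->] := one_le_cases p1.
- rewrite /Lp !Np1//; under eq_integral do rewrite normcM EFinM.
  by rewrite ge0_integralZl//; exact/measurable_EFinP.
- have r0 := lt_trans ltr01 r1.
  rewrite /Lp !NpE//.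
  under eq_integral do rewrite normcM powRM// EFinM.
  rewrite ge0_integralZl//; last 3 first.
  + by apply/measurable_EFinP; exact: measurable_powRF.
  + by move=> x _; rewrite lee_fin powR_ge0.
  + by rewrite lee_fin powR_ge0.
  rewrite poweRM ?lee_fin ?powR_ge0//; last first.
    by apply: integral_ge0 => x _; rewrite lee_fin powR_ge0.
  by rewrite poweR_EFin -powRrM mulfV ?lt0r_neq0// powRr1.
- rewrite /Lp !Npy// -(ess_supZl _ (mu_gt0))//; congr (ess_sup mu _).
  by apply/funext => x; rewrite normcM EFinM.
Qed.

Lemma Np_comp p (F : E -> R) (h : E -> E) : (1 <= p)%E -> measurable_fun setT F ->
  (forall x, 0 <= F x) -> measurable_fun setT h ->
  (forall G : E -> \bar R, measurable_fun setT G -> (forall x, (0 <= G x)%E) ->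
    (\int[mu]_x G (h x) = \int[mu]_x G x)%E) ->
  Np p (fun x => F (h x)) = Np p F.
Proof.
move=> p1 mF F0 mh hG.
have powI r : (\int[mu]_x (F (h x) `^ r)%:E = \int[mu]_x (F x `^ r)%:E)%E.
  apply: (hG (fun x => (F x `^ r)%:E)).
    by apply/measurable_EFinP; exact: measurable_powRF.
  by move=> x; rewrite lee_fin powR_ge0.
have [->|[r -> r1]|->] := one_le_cases p1.
- by rewrite !NpE// powI.
- by rewrite !NpE// powI.
- rewrite !Npy// !ess_supEmu0; last 2 first.
  + exact/measurable_EFinP.
  + by apply/measurable_EFinP; exact: (measurableT_comp mF mh).
  congr ereal_inf; apply/seteqP; suff H y : mu ((fun x => (F (h x))%:E) @^-1` `]y, +oo[) =
      mu ((fun x => (F x)%:E) @^-1` `]y, +oo[).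
    by split=> y /=; rewrite H.
  have mA : measurable ((fun x => (F x)%:E) @^-1` `]y, +oo[).
    rewrite -[X in measurable X]setTI; apply: (_ : measurable_fun setT (fun x => (F x)%:E)) => //.
      exact/measurable_EFinP.
    exact: emeasurable_itv.
  set A := (X in measurable X) in mA.
  have mB : measurable (h @^-1` A) by rewrite -[X in measurable X]setTI; exact: mh.
  have eA : (\int[mu]_x (\1_A x)%:E = mu A)%E.
    by rewrite (@integral_indic _ _ _ mu _ measurableT _ mA) setIT.
  have eB : (\int[mu]_x (\1_(h @^-1` A) x)%:E = mu (h @^-1` A))%E.
    by rewrite (@integral_indic _ _ _ mu _ measurableT _ mB) setIT.
  rewrite -[RHS]eA -[LHS]eB -(hG (fun x => (\1_A x)%:E)).
  + by apply: eq_integral => x _; rewrite !indicE.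
  + by apply/measurable_EFinP; exact: measurable_indic.
  + by move=> x; rewrite lee_fin indicE ler0n.
Qed.

Lemma Lp_translate p f (y : E) : (1 <= p)%E -> cmfun f -> Lp p (fun x => f (x - y)) = Lp p f.
Proof.
move=> p1 mf; apply: (@Np_comp p (fun x => normc (f x)) (fun x => x - y)) => //.
- exact: measurable_normc.
- exact: measurable_addrV.
- by move=> G mG G0; exact: ge0_integral_translate.
Qed.

(* Multiplying the extremal weight by the conjugate phase of f turns it into an
   integral of f itself. *)
Lemma Lp_converse p f t : (1 <= p)%E -> cmfun f -> 0 <= t -> (t%:E < Lp p f)%E ->
  exists w : E -> C, exists M : R, exists k : nat,
    [/\ cmfun w, forall x, normc (w x) <= M, forall x, w x != 0 -> enorm x < k%:R,
        (Lp (conj p) w <= 1)%E &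
        exists2 s : R, t <= s & cint mu (fun x => f x * w x) = s%:C].
Proof.
move=> p1 mf t0 tf.
have p1' := hoelder_conj_ge1 p1.
have mF := measurable_normc mf.
have [om [M [k [mo oM ok on ot]]]] := Np_converse p1 mF (fun x => normc_ge0 _) t0 tf.
have o0 x : 0 <= om x by have /andP[] := oM x.
pose w x : C := (f x)^*%C * ((normc (f x)) `^ (-1))%:C * (om x)%:C.
have mw : cmfun w.
  apply: cmfunM; last exact: cmfunR.
  by apply: cmfunM; [exact: cmfun_conj|apply: cmfunR; exact: measurable_powRF].
have nw x : normc (w x) <= om x.
  rewrite /w !normcM normc_conj !normcR (ger0_norm (o0 x)) ger0_norm ?powR_ge0//.
  rewrite powR_inv1// ler_piMl//; have [->|f0] := eqVneq (normc (f x)) 0; first by rewrite mul0r.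
  by rewrite divff.
have fw x : f x * w x = (normc (f x) * om x)%:C.
  rewrite /w powR_inv1// mulrA mulrA mulc_conj -!rmorphM; congr (_ * _)%:C.
  have [->|f0] := eqVneq (normc (f x)) 0; first by rewrite expr0n mul0r.
  by rewrite expr2 -mulrA divff// mulr1.
exists w, M, k; split=> //.
- by move=> x; apply: le_trans (nw x) _; have /andP[] := oM x.
- move=> x wx; apply: (ok x _).2; apply: contraNneq wx => e; by rewrite /w e mulr0.
- apply: le_trans on; apply: le_Np => //; first exact: measurable_normc.
  exact: aeW.
- exists (\int[mu]_x (normc (f x) * om x)); last first.
    by rewrite -cintR; apply: eq_cint => x; rewrite fw.
  rewrite -lee_fin /Rintegral fineK//.
  rewrite ge0_fin_numE; last by apply: integral_ge0 => x _; rewrite lee_fin mulr_ge0.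
  apply: (@integral_ball_lty R n _ (k%:R * M) k).
  + exact: measurable_funM.
  + by move=> x; rewrite mulr_ge0.
  + move=> x; have [->|ox] := eqVneq (om x) 0.
      by rewrite mulr0 mulr_ge0// (le_trans (o0 x))//; have /andP[] := oM x.
    have [fk _] := ok x ox; have /andP[_ oxM] := oM x.
    by apply: ler_pM.
  + by move=> x; rewrite mulf_eq0 negb_or => /andP[_ ox]; exact: (ok x ox).2.
Qed.

(** Young's inequality by duality. A violation would give, by [Np_converse], a weight of conjugate
    norm at most 1 against which [c] integrates to too large a number; Tonelli and Hoelder's
    inequality on the translates of [a] bound that integral. *)
Lemma young p a b c : (1 <= p)%E -> cmfun a -> cmfun b -> cmfun c ->
  (forall x, (normc (c x))%:E <= \int[mu]_y (normc (a (x - y)) * normc (b y))%:E)%E ->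
  (Lp p c <= Lp p a * \int[mu]_y (normc (b y))%:E)%E.
Proof.
move=> p1 ma mb mc cab.
have I0 : (0 <= \int[mu]_y (normc (b y))%:E)%E by apply: integral_ge0 => y _; rewrite lee_fin.
have B0 : (0 <= Lp p a * \int[mu]_y (normc (b y))%:E)%E by rewrite mule_ge0// Lp_ge0.
rewrite leNgt; apply/negP => lt.
have Bf : (Lp p a * \int[mu]_y (normc (b y))%:E)%E \is a fin_num.
  by rewrite ge0_fin_numE// (lt_le_trans lt)// leey.
rewrite -(fineK Bf) in lt.
have [t Bt tc] := ereal_mid lt.
have t0 : 0 <= t by rewrite (le_trans _ (ltW Bt))// fine_ge0.
have [om [M [k [mo oM _ on ot]]]] := Np_converse p1 (measurable_normc mc) (fun x => normc_ge0 _) t0 tc.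
have o0 x : 0 <= om x by have /andP[] := oM x.
pose F (z : E * E) := (normc (a (z.1 - z.2)) * normc (b z.2) * om z.1)%:E.
have mF : measurable_fun setT F.
  apply/measurable_EFinP; apply: measurable_funM; last exact: (measurableT_comp mo measurable_fst).
  apply: measurable_funM; first exact: measurable_normc (cmfun_sub2 ma).
  exact: (measurableT_comp (measurable_normc mb) measurable_snd).
have F0 z : (0 <= F z)%E by rewrite lee_fin !mulr_ge0.
have mFx x := measurableT_comp mF (measurable_pair1 x : measurable_fun setT (fun y : E => (x, y))).
have : (t%:E <= Lp p a * \int[mu]_y (normc (b y))%:E)%E.
  apply: le_trans ot _.
  apply: (@le_trans _ _ (\int[mu]_x \int[mu]_y F (x, y))%E).
    apply: ge0_le_integral => //.
    - by move=> x _; rewrite lee_fin mulr_ge0.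
    - by apply/measurable_EFinP; apply: measurable_funM => //; exact: measurable_normc.
    - exact: (@measurable_fun_fubini_tonelli_F _ _ _ _ _ mu F).
    move=> x _; rewrite EFinM muleC.
    apply: (@le_trans _ _ ((om x)%:E * \int[mu]_y (normc (a (x - y)) * normc (b y))%:E)%E).
      by rewrite lee_wpmul2l// lee_fin.
    rewrite -ge0_integralZl//.
    - by rewrite le_eqVlt; apply/orP; left; apply/eqP; apply: eq_integral => y _; rewrite -EFinM mulrC.
    - apply/measurable_EFinP; apply: measurable_funM; apply: measurable_normc => //.
      exact: cmfun_subl.
    - by move=> y _; rewrite lee_fin mulr_ge0.
    - by rewrite lee_fin.
  rewrite (@fubini_tonelli _ _ _ _ _ mu mu F mF F0).
  have mbE : measurable_fun setT (fun y => (normc (b y))%:E) by exact: measurable_EFin_normc.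
  have b0E y : setT y -> (0 <= (normc (b y))%:E)%E by move=> _; rewrite lee_fin.
  rewrite -(ge0_integralZl mu measurableT mbE b0E (Lp_ge0 p a)).
  apply: ge0_le_integral => //.
  - by move=> y _; apply: integral_ge0.
  - exact: (@measurable_fun_fubini_tonelli_G _ _ _ _ _ mu F).
  - exact: measurable_funeM.
  move=> y _; rewrite muleC.
  have may : cmfun (fun x : E => a (x - y)).
    exact: (cmfun_comp ma (measurable_addrV (- y))).
  have H := Np_hoelder p1 (measurable_normc may) mo (fun x => normc_ge0 _) o0.
  rewrite (eq_integral (fun x : E => (normc (b y))%:E * (normc (a (x - y)) * om x)%:E)%E); last first.
    by move=> x _; rewrite /F /= -EFinM; congr EFin; ring.
  rewrite ge0_integralZl//.
  - rewrite lee_wpmul2l// ?lee_fin//; apply: le_trans H _.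
    rewrite (_ : Np p (fun x : E => normc (a (x - y))) = Lp p a); last exact: Lp_translate.
    by rewrite -[leRHS]mule1 lee_wpmul2l ?Lp_ge0.
  - by apply/measurable_EFinP; apply: measurable_funM => //; exact: measurable_normc.
  - by move=> x _; rewrite lee_fin mulr_ge0.
by rewrite -(fineK Bf) lee_fin leNgt Bt.
Qed.

Lemma Lp_convol1 p K w : (1 <= p)%E -> schwartz K -> wint w ->
  (Lp p (convol K w) <= Lp p w * (wnorm 0 K)%:E)%E.
Proof.
move=> p1 SK ww; have mw : cmfun w by case: ww.
have [Sc _] := schwartz_convol SK ww.
have IK : (wnorm 0 K)%:E = (\int[mu]_y (normc (K y))%:E)%E.
  by rewrite -(wnormE 0 (schwartz_wint SK)); apply: eq_integral => y _; rewrite expr0 mul1r.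
rewrite IK; apply: young => //; [exact: schwartz_cmfun|exact: schwartz_cmfun|].
move=> x; rewrite convolC//.
have ci : cintable mu (fun y => w (x - y) * K y).
  have := cintable_reflect x (convol_cintable x SK ww).
  by under eq_fun do rewrite subKr mulrC.
apply: le_trans (le_normc_cint ci) _; rewrite le_eqVlt; apply/orP; left; apply/eqP.
by apply: eq_integral => y _; rewrite normcM.
Qed.

Lemma Lp_convol2 p K w : (1 <= p)%E -> schwartz K -> wint w ->
  (Lp p (convol K w) <= Lp p K * (wnorm 0 w)%:E)%E.
Proof.
move=> p1 SK ww; have mw : cmfun w by case: ww.
have [Sc _] := schwartz_convol SK ww.
have IK : (wnorm 0 w)%:E = (\int[mu]_y (normc (w y))%:E)%E.
  by rewrite -(wnormE 0 ww); apply: eq_integral => y _; rewrite expr0 mul1r.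
rewrite IK; apply: young => //; [exact: schwartz_cmfun|exact: schwartz_cmfun|].
move=> x; apply: le_trans (le_normc_cint (convol_cintable x SK ww)) _.
rewrite le_eqVlt; apply/orP; left; apply/eqP.
by apply: eq_integral => y _; rewrite normcM.
Qed.

(** The weight to the power [-2n] is integrable and at most 1, hence lies in every Lebesgue space,
    and it dominates [v] up to a seminorm. *)
Lemma Lp_schwartz p : (1 <= p)%E -> exists2 A : R, 0 <= A &
  forall v, schwartz v -> (Lp p v <= (A * snorm (2 * n) v)%:E)%E.
Proof.
move=> p1; pose W (x : E) : C := (wt x ^- (2 * n))%:C.
have mW : cmfun W by apply: cmfunR; exact: measurable_wtXV.
have W0 (x : E) : 0 < wt x ^- (2 * n) by exact: wtXV_gt0.
have nW x : normc (W x) = wt x ^- (2 * n) by rewrite normcR gtr0_norm.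
have W1 (x : E) : wt x ^- (2 * n) <= 1 by rewrite invf_le1 ?wtX_gt0// wtX_ge1.
have Wy : (Lp p W < +oo)%E.
  have I1 : (\int[mu]_x (normc (W x))%:E < +oo)%E.
    by under eq_integral do rewrite nW; exact: integral_wt_lty.
  have [->|[r -> r1]|->] := one_le_cases p1.
  - by rewrite /Lp Np1.
  - rewrite /Lp NpE//; apply: poweR_lty; apply: le_lt_trans I1.
    apply: ge0_le_integral => //.
    + by move=> x _; rewrite lee_fin powR_ge0.
    + by apply/measurable_EFinP; apply: measurable_powRF; exact: measurable_normc.
    + exact: measurable_EFin_normc.
    move=> x _; rewrite lee_fin nW -[leRHS](powRr1 (ltW (W0 x))).
    by apply: ger_powR; rewrite ?W0 ?W1// ltW.
  - rewrite /Lp Npy//; apply: le_lt_trans (ltry 1); apply/ess_supP; apply: aeW => x.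
    by rewrite nW lee_fin.
have Wf : Lp p W \is a fin_num by rewrite ge0_fin_numE// Lp_ge0.
exists (fine (Lp p W)); first by rewrite fine_ge0// Lp_ge0.
move=> v Sv; rewrite EFinM fineK// muleC.
apply: (@le_trans _ _ (Lp p (fun x => (snorm (2 * n) v)%:C * W x))).
  apply: Lp_le => //; first exact: schwartz_cmfun.
    by apply: cmfunM => //; exact: cmfun_cst.
  move=> x; rewrite normcM nW normcR ger0_norm ?snorm_ge0//.
  exact: (@le_snormV _ _ (2 * n) v [::] x Sv).
by rewrite LpZ// normcR ger0_norm// snorm_ge0.
Qed.

(** Dominated convergence for the power [p] of the modulus. For [p = +oo] its place is taken by
    vanishing at infinity ([space_tail_0]). *)
Lemma Lp_tail p f : (1 <= p)%E -> p != +oo%E -> cmfun f -> (Lp p f < +oo)%E ->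
  forall e, 0 < e -> exists k : nat,
    (Lp p (fun x => (\1_[set y : E | (k%:R <= enorm y)%R] x : R)%:C * f x)%R < (e : R)%:E)%E.
Proof.
move=> p1 py mf fy e e0.
have mT (k : nat) : measurable [set y : E | k%:R <= enorm y].
  have := @measurable_enorm R n measurableT _ (measurable_itv `[k%:R : R, +oo[); rewrite setTI.
  by congr measurable; apply/seteqP; split=> x /=; rewrite in_itv/= andbT.
have [r pr r1] : exists2 r, p = r%:E & 1 <= r.
  by case: p p1 py {fy} => [r| |] // r1 _; exists r.
have r0 := lt_le_trans ltr01 r1.
rewrite pr in fy *.
have mr : measurable_fun setT (fun x => normc (f x) `^ r).
  by apply: measurable_powRF; exact: measurable_normc.
have fI : (\int[mu]_x (normc (f x) `^ r)%:E < +oo)%E.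
  move: fy; rewrite /Lp NpE// => h; apply: lty_poweRy h.
  by rewrite invr_eq0 lt0r_neq0.
have cv := @cint_dominated R _ _ mu
  (fun k x => (\1_[set y : E | k%:R <= enorm y] x * (normc (f x) `^ r))%:C) (fun=> 0)
  (fun x => normc (f x) `^ r).
have e0r : 0 < e `^ r by rewrite powR_gt0.
have : (fun k : nat => normc (cint mu (fun x : E => (\1_[set y : E | k%:R <= enorm y] x * (normc (f x) `^ r))%:C) - cint mu (fun=> 0))) @ \oo --> (0 : R).
  apply: cv => //.
  - by move=> k; apply: cmfunR; apply: measurable_funM => //; exact: measurable_indic.
  - move=> x; have [k xk] := norm_lt_nat x.
    apply: cvg_near_cst; near=> l.
    rewrite indicE memNset ?mul0r ?subrr ?normc0//= => h.
    have : (k <= l)%N by near: l; exact: nbhs_infty_ge.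
    by rewrite -(ler_nat R) => kl; have := le_lt_trans (le_trans kl h) xk; rewrite ltxx.
  - move=> k x; rewrite normcR indicE; case: (_ \in _); rewrite ?mul1r ?mul0r ?normr0 ?powR_ge0//.
    by rewrite ger0_norm// powR_ge0.
  - by move=> x; rewrite normc0 powR_ge0.
move=> /cvgr0Pnorm_lt /(_ _ e0r) [k _ /(_ k (leqnn k))]; rewrite cint0 subr0 cintR normcR normr_id => h.
exists k; rewrite /Lp NpE//.
have E1 : (\int[mu]_x (normc ((\1_[set y : E | (k%:R <= enorm y)%R] x)%:C * f x)%R `^ r)%:E =
    (\int[mu]_x (\1_[set y | k%:R <= enorm y] x * (normc (f x) `^ r)))%:E)%E.
  rewrite /Rintegral fineK.
    apply: eq_integral => x _; rewrite normcM normcR indicE; case: (_ \in _).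
      by rewrite normr1 !mul1r.
    by rewrite normr0 !mul0r powR0// lt0r_neq0.
  rewrite ge0_fin_numE; last by apply: integral_ge0 => x _; rewrite lee_fin mulr_ge0 ?powR_ge0// indicE.
  apply: le_lt_trans fI; apply: ge0_le_integral => //.
  - by move=> x _; rewrite lee_fin mulr_ge0 ?powR_ge0// indicE.
  - by apply/measurable_EFinP; apply: measurable_funM => //; exact: measurable_indic.
  - exact/measurable_EFinP.
  - by move=> x _; rewrite lee_fin indicE; case: (_ \in _); rewrite ?mul1r ?mul0r ?powR_ge0.
rewrite E1 poweR_EFin lte_fin.
have I0 : 0 <= \int[mu]_x (\1_[set y | k%:R <= enorm y] x * (normc (f x) `^ r)).
  by apply: Rintegral_ge0 => x _; rewrite mulr_ge0 ?powR_ge0// indicE.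
rewrite ger0_norm// in h.
have -> : e = (e `^ r) `^ r^-1 by rewrite -powRrM mulfV ?lt0r_neq0// powRr1// ltW.
apply: gt0_ltr_powR => //; rewrite ?invr_gt0 ?nnegrE ?powR_ge0//.
Unshelve. all: by end_near. Qed.

End Lp_complex.

Section repr.
Local Open Scope classical_set_scope.
Local Open Scope ring_scope.
Local Open Scope complex_scope.
Context {R : realType} {n : nat}.
Local Notation E := ('rV[R]_n).
Local Notation C := (R[i]).
Local Notation mu := (@lebesgue_rV R n).
Variable phi : E -> R.
Hypothesis cphi : cutoff phi.
Implicit Types (f g : E -> C) (p : \bar R) (T U : @distrib R n).

Lemma Lp_norm_repr p T f : (1 <= p)%E -> represents f T -> Lp_norm p T = Lp p f.
Proof.
move=> p1 fT; rewrite /Lp_norm (_ : [set _ | _ in _] = [set Lp p f]) ?ereal_inf1//.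
apply/seteqP; split=> [_ [g gT <-]|_ ->]; last by exists f.
have /cmeasurableE mf := fT.1; have /cmeasurableE mg := gT.1.
exact: (Lp_ae_eq p1 mg mf (represents_unique cphi gT fT)).
Qed.

Lemma cint_ae f g : cmfun f -> cmfun g -> {ae mu, forall x, f x = g x} ->
  cintable mu f -> cintable mu g /\ cint mu g = cint mu f.
Proof.
move=> mf mg fg [_ fy]; split.
  split=> //; rewrite -(ge0_ae_eq_integral (f := fun x => (normc (f x))%:E))//.
  - exact: measurable_EFin_normc.
  - exact: measurable_EFin_normc.
  - by apply: filterS fg => x -> _.
rewrite /cint; congr (_ +i* _); rewrite /Rintegral; congr fine.
  apply: ae_eq_integral => //.
  - by apply/measurable_EFinP; case: mg.
  - by apply/measurable_EFinP; case: mf.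
  - by apply: filterS fg => x -> _.
apply: ae_eq_integral => //.
- by apply/measurable_EFinP; case: mg.
- by apply/measurable_EFinP; case: mf.
- by apply: filterS fg => x -> _.
Qed.

Lemma density_ae T f : represents f T ->
  cmfun (density T) /\ {ae mu, forall x, f x = density T x}.
Proof.
move=> fT; have dT : represents (density T) T.
  by have := @xgetPex _ (fun=> 0) [set f | represents f T]; apply; exists f.
split; first by have /cmeasurableE := dT.1.
have := represents_unique cphi fT dT.
by apply: filterS => x ->.
Qed.

Lemma pairing_repr T U f g : represents f T -> represents g U ->
  cintable mu (fun x => f x * g x) ->
  paired T U /\ pairing T U = cint mu (fun x => f x * g x).
Proof.
move=> fT gU fg; have [mT aT] := density_ae fT; have [mU aU] := density_ae gU.
have [||i e] := @cint_ae (fun x => f x * g x) (density T \* density U) fg.1 _ _ fg.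
- exact: cmfunM.
- by apply: filterS2 aT aU => x -> ->.
by split; [exact/cintegrableE|].
Qed.

End repr.

(** * Sequences indexed by the integers *)

Section exhaustion.
Local Open Scope classical_set_scope.
Local Open Scope ring_scope.
Local Open Scope complex_scope.
Context {R : realType} {I : choiceType}.
Variables (D : set I) (F : nat -> seq I) (rk : I -> nat).
Hypotheses (uF : forall N, uniq (F N))
  (memF : forall N i, (i \in F N) <-> (D i /\ (rk i <= N)%N)).

Lemma sum_le_esum (b : I -> \bar R) N : (forall i, D i -> (0 <= b i)%E) ->
  (\sum_(i <- F N) b i <= \esum_(i in D) b i)%E.
Proof.
move=> b0; rewrite fsbig_seq//; apply: ereal_sup_ubound; exists [set` F N] => //.
by split=> [|i /=]; [exact: finite_seq|move=> /memF[]].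
Qed.

Lemma lt_esum_sum (b : I -> \bar R) t : (forall i, D i -> (0 <= b i)%E) ->
  (t < \esum_(i in D) b i)%E -> exists N, forall M, (N <= M)%N -> (t < \sum_(i <- F M) b i)%E.
Proof.
move=> b0 /ereal_sup_gt[_ [X [fX XD] <-] tX].
have /finite_seqP[s Xs] := fX.
exists (\max_(i <- s) rk i)%N => M NM; apply: lt_le_trans tX _.
rewrite [leRHS]fsbig_seq//; apply: lee_fsum_nneg_subset => //.
- move=> i; rewrite !inE => Xi; apply/memF; split; first exact: XD.
  apply: leq_trans NM; apply: (@leq_bigmax_seq _ s xpredT rk i) => //.
  by move: Xi; rewrite Xs.
- by move=> i; rewrite !inE => /andP[_]; rewrite inE => /memF[Di _]; exact: b0.
Qed.

Lemma esum_le_sum (b : I -> \bar R) M : (forall i, D i -> (0 <= b i)%E) ->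
  (forall N, (\sum_(i <- F N) b i <= M)%E) -> (\esum_(i in D) b i <= M)%E.
Proof.
move=> b0 H; rewrite leNgt; apply/negP => /(lt_esum_sum b0)[N /(_ N (leqnn N))].
by rewrite ltNge H.
Qed.

Let cvg_part (b : I -> R) : (forall i, 0 <= b i) -> (\esum_(i in D) (b i)%:E < +oo)%E ->
  \sum_(i <- F N) b i @[N --> \oo] --> fine (\esum_(i in D) (b i)%:E)%E.
Proof.
move=> b0 by_.
have b0E i : D i -> (0 <= (b i)%:E)%E by rewrite lee_fin.
have fin : (\esum_(i in D) (b i)%:E)%E \is a fin_num.
  by rewrite ge0_fin_numE//; exact: esum_ge0.
apply/cvgrPdist_lt => e e0; set S := fine _.
have SE : (\esum_(i in D) (b i)%:E)%E = S%:E by rewrite fineK.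
have : ((S - e)%:E < \esum_(i in D) (b i)%:E)%E by rewrite SE lte_fin; lra.
move=> /(lt_esum_sum b0E)[N NS]; exists N => // M /= NM.
have h1 := NS M NM; have h2 := sum_le_esum M b0E.
rewrite SE in h2; move: h1 h2; rewrite sumEFin lte_fin lee_fin => h1 h2.
by rewrite ger0_norm; lra.
Qed.

(** The four nonnegative families in the definition of [csum] converge separately along the lists
    [F]. The lists are kept abstract because both the integers ([zs]) and the near-diagonal pairs
    ([nd]) are needed. *)
Lemma csum_cvg (a : I -> R[i]) : csummable D a ->
  normc (\sum_(i <- F N) a i - csum D a) @[N --> \oo] --> (0 : R).
Proof.
move=> sa.
have part (g : I -> R) : (forall i, `|g i| <= normc (a i)) ->
    \sum_(i <- F N) g i @[N --> \oo] --> rsum D g.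
  move=> ga.
  have mE (x : R) : maxe x%:E 0%E = (Num.max x 0)%:E by rewrite EFin_max.
  have lt (h : I -> R) : (forall i, 0 <= h i) -> (forall i, h i <= normc (a i)) ->
      \sum_(i <- F N) h i @[N --> \oo] --> fine (\esum_(i in D) (h i)%:E)%E.
    move=> h0 ha; apply: cvg_part => //; apply: le_lt_trans sa.
    by apply: le_esum => i _; rewrite lee_fin.
  have p1 := lt (fun i => Num.max (g i) 0) _ _.
  have p2 := lt (fun i => Num.max (- g i) 0) _ _.
  rewrite (_ : (fun N => _) = (fun N => \sum_(i <- F N) Num.max (g i) 0 -
      \sum_(i <- F N) Num.max (- g i) 0)); last first.
    apply/funext => N; rewrite -sumrB; apply: eq_bigr => i _.
    by case: (leP (g i) 0) => h; [rewrite max_l ?oppr_ge0//; lra|rewrite max_r; lra].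
  rewrite /rsum; apply: cvgB.
    rewrite (eq_esum (b := fun i => (Num.max (g i) 0)%:E)); last by move=> i _; rewrite mE.
    apply: p1 => i; first by rewrite le_max lexx orbT.
    by rewrite ge_max normc_ge0 andbT (le_trans (ler_norm _)).
  rewrite (eq_esum (b := fun i => (Num.max (- g i) 0)%:E)); last by move=> i _; rewrite mE.
  apply: p2 => i; first by rewrite le_max lexx orbT.
  by rewrite ge_max normc_ge0 andbT (le_trans (ler_norm _))// normrN.
have cR := part (fun i => Re (a i)) (fun i => le_Re_normc _).
have cI := part (fun i => Im (a i)) (fun i => le_Im_normc _).
apply: (squeeze_cvgr (f := fun=> 0) (h := fun N =>
  `|\sum_(i <- F N) Re (a i) - rsum D (fun i => Re (a i))| +
  `|\sum_(i <- F N) Im (a i) - rsum D (fun i => Im (a i))|)).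
- apply: nearW => N; rewrite normc_ge0/= (le_trans (normc_le_ReIm _))//.
  by rewrite ReD ImD ReN ImN Re_sum Im_sum.
- exact: cvg_cst.
- rewrite -[X in _ --> X](addr0 0); apply: cvgD; rewrite -[X in _ --> X](normr0 R).
    by apply: cvg_norm; rewrite -[X in _ --> X](subrr (rsum D (fun i => Re (a i)))); apply: cvgB => //; exact: cvg_cst.
  by apply: cvg_norm; rewrite -[X in _ --> X](subrr (rsum D (fun i => Im (a i)))); apply: cvgB => //; exact: cvg_cst.
Qed.

Lemma csum_unique (a : I -> R[i]) (z : R[i]) : csummable D a ->
  normc (\sum_(i <- F N) a i - z) @[N --> \oo] --> (0 : R) -> csum D a = z.
Proof. by move=> sa; exact: normc_cvg_unique (csum_cvg sa). Qed.

Lemma csum_lin (z : R[i]) (a b : I -> R[i]) : csummable D a -> csummable D b ->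
  csummable D (fun i => z * a i + b i) /\
  csum D (fun i => z * a i + b i) = z * csum D a + csum D b.
Proof.
move=> sa sb.
have esumZ (c : R) : 0 <= c -> (\esum_(i in D) (c * normc (a i))%:E < +oo)%E.
  move=> c0; apply: (@le_lt_trans _ _ (c%:E * \esum_(i in D) (normc (a i))%:E)%E).
    apply: esum_le_sum => [i _|N]; first by rewrite lee_fin mulr_ge0.
    rewrite (eq_bigr (fun i => c%:E * (normc (a i))%:E)%E); last by move=> i _; rewrite EFinM.
    rewrite -ge0_sume_distrr; last by move=> i _; rewrite lee_fin.
    by rewrite lee_wpmul2l ?lee_fin//; apply: sum_le_esum => i _; rewrite lee_fin.
  by rewrite lte_mul_pinfty// lee_fin.
have sab : csummable D (fun i => z * a i + b i).
  rewrite /csummable; apply: (@le_lt_trans _ _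
      (\esum_(i in D) ((normc z * normc (a i))%:E + (normc (b i))%:E)%E)).
    by apply: le_esum => i _; rewrite -EFinD lee_fin (le_trans (normcD _ _))// normcM.
  rewrite esumD; [|by move=> i _; rewrite lee_fin mulr_ge0|by move=> i _; rewrite lee_fin].
  by rewrite lte_add_pinfty// esumZ.
split=> //; apply: csum_unique => //.
have ca := csum_cvg sa; have cb := csum_cvg sb.
apply: (squeeze_cvgr (f := fun=> 0) (h := fun N => normc z * normc (\sum_(i <- F N) a i - csum D a) +
   normc (\sum_(i <- F N) b i - csum D b))).
- apply: nearW => N; rewrite normc_ge0/= -normcM.
  rewrite (_ : _ - _ = z * (\sum_(i <- F N) a i - csum D a) + (\sum_(i <- F N) b i - csum D b)).
    exact: normcD.
  by rewrite big_split/= -mulr_sumr; ring.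
- exact: cvg_cst.
- rewrite -[X in _ --> X](addr0 0); apply: cvgD => //.
  by rewrite -[X in _ --> X](mulr0 (normc z)); exact: cvgMr.
Qed.

Lemma le_normc_csum (a : I -> R[i]) (M : R) : csummable D a ->
  (forall N, \sum_(i <- F N) normc (a i) <= M) -> normc (csum D a) <= M.
Proof.
move=> sa aM; apply/ler_addgt0Pr => e e0.
have /cvgr0Pnorm_lt /(_ e e0) [N _ /(_ N (leqnn N))] := csum_cvg sa.
rewrite ger0_norm// => h.
rewrite (_ : csum D a = \sum_(i <- F N) a i - (\sum_(i <- F N) a i - csum D a)); last by ring.
rewrite (le_trans (normcB _ _))// lerD ?(ltW h)//.
exact: le_trans (normc_sum _ _ _) (aM N).
Qed.

End exhaustion.

Section int_sequences.
Local Open Scope classical_set_scope.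
Local Open Scope ring_scope.
Context {R : realType}.
Local Notation conj := (@hoelder_conjugate R).
Implicit Types (q : \bar R) (a b : int -> \bar R) (j d : int).

Definition zs (N : nat) : seq int := [seq Posz i - Posz N | i <- iota 0 (2 * N).+1].

Lemma zs_uniq N : uniq (zs N).
Proof. by rewrite map_inj_uniq ?iota_uniq// => i j /addIr []. Qed.

Lemma mem_zs N j : (j \in zs N) = (`|j| <= N)%N.
Proof.
apply/mapP/idP => [|jN].
  by case=> i; rewrite mem_iota add0n => /andP[_ iN] ->; lia.
by exists (absz (j + Posz N)); [rewrite mem_iota; lia|lia].
Qed.

Let mem_zsT N j : (j \in zs N) <-> ([set: int] j /\ (absz j <= N)%N).
Proof. by rewrite mem_zs; split=> [|[]]. Qed.

Lemma sum_zs_le a N : (forall j, (0 <= a j)%E) -> (\sum_(j <- zs N) a j <= \esum_(j in setT) a j)%E.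
Proof. by move=> a0; apply: (sum_le_esum zs_uniq mem_zsT). Qed.

Lemma lt_sum_zs a t : (forall j, (0 <= a j)%E) -> (t < \esum_(j in setT) a j)%E ->
  exists N, (t < \sum_(j <- zs N) a j)%E.
Proof.
move=> a0 /(lt_esum_sum zs_uniq mem_zsT (fun j _ => a0 j))[N H]; exists N; exact: H.
Qed.

Lemma lq_ge0 q a : (1 <= q)%E -> (forall j, (0 <= a j)%E) -> (0 <= lq_norm q a)%E.
Proof.
move=> /one_le_cases[->|[r -> _]|->] a0; rewrite /lq_norm ?poweR_ge0//.
by apply: (le_trans (a0 0)); apply: ereal_sup_ubound; exists 0.
Qed.

Lemma lq_le q a b : (1 <= q)%E -> (forall j, (0 <= a j)%E) -> (forall j, (a j <= b j)%E) ->
  (lq_norm q a <= lq_norm q b)%E.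
Proof.
move=> q1 a0 ab.
have H r : 1 <= r -> ((\esum_(j in setT) (a j `^ r)) `^ r^-1 <= (\esum_(j in setT) (b j `^ r)) `^ r^-1)%E.
  move=> r1; have r0 : 0 <= r by lra.
  apply: poweR_le; rewrite ?invr_ge0//; first by apply: esum_ge0 => j _; exact: poweR_ge0.
  by apply: le_esum => j _; exact: poweR_le.
case/one_le_cases: q1 => [->|[r -> r1]|->]; rewrite /lq_norm; [exact: H|exact/H/ltW|].
apply: ge_ereal_sup => _ [j _ <-]; apply: le_trans (ab j) _.
by apply: ereal_sup_ubound; exists j.
Qed.

Lemma le_lq q a j : (1 <= q)%E -> (forall j, (0 <= a j)%E) -> (a j <= lq_norm q a)%E.
Proof.
move=> q1 a0.
have H r : 1 <= r -> (a j <= (\esum_(j in setT) (a j `^ r)) `^ r^-1)%E.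
  move=> r1; have r0 : 0 < r by lra.
  rewrite -[leLHS]poweRe1// -(mulfV (lt0r_neq0 r0)) poweRrM.
  apply: poweR_le; rewrite ?poweR_ge0 ?invr_ge0 ?(ltW r0)//.
  rewrite (esumID [set j])//; last by move=> i _; exact: poweR_ge0.
  rewrite setTI esum_set1 ?poweR_ge0// leeDl// esum_ge0// => i _; exact: poweR_ge0.
case/one_le_cases: q1 => [->|[r -> r1]|->]; rewrite /lq_norm; [exact: H|exact/H/ltW|].
by apply: ereal_sup_ubound; exists j.
Qed.

Lemma lq_shift q a d : lq_norm q (fun j => a (j + d)) = lq_norm q a.
Proof.
case: q => [r| |] //=.
- congr (_ `^ _)%E; apply/esym; apply: (@reindex_esum _ _ _ setT setT (fun j => j + d)).
  split=> //; first by move=> j k _ _ /addIr.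
  by move=> j _; exists (j - d); rewrite ?subrK.
- congr ereal_sup; apply/seteqP; split=> [_ [j _ <-]|_ [j _ <-]]; first by exists (j + d).
  by exists (j - d); rewrite ?subrK.
Qed.

Lemma esumZl (c : R) a : 0 <= c -> (forall j, (0 <= a j)%E) ->
  (\esum_(j in setT) (c%:E * a j) <= c%:E * \esum_(j in setT) a j)%E.
Proof.
move=> c0 a0; apply: (esum_le_sum zs_uniq mem_zsT) => [j _|N].
  by rewrite mule_ge0// lee_fin.
by rewrite -ge0_sume_distrr// lee_wpmul2l ?lee_fin// sum_zs_le.
Qed.

Lemma lq_scale q (c : R) a : (1 <= q)%E -> 0 <= c -> (forall j, (0 <= a j)%E) ->
  (lq_norm q (fun j => c%:E * a j) <= c%:E * lq_norm q a)%E.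
Proof.
move=> q1 c0 a0.
have H r : 1 <= r -> ((\esum_(j in setT) ((c%:E * a j) `^ r)) `^ r^-1 <=
    c%:E * (\esum_(j in setT) (a j `^ r)) `^ r^-1)%E.
  move=> r1; have r0 : 0 < r by lra.
  have e0 : (0 <= \esum_(j in setT) (a j `^ r))%E by apply: esum_ge0 => j _; exact: poweR_ge0.
  apply: (@le_trans _ _ (((c `^ r)%:E * \esum_(j in setT) (a j `^ r)) `^ r^-1)%E).
    apply: poweR_le; rewrite ?invr_ge0 ?(ltW r0)//.
      by apply: esum_ge0 => j _; exact: poweR_ge0.
    rewrite (eq_esum (b := fun j => ((c `^ r)%:E * a j `^ r)%E)).
      by apply: esumZl; [exact: powR_ge0|move=> j; exact: poweR_ge0].
    by move=> j _; rewrite poweRM ?lee_fin// poweR_EFin.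
  rewrite poweRM ?lee_fin ?powR_ge0// poweR_EFin -powRrM mulfV ?lt0r_neq0// powRr1//.
case/one_le_cases: q1 => [->|[r -> r1]|->]; rewrite /lq_norm; [exact: H|exact/H/ltW|].
apply: ge_ereal_sup => _ [j _ <-]; rewrite lee_wpmul2l ?lee_fin//.
by apply: ereal_sup_ubound; exists j.
Qed.

(** A crude triangle inequality suffices. Bounding a sum by twice the maximum gives the factor [2^r]
    for the power [r], and adding the two series another factor 2, at most [2^r]; together [4^r]. *)
Lemma lq_add q a b (M : \bar R) : (1 <= q)%E -> (forall j, (0 <= a j)%E) ->
  (forall j, (0 <= b j)%E) -> (lq_norm q a <= M)%E -> (lq_norm q b <= M)%E ->
  (lq_norm q (fun j => a j + b j) <= 4%:E * M)%E.
Proof.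
move=> q1 a0 b0 aM bM.
have M0 : (0 <= M)%E := le_trans (lq_ge0 q1 a0) aM.
have H r : 1 <= r -> ((\esum_(j in setT) (a j `^ r)) `^ r^-1 <= M)%E ->
    ((\esum_(j in setT) (b j `^ r)) `^ r^-1 <= M)%E ->
    ((\esum_(j in setT) ((a j + b j) `^ r)) `^ r^-1 <= 4%:E * M)%E.
  move=> r1 Ha Hb; have r0 : 0 < r by lra.
  have P x : (0 <= x)%E -> (x `^ r^-1 <= M)%E -> (x <= M `^ r)%E.
    move=> x0 /(poweR_le (ltW r0) (poweR_ge0 _ _)); rewrite -poweRrM mulVf ?lt0r_neq0//.
    by rewrite poweRe1.
  have ea : (0 <= \esum_(j in setT) (a j `^ r))%E by apply: esum_ge0 => j _; exact: poweR_ge0.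
  have eb : (0 <= \esum_(j in setT) (b j `^ r))%E by apply: esum_ge0 => j _; exact: poweR_ge0.
  have h1 := P _ ea Ha; have h2 := P _ eb Hb.
  have t0 : (0 <= 2%:E `^ r :> \bar R)%E by exact: poweR_ge0.
  apply: (@le_trans _ _ ((4%:E * M) `^ r `^ r^-1)%E); last first.
    by rewrite -poweRrM mulfV ?lt0r_neq0// poweRe1// mule_ge0// lee_fin.
  apply: poweR_le; rewrite ?invr_ge0 ?(ltW r0)//.
    by apply: esum_ge0 => j _; exact: poweR_ge0.
  apply: (@le_trans _ _ (\esum_(j in setT) ((2 `^ r)%:E * (a j `^ r + b j `^ r))%E)).
    apply: le_esum => j _.
    apply: (@le_trans _ _ ((2%:E * maxe (a j) (b j)) `^ r)%E).
      apply: poweR_le; rewrite ?(ltW r0) ?adde_ge0//.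
      rewrite (_ : 2 = 1 + 1 :> R)// EFinD ge0_muleDl ?lee_fin// mul1e.
      by rewrite leeD// le_max lexx ?orbT.
    rewrite poweRM ?lee_fin ?le_max ?a0// poweR_EFin lee_wpmul2l ?lee_fin ?powR_ge0//.
    by case: (leP (a j) (b j)) => _; [rewrite leeDr// poweR_ge0|rewrite leeDl// poweR_ge0].
  apply: le_trans (esumZl (powR_ge0 _ _) _) _.
    by move=> j; rewrite adde_ge0// poweR_ge0.
  rewrite esumD; [|by move=> j _; exact: poweR_ge0|by move=> j _; exact: poweR_ge0].
  rewrite poweRM ?lee_fin// poweR_EFin.
  have -> : (4 : R) `^ r = 2 `^ r * 2 `^ r by rewrite -powRM//; congr (_ `^ _); lra.
  rewrite EFinM -muleA lee_wpmul2l ?lee_fin ?powR_ge0//.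
  apply: le_trans (leeD h1 h2) _.
  rewrite -[X in (X + X)%E]mul1e -ge0_muleDl ?lee_fin// -EFinD lee_wpmul2r ?poweR_ge0//.
  by rewrite lee_fin -[leLHS]powRr1//; apply: ler_powR => //; lra.
case/one_le_cases: q1 aM bM => [->|[r -> r1]|->]; rewrite /lq_norm => aM bM.
- exact: H.
- by apply: H => //; exact: ltW.
- apply: ge_ereal_sup => _ [j _ <-].
  have h1 : (a j <= M)%E by apply: le_trans aM; apply: ereal_sup_ubound; exists j.
  have h2 : (b j <= M)%E by apply: le_trans bM; apply: ereal_sup_ubound; exists j.
  apply: le_trans (leeD h1 h2) _.
  by rewrite -[X in (X + X)%E]mul1e -ge0_muleDl ?lee_fin// -EFinD lee_wpmul2r// lee_fin; lra.
Qed.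

Lemma lq_sum q (I : Type) (s : seq I) (a : I -> int -> \bar R) (M : \bar R) : (1 <= q)%E ->
  (0 <= M)%E -> (forall i j, (0 <= a i j)%E) -> (forall i, (lq_norm q (a i) <= M)%E) ->
  (lq_norm q (fun j => \sum_(i <- s) a i j) <= (4 ^+ size s)%:E * M)%E.
Proof.
move=> q1 M0 a0 aM; elim: s => [|i s ih].
  rewrite mul1e; apply: le_trans M0; rewrite (_ : (fun j => _) = (fun=> 0%E)).
    have := @lq_scale q 0 (fun=> 0%E) q1 (lexx 0) (fun j => lexx 0%E).
    by under eq_fun do rewrite mule0; rewrite mul0e.
  by apply/funext => j; rewrite big_nil.
rewrite (_ : (fun j => _) = (fun j => a i j + \sum_(k <- s) a k j)%E); last first.
  by apply/funext => j; rewrite big_cons.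
rewrite [size _]/= exprS EFinM -muleA; apply: lq_add => //.
- by move=> j; apply: sume_ge0.
- apply: le_trans (aM i) _; rewrite -[leLHS]mul1e lee_wpmul2r// lee_fin.
  by rewrite exprn_ege1//; lra.
Qed.

(** Once zero and infinite norms are set aside, both sequences are divided by their norms and the
    convexity inequality [x y <= x^r / r + y^s / s] is summed. *)
Lemma lq_hoelder q a b N : (1 <= q)%E -> (forall j, (0 <= a j)%E) -> (forall j, (0 <= b j)%E) ->
  (\sum_(j <- zs N) a j * b j <= lq_norm q a * lq_norm (conj q) b)%E.
Proof.
move=> q1 a0 b0; have q1' := hoelder_conj_ge1 q1.
have H1y (x y : int -> \bar R) : (forall j, (0 <= x j)%E) -> (forall j, (0 <= y j)%E) ->
    (\sum_(j <- zs N) x j * y j <= lq_norm 1 x * lq_norm +oo y)%E.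
  move=> x0 y0; have y1 : (0 <= lq_norm +oo y)%E by apply: lq_ge0; rewrite ?leey.
  apply: (@le_trans _ _ (\sum_(j <- zs N) x j * lq_norm +oo y)%E).
    by apply: lee_sum => j _; rewrite lee_wpmul2l//; apply: le_lq; rewrite ?leey.
  rewrite -ge0_sume_distrl// lee_wpmul2r//.
  rewrite /lq_norm invr1 poweRe1; last by apply: esum_ge0 => j _; exact: poweR_ge0.
  rewrite (eq_esum (b := x)); last by move=> j _; rewrite poweRe1.
  exact: sum_zs_le.
have A0 := lq_ge0 q1 a0; have B0 := lq_ge0 q1' b0.
case/one_le_cases: q1 q1' A0 B0 => [->|[r -> r1]|->] q1' A0 B0.
- by rewrite hoelder_conjugate1; exact: H1y.
- have [s [se s1 rs _]] := conj_real r1; rewrite se in q1' B0 *.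
  have r0 := lt_trans ltr01 r1; have s0 := lt_trans ltr01 s1.
  have q1 : (1 <= r%:E)%E by rewrite lee_fin ltW.
  set A := lq_norm r%:E a in A0 *; set B := lq_norm s%:E b in B0 *.
  have aA j : (a j <= A)%E by exact: le_lq.
  have bB j : (b j <= B)%E by exact: le_lq.
  have [A00|A1] := eqVneq A 0%E.
    rewrite A00 mul0e big1// => j _.
    by have := aA j; rewrite A00 => h; rewrite (_ : a j = 0%E) ?mul0e//; apply/eqP; rewrite eq_le h a0.
  have [B00|B1] := eqVneq B 0%E.
    rewrite B00 mule0 big1// => j _.
    by have := bB j; rewrite B00 => h; rewrite (_ : b j = 0%E) ?mule0//; apply/eqP; rewrite eq_le h b0.
  have Ap : (0 < A)%E by rewrite lt0e A1.
  have Bp : (0 < B)%E by rewrite lt0e B1.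
  have [Ay|Ay] := eqVneq A +oo%E; first by rewrite Ay gt0_mulye ?leey.
  have [By|By] := eqVneq B +oo%E; first by rewrite By gt0_muley ?leey.
  have Af : A \is a fin_num by rewrite ge0_fin_numE// ltey.
  have Bf : B \is a fin_num by rewrite ge0_fin_numE// ltey.
  have afin j : a j \is a fin_num by rewrite ge0_fin_numE// (le_lt_trans (aA j))// ltey.
  have bfin j : b j \is a fin_num by rewrite ge0_fin_numE// (le_lt_trans (bB j))// ltey.
  set A' := fine A; set B' := fine B.
  have A'p : 0 < A' by rewrite fine_gt0// Ap ltey.
  have B'p : 0 < B' by rewrite fine_gt0// Bp ltey.
  pose x j := fine (a j) / A'; pose y j := fine (b j) / B'.
  have x0 j : 0 <= x j by rewrite divr_ge0 ?fine_ge0// ltW.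
  have y0 j : 0 <= y j by rewrite divr_ge0 ?fine_ge0// ltW.
  have S1 (t : R) (c : int -> \bar R) (X : R) : 0 < t -> 0 < X -> (forall j, (0 <= c j)%E) ->
      (forall j, c j \is a fin_num) -> ((\esum_(j in setT) (c j `^ t)) `^ t^-1 = X%:E)%E ->
      \sum_(j <- zs N) (fine (c j) / X) `^ t <= 1.
    move=> t0 X0 c0 cf cX.
    have e0 : (0 <= \esum_(j in setT) (c j `^ t))%E by apply: esum_ge0 => j _; exact: poweR_ge0.
    have : (\esum_(j in setT) (c j `^ t) = (X `^ t)%:E)%E.
      by rewrite -poweR_EFin -cX -poweRrM mulVf ?lt0r_neq0// poweRe1.
    move=> eX; have := @sum_zs_le (fun j => c j `^ t)%E N (fun j => poweR_ge0 _ _).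
    rewrite eX; under eq_bigr => j _ do rewrite -(fineK (cf j)) poweR_EFin.
    rewrite sumEFin lee_fin => h.
    rewrite (eq_bigr (fun j => (X `^ t)^-1 * fine (c j) `^ t)); last first.
      move=> j _; rewrite powRM ?fine_ge0 ?invr_ge0 ?(ltW X0)// mulrC; congr (_ * _).
      by rewrite -powR_inv1 ?(ltW X0)// -powRrM mulN1r powRN.
    by rewrite -mulr_sumr mulrC ler_pdivrMr ?powR_gt0// mul1r.
  have hx : \sum_(j <- zs N) x j `^ r <= 1 by apply: S1 => //; rewrite fineK.
  have hy : \sum_(j <- zs N) y j `^ s <= 1 by apply: S1 => //; rewrite fineK.
  rewrite -(fineK Af) -(fineK Bf) -EFinM.
  under eq_bigr => j _ do rewrite -(fineK (afin j)) -(fineK (bfin j)) -EFinM.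
  rewrite sumEFin lee_fin.
  rewrite (eq_bigr (fun j => (A' * B') * (x j * y j))); last first.
    by move=> j _; rewrite /x /y; field; rewrite !lt0r_neq0.
  rewrite -mulr_sumr ler_piMr ?mulr_ge0 ?(ltW A'p) ?(ltW B'p)//.
  apply: (@le_trans _ _ (\sum_(j <- zs N) (x j `^ r / r + y j `^ s / s))).
    by apply: ler_sum => j _; exact: conjugate_powR.
  rewrite big_split /= -!mulr_suml -rs lerD// ler_piMl// invr_ge0 ltW//.
- rewrite hoelder_conjugatey muleC.
  under eq_bigr do rewrite muleC.
  exact: H1y.
Qed.

End int_sequences.

Section lq_converse.
Local Open Scope classical_set_scope.
Local Open Scope ring_scope.
Context {R : realType}.
Local Notation conj := (@hoelder_conjugate R).
Implicit Types (q : \bar R) (a b : int -> \bar R) (j d : int).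

Lemma lq_real_le1 q (al : int -> R) N : (1 <= q)%E -> (forall j, 0 <= al j) ->
  (forall j, j \notin zs N -> al j = 0) -> (forall j, q = +oo%E -> al j <= 1) ->
  (forall r, q = r%:E -> \sum_(j <- zs N) al j `^ r <= 1) ->
  (lq_norm q (fun j => (al j)%:E) <= 1)%E.
Proof.
move=> q1 a0 aN ay ar.
have H r : q = r%:E -> 1 <= r -> ((\esum_(j in setT) ((al j)%:E `^ r)) `^ r^-1 <= 1)%E.
  move=> qr r1; have r0 : 0 < r := lt_le_trans ltr01 r1.
  rewrite -(poweR1r r^-1); apply: poweR_le; rewrite ?invr_ge0 ?(ltW r0)//.
    by apply: esum_ge0 => j _; exact: poweR_ge0.
  rewrite (_ : \esum_(j in setT) ((al j)%:E `^ r) = \esum_(j in [set` zs N]) ((al j)%:E `^ r))%E.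
    rewrite esum_fset//; [|exact: finite_seq|by move=> j _; exact: poweR_ge0].
    rewrite -fsbig_seq ?zs_uniq//.
    by under eq_bigr do rewrite poweR_EFin; rewrite sumEFin lee_fin; exact: ar.
  rewrite [RHS]esum_mkcond; apply: eq_esum => j _; case: ifPn => //.
  by rewrite notin_setE => jN; rewrite poweR_EFin (aN j) ?powR0// ?lt0r_neq0//; apply/negP.
case/one_le_cases: (q1) => [e|[r e r1]|e].
- by rewrite e /lq_norm; apply: H.
- by rewrite e /lq_norm; apply: H => //; exact: ltW.
- rewrite e /lq_norm; apply: ge_ereal_sup => _ [j _ <-]; rewrite lee_fin; exact: ay.
Qed.

(** [al] is a finitely supported near-extremal sequence of conjugate norm at most 1. The nonzero
    [rho j] lie strictly below [a j], which leaves the room that [Lp_converse] asks for in each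
    block and also covers infinite terms. If one term exceeds [t], that index alone does; otherwise
    all terms are finite. *)
Lemma lq_converse q a t : (1 <= q)%E -> (forall j, (0 <= a j)%E) -> 0 <= t ->
  (t%:E < lq_norm q a)%E -> exists N, exists al : int -> R, exists rho : int -> R,
  [/\ forall j, 0 <= al j /\ 0 <= rho j, forall j, j \notin zs N -> al j = 0,
      forall j, rho j = 0 \/ ((rho j)%:E < a j)%E,
      (lq_norm (conj q) (fun j => (al j)%:E) <= 1)%E &
      t < \sum_(j <- zs N) al j * rho j].
Proof.
move=> q1 a0 t0 ta; have q1' := hoelder_conj_ge1 q1.
have [[j0 tj]|nt] := pselect (exists j, (t%:E < a j)%E).
  have [t' tt' t'a] := ereal_mid tj.
  have sumd (f : R -> R) N : (absz j0 <= N)%N -> f 0 = 0 ->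
      \sum_(j <- zs N) f (j == j0)%:R = f 1.
    move=> jN f0; rewrite (bigD1_seq j0) ?zs_uniq ?mem_zs//= eqxx big1 ?addr0//.
    by move=> j /negPf ->.
  exists (absz j0), (fun j => (j == j0)%:R), (fun j => (j == j0)%:R * t'); split.
  - by move=> j; rewrite ler0n mulr_ge0 ?ler0n// (le_trans t0)// ltW.
  - by move=> j; rewrite mem_zs; case: eqVneq => // ->; rewrite leqnn.
  - by move=> j; case: eqVneq => [->|_]; rewrite ?mul1r ?mul0r; [right|left].
  - apply: (@lq_real_le1 _ _ (absz j0)) => //.
    + by move=> j; rewrite mem_zs; case: eqVneq => // ->; rewrite leqnn.
    + by move=> j _; case: (j == j0).
    + move=> r e; rewrite (sumd (fun x => x `^ r))// ?powR1//.
      by rewrite powR0//; move: q1'; rewrite e lee_fin => h; exact: lt0r_neq0 (lt_le_trans ltr01 h).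
  - by rewrite (sumd (fun x => x * (x * t')))// ?mul0r// !mul1r.
have at_ j : (a j <= t%:E)%E by rewrite leNgt; apply/negP => h; apply: nt; exists j.
have afin j : a j \is a fin_num by rewrite ge0_fin_numE// (le_lt_trans (at_ j))// ltry.
pose A j := fine (a j).
have aE j : a j = (A j)%:E by rewrite fineK.
have A0 j : 0 <= A j by rewrite fine_ge0.
have main r : q = r%:E -> 1 <= r -> exists N, exists sg : R, [/\ 0 < sg, t < sg &
    \sum_(j <- zs N) A j `^ r = sg `^ r].
  move=> qr r1; have r0 := lt_le_trans ltr01 r1.
  rewrite qr /lq_norm in ta.
  have h : ((t `^ r)%:E < \esum_(j in setT) (a j `^ r))%E.
    rewrite ltNge; apply/negP => h; move: ta; rewrite ltNge => /negP; apply.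
    have e0 : (0 <= \esum_(j in setT) (a j `^ r))%E by apply: esum_ge0 => j _; exact: poweR_ge0.
    have ri : 0 <= r^-1 by rewrite invr_ge0 ltW.
    by have := poweR_le ri e0 h; rewrite poweR_EFin -powRrM mulfV ?lt0r_neq0// powRr1.
  have [N] := lt_sum_zs (fun j => poweR_ge0 _ _) h.
  under eq_bigr do rewrite aE poweR_EFin; rewrite sumEFin lte_fin => tN.
  set S := \sum_(j <- zs N) _ in tN *.
  have S0 : 0 < S by exact: le_lt_trans (powR_ge0 _ _) tN.
  exists N, (S `^ r^-1); split; first exact: powR_gt0.
    rewrite -[ltLHS]powRr1// -(mulfV (lt0r_neq0 r0)) powRrM.
    by apply: gt0_ltr_powR; rewrite ?invr_gt0 ?nnegrE ?powR_ge0 ?ltW.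
  by rewrite -powRrM mulVf ?lt0r_neq0// powRr1// ltW.
have fin r N (sg : R) : q = r%:E -> 1 <= r -> 0 < sg -> t < sg ->
    \sum_(j <- zs N) A j `^ r = sg `^ r ->
    (lq_norm (conj q) (fun j => (if j \in zs N then A j `^ (r - 1) / sg `^ (r - 1) else 0)%:E) <= 1)%E ->
    exists N, exists al : int -> R, exists rho : int -> R,
  [/\ forall j, 0 <= al j /\ 0 <= rho j, forall j, j \notin zs N -> al j = 0,
      forall j, rho j = 0 \/ ((rho j)%:E < a j)%E,
      (lq_norm (conj q) (fun j => (al j)%:E) <= 1)%E &
      t < \sum_(j <- zs N) al j * rho j].
  move=> qr r1 sg0 tsg SE lq1; have r0 := lt_le_trans ltr01 r1.
  (* A factor below 1, which keeps [rho] strictly under [a], chosen so that the sum becomes the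
     midpoint of [t] and [sg]. *)
  pose la := (t + sg) / (2 * sg).
  have la0 : 0 < la by rewrite divr_gt0 ?mulr_gt0// ltr_wpDl.
  have la1 : la < 1 by rewrite ltr_pdivrMr ?mulr_gt0// mul1r mulr_natl mulr2n ltrD2r.
  exists N, (fun j => if j \in zs N then A j `^ (r - 1) / sg `^ (r - 1) else 0), (fun j => la * A j); split.
  - move=> j; rewrite mulr_ge0 ?(ltW la0)//; split=> //.
    by case: ifP => // _; rewrite divr_ge0 ?powR_ge0.
  - by move=> j /negPf ->.
  - move=> j; have [->|Aj] := eqVneq (A j) 0; first by left; rewrite mulr0.
    right; have Aj0 : 0 < A j by rewrite lt_neqAle eq_sym Aj A0.
    by rewrite aE lte_fin -[ltRHS]mul1r ltr_pM2r.
  - exact: lq1.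
  - rewrite big_seq (eq_bigr (fun j => (la / sg `^ (r - 1)) * A j `^ r)); last first.
      by move=> j jN; rewrite jN -(mulr_powRB1 (A0 j) r0); ring.
    rewrite -big_seq -mulr_sumr SE -(mulr_powRB1 (ltW sg0) r0).
    have ps : sg `^ (r - 1) != 0 by rewrite lt0r_neq0// powR_gt0.
    have -> : la / sg `^ (r - 1) * (sg * sg `^ (r - 1)) = (t + sg) / 2.
      by rewrite /la; move: ps (lt0r_neq0 sg0) => ps sg1; field; rewrite ps sg1.
    by rewrite ltr_pdivlMr// mulr_natr mulr2n ltrD2l.
case/one_le_cases: (q1) => [e|[r e r1]|e].
- have [N [sg [sg0 tsg SE]]] := main 1 e (lexx _).
  apply: (fin 1 N sg) => //; rewrite e hoelder_conjugate1 /lq_norm.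
  apply: ge_ereal_sup => _ [j _ <-]; rewrite lee_fin subrr !powRr0 divr1.
  by case: ifP.
- have [N [sg [sg0 tsg SE]]] := main r e (ltW r1).
  apply: (fin r N sg) => //; first exact: ltW.
  have [s [se s1 rs rs1]] := conj_real r1.
  have ps : 0 < sg `^ (r - 1) by rewrite powR_gt0.
  apply: (@lq_real_le1 _ _ N) => //.
  + by move=> j; case: ifP => // _; rewrite divr_ge0 ?powR_ge0.
  + by move=> j /negPf ->.
  + by rewrite e se.
  + move=> s'; rewrite e se => -[<-].
    rewrite big_seq (eq_bigr (fun j => (sg `^ r)^-1 * A j `^ r)); last first.
      move=> j jN; rewrite jN /= powRM ?invr_ge0 ?powR_ge0// -powRrM rs1 mulrC; congr (_ * _).
      rewrite -(powR_inv1 (ltW ps)) -!powRrM [X in sg `^ X](_ : _ = - r); last first.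
        by rewrite -[in RHS]rs1; ring.
      by rewrite powRN.
    by rewrite -big_seq -mulr_sumr SE mulVf// lt0r_neq0// powR_gt0.
- move: ta; rewrite e /lq_norm ltNge => /negP[]; apply: ge_ereal_sup => _ [j _ <-].
  exact: at_.
Qed.

End lq_converse.

(** * Scaling of the block kernels in Lebesgue norms *)

Section Lp_kernel.
Local Open Scope classical_set_scope.
Local Open Scope ring_scope.
Local Open Scope complex_scope.
Context {R : realType} {n : nat}.
Local Notation E := ('rV[R]_n).
Local Notation C := (R[i]).
Local Notation mu := (@lebesgue_rV R n).
Local Notation conj := (@hoelder_conjugate R).
Variable phi : E -> R.
Hypothesis cphi : cutoff phi.

(** The kernel of block [j] is [2^(jn)] times the kernel of block 0 at [2^j x], so its norm of
    exponent p' scales like [2^(jn(1 - 1/p'))], and [1 - 1/p' = 1/p]. *)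
Lemma Lp_kapj (p : \bar R) : (1 <= p)%E -> exists2 A : R, 0 <= A & forall j : int,
  (Lp (conj p) (kapj phi j) <= (A * 2 `^ (j%:~R * (n%:R * fine p^-1)))%:E)%E.
Proof.
move=> p1; have p1' := hoelder_conj_ge1 p1.
pose K0 := kapj phi 0.
have SK0 : schwartz K0 := schwartz_kapA cphi 0 (0 + 1).
have mK0 := measurable_normc (schwartz_cmfun SK0).
have [A A0 hA] := Lp_schwartz p1' (n := n).
exists (Num.max (A * snorm (2 * n) K0) (snorm 0 K0)); first by rewrite le_max snorm_ge0 orbT.
move=> j; pose c : R := 2 ^ (- j).
have c0 : 0 < c := exp2_gt0 R (- j).
pose b : R := c ^- n.
have b0 : 0 < b by rewrite invr_gt0 exprn_gt0.
have bE : b = 2 `^ (j%:~R * n%:R).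
  rewrite powRrM powR_mulrn ?powR_ge0// powR_intmul// /b /c -exprVn; congr (_ ^+ n).
  by rewrite /c -[2 ^ (- j)]invr_expz invrK.
have kE x : normc (kapj phi j x) = b * normc (K0 (c^-1 *: x)).
  rewrite /kapj /kapA.
  have -> : ann phi j (j + 1) = (fun xi => ann phi 0 (0 + 1) (c *: xi)).
    by rewrite -annE add0r addrC add0r.
  by rewrite kap_scale//; [rewrite normcM normcR gtr0_norm|exact: schwartz_ann].
have fin (x y : R) : 0 <= x -> x <= y -> 0 <= 2 `^ (j%:~R * (n%:R * fine p^-1)) ->
  x * 2 `^ (j%:~R * (n%:R * fine p^-1)) <= y * 2 `^ (j%:~R * (n%:R * fine p^-1)).
  by move=> x0 xy h; rewrite ler_wpM2r.
have main s : conj p = s%:E -> 1 <= s -> fine p^-1 = 1 - s^-1 ->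
    (Lp s%:E (kapj phi j) <= (A * snorm (2 * n) K0 * 2 `^ (j%:~R * (n%:R * fine p^-1)))%:E)%E.
  move=> ps s1 fp; have s0 := lt_le_trans ltr01 s1.
  rewrite /Lp NpE//.
  have mKs : measurable_fun setT (fun x => (normc (K0 x) `^ s)%:E).
    by apply/measurable_EFinP; exact: measurable_powRF.
  have Ks0 (x : E) : (0 <= (normc (K0 x) `^ s)%:E)%E by rewrite lee_fin powR_ge0.
  have mKs' : measurable_fun setT (fun x : E => (normc (K0 (c^-1 *: x)) `^ s)%:E).
    exact: (measurableT_comp mKs (measurable_scalerV c^-1)).
  have cV : 0 < c^-1 by rewrite invr_gt0.
  have -> : (\int[mu]_x (normc (kapj phi j x) `^ s)%:E =
      (b `^ s * b^-1)%:E * \int[mu]_x (normc (K0 x) `^ s)%:E)%E.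
    have H : (\int[mu]_x (normc (K0 (c^-1 *: x)) `^ s)%:E = b^-1%:E * \int[mu]_x (normc (K0 x) `^ s)%:E)%E.
      have := @ge0_integral_affine_rV R n c^-1 0 _ cV mKs Ks0.
      rewrite /b invrK exprVn invrK => <-.
      by apply: eq_integral => x _; rewrite addr0.
    rewrite EFinM -muleA -H.
    have bs : (0 <= (b `^ s)%:E)%E by rewrite lee_fin powR_ge0.
    rewrite -(ge0_integralZl mu measurableT mKs' (fun x _ => Ks0 (c^-1 *: x)) bs).
    by apply: eq_integral => x _; rewrite kE powRM ?(ltW b0)// EFinM.
  rewrite poweRM; last 2 first.
  - by rewrite lee_fin mulr_ge0 ?powR_ge0// invr_ge0 ltW.
  - by apply: integral_ge0 => x _; exact: Ks0.
  rewrite -NpE// poweR_EFin.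
  have -> : (b `^ s * b^-1) `^ s^-1 = 2 `^ (j%:~R * (n%:R * fine p^-1)).
    rewrite -(powR_inv1 (ltW b0)) -powRD; last by rewrite (gt_eqF b0) implybT.
    rewrite -powRrM mulrA [RHS]powRrM -bE; congr (b `^ _).
    by rewrite fp mulrBl mulfV ?lt0r_neq0// mul1r.
  rewrite [X in (_ <= X%:E)%E]mulrC EFinM; apply: lee_wpmul2l; first by rewrite lee_fin powR_ge0.
  by rewrite -ps; exact: hA.
have pw : 0 <= 2 `^ (j%:~R * (n%:R * fine p^-1)) :> R by exact: powR_ge0.
case/one_le_cases: (p1) => [e|[r e r1]|e].
- rewrite e hoelder_conjugate1 /Lp Npy//; apply/ess_supP; apply: aeW => x.
  rewrite lee_fin; apply: (@le_trans _ _ (snorm 0 K0 * b)).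
    by rewrite kE mulrC ler_wpM2r ?(ltW b0)//; exact: schwartz_bound.
  rewrite bE inve1 /= mulr1 ler_wpM2r ?powR_ge0// le_max lexx orbT//.
- have [s [se s1 rs _]] := conj_real r1.
  rewrite e se; apply: le_trans (main s _ (ltW s1) _) _; first by rewrite e.
    by rewrite e inver gt_eqF ?(lt_trans ltr01 r1)//= -rs addrK.
  by rewrite lee_fin -e ler_wpM2r// le_max lexx.
- rewrite e hoelder_conjugatey; apply: le_trans (main 1 _ (lexx _) _) _; first by rewrite e.
    by rewrite e invey /= invr1 subrr.
  by rewrite lee_fin -e ler_wpM2r// le_max lexx.
Qed.

End Lp_kernel.

(** * Dyadic blocks and the pairing *)

Section blocks.
Local Open Scope classical_set_scope.
Local Open Scope ring_scope.
Local Open Scope complex_scope.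
Context {R : realType} {n : nat}.
Local Notation E := ('rV[R]_n).
Local Notation C := (R[i]).
Local Notation mu := (@lebesgue_rV R n).
Local Notation conj := (@hoelder_conjugate R).
Variable phi : E -> R.
Hypothesis cphi : cutoff phi.
Implicit Types (f g v w : E -> C) (p q : \bar R) (u T : @distrib R n) (s : R) (j k d : int).

(** For tempered [u], the continuous function that represents [Delta phi j u] ([Delta_repr]). *)
Definition blk j u : E -> C := ptconv u (kapj phi j).

Lemma schwartz_kapj j : schwartz (kapj phi j).
Proof. exact: schwartz_kapA. Qed.

Lemma blk_cmfun j u : tempered u -> cmfun (blk j u).
Proof. by move=> tu; exact: ptconv_cmfun tu (schwartz_kapj j). Qed.

Lemma blk_convol j u w : tempered u -> wint w ->
  u (convol (kapj phi j) w) = cint mu (fun y => blk j u y * w y).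
Proof. by move=> tu ww; exact: (tempered_convol tu (schwartz_kapj j) ww). Qed.

Lemma Delta_repr j u : tempered u -> represents (blk j u) (Delta phi j u).
Proof.
move=> tu; split; first exact/cmeasurableE/blk_cmfun.
move=> v Sv; split; first exact/cintegrableE/(ptconv_cintable tu (schwartz_kapj j) (schwartz_wint Sv)).
by rewrite DeltaE// blk_convol//; exact: schwartz_wint.
Qed.

Definition wgt s j : R := 2 `^ (j%:~R * s).

Lemma wgt_gt0 s j : 0 < wgt s j. Proof. exact: powR_gt0. Qed.
Lemma wgt_ge0 s j : 0 <= wgt s j. Proof. exact: powR_ge0. Qed.

Lemma wgtD s j k : wgt s (j + k) = wgt s j * wgt s k.
Proof. by rewrite /wgt intrD mulrDl powRD// pnatr_eq0 implybT. Qed.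

Lemma wgtN s j : wgt (- s) j * wgt s j = 1.
Proof. by rewrite /wgt -powRD ?pnatr_eq0 ?implybT// mulrN addNr powRr0. Qed.

Lemma wgt_shift s d (m : nat) : (absz d <= m)%N -> wgt s d <= 2 `^ (m%:R * `|s|).
Proof.
move=> dm; apply: ler_powR; first by rewrite ler1n.
apply: le_trans (ler_norm _) _; rewrite normrM ler_wpM2r// -intr_norm -abszE.
by rewrite -[leLHS]/(_%:R) ler_nat.
Qed.

Lemma coefE s p u j : (1 <= p)%E -> tempered u ->
  besov_coef phi s p u j = ((wgt s j)%:E * Lp p (blk j u))%E.
Proof. by move=> p1 tu; rewrite /besov_coef (Lp_norm_repr cphi p1 (Delta_repr j tu)). Qed.

Lemma coef_ge0 s p u j : (1 <= p)%E -> tempered u -> (0 <= besov_coef phi s p u j)%E.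
Proof. by move=> p1 tu; rewrite coefE// mule_ge0 ?Lp_ge0// lee_fin wgt_ge0. Qed.

Lemma norm_ge0 s p q u : (1 <= p)%E -> (1 <= q)%E -> tempered u ->
  (0 <= besov_norm phi s p q u)%E.
Proof. by move=> p1 q1 tu; apply: lq_ge0 => // j; exact: coef_ge0. Qed.

Lemma blk_lty s p q u j : (1 <= p)%E -> (1 <= q)%E -> tempered u ->
  (besov_norm phi s p q u < +oo)%E -> (Lp p (blk j u) < +oo)%E.
Proof.
move=> p1 q1 tu uy.
have := le_lt_trans (le_lq j q1 (fun j => coef_ge0 s j p1 tu)) uy.
rewrite coefE//; move: (Lp_ge0 p (blk j u)); case: (Lp p (blk j u)) => [r _ _||//]; first by rewrite ltry.
by rewrite gt0_muley ?lte_fin ?wgt_gt0.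
Qed.

Definition nd (N : nat) : seq (int * int) :=
  [seq (j, j + d) | j <- zs N, d <- [:: -1; 0; 1]].

Lemma nd_uniq N : uniq (nd N).
Proof.
apply: allpairs_uniq => //; first exact: zs_uniq.
by move=> [j d] [j' d'] _ _ /= [-> /addrI ->].
Qed.

Lemma mem_nd N (k : int * int) : (k \in nd N) <-> (near_diag k /\ (absz k.1 <= N)%N).
Proof.
rewrite /near_diag /=; split.
  move=> /allpairsP[[j d] /= [jN dd ->]] /=; rewrite -mem_zs; split=> //.
  by move: dd; rewrite !inE => /or3P[] /eqP ->; lia.
move=> [h kN]; apply/allpairsP; exists (k.1, k.2 - k.1); split=> /=.
- by rewrite mem_zs.
- by rewrite !inE; move: h; lia.
- by case: k h {kN} => a b /= _; rewrite addrC subrK.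
Qed.

Lemma sum_nd (V : nmodType) N (F : int * int -> V) :
  \sum_(k <- nd N) F k = \sum_(j <- zs N) \sum_(d <- [:: -1; 0; 1]) F (j, j + d).
Proof. by rewrite /nd big_allpairs_dep. Qed.

Section pairing_bound.
Variables (s : R) (p q : \bar R).
Hypotheses (p1 : (1 <= p)%E) (q1 : (1 <= q)%E).
Local Notation NB := (besov_norm phi s p q).
Local Notation NB' := (besov_norm phi (- s) (conj p) (conj q)).

Let p1' : (1 <= conj p)%E. Proof. exact: hoelder_conj_ge1. Qed.
Let q1' : (1 <= conj q)%E. Proof. exact: hoelder_conj_ge1. Qed.

Definition good u := tempered u /\ (NB u < +oo)%E.
Definition good' u := tempered u /\ (NB' u < +oo)%E.

(** Three near diagonals, on each of which the weights of the two blocks differ by at most one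
    dyadic step. *)
Definition pc : R := 3 * 2 `^ (1%:R * `|s|).

Lemma pc_ge0 : 0 <= pc. Proof. by rewrite mulr_ge0 ?powR_ge0. Qed.

Lemma big_seq3 (V : nmodType) (F : int -> V) a b c :
  \sum_(d <- [:: a; b; c]) F d = F a + (F b + F c).
Proof. by rewrite !big_cons big_nil addr0. Qed.

(** On the diagonal of offset [d] the weights [wgt s j] and [wgt (- s) (j + d)] cancel up to
    [wgt s d]; what remains is Hoelder's inequality in [j]. *)
Lemma block_sum_le u (v : @distrib R n) N : tempered u -> tempered v ->
  (\sum_(j <- zs N) \sum_(d <- [:: -1; 0; 1]%R)
     Lp p (blk j u) * Lp (conj p) (blk (j + d) v) <= pc%:E * (NB u * NB' v))%E.
Proof.
move=> tu tv; rewrite exchange_big /=.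
have H d : (absz d <= 1)%N -> (\sum_(j <- zs N) Lp p (blk j u) * Lp (conj p) (blk (j + d) v) <=
    (2 `^ (1%:R * `|s|))%:E * (NB u * NB' v))%E.
  move=> d1; apply: (@le_trans _ _ ((wgt s d)%:E * \sum_(j <- zs N)
      besov_coef phi s p u j * besov_coef phi (- s) (conj p) v (j + d)%R)%E).
    rewrite ge0_sume_distrr; last by move=> j _; rewrite mule_ge0// coef_ge0.
    rewrite le_eqVlt; apply/orP; left; apply/eqP; apply: eq_bigr => j _.
    rewrite (coefE s j p1 tu) (coefE (- s) (j + d) p1' tv).
    set A := Lp p _; set B := Lp _ (blk (j + d) v).
    rewrite [RHS](_ : _ = ((wgt s d * (wgt s j * wgt (- s) (j + d)))%:E * (A * B))%E); last first.
      by rewrite (muleACA (wgt s j)%:E) muleA !EFinM.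
    rewrite (_ : wgt s d * (wgt s j * wgt (- s) (j + d)) = 1) ?mul1e//.
    by rewrite mulrA (mulrC (wgt s d)) -wgtD mulrC wgtN.
  apply: lee_pmul; rewrite ?lee_fin ?wgt_ge0 ?wgt_shift//.
    by apply: sume_ge0 => j _; rewrite mule_ge0// coef_ge0.
  apply: le_trans (lq_hoelder N q1 _ _) _; rewrite ?lq_shift//.
  - by move=> j; exact: coef_ge0.
  - by move=> j; exact: coef_ge0.
rewrite big_seq3.
have X0 : (0 <= (2 `^ (1%:R * `|s|))%:E * (NB u * NB' v))%E.
  apply: mule_ge0; first by rewrite lee_fin powR_ge0.
  by apply: mule_ge0; [exact: (norm_ge0 s p1 q1 tu)|exact: (norm_ge0 (- s) p1' q1' tv)].
have h1 := H (-1) isT; have h2 := H 0 isT; have h3 := H 1 isT.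
apply: le_trans (leeD h1 (leeD h2 h3)) _.
rewrite /pc EFinM -muleA; move: X0; set X := (_ * _)%E => X0.
have -> : (3%:E = 1 + (1 + 1) :> \bar R)%E by rewrite -!EFinD; congr EFin; lra.
by rewrite ge0_muleDl ?lee_fin// ge0_muleDl ?lee_fin// !mul1e.
Qed.

Lemma block_pairingE u (v : @distrib R n) j k : good u -> good' v ->
  paired (Delta phi j u) (Delta phi k v) /\
  pairing (Delta phi j u) (Delta phi k v) = cint mu (fun x => blk j u x * blk k v x) /\
  ((normc (pairing (Delta phi j u) (Delta phi k v)))%:E <=
    Lp p (blk j u) * Lp (conj p) (blk k v))%E.
Proof.
move=> [tu uy] [tv vy].
have ci : cintable mu (fun x => blk j u x * blk k v x).
  split; first by apply: cmfunM; exact: blk_cmfun.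
  apply: le_lt_trans (Lp_hoelder p1 (blk_cmfun j tu) (blk_cmfun k tv)) _.
  have := blk_lty j p1 q1 tu uy; have := blk_lty k p1' q1' tv vy.
  have := Lp_ge0 p (blk j u); have := Lp_ge0 (conj p) (blk k v).
  by case: (Lp p _) => // r; case: (Lp (conj p) _) => // r' _ _ _ _; rewrite -EFinM ltry.
have [h e] := pairing_repr cphi (Delta_repr j tu) (Delta_repr k tv) ci.
split=> //; split=> //; rewrite e; apply: le_trans (le_normc_cint ci) _.
exact: Lp_hoelder p1 (blk_cmfun j tu) (blk_cmfun k tv).
Qed.

Lemma good_pairing u (v : @distrib R n) : good u -> good' v ->
  csummable near_diag (block_pairing phi u v) /\
  ((normc (besov_pairing phi u v))%:E <= pc%:E * (NB u * NB' v))%E.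
Proof.
move=> gu gv; have [tu uy] := gu; have [tv vy] := gv.
have hN N : (\sum_(k <- nd N) (normc (block_pairing phi u v k))%:E <= pc%:E * (NB u * NB' v))%E.
  rewrite sum_nd; apply: le_trans (block_sum_le N tu tv).
  apply: lee_sum => j _; apply: lee_sum => d _.
  exact: (block_pairingE j (j + d) gu gv).2.2.
have Bf : (pc%:E * (NB u * NB' v))%E \is a fin_num.
  have nu : NB u \is a fin_num by rewrite ge0_fin_numE// norm_ge0.
  have nv : NB' v \is a fin_num by rewrite ge0_fin_numE// norm_ge0.
  by rewrite fin_numM// fin_numM.
have cs : csummable near_diag (block_pairing phi u v).
  apply: (@le_lt_trans _ _ (pc%:E * (NB u * NB' v))%E); last by rewrite -(fineK Bf) ltry.
  by apply: (esum_le_sum nd_uniq mem_nd) => [k _|N]; [rewrite lee_fin|exact: hN].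
split=> //; rewrite -(fineK Bf) lee_fin.
apply: (le_normc_csum nd_uniq mem_nd) => // N.
by rewrite -lee_fin fineK// -sumEFin.
Qed.

Lemma tempered_comb (a : C) u1 u2 : tempered u1 -> tempered u2 -> tempered (a \*o u1 \+ u2).
Proof.
move=> t1 t2; split.
  move=> b v w Sv Sw /=; rewrite -[u1 _]/(u1 (fun x => b * v x + w x)) -[u2 _]/(u2 (fun x => b * v x + w x)).
  by rewrite !tempered_lin//; ring.
have [k1 [M1 [M10 H1]]] := tempered_bound t1.
have [k2 [M2 [M20 H2]]] := tempered_bound t2.
exists (maxn k1 k2), (normc a * M1 + M2) => v Sv; rewrite seminormE// -EFinM lee_fin /=.
have mono (k l : nat) : (k <= l)%N -> snorm k v <= snorm l v.
  move=> kl; apply: snorm_le => // t x tk.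
  apply: le_trans (le_snorm x Sv (leq_trans tk kl)).
  by rewrite ler_wpM2r// wtX_le.
apply: le_trans (normcD _ _) _; rewrite normcM mulrDl lerD//.
  rewrite -mulrA ler_wpM2l// (le_trans (H1 v Sv))// ler_wpM2l// mono// leq_maxl//.
by rewrite (le_trans (H2 v Sv))// ler_wpM2l// mono// leq_maxr.
Qed.

Lemma blk_lin (a : C) j u1 u2 : blk j (a \*o u1 \+ u2) = (fun x => a * blk j u1 x + blk j u2 x).
Proof. by []. Qed.

Lemma norm_comb (a : C) u1 u2 t r1 r2 : (1 <= r1)%E -> (1 <= r2)%E -> tempered u1 -> tempered u2 ->
  (besov_norm phi t r1 r2 u1 < +oo)%E -> (besov_norm phi t r1 r2 u2 < +oo)%E ->
  (besov_norm phi t r1 r2 (a \*o u1 \+ u2)%R < +oo)%E.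
Proof.
move=> hr1 hr2 t1 t2 y1 y2; have t12 := tempered_comb a t1 t2.
pose M := maxe ((normc a)%:E * besov_norm phi t r1 r2 u1)%E (besov_norm phi t r1 r2 u2).
apply: (@le_lt_trans _ _ (4%:E * M)%E); last first.
  have My : (M < +oo)%E by rewrite gt_max y2 andbT lte_mul_pinfty// lee_fin.
  by rewrite lte_mul_pinfty// lee_fin.
apply: (@le_trans _ _ (lq_norm r2 (fun j => (normc a)%:E * besov_coef phi t r1 u1 j + besov_coef phi t r1 u2 j)%E)).
  apply: lq_le => // j; first exact: coef_ge0.
  rewrite !coefE// blk_lin muleCA -ge0_muleDr; last 2 first.
  - by rewrite mule_ge0 ?Lp_ge0// lee_fin.
  - exact: Lp_ge0.
  rewrite lee_wpmul2l ?lee_fin ?wgt_ge0//.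
  rewrite -LpZ//; last exact: blk_cmfun.
  apply: Lp_triangle => //; last exact: blk_cmfun.
  by apply: cmfunM; [exact: cmfun_cst|exact: blk_cmfun].
apply: lq_add => //.
- by move=> j; rewrite mule_ge0 ?lee_fin// coef_ge0.
- by move=> j; rewrite coef_ge0.
- apply: (@le_trans _ _ ((normc a)%:E * besov_norm phi t r1 r2 u1)%E).
    by apply: lq_scale => // j; exact: coef_ge0.
  by rewrite le_max lexx.
- by rewrite le_max lexx orbT.
Qed.

Lemma pairing_linl (a : C) u1 u2 (v : @distrib R n) : good u1 -> good u2 -> good' v ->
  besov_pairing phi (a \*o u1 \+ u2) v =
  a * besov_pairing phi u1 v + besov_pairing phi u2 v.
Proof.
move=> g1 g2 gv; have [t1 y1] := g1; have [t2 y2] := g2; have [tv vy] := gv.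
have g12 : good (a \*o u1 \+ u2).
  by split; [exact: tempered_comb|exact: norm_comb].
have [s1 _] := good_pairing g1 gv; have [s2 _] := good_pairing g2 gv.
have [_ <-] := csum_lin nd_uniq mem_nd a s1 s2.
congr csum; apply/funext => k; rewrite /block_pairing.
have [_ [-> _]] := block_pairingE k.1 k.2 g12 gv.
have ci u : good u -> cintable mu (fun x => blk k.1 u x * blk k.2 v x).
  move=> gu; have [/cintegrableE _ _] := block_pairingE k.1 k.2 gu gv.
  have [tu uy] := gu; split; first by apply: cmfunM; exact: blk_cmfun.
  apply: le_lt_trans (Lp_hoelder p1 (blk_cmfun _ tu) (blk_cmfun _ tv)) _.
  have := blk_lty k.1 p1 q1 tu uy; have := blk_lty k.2 p1' q1' tv vy.
  have := Lp_ge0 p (blk k.1 u); have := Lp_ge0 (conj p) (blk k.2 v).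
  by case: (Lp p _) => // r; case: (Lp (conj p) _) => // r' _ _ _ _; rewrite -EFinM ltry.
have [_ [-> _]] := block_pairingE k.1 k.2 g1 gv.
have [_ [-> _]] := block_pairingE k.1 k.2 g2 gv.
rewrite -(cintZ a (ci u1 g1)) -(cintD (cintableZ a (ci u1 g1)) (ci u2 g2)).
by apply: eq_cint => x; rewrite blk_lin; ring.
Qed.

Lemma pairing_linr (a : C) u (v1 v2 : @distrib R n) : good u -> good' v1 -> good' v2 ->
  besov_pairing phi u (a \*o v1 \+ v2) =
  a * besov_pairing phi u v1 + besov_pairing phi u v2.
Proof.
move=> gu g1 g2; have [tu uy] := gu; have [t1 y1] := g1; have [t2 y2] := g2.
have g12 : good' (a \*o v1 \+ v2).
  by split; [exact: tempered_comb|exact: norm_comb].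
have [s1 _] := good_pairing gu g1; have [s2 _] := good_pairing gu g2.
have [_ <-] := csum_lin nd_uniq mem_nd a s1 s2.
congr csum; apply/funext => k; rewrite /block_pairing.
have [_ [-> _]] := block_pairingE k.1 k.2 gu g12.
have ci (v : @distrib R n) : good' v -> cintable mu (fun x => blk k.1 u x * blk k.2 v x).
  move=> [tv vy]; split; first by apply: cmfunM; exact: blk_cmfun.
  apply: le_lt_trans (Lp_hoelder p1 (blk_cmfun _ tu) (blk_cmfun _ tv)) _.
  have := blk_lty k.1 p1 q1 tu uy; have := blk_lty k.2 p1' q1' tv vy.
  have := Lp_ge0 p (blk k.1 u); have := Lp_ge0 (conj p) (blk k.2 v).
  by case: (Lp p _) => // r; case: (Lp (conj p) _) => // r' _ _ _ _; rewrite -EFinM ltry.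
have [_ [-> _]] := block_pairingE k.1 k.2 gu g1.
have [_ [-> _]] := block_pairingE k.1 k.2 gu g2.
rewrite -(cintZ a (ci v1 g1)) -(cintD (cintableZ a (ci v1 g1)) (ci v2 g2)).
by apply: eq_cint => x; rewrite blk_lin; ring.
Qed.

End pairing_bound.

End blocks.

(** * Dyadic powers, telescoping sums and finitely supported sequences *)

Section sequences_more.
Local Open Scope classical_set_scope.
Local Open Scope ring_scope.
Context {R : realType}.
Implicit Types (q : \bar R) (a b : int -> \bar R) (j d k : int).

Lemma lt_exp2 (M : R) : exists N0 : nat, forall N, (N0 <= N)%N -> M < 2 ^ (N : int).
Proof.
exists (Num.bound `|M|) => N hN; apply: le_lt_trans (ler_norm M) _.
apply: lt_trans (archi_boundP (normr_ge0 M)) _.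
apply: (@le_lt_trans _ _ N%:R); first by rewrite ler_nat.
by rewrite -exprnP -natrX ltr_nat ltn_expl.
Qed.

Lemma exp2N_lt (e : R) : 0 < e -> exists N0 : nat, forall N, (N0 <= N)%N -> 2 ^ (- (N : int)) < e.
Proof.
move=> e0; have [N0 h] := lt_exp2 e^-1; exists N0 => N /h hN.
rewrite -[2 ^ (- _)]invr_expz -(invrK e); rewrite ltf_pV2 ?posrE ?invr_gt0//.
Qed.

Lemma telescope_zs (V : zmodType) (P : int -> V) N :
  \sum_(j <- zs N) (P (j + 1) - P j) = P (N%:Z + 1) - P (- N%:Z).
Proof.
rewrite /zs big_map.
have -> : iota 0 (2 * N).+1 = index_iota 0 (2 * N).+1 by rewrite /index_iota subn0.
rewrite (eq_bigr (fun i : nat => P (i.+1%:Z - N%:Z) - P (i%:Z - N%:Z))); last first.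
  by move=> i _; congr (P _ - _); lia.
rewrite (telescope_sumr (fun i : nat => P (i%:Z - N%:Z)))//.
by congr (P _ - P _); lia.
Qed.

(** The offsets between a block and the enlarged blocks that it can meet ([kapj_fat0]). *)
Definition band : seq int := [:: -2; -1; 0; 1; 2].

Lemma big_band (V : nmodType) (F : int -> V) :
  \sum_(d <- band) F d = F (-2) + (F (-1) + (F 0 + (F 1 + F 2))).
Proof. by rewrite /band !big_cons big_nil addr0. Qed.

Lemma mem_band d : (d \in band) = (absz d <= 2)%N.
Proof. by rewrite /band !inE; apply/idP/idP; lia. Qed.

Lemma sum_band (V : nmodType) N k (F : int -> V) :
  (forall j, (2 < absz (j - k))%N -> F j = 0) ->
  \sum_(j <- zs N) F j = \sum_(d <- band) (if k + d \in zs N then F (k + d) else 0).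
Proof.
move=> F0.
transitivity (\sum_(j <- zs N) \sum_(d <- band) (if j == k + d then F j else 0)).
  apply: eq_bigr => j _; case: (leqP (absz (j - k)) 2) => h; last first.
    by rewrite big1 F0// => d _; case: ifP.
  have kj : k + (j - k) = j by lia.
  rewrite (bigD1_seq (j - k)) ?mem_band//= kj eqxx big1 ?addr0// => d dk.
  by case: eqP => // e; case/negP: dk; apply/eqP; lia.
rewrite exchange_big; apply: eq_bigr => d _ /=.
case: ifPn => h.
  rewrite (bigD1_seq (k + d)) ?zs_uniq//= eqxx big1 ?addr0// => j /negPf ->//.
rewrite big_seq big1// => j jN; case: eqP => // e.
by move: h; rewrite -e jN.
Qed.

(** After division by [M] all terms are at most 1, so raising them to a power at least 1 only
    decreases them, and the sum dominates every sequence norm. *)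
Lemma lq_fin_le q a (M : R) N : (1 <= q)%E -> (forall j, (0 <= a j)%E) -> 0 < M ->
  (forall j, j \notin zs N -> a j = 0%E) -> (\sum_(j <- zs N) a j <= M%:E)%E ->
  (lq_norm q a <= M%:E)%E.
Proof.
move=> q1 a0 M0 aN sM.
have aM j : (a j <= M%:E)%E.
  have [jN|jN] := boolP (j \in zs N); last by rewrite aN// lee_fin ltW.
  apply: le_trans sM; rewrite (bigD1_seq j) ?zs_uniq//= leeDl//.
  by apply: sume_ge0 => i _; exact: a0.
have aE j : a j = (fine (a j))%:E.
  by rewrite fineK// ge0_fin_numE// (le_lt_trans (aM j))// ltry.
pose al j := fine (a j) / M.
have al0 j : 0 <= al j by rewrite divr_ge0 ?fine_ge0// ltW.
have al1 j : al j <= 1 by rewrite ler_pdivrMr// mul1r -lee_fin -aE.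
have alN j : j \notin zs N -> al j = 0 by move=> jN; rewrite /al aN// mul0r.
have h : (lq_norm q (fun j => (al j)%:E) <= 1)%E.
  apply: (@lq_real_le1 _ _ _ N) => // r e.
  have r1 : 1 <= r by rewrite -lee_fin -e.
  apply: (@le_trans _ _ (\sum_(j <- zs N) al j)).
    apply: ler_sum => j _; rewrite -(mulr_powRB1 (al0 j) (lt_le_trans ltr01 r1)).
    rewrite -[leRHS]mulr1 ler_wpM2l//.
    have := @powR_le _ (r - 1) (al j) 1; rewrite powR1; apply=> //.
    by rewrite subr_ge0.
  rewrite -mulr_suml ler_pdivrMr// mul1r -lee_fin -sumEFin.
  by under eq_bigr do rewrite -aE.
rewrite (_ : a = fun j => (M%:E * (al j)%:E)%E); last first.
  by apply/funext => j; rewrite -EFinM /al mulrC divfK ?lt0r_neq0.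
have h0 j : (0 <= (al j)%:E)%E by rewrite lee_fin.
apply: le_trans (lq_scale q1 (ltW M0) h0) _.
by rewrite -[leRHS]mule1 lee_wpmul2l// lee_fin ltW.
Qed.

End sequences_more.

(** * Schwartz functions with spectrum in an annulus *)

Section annular.
Local Open Scope classical_set_scope.
Local Open Scope ring_scope.
Local Open Scope complex_scope.
Context {R : realType} {n : nat}.
Local Notation E := ('rV[R]_n).
Local Notation C := (R[i]).
Local Notation mu := (@lebesgue_rV R n).
Variable phi : E -> R.
Hypothesis cphi : cutoff phi.
Implicit Types (f g v w : E -> C) (u T : @distrib R n) (a b c d j k : int).

Lemma annM a b c d xi : a + 1 <= c -> c <= d -> d + 1 <= b ->
  ann phi a b xi * ann phi c d xi = ann phi c d xi.
Proof.
move=> ac cd db; have [->|h] := eqVneq (ann phi c d xi) 0; first by rewrite mulr0.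
have xc : 3 / 4 * 2 ^ c <= enorm xi.
  rewrite leNgt; apply: contraNN h => h; have := exp2_le (R:=R) cd => h2.
  by rewrite /ann !(phic_eq1 cphi) ?subrr//; lra.
have xd : enorm xi < 4 / 3 * 2 ^ d.
  rewrite ltNge; apply: contraNN h => h; have := exp2_le (R:=R) cd => h2.
  by rewrite /ann !(phic_eq0 cphi) ?subrr//; lra.
have ea : (2 : R) ^ (a + 1) = 2 ^ a * 2 by rewrite expfzDr ?pnatr_eq0.
have ed : (2 : R) ^ (d + 1) = 2 ^ d * 2 by rewrite expfzDr ?pnatr_eq0.
have := exp2_le (R:=R) ac; have := exp2_le (R:=R) db; rewrite ea ed => h1 h2.
have pa := exp2_gt0 R a; have pd := exp2_gt0 R d.
by rewrite {1}/ann (phic_eq1 cphi) ?(phic_eq0 cphi) ?subr0 ?mul1r//; lra.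
Qed.

Lemma convol_annM a b c d w : a + 1 <= c -> c <= d -> d + 1 <= b -> wint w ->
  convol (kapA phi a b) (convol (kapA phi c d) w) = convol (kapA phi c d) w.
Proof.
move=> ac cd db ww; rewrite {1 2}/kapA.
rewrite (convol_kap2 (schwartz_ann cphi a b) (schwartz_ann cphi c d) ww).
rewrite (_ : (fun xi => ann phi a b xi * ann phi c d xi) = ann phi c d)//.
by apply/funext => xi; rewrite annM.
Qed.

Definition lowpass b w := convol (kap (phic phi b)) w.

Lemma sum_kapj N w x : wint w ->
  \sum_(j <- zs N) convol (kapj phi j) w x = lowpass (N%:Z + 1) w x - lowpass (- N%:Z) w x.
Proof.
move=> ww; rewrite -(telescope_zs (fun b => lowpass b w x)).
by apply: eq_bigr => j _; rewrite (convol_kapA cphi).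
Qed.

Lemma schwartz_kap_convol a b w : wint w -> schwartz (convol (kapA phi a b) w).
Proof. by move=> ww; have [] := schwartz_convol (schwartz_kapA cphi a b) ww. Qed.

Lemma schwartz_lowpass b w : wint w -> schwartz (lowpass b w).
Proof. by move=> ww; have [] := schwartz_convol (schwartz_kap (schwartz_phic cphi b)) ww. Qed.

Lemma sum_tempered u N v : tempered u -> schwartz v ->
  \sum_(j <- zs N) u (convol (kapj phi j) v) =
  u (lowpass (N%:Z + 1) v) - u (lowpass (- N%:Z) v).
Proof.
move=> tu Sv; have wv := schwartz_wint Sv.
rewrite -(tempered_sum _ tu); last by move=> j; exact: schwartz_kap_convol.
rewrite (_ : (fun x => _) = (fun x => lowpass (N%:Z + 1) v x - lowpass (- N%:Z) v x)).
  by rewrite temperedB//; exact: schwartz_lowpass.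
by apply/funext => x; rewrite sum_kapj.
Qed.

Lemma Lp_norm_bound T (e : R) : (Lp_norm +oo T < e%:E)%E -> forall v, schwartz v ->
  normc (T v) <= e * wnorm 0 v.
Proof.
move=> /ereal_inf_lt[_ [f [mf rf] <-] fe] v Sv.
have [/cintegrableE ci ->] := rf v Sv.
rewrite -lee_fin; apply: le_trans (le_normc_cint ci) _.
have y1 : (1 <= +oo :> \bar R)%E by rewrite leey.
have cf : cmfun f by exact/cmeasurableE.
apply: le_trans (Lp_hoelder y1 cf (schwartz_cmfun Sv)) _.
rewrite hoelder_conjugatey /Lp Np1// EFinM.
rewrite (_ : (\int[mu]_x (normc (v x))%:E)%E = (wnorm 0 v)%:E); last first.
  by rewrite -(wnormE 0 (schwartz_wint Sv)); apply: eq_integral => y _; rewrite expr0 mul1r.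
by apply: lee_wpmul2r; [rewrite lee_fin wnorm_ge0|exact: ltW].
Qed.

(** The defining property of [Sh'], tested on the cut-off [phi] itself at the scales [2^N]. *)
Lemma lowpass_cvg0 u v (e : R) : Sh' u -> schwartz v -> 0 < e ->
  exists N0 : nat, forall N, (N0 <= N)%N -> normc (u (lowpass (- N%:Z) v)) < e.
Proof.
move=> [tu hu] Sv e0; have w0 := wnorm_ge0 0 v.
pose e' := e / (2 * (1 + wnorm 0 v)).
have e'0 : 0 < e' by rewrite divr_gt0// mulr_gt0// ltr_wpDr.
have tphi : test_function (fun x : E => (phi x)%:C) by case: cphi.
have nb : nbhs (0%E : \bar R) [set x | (x < e'%:E)%E].
  by apply: open_nbhs_nbhs; split; [exact: open_ereal_lt_ereal|rewrite /= lte_fin].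
have [M [_ hM]] := hu _ tphi _ nb.
have [N0 hN] := lt_exp2 M; exists N0 => N /hN/hM /= /Lp_norm_bound/(_ v Sv).
rewrite multiplierE//; last exact: (schwartz_scale (exp2_gt0 R _) (schwartz_phi cphi)).
rewrite (_ : (fun xi : E => (phi (2 ^ (N : int) *: xi))%:C) = phic phi (- N%:Z)); last first.
  by apply/funext => xi; rewrite phicD opprK.
move=> h; apply: le_lt_trans h _; rewrite /e' mulrAC ltr_pdivrMr ?mulr_gt0 ?ltr_wpDr//.
by rewrite ltr_pM2l//; lra.
Qed.

(** The blocks telescope. The high-frequency error is controlled by [phic_approx] and the
    temperedness of [u], the low-frequency one by membership in [Sh']. *)
Lemma blocks_cvg u v (e : R) : Sh' u -> schwartz v -> 0 < e ->
  exists N0 : nat, forall N, (N0 <= N)%N ->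
    normc (\sum_(j <- zs N) u (convol (kapj phi j) v) - u v) < e.
Proof.
move=> hu Sv e0; have [tu _] := hu; have wv := schwartz_wint Sv.
have e20 : 0 < e / 2 by rewrite divr_gt0.
have [N1 h1] := lowpass_cvg0 hu Sv e20.
have [k [M [M0 hM]]] := tempered_bound tu.
have [A A0 hA] := phic_approx cphi k.
pose B := 1 + M * (A * snorm k.+1 v).
have B0 : 0 < B by rewrite ltr_wpDr// !mulr_ge0// snorm_ge0.
have [N2 h2] := exp2N_lt (divr_gt0 e20 B0).
exists (maxn N1 N2) => N; rewrite geq_max => /andP[N1N N2N].
have E3 (z1 z2 z3 : C) : z1 - z2 - z3 = - (z3 - z1) - z2 by ring.
rewrite (sum_tempered N tu Sv) E3; apply: le_lt_trans (normcB _ _) _.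
rewrite normcN [ltRHS](splitr e); apply: ltrD; last exact: h1.
rewrite -(temperedB tu Sv (schwartz_lowpass _ wv)).
apply: le_lt_trans (hM _ (schwartzB Sv (schwartz_lowpass _ wv))) _.
have hS := hA (N%:Z + 1) v isT Sv.
have p0 := exp2_gt0 R (- (N%:Z + 1)).
have p1 : (2 : R) ^ (- (N%:Z + 1)) < e / 2 / B.
  have -> : N%:Z + 1 = N.+1%:Z by lia.
  exact: (h2 N.+1 (leq_trans N2N (leqnSn N))).
apply: (@le_lt_trans _ _ (2 ^ (- (N%:Z + 1)) * B)).
  apply: le_trans (ler_wpM2l M0 hS) _.
  have E4 (z1 z2 z3 z4 : R) : z1 * (z2 * z3 * z4) = z3 * (z1 * (z2 * z4)) by ring.
  by rewrite E4; apply: (ler_wpM2l (ltW p0)); rewrite /B lerDr.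
by rewrite -ltr_pdivlMr.
Qed.

(** Spectrum in an annulus, expressed on the convolution side: the function is reproduced by some
    annular kernel. *)
Definition annular v := schwartz v /\ exists a b, a <= b /\ convol (kapA phi a b) v = v.

Lemma annular_widen v : annular v -> exists a b, a <= b /\
  forall a' b', a' <= a -> b <= b' -> convol (kapA phi a' b') v = v.
Proof.
move=> [Sv [a [b [ab e]]]]; exists (a - 1), (b + 1); split; first by lia.
move=> a' b' a'a b'b; rewrite -[in LHS]e convol_annM//; last exact: schwartz_wint.
by lia.
Qed.

Lemma annular_sum v : annular v -> exists N0 : nat, forall N, (N0 <= N)%N ->
  (fun x => \sum_(j <- zs N) convol (kapj phi j) v x) = v.
Proof.
move=> av; have [Sv _] := av; have [a [b [ab h]]] := annular_widen av.
exists (maxn (absz a) (absz b)) => N; rewrite geq_max => /andP[aN bN].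
rewrite -[RHS](h (- N%:Z) (N%:Z + 1)); [|lia|lia].
have wv := schwartz_wint Sv.
by apply/funext => x; rewrite (sum_kapj N x wv) (convol_kapA cphi _ _ x wv).
Qed.

Lemma annular_kap c d w : c <= d -> wint w -> annular (convol (kapA phi c d) w).
Proof.
move=> cd ww; split; first exact: schwartz_kap_convol.
by exists (c - 1), (d + 1); split; [lia|rewrite convol_annM//; lia].
Qed.

Lemma convol_0 (K : E -> C) : convol K (fun=> 0) = (fun=> 0).
Proof. by apply/funext => x; rewrite /convol; under eq_cint do rewrite mulr0; exact: cint0. Qed.

Lemma annular0 : annular (fun=> 0).
Proof.
rewrite -(convol_0 (kapA phi 0 0)); apply: annular_kap => //; exact: wint_cst0.
Qed.

Lemma annular_lin (z : C) v w : annular v -> annular w -> annular (fun x => z * v x + w x).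
Proof.
move=> av aw; have [Sv _] := av; have [Sw _] := aw.
split; first by have [] := schwartz_lin z Sv Sw.
have [a [b [ab h]]] := annular_widen av; have [c [d [cd k]]] := annular_widen aw.
exists (Num.min a c), (Num.max b d); split; first by lia.
rewrite convol_linr; [|exact: schwartz_kapA|exact: schwartz_wint|exact: schwartz_wint].
by apply/funext => x; rewrite h ?k//; lia.
Qed.

Lemma annular_bigsum (I : Type) (r : seq I) (F : I -> E -> C) :
  (forall i, annular (F i)) -> annular (fun x => \sum_(i <- r) F i x).
Proof.
move=> aF; elim: r => [|i r ih].
  by under eq_fun do rewrite big_nil; exact: annular0.
rewrite (_ : (fun x => _) = (fun x => 1 * F i x + \sum_(i <- r) F i x)); first exact: annular_lin.
by apply/funext => x; rewrite big_cons mul1r.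
Qed.

Lemma annular_blocks v : annular v -> exists N0 : nat, forall k, (N0 < absz k)%N ->
  convol (kapj phi k) v = (fun=> 0).
Proof.
move=> [Sv [a [b [ab e]]]]; have wv := schwartz_wint Sv.
exists (maxn (absz a) (absz b) + 2)%N => k hk.
rewrite -[in LHS]e /kapj (convol_comm cphi _ _ _ _ wv) (convol_ann0 cphi ab _ wv)//.
by apply/orP; lia.
Qed.

Lemma blk_eqD j T U : eqD T U -> blk phi j T = blk phi j U.
Proof.
move=> TU; apply/funext => y; apply: TU.
by have [] := schwartz_trans y (schwartz_kapj cphi j).
Qed.

Lemma tempered_eqD T U : eqD T U -> tempered U -> tempered T.
Proof.
move=> TU [lU [k [M bU]]]; split.
  move=> a v w Sv Sw; rewrite !TU//; first exact: lU.
  by have [] := schwartz_lin a Sv Sw.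
by exists k, M => v Sv; rewrite TU// bU.
Qed.

Lemma blk_distr_of j v : schwartz v -> blk phi j (distr_of v) = convol (kapj phi j) v.
Proof.
move=> Sv; apply/funext => y; apply: ptconv_distr_of; first exact: schwartz_kapj.
exact: kapA_even.
Qed.

End annular.

(** * Approximation in Besov norm *)

Section approximation.
Local Open Scope classical_set_scope.
Local Open Scope ring_scope.
Local Open Scope complex_scope.
Context {R : realType} {n : nat}.
Local Notation E := ('rV[R]_n).
Local Notation C := (R[i]).
Local Notation mu := (@lebesgue_rV R n).
Local Notation conj := (@hoelder_conjugate R).
Variable phi : E -> R.
Hypothesis cphi : cutoff phi.
Implicit Types (f g w K : E -> C) (W : int -> E -> C) (p q : \bar R) (u T : @distrib R n).
Implicit Types (s t : R) (a b c d j k : int).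

(** The enlarged block: its symbol equals 1 on the support of the symbol of block [j], so it fixes
    every block [j] ([fat_kapj]). *)
Definition fat j w := convol (kapA phi (j - 1) (j + 2)) w.
(** The kernel of block [k] composed with the enlarged block [j]. *)
Definition hk j k := fat j (kapj phi k).
(** The synthesis operator. The [W j] carry no spectral condition; the enlarged blocks put each of
    them into its annulus before summing. *)
Definition synth N W x : C := \sum_(j <- zs N) fat j (W j) x.

Lemma fat_index_le j : j - 1 <= j + 2.
Proof. lia. Qed.

Lemma schwartz_fat j w : wint w -> schwartz (fat j w).
Proof. exact: schwartz_kap_convol. Qed.

Lemma schwartz_hk j k : schwartz (hk j k).
Proof. exact/schwartz_fat/schwartz_wint/schwartz_kapj. Qed.

Lemma convol_sum K (I : Type) (r : seq I) (F : I -> E -> C) : schwartz K ->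
  (forall i, wint (F i)) ->
  convol K (fun x => \sum_(i <- r) F i x) = (fun x => \sum_(i <- r) convol K (F i) x).
Proof.
move=> SK wF; apply/funext => x; rewrite /convol.
rewrite -(cint_sum _ (fun i => convol_cintable x SK (wF i))).
by apply: eq_cint => y; rewrite mulr_sumr.
Qed.

Lemma convolZ K (z : C) w : schwartz K -> wint w ->
  convol K (fun x => z * w x) = (fun x => z * convol K w x).
Proof.
move=> SK ww; apply/funext => x; rewrite /convol -(cintZ z (convol_cintable x SK ww)).
by apply: eq_cint => y; rewrite mulrCA.
Qed.

Lemma convol_even K w x : schwartz K -> wint w -> (forall y, K (- y) = K y) ->
  (forall y, w (- y) = w y) -> convol K w (- x) = convol K w x.
Proof.
move=> SK ww Ke we; rewrite /convol -[RHS](cint_reflect 0 (convol_cintable x SK ww)).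
by apply: eq_cint => y; rewrite sub0r we opprK -[in LHS]Ke opprD !opprK.
Qed.

Lemma hk_even j k x : hk j k (- x) = hk j k x.
Proof.
apply: convol_even; [exact: schwartz_kapA|exact/schwartz_wint/schwartz_kapj| |];
  by move=> y; exact: kapA_even.
Qed.

Lemma kapA_kapj a b k : a + 1 <= k -> k + 2 <= b -> convol (kapA phi a b) (kapj phi k) = kapj phi k.
Proof.
move=> ak kb; rewrite /kapj /kapA (convol_kapM (schwartz_ann cphi a b) (schwartz_ann cphi k (k + 1))).
rewrite (_ : (fun xi => _) = ann phi k (k + 1))//.
by apply/funext => xi; rewrite (ann_psi1 cphi).
Qed.

Lemma kapj_fat j k w : wint w -> convol (kapj phi k) (fat j w) = convol (hk j k) w.
Proof.
move=> ww; rewrite /hk /fat /kapj (convol_comm cphi _ _ _ _ ww).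
by rewrite convolA//; exact: schwartz_kapA.
Qed.

Lemma fat_kapj j w : wint w -> fat j (convol (kapj phi j) w) = convol (kapj phi j) w.
Proof. by move=> ww; rewrite /fat (convol_ann1 cphi)//; lia. Qed.

Lemma kapj_fat_diag j w : wint w -> convol (kapj phi j) (fat j w) = convol (kapj phi j) w.
Proof.
move=> ww; rewrite /fat {1}/kapj (convol_comm cphi _ _ _ _ ww).
exact: fat_kapj.
Qed.

Lemma kapj_fat0 j k w : wint w -> (2 < absz (j - k))%N -> convol (kapj phi k) (fat j w) = (fun=> 0).
Proof.
move=> ww jk; rewrite /fat {1}/kapj (convol_comm cphi _ _ _ _ ww) (convol_ann0 cphi _ _ ww)//.
  by lia.
by apply/orP; lia.
Qed.

(** Writes block [k] of [u] in terms of the blocks [k + d] of [u] seen through the same kernels [hk]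
    that act on [W (k + d)] in the block [k] of a synthesis, so that the two can be subtracted term
    by term. *)
Lemma split_kapj k x : \sum_(d <- band) convol (kapj phi (k + d)) (hk (k + d) k) x = kapj phi k x.
Proof.
have wk : wint (kapj phi k) by exact/schwartz_wint/schwartz_kapj.
pose P b := lowpass phi b (kapj phi k) x.
have H j : convol (kapj phi j) (hk j k) x = P (j + 1) - P j.
  by rewrite /hk kapj_fat_diag// (convol_kapA cphi).
rewrite big_band !H.
have -> : k + (-2) + 1 = k + (-1) by lia.
have -> : k + (-1) + 1 = k + 0 by lia.
have -> : k + 0 + 1 = k + 1 by lia.
have -> : k + 1 + 1 = k + 2 by lia.
have E6 (z1 z2 z3 z4 z5 z6 : C) :
    z2 - z1 + (z3 - z2 + (z4 - z3 + (z5 - z4 + (z6 - z5)))) = z6 - z1 by ring.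
rewrite E6 /P /lowpass -(convol_kapA cphi (k + (-2)) (k + 2 + 1) x wk).
by rewrite kapA_kapj//; lia.
Qed.

(** A bound for the L1 norm of every [hk j k], namely the product of the bounds for its two annular
    kernels. *)
Definition H1 : R := (2 * C1 phi) ^+ 2.
Lemma H1_ge0 : 0 <= H1. Proof. exact: sqr_ge0. Qed.

Lemma Lp1E w : wint w -> Lp 1 w = (wnorm 0 w)%:E.
Proof.
by move=> ww; rewrite /Lp Np1// -(wnormE 0 ww); apply: eq_integral => y _; rewrite expr0 mul1r.
Qed.

Lemma wnorm_kapj k : wnorm 0 (kapj phi k) <= 2 * C1 phi.
Proof. exact: wnorm_kapA. Qed.

Lemma int_hk j k : (\int[mu]_y (normc (hk j k y))%:E <= H1%:E)%E.
Proof.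
have o1 : (1 <= 1 :> \bar R)%E by [].
have wk : wint (kapj phi k) by exact/schwartz_wint/schwartz_kapj.
rewrite -[leLHS]Np1// -/(Lp 1 (hk j k)).
apply: le_trans (Lp_convol1 o1 (schwartz_kapA cphi _ _) wk) _.
rewrite Lp1E// -EFinM lee_fin /H1 expr2; apply: ler_pM; rewrite ?wnorm_ge0//.
  exact: wnorm_kapj.
exact: wnorm_kapA.
Qed.

(** The contribution of index [j] to block [k] of the difference between [u] and a synthesis with
    [W j = w]. *)
Definition piece j k u w y : C :=
  ptconv u (convol (kapj phi j) (hk j k)) y - convol (hk j k) w y.

Lemma piece_cmfun j k u w : tempered u -> wint w -> cmfun (piece j k u w).
Proof.
move=> tu ww; apply: cmfunB.
  apply: (ptconv_cmfun tu); apply: schwartz_kap_convol => //.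
  exact/schwartz_wint/schwartz_hk.
by have [Sc _] := schwartz_convol (schwartz_hk j k) ww; exact: schwartz_cmfun.
Qed.

(** By [tempered_convol] and the evenness of [hk], the piece is the convolution of [blk phi j u - w]
    with [hk j k]; Young's inequality concludes. *)
Lemma piece_bound p j k u w : (1 <= p)%E -> tempered u -> wint w ->
  (Lp p (piece j k u w) <= H1%:E * Lp p (fun x => blk phi j u x - w x)%R)%E.
Proof.
move=> p1 tu ww; have Sh := schwartz_hk j k.
have cD : cmfun (fun x => blk phi j u x - w x).
  by apply: cmfunB; [exact: blk_cmfun|case: ww].
rewrite muleC.
apply: (@le_trans _ _ (Lp p (fun x => blk phi j u x - w x)%R * \int[mu]_y (normc (hk j k y))%:E)%E); last first.
  by apply: lee_wpmul2l; [exact: Lp_ge0|exact: int_hk].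
apply: young => //; [exact: schwartz_cmfun|exact: piece_cmfun|].
move=> y; have [St _] := schwartz_trans y Sh.
have c1 := ptconv_cintable tu (schwartz_kapj cphi j) (schwartz_wint St).
have c2 := convol_cintable y Sh ww.
have -> : piece j k u w y = cint mu (fun z => (blk phi j u z - w z) * hk j k (z - y)).
  rewrite /piece (_ : ptconv u _ y = cint mu (fun z => blk phi j u z * trans (hk j k) y z)).
    rewrite -(cintB c1 c2); apply: eq_cint => z.
    by rewrite /trans mulrBl -[hk j k (y - z)]hk_even opprB [w z * _]mulrC.
  transitivity (u (convol (kapj phi j) (trans (hk j k) y))).
    have et : trans (convol (kapj phi j) (hk j k)) y = convol (kapj phi j) (trans (hk j k) y).
      by apply/funext => x; exact: esym (convol_trans y x (schwartz_kapj cphi j) Sh).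
    exact: (congr1 u et).
  exact: (blk_convol cphi j tu (schwartz_wint St)).
have c3 : cintable mu (fun z => (blk phi j u z - w z) * hk j k (z - y)).
  move: (cintableB c1 c2); congr (cintable mu _); apply/funext => z.
  by rewrite /trans mulrBl -[hk j k (y - z)]hk_even opprB [w z * _]mulrC.
apply: le_trans (le_normc_cint c3) _.
have mF : measurable_fun setT (fun z : E => (normc ((blk phi j u z - w z) * hk j k (z - y)))%:E).
  by apply: measurable_EFin_normc; case: c3.
rewrite -(@ge0_integral_reflect R n y _ mF) => [|z]; last by rewrite lee_fin.
rewrite le_eqVlt; apply/orP; left; apply/eqP; apply: eq_integral => z _.
by rewrite normcM addrAC subrr add0r hk_even.
Qed.

Lemma block_approx T u N W k : tempered u -> (forall j, wint (W j)) ->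
  (forall j, j \notin zs N -> W j = (fun=> 0)) ->
  eqD T (fun v => u v - distr_of (synth N W) v) ->
  blk phi k T = (fun y => \sum_(d <- band) piece (k + d) k u (W (k + d)) y).
Proof.
move=> tu wW W0 TE; apply/funext => y.
have Sk := schwartz_kapj cphi k; have [St _] := schwartz_trans y Sk.
have Ss : schwartz (synth N W) by apply: schwartz_sum => j _; exact: schwartz_fat.
rewrite /blk /ptconv TE// sumrB; congr (_ - _).
  rewrite -(tempered_sum _ tu); last first.
    move=> d; apply: (schwartz_trans y _).1; apply: schwartz_kap_convol => //.
    exact/schwartz_wint/schwartz_hk.
  by congr (u _); apply/funext => x; rewrite /trans split_kapj.
rewrite -/(ptconv (distr_of (synth N W)) (kapj phi k) y) -/(blk phi k _ y) blk_distr_of//.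
rewrite /synth convol_sum//; last by move=> j; exact/schwartz_wint/schwartz_fat.
rewrite (@sum_band _ N k (fun i => convol (kapj phi k) (fat i (W i)) y)); last by move=> j jk; rewrite kapj_fat0.
apply: eq_bigr => d _; rewrite -kapj_fat//; case: ifPn => // h.
by rewrite W0// /fat !convol_0.
Qed.

(** Block [k] of the difference involves five indices only, and moving the weight by at most two
    dyadic steps costs [2^(2|s|)]. The difference is given as any [T] equal to it on Schwartz
    functions, which makes the estimate usable for [u = 0] and up to signs. *)
Lemma besov_approx s p q : (1 <= p)%E -> (1 <= q)%E -> exists2 A : R, 0 <= A &
  forall T u N W, tempered T -> tempered u -> (forall j, wint (W j)) ->
  (forall j, j \notin zs N -> W j = (fun=> 0)) ->
  eqD T (fun v => u v - distr_of (synth N W) v) ->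
  (besov_norm phi s p q T <=
   A%:E * lq_norm q (fun j => (wgt s j)%:E * Lp p (fun x => blk phi j u x - W j x)%R))%E.
Proof.
move=> p1 q1; pose B : R := 2 `^ (2%:R * `|s|) * H1.
have B0 : 0 <= B by rewrite mulr_ge0 ?powR_ge0 ?H1_ge0.
(* One factor 4 from [lq_add] for each of the five offsets. *)
exists (4 ^+ 5 * B); first by rewrite mulr_ge0.
move=> T u N W tT tu wW W0 TE.
pose a j := ((wgt s j)%:E * Lp p (fun x => blk phi j u x - W j x)%R)%E.
have a0 j : (0 <= a j)%E by rewrite mule_ge0 ?Lp_ge0// lee_fin wgt_ge0.
rewrite -/a.
apply: (@le_trans _ _ (lq_norm q (fun k => \sum_(d <- band) (B%:E * a (k + d)%R))%E)).
  apply: lq_le => // [k|k]; first exact: coef_ge0.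
  rewrite coefE// (block_approx _ tu wW W0 TE).
  apply: (@le_trans _ _ ((wgt s k)%:E * \sum_(d <- band) Lp p (piece (k + d)%R k u (W (k + d)%R)))%E).
    apply: lee_wpmul2l; first by rewrite lee_fin wgt_ge0.
    by apply: Lp_sum => // d; exact: piece_cmfun.
  rewrite ge0_sume_distrr; last by move=> d _; exact: Lp_ge0.
  rewrite big_seq [leRHS]big_seq; apply: lee_sum => d; rewrite mem_band => d2.
  apply: (@le_trans _ _ ((wgt s k)%:E * (H1%:E * Lp p (fun x => blk phi (k + d) u x - W (k + d) x)%R))%E).
    apply: lee_wpmul2l; first by rewrite lee_fin wgt_ge0.
    exact: piece_bound.
  rewrite /a !muleA -!EFinM; apply: lee_wpmul2r; first exact: Lp_ge0.
  rewrite lee_fin /B.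
  have -> : wgt s k = wgt s (k + d) * wgt s (- d) by rewrite -wgtD addrK.
  have h : wgt s (- d) <= 2 `^ (2%:R * `|s|) by apply: wgt_shift; rewrite abszN.
  have E3 (z1 z2 z3 : R) : z1 * z2 * z3 = z2 * z3 * z1 by ring.
  rewrite [leLHS]E3; apply: ler_wpM2r; first exact: wgt_ge0.
  by apply: ler_wpM2r; first exact: H1_ge0.
have hs := @lq_sum R q _ band (fun d k => (B%:E * a (k + d)%R)%E) (B%:E * lq_norm q a)%E q1.
rewrite (EFinM (4 ^+ 5) B) -(muleA (4 ^+ 5)%:E B%:E); apply: (hs _ _ _).
- by rewrite mule_ge0 ?lee_fin//; exact: lq_ge0.
- by move=> d k; rewrite mule_ge0 ?lee_fin.
- move=> d; rewrite -(lq_shift q a d); exact: (@lq_scale _ q B (fun j => a (j + d)) q1 B0).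
Qed.

Lemma schwartz_mul_cintable g v : schwartz g -> schwartz v -> cintable mu (fun x => g x * v x).
Proof.
move=> Sg Sv; have [] := @wint_mul R n 0 (snorm 0 g) g v (schwartz_wint Sv) (schwartz_cmfun Sg) _ => //.
by move=> y; rewrite expr0 mulr1; exact: schwartz_bound.
Qed.

Lemma tempered_zero : @tempered R n (fun=> 0).
Proof.
split; first by move=> z v w _ _; rewrite mulr0 addr0.
by exists 0, 0 => v _; rewrite normc0 mul0e.
Qed.

(** [besov_approx] for the zero distribution and the functions [- W j]. *)
Lemma besov_synth s p q : (1 <= p)%E -> (1 <= q)%E -> exists2 A : R, 0 <= A &
  forall T N W, tempered T -> (forall j, wint (W j)) ->
  (forall j, j \notin zs N -> W j = (fun=> 0)) ->
  eqD T (distr_of (synth N W)) ->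
  (besov_norm phi s p q T <= A%:E * lq_norm q (fun j => (wgt s j)%:E * Lp p (W j)))%E.
Proof.
move=> p1 q1; have [A A0 h] := besov_approx s p1 q1; exists A => // T N W tT wW W0 TE.
pose W' j x : C := -1 * W j x.
have wW' j : wint (W' j) by exact: wintZ.
apply: le_trans (h T (fun=> 0) N W' tT tempered_zero wW' _ _) _.
- by move=> j jN; apply/funext => x; rewrite /W' W0// mulr0.
- move=> v Sv; rewrite TE// sub0r /distr_of.
  have Ss : schwartz (synth N W) by apply: schwartz_sum => j _; exact: schwartz_fat.
  rewrite (_ : synth N W' = (fun x => -1 * synth N W x)).
    have ci := schwartz_mul_cintable Ss Sv.
    transitivity (- (- cint mu (fun x => synth N W x * v x))); first by rewrite opprK.
    congr (- _); rewrite -(cintN ci); apply: eq_cint => x /=.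
    by rewrite mulN1r mulNr.
  apply/funext => x; rewrite /synth mulr_sumr; apply: eq_bigr => j _.
  by rewrite /W' /fat convolZ//; exact: schwartz_kapA.
- rewrite le_eqVlt; apply/orP; left; apply/eqP; congr (_ * lq_norm q _)%E.
  apply/funext => j; congr (_ * Lp p _)%E; apply/funext => x.
  by rewrite /blk /ptconv /W' mulN1r opprK add0r.
Qed.

End approximation.

(** * Distributions with annular spectrum and the lower bound for the pairing *)

Section annular_distributions.
Local Open Scope classical_set_scope.
Local Open Scope ring_scope.
Local Open Scope complex_scope.
Context {R : realType} {n : nat}.
Local Notation E := ('rV[R]_n).
Local Notation C := (R[i]).
Local Notation mu := (@lebesgue_rV R n).
Local Notation conj := (@hoelder_conjugate R).
Variable phi : E -> R.
Hypothesis cphi : cutoff phi.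
Implicit Types (f g w K : E -> C) (W : int -> E -> C) (p q : \bar R) (u T : @distrib R n).
Implicit Types (s t : R) (a b c d j k : int).

Lemma ann_out a b xi : a <= b -> ann phi a b xi != 0 -> 3 / 4 * 2 ^ a <= enorm xi.
Proof.
move=> ab; apply: contraNle => h; have h2 := exp2_le (R:=R) ab.
by rewrite /ann !(phic_eq1 cphi) ?subrr//; lra.
Qed.

(** For large [lambda] the support of the dilated [Theta] shrinks into the hole of the annulus, and
    the multiplier then annihilates [T] exactly. *)
Lemma annular_Sh' v T : annular phi v -> eqD T (distr_of v) -> Sh' T.
Proof.
move=> [Sv [a [b [ab e]]]] TE; have wv := schwartz_wint Sv.
have tT : tempered T by exact: tempered_eqD TE (tempered_distr_of Sv).
split=> // Theta tTh; have STh := test_schwartz tTh.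
have [A _ hA] := test_support tTh.
have y1 : (1 <= +oo :> \bar R)%E by rewrite leey.
have a0 := exp2_gt0 R a.
apply: cvg_near_cst; exists (Num.max 0 (A / (3 / 4 * 2 ^ a))); split; first exact: num_real.
(* Beyond this threshold the dilated [Theta] vanishes wherever [enorm xi] is at least [3/4 * 2^a],
   the inner radius of the annulus. *)
move=> lam; rewrite gt_max => /andP[l0 lA].
have Sm : schwartz (fun xi => Theta (lam *: xi)) by exact: schwartz_scale.
suff r0 : represents (fun=> 0) (multiplier (fun xi => Theta (lam *: xi)) T).
  by rewrite (Lp_norm_repr cphi y1 r0) Lp_zero.
split; first by apply/cmeasurableE; exact: cmfun_cst.
move=> w Sw; have z0 : ((fun=> 0) \* w) = (fun=> 0) :> (E -> C).
  by apply/funext => x /=; rewrite mul0r.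
rewrite z0; split; first by apply/cintegrableE; exact: cintable0.
rewrite -[RHS]/(cint mu (fun=> 0)) cint0 multiplierE//.
have [Sf _] := schwartz_convol (schwartz_kap Sm) (schwartz_wint Sw).
set f := convol _ w in Sf *.
rewrite TE// -[LHS]/(cint mu (fun x => v x * f x)).
have f0 : convol (kapA phi a b) f = (fun=> 0).
  rewrite /kapA /f (convol_kap2 (schwartz_ann cphi a b) Sm (schwartz_wint Sw)).
  rewrite (_ : (fun xi => _) = (fun=> 0)) ?kap_zero ?kap0//.
  apply/funext => xi; have [->|h] := eqVneq (ann phi a b xi) 0; first by rewrite mul0r.
  rewrite hA ?mulr0// enormZ (gtr0_norm l0).
  have h1 := ann_out ab h.
  apply: lt_le_trans (ler_wpM2l (ltW l0) h1).
  by rewrite -ltr_pdivrMr// mulr_gt0// divr_gt0.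
transitivity (cint mu (fun x => f x * convol (kapA phi a b) v x)).
  by apply: eq_cint => x; rewrite e mulrC.
rewrite (convol_sym (schwartz_kapA cphi a b) (kapA_even cphi a b) wv Sf) f0.
by under eq_cint do rewrite mul0r; exact: cint0.
Qed.

Lemma annular_blk v T : annular phi v -> eqD T (distr_of v) ->
  (forall k, blk phi k T = convol (kapj phi k) v) /\
  exists N0 : nat, forall k, (N0 < absz k)%N -> blk phi k T = (fun=> 0).
Proof.
move=> av TE; have [Sv _] := av.
have H k : blk phi k T = convol (kapj phi k) v.
  by rewrite (blk_eqD cphi k TE) blk_distr_of.
split=> //; have [N0 h] := annular_blocks cphi av; exists N0 => k /h; by rewrite H.
Qed.

Lemma annular_norm s p q v T : (1 <= p)%E -> (1 <= q)%E -> annular phi v ->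
  eqD T (distr_of v) -> (besov_norm phi s p q T < +oo)%E.
Proof.
move=> p1 q1 av TE; have [Sv _] := av; have [H [N0 h0]] := annular_blk av TE.
have tT : tempered T by exact: tempered_eqD TE (tempered_distr_of Sv).
have c0 j : (0 <= besov_coef phi s p T j)%E by exact: coef_ge0.
have [A A0 hA] := Lp_schwartz (n := n) p1.
have cy j : (besov_coef phi s p T j < +oo)%E.
  rewrite coefE// H; apply: lte_mul_pinfty; rewrite ?lee_fin ?wgt_ge0//.
  apply: le_lt_trans (hA _ _) (ltry _).
  exact/schwartz_kap_convol/schwartz_wint.
pose M := fine (\sum_(j <- zs N0) besov_coef phi s p T j) + 1.
have s0 : (0 <= \sum_(j <- zs N0) besov_coef phi s p T j)%E by apply: sume_ge0 => j _; exact: c0.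
apply: (@le_lt_trans _ _ M%:E); last by rewrite ltry.
apply: (@lq_fin_le _ _ _ M N0) => //.
- by rewrite /M ltr_wpDl// fine_ge0.
- move=> j; rewrite mem_zs -ltnNge => /h0 e0.
  by rewrite coefE// e0 Lp_zero// mule0.
- rewrite /M EFinD fineK ?leeDl ?lee_fin//.
  by rewrite (ge0_fin_numE s0); apply: lte_sum_pinfty => j _; exact: cy.
Qed.

Lemma schwartz_C0 f : schwartz f -> C0 f.
Proof.
move=> Sf; split.
- by move=> x; apply: differentiable_continuous; have [/(_ [::] x)[]] := Sf.
- by move=> x; apply: differentiable_continuous; have [/(_ [::] x)[]] := Sf.
- move=> e e0; exists (snorm 1 f / e) => x hx.
  have w0 := wt_gt0 x.
  have := le_snorm (k := 1) (s := [::]) x Sf isT; rewrite expr1 /= => h.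
  have : snorm 1 f < e * wt x.
    rewrite mulrC -ltr_pdivrMr//; apply: le_lt_trans hx _.
    by rewrite /wt ltrDr.
  by move=> h2; have := le_lt_trans h h2; rewrite mulrC ltr_pM2r.
Qed.

Section sup_bound.
Variables (s : R) (p q : \bar R).
Hypotheses (p1 : (1 <= p)%E) (q1 : (1 <= q)%E).
Local Notation NB := (besov_norm phi s p q).
Local Notation NB' := (besov_norm phi (- s) (conj p) (conj q)).
Let p1' : (1 <= conj p)%E. Proof. exact: hoelder_conj_ge1. Qed.
Let q1' : (1 <= conj q)%E. Proof. exact: hoelder_conj_ge1. Qed.

(** The three neighbours of block [j] reproduce it, so summing over the offset first turns the
    partial sums over near-diagonal pairs into the sums of [u (Delta_j v)], which converge to [u v]
    by [blocks_cvg]. *)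
Lemma besov_pairing_schwartz u v : Sh' u -> good phi s p q u -> schwartz v ->
  good' phi s p q (distr_of v) -> besov_pairing phi u (distr_of v) = u v.
Proof.
move=> hu gu Sv gv; have [tu _] := hu; have wv := schwartz_wint Sv.
have [cs _] := good_pairing cphi p1 q1 gu gv.
apply: (csum_unique nd_uniq mem_nd cs).
have SE N : \sum_(k <- nd N) block_pairing phi u (distr_of v) k =
    \sum_(j <- zs N) u (convol (kapj phi j) v).
  rewrite sum_nd; apply: eq_bigr => j _.
  have wj d : wint (convol (kapj phi d) v) by exact/schwartz_wint/schwartz_kap_convol.
  have wjj : wint (convol (kapj phi j) v) := wj j.
  rewrite (eq_bigr (fun d => u (convol (kapj phi j) (convol (kapj phi (j + d)) v)))); last first.
    move=> d _; have [_ [e _]] := block_pairingE cphi p1 q1 j (j + d) gu gv.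
    rewrite (blk_distr_of cphi (j + d) Sv) in e.
    exact: etrans e (esym (blk_convol cphi j tu (wj (j + d)))).
  rewrite -(tempered_sum _ tu); last by move=> d; exact/schwartz_kap_convol/wj.
  congr (u _); apply/funext => x.
  pose P b := lowpass phi b (convol (kapj phi j) v) x.
  have H d : convol (kapj phi j) (convol (kapj phi d) v) x = P (d + 1) - P d.
    by rewrite /kapj (convol_comm cphi _ _ _ _ wv) (convol_kapA cphi).
  rewrite (eq_bigr (fun d => P (j + d + 1) - P (j + d)) (fun d _ => H (j + d))) big_seq3.
  have -> : j + (-1) + 1 = j + 0 by lia.
  have -> : j + 0 + 1 = j + 1 by lia.
  have E4 (z1 z2 z3 z4 : C) : z2 - z1 + (z3 - z2 + (z4 - z3)) = z4 - z1 by ring.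
  rewrite E4 /P /lowpass -(convol_kapA cphi (j + (-1)) (j + 1 + 1) x wjj).
  by rewrite (convol_ann1 cphi)//; lia.
under eq_fun do rewrite SE.
apply/cvgrPdist_lt => e e0; have [N0 h] := blocks_cvg cphi hu Sv e0.
exists N0 => // N /= /h hN; rewrite sub0r normrN ger0_norm//; exact: normc_ge0.
Qed.

(** By contradiction, which also covers infinite norms: if the norm exceeds [c * S], a finitely
    supported sequence from [lq_converse] and a weight from [Lp_converse] in each block combine into
    an annular function of norm at most [c] on which [u] exceeds [c * S]. Only temperedness of [u]
    is assumed, so the bound applies to a representing distribution before it is known to lie in
    [Sh']. *)
Lemma norm_le_annular : exists2 c : R, 0 < c & forall u (S : R), tempered u -> 0 <= S ->
  (forall v M, annular phi v -> 0 < M -> (NB' (distr_of v) <= M%:E)%E -> normc (u v) <= S * M) ->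
  (NB u <= (c * S)%:E)%E.
Proof.
have [A A0 hA] := besov_synth cphi (- s) p1' q1'.
(* [A] is the cost of the synthesis and [2 * C1] that of convolving the weights with the block
   kernels; the 1 makes the constant positive. *)
pose c := A * (2 * C1 phi) + 1.
have C10 : 0 <= 2 * C1 phi by rewrite mulr_ge0// C1_ge0.
have c0 : 0 < c by rewrite ltr_wpDl// mulr_ge0.
exists c => // u S tu S0 hS; rewrite leNgt; apply/negP => lt1.
have cS0 : 0 <= c * S by rewrite mulr_ge0// ltW.
have cf0 j : (0 <= besov_coef phi s p u j)%E by exact: coef_ge0.
have [N [al [rho [alrho alN rhoa lqal tlt]]]] := lq_converse q1 cf0 cS0 lt1.
have ex j : exists w, exists r : R, [/\ wint w, (Lp (conj p) w <= 1)%E,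
    cint mu (fun y => blk phi j u y * w y) = r%:C & rho j <= wgt s j * r].
  have wg := wgt_gt0 s j.
  have [r0|rj] := rhoa j.
    exists (fun=> 0), 0; split; first exact: wint_cst0.
    - by rewrite Lp_zero.
    - by under eq_cint do rewrite mulr0; rewrite cint0.
    - by rewrite mulr0 r0.
  have lt2 : ((rho j / wgt s j)%:E < Lp p (blk phi j u))%E.
    rewrite ltNge; apply/negP => h; move: rj; rewrite coefE// ltNge => /negP; apply.
    have -> : rho j = wgt s j * (rho j / wgt s j) by rewrite mulrC divfK// lt0r_neq0.
    by rewrite EFinM; apply: lee_wpmul2l; rewrite ?lee_fin ?wgt_ge0.
  have q0 : 0 <= rho j / wgt s j by rewrite divr_ge0 ?wgt_ge0//; case: (alrho j).
  have [w [M [k [mw wM ws w1 [r tr er]]]]] := Lp_converse p1 (blk_cmfun cphi j tu) q0 lt2.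
  exists w, r; split=> //; first exact: (wint_bounded cphi mw wM ws).
  by rewrite mulrC -ler_pdivrMr.
have [w hw] := choice ex; have [r hr] := choice hw.
(* The factor [wgt s j] cancels the weight of the dual norm and restores the weight of the norm of
   [u] in the pairing. *)
pose cj j := al j * wgt s j.
have cj0 j : 0 <= cj j by rewrite mulr_ge0 ?wgt_ge0//; case: (alrho j).
have ww j : wint (fun x => (cj j)%:C * w j x) by apply: wintZ; case: (hr j).
pose W j := if j \in zs N then convol (kapj phi j) (fun x => (cj j)%:C * w j x) else (fun=> 0).
have wW j : wint (W j).
  rewrite /W; case: ifP => _; last exact: wint_cst0.
  exact/schwartz_wint/schwartz_kap_convol.
have W0 j : j \notin zs N -> W j = (fun=> 0) by rewrite /W => /negPf ->.
have av : annular phi (synth phi N W).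
  apply: annular_bigsum => // j; exact: (annular_kap cphi (fat_index_le j) (wW j)).
have [Sv _] := av.
have nv : (NB' (distr_of (synth phi N W)) <= c%:E)%E.
  apply: le_trans (hA _ N W (tempered_distr_of Sv) wW W0 _) _ => //.
  apply: (@le_trans _ _ (A%:E * ((2 * C1 phi)%:E * 1))%E); last first.
    by rewrite mule1 -EFinM lee_fin /c lerDl.
  apply: lee_wpmul2l; first by rewrite lee_fin.
  have l0 j : (0 <= (al j)%:E)%E by rewrite lee_fin; case: (alrho j).
  apply: (@le_trans _ _ ((2 * C1 phi)%:E * lq_norm (conj q) (fun j => (al j)%:E))%E); last first.
    by apply: lee_wpmul2l; rewrite ?lee_fin.
  apply: (@le_trans _ _ (lq_norm (conj q) (fun j => (2 * C1 phi)%:E * (al j)%:E)%E)); last first.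
    exact: lq_scale q1' C10 l0.
  apply: lq_le => // j; first by rewrite mule_ge0 ?Lp_ge0// lee_fin wgt_ge0.
  have [jN|jN] := boolP (j \in zs N); last first.
    by rewrite W0// Lp_zero// mule0 mule_ge0 ?lee_fin//; case: (alrho j).
  rewrite /W jN; have [wj w1 _ _] := hr j.
  apply: (@le_trans _ _ ((wgt (- s) j)%:E * ((cj j)%:E * (2 * C1 phi)%:E))%E).
    apply: lee_wpmul2l; first by rewrite lee_fin wgt_ge0.
    apply: le_trans (Lp_convol1 p1' (schwartz_kapj cphi j) (ww j)) _.
    apply: lee_pmul; rewrite ?Lp_ge0 ?lee_fin ?wnorm_ge0//.
      rewrite LpZ//; last by case: wj.
      rewrite normcR (ger0_norm (cj0 j)) -[leRHS]mule1.
      by apply: lee_wpmul2l; rewrite ?lee_fin.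
    exact: wnorm_kapA.
  rewrite -!EFinM lee_fin /cj.
  have E4 (z1 z2 z3 z4 : R) : z1 * (z2 * z3 * z4) = z4 * z2 * (z1 * z3) by ring.
  by rewrite E4 wgtN mulr1.
have := hS _ _ av c0 nv; apply/negP; rewrite -ltNge.
have uE : u (synth phi N W) = (\sum_(j <- zs N) cj j * r j)%:C.
  rewrite /synth (tempered_sum _ tu); last by move=> j; exact: schwartz_fat.
  rewrite rmorph_sum big_seq [RHS]big_seq; apply: eq_bigr => j jN.
  have [wj _ er _] := hr j.
  rewrite /W jN (fat_kapj cphi _ (ww j)) (blk_convol cphi j tu (ww j)).
  have ci := ptconv_cintable tu (schwartz_kapj cphi j) wj.
  transitivity ((cj j)%:C * (r j)%:C : C); last by rewrite -rmorphM.
  rewrite -er -(cintZ (cj j)%:C ci); apply: eq_cint => y.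
  by rewrite mulrCA.
rewrite uE normcR; apply: lt_le_trans (ler_norm _).
rewrite mulrC; apply: lt_le_trans tlt _; apply: ler_sum => j _.
have [al0 _] := alrho j; have [_ _ _ h] := hr j.
by rewrite /cj -mulrA ler_wpM2l.
Qed.

End sup_bound.

End annular_distributions.

(** * Tails and geometric bounds for series over the integers *)

Section int_series.
Local Open Scope classical_set_scope.
Local Open Scope ring_scope.
Context {R : realType}.
Implicit Types (q : \bar R) (a b : int -> \bar R) (j d k : int).

Lemma ler_succz j : j <= j + 1.
Proof. lia. Qed.

Lemma ltNz_zs (J : nat) j : j < - J%:Z -> (j \in zs J) = false /\ (j < 0) = true.
Proof. by move=> h; split; [rewrite mem_zs; apply/negbTE|]; lia. Qed.

Lemma mem_zsT N j : (j \in zs N) <-> ([set: int] j /\ (absz j <= N)%N).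
Proof. by rewrite mem_zs; split=> // -[]. Qed.

Lemma esum_tail a (e : R) : (forall j, (0 <= a j)%E) -> (\esum_(j in setT) a j < +oo)%E -> 0 < e ->
  exists J : nat, (\esum_(j in setT) (if j \in zs J then 0 else a j) <= e%:E)%E.
Proof.
move=> a0 ay e0; set S := (\esum_(j in setT) a j)%E in ay.
have S0 : (0 <= S)%E by exact: esum_ge0.
have Sf : S \is a fin_num by rewrite ge0_fin_numE.
have lt2 : ((fine S - e)%:E < S)%E by rewrite -[ltRHS](fineK Sf) lte_fin ltrBlDr ltrDl.
have [J hJ] := lt_sum_zs a0 lt2; exists J.
pose b j := if j \in zs J then a j else 0%E.
pose c j := if j \in zs J then 0%E else a j.
have b0 j : (0 <= b j)%E by rewrite /b; case: ifP.
have c0 j : (0 <= c j)%E by rewrite /c; case: ifP.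
have SE : S = (\esum_(j in setT) b j + \esum_(j in setT) c j)%E.
  rewrite -esumD//; apply: eq_esum => j _; rewrite /b /c.
  by case: ifP => _; rewrite ?adde0 ?add0e.
have bJ : (\sum_(j <- zs J) a j <= \esum_(j in setT) b j)%E.
  apply: le_trans (sum_zs_le J b0); rewrite big_seq [leRHS]big_seq.
  by apply: lee_sum => j jJ; rewrite /b jJ.
rewrite leNgt; apply/negP; rewrite -/c => ce.
have h : ((fine S - e)%:E + e%:E < S)%E.
  by rewrite [ltRHS]SE; apply: lteD => //; exact: lt_le_trans hJ bJ.
by move: h; rewrite -EFinD subrK fineK// ltxx.
Qed.

Lemma lq_l1 q a (M : R) : (1 <= q)%E -> (forall j, (0 <= a j)%E) -> 0 < M ->
  (forall N, (\sum_(j <- zs N) a j <= M%:E)%E) -> (lq_norm q a <= M%:E)%E.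
Proof.
move=> q1 a0 M0 sM.
have aM j : (a j <= M%:E)%E.
  have jN : j \in zs (absz j) by rewrite mem_zs.
  apply: le_trans (sM (absz j)); rewrite (bigD1_seq j) ?zs_uniq//= leeDl//.
  by apply: sume_ge0 => i _; exact: a0.
have aE j : a j = (fine (a j))%:E.
  by rewrite fineK// ge0_fin_numE// (le_lt_trans (aM j))// ltry.
pose al j := fine (a j) / M.
have al0 j : 0 <= al j by rewrite divr_ge0 ?fine_ge0// ltW.
have al1 j : al j <= 1 by rewrite ler_pdivrMr// mul1r -lee_fin -aE.
have H r : 1 <= r -> ((\esum_(j in setT) ((al j)%:E `^ r)) `^ r^-1 <= 1)%E.
  move=> r1; have r0 := lt_le_trans ltr01 r1.
  rewrite -(poweR1r r^-1); apply: poweR_le; rewrite ?invr_ge0 ?(ltW r0)//.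
    by apply: esum_ge0 => j _; exact: poweR_ge0.
  apply: (esum_le_sum zs_uniq mem_zsT) => [j _|N]; first exact: poweR_ge0.
  under eq_bigr do rewrite poweR_EFin; rewrite sumEFin lee_fin.
  apply: (@le_trans _ _ (\sum_(j <- zs N) al j)).
    apply: ler_sum => j _; rewrite -(mulr_powRB1 (al0 j) r0).
    rewrite -[leRHS]mulr1 ler_wpM2l//.
    have := @powR_le _ (r - 1) (al j) 1; rewrite powR1; apply=> //.
    by rewrite subr_ge0.
  rewrite -mulr_suml ler_pdivrMr// mul1r -lee_fin -sumEFin.
  by under eq_bigr do rewrite -aE.
have h : (lq_norm q (fun j => (al j)%:E) <= 1)%E.
  case/one_le_cases: (q1) => [e|[r e r1]|e].
  - by rewrite e /lq_norm; apply: H.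
  - by rewrite e /lq_norm; apply: H; exact: ltW.
  - by rewrite e /lq_norm; apply: ge_ereal_sup => _ [j _ <-]; rewrite lee_fin.
rewrite (_ : a = fun j => (M%:E * (al j)%:E)%E); last first.
  by apply/funext => j; rewrite -EFinM /al mulrC divfK ?lt0r_neq0.
have h0 j : (0 <= (al j)%:E)%E by rewrite lee_fin.
apply: le_trans (lq_scale q1 (ltW M0) h0) _.
by rewrite -[leRHS]mule1 lee_wpmul2l// lee_fin ltW.
Qed.

Lemma zsS N : zs N.+1 = (- N.+1%:Z) :: rcons (zs N) N.+1%:Z.
Proof.
have [K KE] : exists K, K = (2 * N).+1 by exists (2 * N).+1.
rewrite /zs -KE (_ : (2 * N.+1).+1 = (1 + (K + 1))%N); last by lia.
have e1 : [seq Posz i - Posz N.+1 | i <- iota (0 + 1) K] = [seq Posz i - Posz N | i <- iota 0 K].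
  by rewrite addnC (iotaDl 1 0) -map_comp; apply: eq_map => i /=; lia.
rewrite iotaD iotaD !map_cat e1 -cats1 /=; congr cons; first by lia.
by congr cat; congr cons; lia.
Qed.

Lemma sum_geo (th : R) N : 0 <= th -> th < 1 ->
  \sum_(j <- zs N) th ^+ absz j <= 2 / (1 - th).
Proof.
move=> t0 t1; have d0 : 0 < 1 - th by rewrite subr_gt0.
(* The induction runs on the partial geometric sum; counting the index 0 twice gives the closed
   form. *)
suff : \sum_(j <- zs N) th ^+ absz j <= 2 * (1 - th ^+ N.+1) / (1 - th).
  move=> h; apply: le_trans h _; rewrite ler_pM2r ?invr_gt0//.
  by rewrite ler_piMr// lerBlDr lerDl exprn_ge0.
elim: N => [|N ih].
  by rewrite /zs /= big_seq1 subr0 /= expr0 expr1 mulfK ?lt0r_neq0// ler1n.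
rewrite zsS big_cons -cats1 big_cat big_seq1 abszN absz_nat.
have -> : 2 * (1 - th ^+ N.+2) / (1 - th) = th ^+ N.+1 + (2 * (1 - th ^+ N.+1) / (1 - th) + th ^+ N.+1).
  by rewrite [th ^+ N.+2]exprS; move: (th ^+ N.+1) => z; field; rewrite lt0r_neq0.
by rewrite lerD2l lerD2r.
Qed.

End int_series.

(** * Bernstein's inequality and membership in the space of homogeneous distributions *)

Section bernstein.
Local Open Scope classical_set_scope.
Local Open Scope ring_scope.
Local Open Scope complex_scope.
Context {R : realType} {n : nat}.
Local Notation E := ('rV[R]_n).
Local Notation C := (R[i]).
Local Notation mu := (@lebesgue_rV R n).
Local Notation conj := (@hoelder_conjugate R).
Variable phi : E -> R.
Hypothesis cphi : cutoff phi.
Implicit Types (f g w K : E -> C) (q : \bar R) (u T : @distrib R n).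
Implicit Types (a b c d j k : int).
Variables (s : R) (p q : \bar R).
Hypotheses (p1 : (1 <= p)%E) (q1 : (1 <= q)%E).
Let p1' : (1 <= conj p)%E. Proof. exact: hoelder_conj_ge1. Qed.
Let q1' : (1 <= conj q)%E. Proof. exact: hoelder_conj_ge1. Qed.

(** The exponent [n/p - s] of the low-frequency factor; for [p = +oo] the inverse is 0. *)
Definition gap : R := n%:R * fine p^-1 - s.

Definition neg_wgt j : \bar R := (if j < 0 then wgt gap j else 0)%:E.

Lemma neg_wgt_ge0 j : (0 <= neg_wgt j)%E.
Proof. by rewrite /neg_wgt lee_fin; case: ifP => // _; exact: wgt_ge0. Qed.

Lemma neg_wgt_lty : 0 < gap \/ (0 <= gap /\ conj q = +oo%E) ->
  (lq_norm (conj q) neg_wgt < +oo)%E.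
Proof.
move=> [d0|[d0 qy]].
  pose th : R := 2 `^ (- gap).
  have t0 : 0 <= th by exact: powR_ge0.
  have t1 : th < 1.
    have h : 1 `^ gap < 2 `^ gap by apply: gt0_ltr_powR; rewrite ?nnegrE ?ltr1n.
    by rewrite powR1 in h; rewrite /th powRN invf_lt1 ?powR_gt0.
  have d1 : 0 < 2 / (1 - th) by rewrite divr_gt0// subr_gt0.
  apply: le_lt_trans (lq_l1 q1' neg_wgt_ge0 d1 _) (ltry _) => N.
  rewrite sumEFin lee_fin; apply: le_trans (sum_geo N t0 t1).
  apply: ler_sum => j _; case: ifPn => j0; last by rewrite exprn_ge0.
  rewrite -powR_mulrn// -powRrM le_eqVlt; apply/orP; left; apply/eqP; congr (2 `^ _).
  have -> : j = - (absz j)%:Z by lia.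
  by rewrite abszN mulrNz; ring.
apply: (@le_lt_trans _ _ 1%E); last by rewrite ltry.
rewrite qy /lq_norm; apply: ge_ereal_sup => _ [j _ <-]; rewrite lee_fin.
case: ifPn => // j0; rewrite -(powRr0 2); apply: ler_powR; first by rewrite ler1n.
by rewrite mulr_le0_ge0// lerz0 ltW.
Qed.

Lemma Lp_kapA3 : exists2 A : R, 0 <= A & forall j,
  (Lp (conj p) (kapA phi (j - 1) (j + 2)) <= (A * wgt (n%:R * fine p^-1) j)%:E)%E.
Proof.
have [A A0 hA] := Lp_kapj cphi p1; set g := n%:R * fine p^-1 in hA *.
exists (A * 3 * 2 `^ (1%:R * `|g|)); first by rewrite !mulr_ge0 ?powR_ge0.
move=> j.
have -> : kapA phi (j - 1) (j + 2) = (fun x => \sum_(d <- [:: -1; 0; 1]) kapj phi (j + d) x).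
  apply/funext => x; rewrite (big_seq3 (fun d => kapj phi (j + d) x)) /kapj.
  have -> : j + (-1) + 1 = j by lia.
  have -> : j + 1 + 1 = j + 2 by lia.
  by rewrite addr0 !(kapA_cat cphi).
apply: le_trans (Lp_sum _ p1' (fun d => schwartz_cmfun (schwartz_kapj cphi (j + d)))) _.
have H d : (absz d <= 1)%N -> (Lp (conj p) (kapj phi (j + d)) <= (A * (2 `^ (1%:R * `|g|) * wgt g j))%:E)%E.
  move=> d1; apply: le_trans (hA (j + d)) _; rewrite lee_fin ler_wpM2l//.
  by rewrite -/(wgt g (j + d)) wgtD mulrC ler_wpM2r ?wgt_ge0// wgt_shift.
rewrite big_seq3; apply: le_trans (leeD (H (-1) isT) (leeD (H 0 isT) (H 1 isT))) _.
rewrite -!EFinD lee_fin le_eqVlt; apply/orP; left; apply/eqP; ring.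
Qed.

(** Bernstein's inequality in dual form. Inserting the enlarged block around [w] leaves the block
    unchanged; Hoelder's inequality separates [u], and Young's inequality puts the norm of exponent
    p' on the enlarged kernel, whose scaling [2^(jn/p)] combines with the weight into
    [wgt gap j]. *)
Lemma block_le : exists2 A : R, 0 <= A & forall u j w, tempered u -> wint w ->
  ((normc (u (convol (kapj phi j) w)))%:E <=
   (A * wnorm 0 w)%:E * (besov_coef phi s p u j * (wgt gap j)%:E))%E.
Proof.
have [A A0 hA] := Lp_kapA3; exists A => // u j w tu ww.
have Sf := schwartz_fat cphi j ww; have wf := schwartz_wint Sf.
rewrite -(kapj_fat_diag cphi j ww) (blk_convol cphi j tu wf).
have ci := ptconv_cintable tu (schwartz_kapj cphi j) wf.
apply: le_trans (le_normc_cint ci) _.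
apply: le_trans (Lp_hoelder p1 (blk_cmfun cphi j tu) (schwartz_cmfun Sf)) _.
apply: (@le_trans _ _ (Lp p (blk phi j u) * ((A * wgt (n%:R * fine p^-1) j)%:E * (wnorm 0 w)%:E))%E).
  apply: lee_wpmul2l; first exact: Lp_ge0.
  apply: le_trans (Lp_convol2 p1' (schwartz_kapA cphi _ _) ww) _.
  by apply: lee_wpmul2r; rewrite ?lee_fin ?wnorm_ge0.
rewrite coefE// le_eqVlt; apply/orP; left; apply/eqP.
have -> : n%:R * fine p^-1 = s + gap by rewrite /gap addrC subrK.
have -> : wgt (s + gap) j = wgt s j * wgt gap j by rewrite /wgt mulrDr powRD// pnatr_eq0 implybT.
move: (Lp p (blk phi j u)) => L.
rewrite (muleC (wgt s j)%:E L) -(muleA L (wgt s j)%:E (wgt gap j)%:E) (muleCA (A * wnorm 0 w)%:E L).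
congr (L * _)%E.
by rewrite -!EFinM; congr EFin; ring.
Qed.

Lemma mult_repr u m : tempered u -> schwartz m ->
  represents (ptconv u (kap m)) (multiplier m u).
Proof.
move=> tu Sm; have Sk := schwartz_kap Sm; split; first exact/cmeasurableE/(ptconv_cmfun tu Sk).
move=> v Sv; split; first exact/cintegrableE/(ptconv_cintable tu Sk (schwartz_wint Sv)).
by rewrite multiplierE// (tempered_convol tu Sk (schwartz_wint Sv)).
Qed.

Lemma wnorm_trans K y : schwartz K -> wnorm 0 (trans K y) = wnorm 0 K.
Proof.
move=> SK; have mK : measurable_fun setT (fun z : E => (normc (K z))%:E).
  exact/measurable_EFin_normc/schwartz_cmfun.
have K0 (z : E) : (0 <= (normc (K z))%:E)%E by rewrite lee_fin.
rewrite /wnorm; apply: (congr1 fine).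
transitivity (\int[mu]_x (normc (K (x - y)))%:E)%E.
  by apply: eq_integral => x _; rewrite expr0 mul1r.
rewrite (@ge0_integral_translate R n (- y) _ mK K0).
by apply: eq_integral => x _; rewrite expr0 mul1r.
Qed.

Lemma ereal_cvg0 (f : R -> \bar R) : (forall x, (0 <= f x)%E) ->
  (forall e : R, 0 < e -> exists M, forall x, M < x -> (f x <= e%:E)%E) ->
  f x @[x --> +oo] --> 0%E.
Proof.
move=> f0 h B nB.
have /nbhs_ballP[e /= e0 hB] : nbhs (0 : R) (fun r => B r%:E) := nB.
have [M hM] := h (e / 2) (divr_gt0 e0 (ltr0n _ 2)).
exists M; split; first exact: num_real.
move=> x /hM fx; have ff : f x \is a fin_num.
  by rewrite ge0_fin_numE// (le_lt_trans fx)// ltry.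
rewrite /= -(fineK ff); apply: hB; rewrite /ball /= sub0r normrN.
rewrite ger0_norm ?fine_ge0//; apply: (@le_lt_trans _ _ (e / 2)).
  by rewrite -lee_fin fineK.
by rewrite ltr_pdivrMr// ltr_pMr// ltr1n.
Qed.

(** A dilated [Theta] with large [lambda] lets only blocks of very negative index through, and by
    [block_le] their sum is a tail of a series that converges by Hoelder's inequality, uniformly in
    the translate. The last hypothesis says that [u] is the sum of its blocks, which excludes a
    polynomial part invisible to them. *)
Lemma Sh'_of_blocks u : tempered u -> (besov_norm phi s p q u < +oo)%E ->
  (lq_norm (conj q) neg_wgt < +oo)%E ->
  (forall v (e : R), schwartz v -> 0 < e -> exists N : nat,
    normc (\sum_(j <- zs N) u (convol (kapj phi j) v) - u v) < e) ->
  Sh' u.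
Proof.
move=> tu uy wy cv; split=> // Theta tTh.
have STh := test_schwartz tTh; have [A _ hA] := test_support tTh.
have y1 : (1 <= +oo :> \bar R)%E by rewrite leey.
have [B B0 hB] := block_le.
pose a j := (besov_coef phi s p u j * neg_wgt j)%E.
have cf0 j : (0 <= besov_coef phi s p u j)%E by exact: coef_ge0.
have a0 j : (0 <= a j)%E by rewrite /a mule_ge0 ?neg_wgt_ge0.
have ay : (\esum_(j in setT) a j < +oo)%E.
  apply: (@le_lt_trans _ _ (besov_norm phi s p q u * lq_norm (conj q) neg_wgt)%E).
    apply: (esum_le_sum zs_uniq mem_zsT) => // N.
    exact: (lq_hoelder N q1 cf0 neg_wgt_ge0).
  by apply: lte_mul_pinfty => //; rewrite ?ge0_fin_numE// norm_ge0.
have w0 := wnorm_ge0 0 (kap Theta).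
pose D := B * wnorm 0 (kap Theta).
have D0 : 0 <= D by rewrite mulr_ge0.
apply: ereal_cvg0 => [lam|e e0].
  by apply: le_ereal_inf_tmp => _ [f _ <-]; exact: Lnorm_ge0.
have e'0 : 0 < e / (D + 1) by rewrite divr_gt0// ltr_wpDl.
have [J hJ] := esum_tail a0 ay e'0.
have p0 := exp2_gt0 R (- J%:Z).
(* Above this threshold the dilated [Theta] vanishes on the supports of the symbols of all blocks of
   index at least [-J]. *)
exists (Num.max 0 (A / (3 / 4 * 2 ^ (- J%:Z)))) => lam; rewrite gt_max => /andP[l0 lA].
have Sm : schwartz (fun xi => Theta (lam *: xi)) by exact: schwartz_scale.
set m := fun xi => _ in Sm *; have Sk := schwartz_kap Sm.
rewrite (Lp_norm_repr cphi y1 (mult_repr tu Sm)) /Lp Npy; last by move=> x; exact: normc_ge0.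
apply/ess_supP; apply: aeW => y; rewrite lee_fin.
have [St _] := schwartz_trans y Sk; have wt' := schwartz_wint St.
have z0 j : - J%:Z <= j -> convol (kapj phi j) (trans (kap m) y) = (fun=> 0).
  move=> jJ; apply/funext => x.
  rewrite (convol_trans y x (schwartz_kapj cphi j) Sk) /kapj /kapA.
  rewrite (convol_kapM (schwartz_ann cphi j (j + 1)) Sm).
  rewrite (_ : (fun xi => _) = (fun=> 0)) ?kap_zero//.
  apply/funext => xi; have [->|h] := eqVneq (ann phi j (j + 1) xi) 0; first by rewrite mul0r.
  rewrite /m hA ?mulr0// enormZ (gtr0_norm l0).
  have jj := ler_succz j.
  have h1 := ann_out cphi jj h.
  have h2 := exp2_le (R:=R) jJ.
  have h3 : 3 / 4 * 2 ^ (- J%:Z) <= enorm xi.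
    by apply: le_trans h1; apply: ler_wpM2l h2; rewrite divr_ge0.
  apply: lt_le_trans (ler_wpM2l (ltW l0) h3).
  by rewrite -ltr_pdivrMr// mulr_gt0// divr_gt0.
have sb N : normc (\sum_(j <- zs N) u (convol (kapj phi j) (trans (kap m) y))) <= D * (e / (D + 1)).
  rewrite -lee_fin.
  apply: (@le_trans _ _ (\sum_(j <- zs N) (normc (u (convol (kapj phi j) (trans (kap m) y))))%:E)%E).
    by rewrite sumEFin lee_fin; exact: normc_sum.
  apply: (@le_trans _ _ (\sum_(j <- zs N) (D%:E * (if j \in zs J then 0 else a j)))%E).
    apply: lee_sum => j _; have [jJ|jJ] := leP (- J%:Z) j.
      rewrite z0// tempered0// normc0 mule_ge0 ?lee_fin//.
      by case: ifP.
    have [-> j0] := ltNz_zs jJ.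
    apply: le_trans (hB u j _ tu wt') _.
    rewrite (wnorm_trans y Sk) (wnorm_kap_scale l0 STh) /D /a /neg_wgt.
    by rewrite j0.
  rewrite -ge0_sume_distrr; last by move=> j _; case: ifP.
  rewrite (EFinM D (e / (D + 1))); apply: lee_wpmul2l; first by rewrite lee_fin.
  apply: le_trans hJ; apply: (sum_zs_le N (a := fun j => if j \in zs J then 0%E else a j)).
  by move=> j; case: ifP.
have De : D * (e / (D + 1)) < e.
  by rewrite mulrA ltr_pdivrMr ?ltr_wpDl// mulrC ltr_pM2l// ltrDl.
(* The partial sums stay below [D * (e / (D + 1)) < e], so a value above [e] could not be approached
   by them. *)
rewrite leNgt; apply/negP => lt1.
have d0 : 0 < normc (ptconv u (kap m) y) - D * (e / (D + 1)).
  by rewrite subr_gt0 (lt_trans De).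
have [N hN] := cv _ _ St d0.
move: hN; rewrite ltNge => /negP; apply.
rewrite lerBlDr; apply: le_trans (lerD (lexx _) (sb N)).
rewrite -[u _]/(ptconv u (kap m) y).
set z1 := ptconv _ _ _; set z2 := \sum_(j <- _) _.
rewrite {1}(_ : z1 = - (z2 - z1) + z2); last by ring.
by apply: le_trans (normcD _ _) _; rewrite normcN.
Qed.

End bernstein.

(** * Representation of functionals *)

Section duality_proof.
Local Open Scope classical_set_scope.
Local Open Scope ring_scope.
Local Open Scope complex_scope.
Context {R : realType} {n : nat}.
Local Notation E := ('rV[R]_n).
Local Notation C := (R[i]).
Local Notation mu := (@lebesgue_rV R n).
Local Notation conj := (@hoelder_conjugate R).
Variable phi : E -> R.
Hypothesis cphi : cutoff phi.
Implicit Types (f g w v : E -> C) (u T U : @distrib R n) (j k : int) (z : C).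

Lemma distr_lin z v w : schwartz v -> schwartz w ->
  eqD (z \*o distr_of v \+ distr_of w) (distr_of (fun x => z * v x + w x)).
Proof.
move=> Sv Sw f Sf.
have cv := schwartz_mul_cintable Sv Sf; have cw := schwartz_mul_cintable Sw Sf.
rewrite -[LHS]/(z * cint mu (fun x => v x * f x) + cint mu (fun x => w x * f x)).
rewrite -(cintZ z cv) -(cintD (cintableZ z cv) cw).
by apply: eq_cint => x /=; rewrite mulrDl mulrA.
Qed.

Lemma distrZ z v f : schwartz v -> schwartz f ->
  distr_of (fun x => z * v x) f = z * distr_of v f.
Proof.
move=> Sv Sf; have cv := schwartz_mul_cintable Sv Sf.
rewrite -[RHS]/(z * cint mu (fun x => v x * f x)) -(cintZ z cv).
by apply: eq_cint => x /=; rewrite mulrA.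
Qed.

Lemma distr0 f : @distr_of R n (fun=> 0) f = 0.
Proof.
rewrite -[LHS]/(cint mu (fun x => 0 * f x)).
by under eq_cint do rewrite mul0r; exact: cint0.
Qed.

Lemma norm_zeroD t r1 r2 T (M : R) : (1 <= r1)%E -> (1 <= r2)%E -> eqD T (fun=> 0) -> 0 < M ->
  (besov_norm phi t r1 r2 T <= M%:E)%E.
Proof.
move=> h1 h2 TE M0; have tT := tempered_eqD TE tempered_zero.
have c0 j : besov_coef phi t r1 T j = 0%E.
  rewrite (coefE cphi t j h1 tT) (blk_eqD cphi j TE).
  by rewrite (_ : blk phi j (fun=> 0) = (fun=> 0))// Lp_zero// mule0.
apply: (@lq_fin_le _ _ _ M 0) => // [j|]; first by rewrite c0.
by rewrite big1 ?lee_fin ?(ltW M0)// => j _; rewrite c0.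
Qed.

Lemma norm_scaleD t r1 r2 z T U : (1 <= r1)%E -> (1 <= r2)%E -> tempered U ->
  eqD T (fun v => z * U v) ->
  (besov_norm phi t r1 r2 T <= (normc z)%:E * besov_norm phi t r1 r2 U)%E.
Proof.
move=> h1 h2 tU TE.
have tT : tempered T.
  apply: tempered_eqD (tempered_comb z tU (tempered_zero (n := n))) => v Sv.
  by rewrite /= TE// addr0.
have U0 j : (0 <= besov_coef phi t r1 U j)%E by exact: coef_ge0.
apply: le_trans (lq_scale h2 (normc_ge0 z) U0).
apply: lq_le => // j; first exact: coef_ge0.
rewrite (coefE cphi t j h1 tT) (coefE cphi t j h1 tU) (blk_eqD cphi j TE).
rewrite (_ : blk phi j (fun v => z * U v) = (fun x => z * blk phi j U x))//.
by rewrite LpZ//; [rewrite muleCA|exact: blk_cmfun].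
Qed.

Lemma snorm_mono (k l : nat) v : schwartz v -> (k <= l)%N -> snorm k v <= snorm l v.
Proof.
move=> Sv kl; apply: snorm_le => // t x tk.
apply: le_trans (le_snorm x Sv (leq_trans tk kl)).
by rewrite ler_wpM2r// wtX_le.
Qed.

Lemma phase z : exists2 c : C, normc c <= 1 & c * z = (normc z)%:C.
Proof.
have [->|z0] := eqVneq z 0; first by exists 0; rewrite ?normc0 ?mul0r.
have n0 : normc z != 0 by apply: contra_neq z0; exact: normc_eq0.
exists ((z^*)%C * (normc z)^-1%:C).
  by rewrite normcM normc_conj normcR ger0_norm ?invr_ge0 ?normc_ge0// mulfV.
rewrite mulrAC (mulrC _ z) mulc_conj -rmorphM; congr (_%:C).
by rewrite expr2 mulfK.
Qed.

Section exponents.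
Variables (s : R) (p q : \bar R).
Hypotheses (p1 : (1 <= p)%E) (q1 : (1 <= q)%E).
Hypothesis gap_lty : (lq_norm (conj q) (neg_wgt s p (n := n)) < +oo)%E.
Local Notation NB := (besov_norm phi s p q).
Local Notation NB' := (besov_norm phi (- s) (conj p) (conj q)).
Let p1' : (1 <= conj p)%E. Proof. exact: hoelder_conj_ge1. Qed.
Let q1' : (1 <= conj q)%E. Proof. exact: hoelder_conj_ge1. Qed.

(** Blocks of a Schwartz function decay faster than any power of [2^-j]; the rate [2^-j] is kept
    after the weight has been absorbed. *)
Definition pos_wgt j : \bar R := (if 0 <= j then (2^-1) ^+ absz j else 0 : R)%:E.
Definition all_wgt j : \bar R := (neg_wgt s p (n := n) j + pos_wgt j)%E.

Lemma pos_wgt_ge0 j : (0 <= pos_wgt j)%E.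
Proof. by rewrite /pos_wgt lee_fin; case: ifP => // _; rewrite exprn_ge0// invr_ge0. Qed.

Lemma all_wgt_ge0 j : (0 <= all_wgt j)%E.
Proof. by rewrite /all_wgt adde_ge0 ?neg_wgt_ge0 ?pos_wgt_ge0. Qed.

Lemma all_wgt_lty : (lq_norm (conj q) all_wgt < +oo)%E.
Proof.
have h0 := @neg_wgt_ge0 R n s p.
have l0 : (0 <= lq_norm (conj q) (neg_wgt s p (n := n)))%E by exact: lq_ge0.
apply: (@le_lt_trans _ _ (4%:E * (lq_norm (conj q) (neg_wgt s p (n := n)) + 4%:E))%E); last first.
  by rewrite lte_mul_pinfty ?lee_fin// lte_add_pinfty// ltry.
have f0 : 0 < 4 :> R by [].
apply: lq_add => //; [exact: pos_wgt_ge0|by rewrite leeDl ?lee_fin|].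
apply: (@le_trans _ _ 4%:E); last by rewrite leeDr.
apply: (lq_l1 q1' pos_wgt_ge0 f0) => N; rewrite sumEFin lee_fin.
have t0 : 0 <= 2^-1 :> R by rewrite invr_ge0.
have t1 : 2^-1 < 1 :> R by rewrite invf_lt1 ?ltr1n.
apply: (@le_trans _ _ (2 / (1 - 2^-1))); last by rewrite le_eqVlt; apply/orP; left; apply/eqP; field.
apply: le_trans (sum_geo N t0 t1); apply: ler_sum => j _.
by case: ifP => // _; rewrite exprn_ge0.
Qed.

(** For negative [j] the norm of exponent p' falls on the block kernel, which gives the
    low-frequency factor; for the other [j] the decay of [kap_decay] beats the weight. *)
Lemma schwartz_block_le : exists2 Q : R, 0 <= Q & exists k : nat, forall v j, schwartz v ->
  ((wgt (- s) j)%:E * Lp (conj p) (convol (kapj phi j) v) <=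
   (Q * snorm k v)%:E * all_wgt j)%E.
Proof.
have o1 : (1 <= 1 :> \bar R)%E by [].
have [A A0 hA] := Lp_kapj cphi p1.
have [D D0 hD] := Lp_schwartz (n := n) o1.
have [A' A'0 hA'] := Lp_schwartz (n := n) p1'.
(* [N] powers of [2^-j] absorb the weight [2^(-js)], and the decay of order [N + 1] leaves one
   more. *)
pose N := Num.bound `|s|.
have sN : `|s| <= N%:R by rewrite ltW// archi_boundP.
have [B B0 hB] := kap_decay cphi N (2 * n).
exists (A * D + A' * B); first by rewrite addr_ge0 ?mulr_ge0.
exists (2 * n + N.+1)%N => v j Sv; have wv := schwartz_wint Sv.
have Sn := snorm_ge0 (2 * n + N.+1) v.
have [j0|j0] := ltP j 0.
  have -> : all_wgt j = (wgt (gap s p (n := n)) j)%:E.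
    by rewrite /all_wgt /neg_wgt /pos_wgt j0 leNgt j0 /= adde0.
  apply: (@le_trans _ _ ((wgt (- s) j)%:E * ((A * wgt (n%:R * fine p^-1) j)%:E * (D * snorm (2 * n) v)%:E))%E).
    apply: lee_wpmul2l; first by rewrite lee_fin wgt_ge0.
    apply: le_trans (Lp_convol2 p1' (schwartz_kapj cphi j) wv) _.
    apply: lee_pmul; [exact: Lp_ge0|by rewrite lee_fin wnorm_ge0|exact: hA|].
    by rewrite -(Lp1E wv); exact: hD.
  rewrite -!EFinM lee_fin.
  have -> : wgt (gap s p (n := n)) j = wgt (- s) j * wgt (n%:R * fine p^-1) j.
    by rewrite /wgt /gap -powRD ?pnatr_eq0 ?implybT//; congr (2 `^ _); ring.
  have E5 (z1 z2 z3 z4 z5 : R) : z1 * (z2 * z3 * (z4 * z5)) = z2 * z4 * z5 * (z1 * z3) by ring.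
  rewrite E5; apply: ler_wpM2r; first by rewrite mulr_ge0 ?wgt_ge0.
  apply: ler_pM; rewrite ?mulr_ge0 ?snorm_ge0//; first by rewrite lerDl mulr_ge0.
  by apply: snorm_mono => //; exact: leq_addr.
have -> : all_wgt j = ((2^-1) ^+ absz j)%:E.
  by rewrite /all_wgt /neg_wgt /pos_wgt j0 ltNge j0 /= add0e.
apply: (@le_trans _ _ ((wgt (- s) j)%:E * (A' * (B * (2 ^ (- j)) ^+ N.+1 * snorm (2 * n + N.+1) v))%:E)%E).
  apply: lee_wpmul2l; first by rewrite lee_fin wgt_ge0.
  apply: le_trans (hA' _ (schwartz_kap_convol cphi _ _ wv)) _.
  by rewrite lee_fin ler_wpM2l//; exact: hB.
rewrite -EFinM -EFinM lee_fin; case: j j0 => // m _ /=.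
have p2 : 0 < (2 : R) ^+ m by rewrite exprn_gt0.
have w1 : wgt (- s) m%:Z <= (2 ^+ m) ^+ N.
  rewrite -exprM -powR_mulrn// natrM; apply: ler_powR; first by rewrite ler1n.
  rewrite -[m%:Z%:~R]/(m%:R : R); apply: ler_wpM2l => //.
  by apply: le_trans sN; apply: le_trans (ler_norm _) _; rewrite normrN.
have e1 : (2 : R) ^ (- m%:Z) = (2 ^+ m)^-1 by rewrite -[LHS]invr_expz.
rewrite e1 (_ : (2^-1 : R) ^+ m = (2 ^+ m)^-1); last by rewrite exprVn.
set X := (2 : R) ^+ m in p2 w1 *; set S := snorm _ v in Sn *.
apply: (@le_trans _ _ (X ^+ N * (A' * (B * X^-1 ^+ N.+1 * S)))).
  have n0 : 0 <= X^-1 ^+ N.+1 by apply: exprn_ge0; rewrite invr_ge0 ltW.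
  exact: (ler_wpM2r (mulr_ge0 A'0 (mulr_ge0 (mulr_ge0 B0 n0) Sn)) w1).
have -> : X ^+ N * (A' * (B * X^-1 ^+ N.+1 * S)) = A' * B * S * X^-1.
  have XN : X ^+ N * X^-1 ^+ N = 1 by rewrite -exprMn mulfV ?expr1n// lt0r_neq0.
  rewrite exprS (_ : _ * _ = A' * B * S * X^-1 * (X ^+ N * X^-1 ^+ N)); last by ring.
  by rewrite XN mulr1.
apply: ler_wpM2r; first by rewrite invr_ge0 ltW.
by apply: ler_wpM2r => //; rewrite lerDr mulr_ge0.
Qed.

(** [norm_le_annular] normalised to test functions in the unit ball, with a possibly infinite
    bound. *)
Lemma norm_le_sup : exists2 c : R, 0 < c & forall u (D : \bar R), tempered u -> (0 <= D)%E ->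
  (forall v, annular phi v -> (NB' (distr_of v) <= 1)%E -> ((normc (u v))%:E <= D)%E) ->
  (NB u <= c%:E * D)%E.
Proof.
have [c c0 h] := norm_le_annular cphi s p1 q1; exists c => // u D tu D0 hD.
case: D D0 hD => [S|_ _|//]; last by rewrite gt0_muley ?lte_fin// leey.
rewrite lee_fin => S0 hS; rewrite -EFinM; apply: h => // v M av M0 vM.
have [Sv _] := av; have mv : 0 <= M^-1 by rewrite invr_ge0 ltW.
have av' : annular phi (fun x => M^-1%:C * v x + 0) by apply: annular_lin => //; exact: annular0.
have Sv' := av'.1.
have SMv : (fun x => M^-1%:C * v x + 0) = (fun x => M^-1%:C * v x) by apply/funext => x; rewrite addr0.
rewrite SMv in av' Sv'.
have : ((normc (u (fun x => M^-1%:C * v x)%R))%:E <= S%:E)%E.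
  apply: hS => //; apply: le_trans (norm_scaleD _ p1' q1' (tempered_distr_of Sv) _) _.
  - by move=> f Sf; exact: (distrZ M^-1%:C Sv Sf).
  - rewrite normcR ger0_norm//; apply: (@le_trans _ _ (M^-1%:E * M%:E)%E).
      by apply: lee_wpmul2l; rewrite ?lee_fin.
    by rewrite -EFinM mulVf ?lt0r_neq0.
rewrite lee_fin temperedZ// normcM normcR ger0_norm// => h1.
by rewrite -ler_pdivrMr// mulrC.
Qed.

Lemma tempered_sub T U : tempered T -> tempered U -> tempered (T \- U).
Proof.
move=> tT tU; apply: tempered_eqD (tempered_comb (-1) tU tT) => v Sv /=.
by rewrite mulN1r addrC.
Qed.

Lemma pairing_leK u T (K1 K2 : R) : tempered u -> tempered T ->
  (NB u <= K1%:E)%E -> (NB' T <= K2%:E)%E ->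
  normc (besov_pairing phi u T) <= pc s * (K1 * K2).
Proof.
move=> tu tT uK TK; rewrite -lee_fin (EFinM (pc s)) (EFinM K1).
have gu : good phi s p q u by split=> //; exact: le_lt_trans uK (ltry _).
have gT : good' phi s p q T by split=> //; exact: le_lt_trans TK (ltry _).
have [_ h] := good_pairing cphi p1 q1 gu gT; apply: le_trans h _.
apply: lee_wpmul2l; first by rewrite lee_fin pc_ge0.
by apply: lee_pmul; rewrite ?norm_ge0.
Qed.

(** * An abstract predual in which functions with annular spectrum are dense *)

Section dual_space.
Variable X : set (@distrib R n).
Hypothesis XB : forall T, X T -> Sh' T /\ (NB' T < +oo)%E.
Hypothesis XA : forall T v, annular phi v -> eqD T (distr_of v) -> X T.
Hypothesis Xapp : forall T (e : R), X T -> 0 < e ->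
  exists2 g, annular phi g & (NB' (distr_of g \- T)%R < e%:E)%E.

Let XAd v : annular phi v -> X (distr_of v).
Proof. by move=> av; apply: (XA av). Qed.

Let goodX T : X T -> good' phi s p q T.
Proof. by move=> /XB[[tT _] Ty]. Qed.

Section functional.
Variable l : @distrib R n -> C.
Hypothesis hl : top_dual X NB' l.
Let Lv v := l (distr_of v).

(** The functional sees all values of its argument, whereas distributions matter only through
    Schwartz functions; the difference has norm zero, so continuity forces equal values. *)
Lemma functional_eqD T U : X T -> X U -> eqD T U -> l T = l U.
Proof.
move=> XT XU TU; have [_ lc] := hl; apply/eqP; rewrite -subr_eq0; apply/eqP.
apply: contrapT => /eqP ne.
have e0 : 0 < normc (l T - l U).
  by rewrite lt_neqAle normc_ge0 andbT eq_sym; apply: contra_neq ne; exact: normc_eq0.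
have [d d0 h] := lc U XU _ e0.
have := h T XT; rewrite ltxx => hh; apply/notF/hh.
have d2 : 0 < d / 2 by rewrite divr_gt0.
apply: le_lt_trans (norm_zeroD _ p1' q1' _ d2) _.
  by move=> v Sv /=; rewrite TU// subrr.
by rewrite lte_fin ltr_pdivrMr// ltr_pMr// ltr1n.
Qed.

Lemma functional_lin z v w : annular phi v -> annular phi w ->
  Lv (fun x => z * v x + w x) = z * Lv v + Lv w.
Proof.
move=> av aw; have [ll _] := hl; rewrite /Lv -(ll z _ _ (XAd av) (XAd aw)).
have Dl := distr_lin z av.1 aw.1; have avw := annular_lin cphi z av aw.
apply: functional_eqD; [exact: XAd|exact: (XA avw Dl)|].
by move=> f Sf; rewrite Dl.
Qed.

Lemma functional0 : Lv (fun=> 0) = 0.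
Proof.
have := functional_lin 1 (annular0 cphi) (annular0 cphi); 
  rewrite (_ : (fun x : E => 1 * 0 + 0) = (fun=> 0)) ?mul1r; last first.
  by apply/funext => x; rewrite ?mulr0 addr0.
by move=> /eqP; rewrite -subr_eq0 opprD addrA subrr sub0r oppr_eq0 => /eqP.
Qed.

Lemma functionalZ z v : annular phi v -> Lv (fun x => z * v x) = z * Lv v.
Proof.
move=> av; have := functional_lin z av (annular0 cphi); rewrite functional0 addr0 => <-.
by congr Lv; apply/funext => x; rewrite addr0.
Qed.

Lemma functional_sum (I : Type) (r : seq I) (F : I -> E -> C) : (forall i, annular phi (F i)) ->
  Lv (fun x => \sum_(i <- r) F i x) = \sum_(i <- r) Lv (F i).
Proof.
move=> aF; elim: r => [|i r ih].
  rewrite big_nil; transitivity (Lv (fun=> 0)); last exact: functional0.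
  by congr Lv; apply/funext => x; rewrite big_nil.
rewrite big_cons -ih -[Lv (F i)]mul1r -functional_lin//; last exact: annular_bigsum.
by congr Lv; apply/funext => x; rewrite big_cons mul1r.
Qed.

(** Continuity at zero and rescaling; the case [K = 0] follows by enlarging [K] slightly. *)
Lemma functional_bound : exists2 M : R, 0 < M & forall v (K : R), annular phi v -> 0 <= K ->
  (NB' (distr_of v) <= K%:E)%E -> normc (Lv v) <= M * K.
Proof.
have [_ lc] := hl; have [d d0 h] := lc _ (XAd (annular0 cphi)) _ ltr01.
have M0 : 0 < 2 / d by rewrite divr_gt0.
exists (2 / d) => //.
have H v (K : R) : annular phi v -> 0 < K -> (NB' (distr_of v) <= K%:E)%E ->
    normc (Lv v) <= 2 / d * K.
  move=> av K0 vK; have [Sv _] := av.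
  (* This factor brings the norm down to [d / 2], strictly inside the ball of radius [d] given by
     continuity. *)
  pose t := d / (2 * K); have t0 : 0 < t by rewrite divr_gt0// mulr_gt0.
  have av' : annular phi (fun x => t%:C * v x).
    have := annular_lin cphi t%:C av (annular0 cphi).
    by congr (annular phi _); apply/funext => x; rewrite addr0.
  have := h _ (XAd av'); rewrite -/(Lv _) -/(Lv (fun=> 0)) functional0 subr0 functionalZ//.
  rewrite normcM normcR (gtr0_norm t0) => /(_ _) H.
  have : t * normc (Lv v) < 1.
    apply: H; apply: le_lt_trans (norm_scaleD (z := t%:C) _ p1' q1' (tempered_distr_of Sv) _) _.
      by move=> f Sf /=; rewrite distr0 subr0 distrZ.
    rewrite normcR (gtr0_norm t0); apply: (@le_lt_trans _ _ (t%:E * K%:E)%E).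
      by apply: lee_wpmul2l; rewrite ?lee_fin ?(ltW t0).
    rewrite -EFinM lte_fin /t (_ : d / (2 * K) * K = d / 2); last by field; rewrite lt0r_neq0.
    by rewrite ltr_pdivrMr// ltr_pMr// ltr1n.
  rewrite mulrC -ltr_pdivlMr// div1r /t invf_div => /ltW h1.
  by apply: le_trans h1 _; rewrite mulrAC.
move=> v K av K0 vK; apply/ler_addgt0Pr => e e0.
have e1 : 0 < e / (2 / d) by rewrite divr_gt0.
apply: le_trans (H v (K + e / (2 / d)) av _ _) _; first by rewrite ltr_wpDl.
  by apply: le_trans vK _; rewrite lee_fin lerDl ltW.
by rewrite mulrDr lerD2l mulrC divfK// lt0r_neq0.
Qed.

Let ej v j := Lv (convol (kapj phi j) v).

Let aj v j : schwartz v -> annular phi (convol (kapj phi j) v).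
Proof. by move=> Sv; apply: annular_kap => //; [exact: ler_succz|exact: schwartz_wint]. Qed.

(** Multiplying each block of [v] by a phase [z j] turns the sum of moduli into one value of the
    functional, at a synthesised function whose norm is controlled by [schwartz_block_le] uniformly
    in [N]. The same bound gives the summability and the temperedness of the representing series. *)
Lemma functional_sum_bound : exists2 B : R, 0 <= B & exists k : nat, forall v N, schwartz v ->
  \sum_(j <- zs N) normc (ej v j) <= B * snorm k v.
Proof.
have [M M0 hM] := functional_bound.
have [Q Q0 [k hQ]] := schwartz_block_le.
have [A A0 hA] := besov_synth cphi (- s) p1' q1'.
have l0 : (0 <= lq_norm (conj q) all_wgt)%E by apply: lq_ge0 => // j; exact: all_wgt_ge0.
have lf : lq_norm (conj q) all_wgt \is a fin_num by rewrite ge0_fin_numE// all_wgt_lty.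
pose L := fine (lq_norm (conj q) all_wgt).
have L0 : 0 <= L by rewrite fine_ge0.
exists (M * (A * (Q * L))); first by rewrite !mulr_ge0// ltW.
exists k => v N Sv; have wv := schwartz_wint Sv.
have S0 := snorm_ge0 k v.
have ex j : exists c : C, normc c <= 1 /\ c * ej v j = (normc (ej v j))%:C.
  by have [c h1 h2] := phase (ej v j); exists c.
have [z hz] := choice ex.
pose W j := if j \in zs N then (fun x => z j * convol (kapj phi j) v x) else (fun=> 0).
have wW j : wint (W j).
  rewrite /W; case: ifP => _; last exact: wint_cst0.
  exact/wintZ/schwartz_wint/(aj j Sv).1.
have W0 j : j \notin zs N -> W j = (fun=> 0) by rewrite /W => /negPf ->.
have af j : annular phi (fat phi j (W j)) := annular_kap cphi (fat_index_le j) (wW j).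
have av' : annular phi (synth phi N W) by apply: annular_bigsum.
have [Sv' _] := av'.
have nb : (NB' (distr_of (synth phi N W)) <= (A * (Q * L) * snorm k v)%:E)%E.
  apply: le_trans (hA _ N W (tempered_distr_of Sv') wW W0 _) _ => //.
  rewrite -mulrA EFinM; apply: lee_wpmul2l; first by rewrite lee_fin.
  have c0 : 0 <= Q * snorm k v by rewrite mulr_ge0.
  apply: (@le_trans _ _ ((Q * snorm k v)%:E * lq_norm (conj q) all_wgt)%E); last first.
    by rewrite -(fineK lf) -EFinM lee_fin mulrAC.
  apply: le_trans (lq_scale q1' c0 all_wgt_ge0).
  apply: lq_le => // j; first by rewrite mule_ge0 ?Lp_ge0// lee_fin wgt_ge0.
  have [jN|jN] := boolP (j \in zs N); last first.
    by rewrite (W0 j jN) Lp_zero// mule0; apply: mule_ge0; [rewrite lee_fin|exact: all_wgt_ge0].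
  apply: le_trans (hQ v j Sv); apply: lee_wpmul2l; first by rewrite lee_fin wgt_ge0.
  rewrite /W jN LpZ//; last exact/schwartz_cmfun/(aj j Sv).1.
  by rewrite -[leRHS]mul1e; apply: lee_wpmul2r; [exact: Lp_ge0|rewrite lee_fin; case: (hz j)].
have K0 : 0 <= A * (Q * L) * snorm k v by rewrite !mulr_ge0.
have := hM _ _ av' K0 nb; rewrite /synth functional_sum//.
rewrite (_ : \sum_(i <- zs N) Lv (fat phi i (W i)) = (\sum_(j <- zs N) normc (ej v j))%:C); last first.
  rewrite rmorph_sum big_seq [RHS]big_seq; apply: eq_bigr => j jN.
  have wj : wint (convol (kapj phi j) v) by exact/schwartz_wint/(aj j Sv).1.
  rewrite /W jN /fat (convolZ _ (schwartz_kapA cphi _ _) wj) -/(fat phi j _) (fat_kapj cphi j wv).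
  by rewrite functionalZ; [case: (hz j)|exact: aj].
by rewrite normcR => h; rewrite -mulrA; apply: le_trans (ler_norm _) h.
Qed.

Definition representing : @distrib R n := fun v => csum [set: int] (ej v).

Lemma representing_summable v : schwartz v -> csummable [set: int] (ej v).
Proof.
move=> Sv; have [B B0 [k h]] := functional_sum_bound.
apply: (@le_lt_trans _ _ (B * snorm k v)%:E); last by rewrite ltry.
apply: (esum_le_sum zs_uniq mem_zsT) => [j _|N]; first by rewrite lee_fin; exact: normc_ge0.
by rewrite sumEFin lee_fin; exact: h.
Qed.

Lemma representing_tempered : tempered representing.
Proof.
split.
  move=> z v w Sv Sw; have wv := schwartz_wint Sv; have ww := schwartz_wint Sw.
  have [_ <-] := csum_lin zs_uniq mem_zsT z (representing_summable Sv) (representing_summable Sw).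
  congr csum; apply/funext => j; rewrite /ej.
  rewrite -functional_lin; [|exact: aj|exact: aj]; congr Lv.
  exact: (convol_linr z (schwartz_kapj cphi j) wv ww).
have [B B0 [k h]] := functional_sum_bound; exists k, B => v Sv.
rewrite seminormE// -EFinM lee_fin.
by apply: (le_normc_csum zs_uniq mem_zsT (representing_summable Sv)) => N; exact: h.
Qed.

Lemma representing_annular v : annular phi v -> representing v = Lv v.
Proof.
move=> av; have [Sv _] := av.
apply: (csum_unique zs_uniq mem_zsT (representing_summable Sv)).
have [N0 h] := annular_sum cphi av.
apply/cvgrPdist_lt => e e0; exists N0 => // N /= /h hN.
rewrite -functional_sum; last by move=> j; exact: aj.
by rewrite hN subrr normc0 subrr normr0.
Qed.

(** On annular functions the series reduces to the functional, so [norm_le_annular] bounds the norm;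
    the low-frequency hypothesis [gap_lty] then gives membership in [Sh']. *)
Lemma representing_besov : Sh' representing /\ (NB representing < +oo)%E.
Proof.
have tu := representing_tempered.
have [M M0 hM] := functional_bound.
have uy : (NB representing < +oo)%E.
  have [c c0 h] := norm_le_annular cphi s p1 q1.
  apply: le_lt_trans (h _ M tu (ltW M0) _) (ltry _) => v K av K0 vK.
  by rewrite representing_annular//; apply: hM => //; exact: ltW.
split=> //; apply: (Sh'_of_blocks cphi p1 q1 tu uy gap_lty) => v e Sv e0.
have /cvgrPdist_lt /(_ e e0) [N _ /(_ N (leqnn N))] :=
  csum_cvg zs_uniq mem_zsT (representing_summable Sv).
rewrite sub0r normrN ger0_norm ?normc_ge0// => h; exists N.
rewrite (eq_bigr (fun j => ej v j)); first exact: h.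
by move=> j _; apply: representing_annular; exact: aj.
Qed.

Lemma pairing_subr u T U : good phi s p q u -> good' phi s p q T -> good' phi s p q U ->
  besov_pairing phi u (T \- U) = besov_pairing phi u T - besov_pairing phi u U.
Proof.
move=> gu gT gU; have := pairing_linr cphi p1 q1 (-1) gu gU gT; rewrite mulN1r addrC => <-.
by congr besov_pairing; apply/funext => v /=; rewrite mulN1r addrC.
Qed.

(** Both sides are continuous on [X] and agree on annular functions, which are dense there. *)
Lemma representing_pairing T : X T -> besov_pairing phi representing T = l T.
Proof.
move=> XT; have [hu uy] := representing_besov; have tu := representing_tempered.
have gu : good phi s p q representing by [].
have gT := goodX XT; have [tT Ty] := gT.
have N0 := norm_ge0 cphi s p1 q1 tu.
have Nf : NB representing \is a fin_num by rewrite (ge0_fin_numE N0).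
have [_ lc] := hl.
apply/eqP; rewrite -subr_eq0; apply/eqP/normc_eq0/eqP.
rewrite eq_le normc_ge0 andbT; apply/ler_addgt0Pr => e e0; rewrite add0r.
have e2 : 0 < e / 2 by rewrite divr_gt0.
have [d d0 hd] := lc T XT _ e2.
pose P := pc s * fine (NB representing) + 1.
have P0 : 0 < P by rewrite ltr_wpDl// mulr_ge0 ?pc_ge0 ?fine_ge0.
have m0 : 0 < Num.min d (e / 2 / P) by rewrite lt_min d0 divr_gt0.
have [g ag hg] := Xapp XT m0; have [Sg _] := ag.
have gg := goodX (XAd ag); have [tg gy] := gg.
have tD : tempered (distr_of g \- T).
  apply: tempered_eqD (tempered_comb (-1) tT tg) => v Sv /=.
  by rewrite mulN1r addrC.
have D0 := norm_ge0 cphi (- s) p1' q1' tD.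
have hg1 : (NB' (distr_of g \- T)%R < d%:E)%E by apply: lt_le_trans hg _; rewrite lee_fin ge_min lexx.
have hg2 : (NB' (distr_of g \- T)%R <= (e / 2 / P)%:E)%E.
  by apply: le_trans (ltW hg) _; rewrite lee_fin ge_min lexx orbT.
have Dy := lt_trans hg1 (ltry d).
have bg : besov_pairing phi representing (distr_of g) = Lv g.
  by rewrite (besov_pairing_schwartz cphi p1 q1 hu gu Sg gg) representing_annular.
have h1 : normc (besov_pairing phi representing (distr_of g \- T)) <= e / 2.
  have [_ hb] := good_pairing cphi p1 q1 gu (Logic.conj tD Dy).
  rewrite -lee_fin; apply: le_trans hb _.
  apply: (@le_trans _ _ ((pc s)%:E * (NB representing * (e / 2 / P)%:E))%E).
    apply: lee_wpmul2l; first by rewrite lee_fin pc_ge0.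
    by apply: lee_wpmul2l.
  rewrite -(fineK Nf) -!EFinM lee_fin mulrA mulrA ler_pdivrMr// mulrAC.
  rewrite (mulrC (pc s)) -mulrA; apply: (ler_wpM2l (ltW e2)).
  by rewrite /P lerDl.
have h2 := hd _ (XAd ag) hg1.
rewrite (pairing_subr gu gg gT) bg in h1.
have -> : besov_pairing phi representing T - l T =
    (Lv g - l T) - (Lv g - besov_pairing phi representing T) by ring.
apply: le_trans (normcB _ _) _; rewrite [leRHS](splitr e) lerD//; exact: ltW.
Qed.

End functional.

Lemma is_dual_of_space : is_dual_of (besov phi s p q) NB X NB' (besov_pairing phi).
Proof.
have gY u : besov phi s p q u -> good phi s p q u by move=> [[tu _] uy].
have X0 : X (distr_of (fun=> 0)) := XAd (annular0 cphi).
have b0 u : besov phi s p q u -> besov_pairing phi u (distr_of (fun=> 0)) = 0.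
  move=> hu; have [hs _] := hu.
  rewrite (besov_pairing_schwartz cphi p1 q1 hs (gY _ hu) (annular0 cphi).1 (goodX X0)).
  exact: (tempered0 hs.1).
split.
- move=> u hu; have gu := gY u hu; split.
    by move=> a v1 v2 X1 X2; exact: (pairing_linr cphi p1 q1 a gu (goodX X1) (goodX X2)).
  move=> v0 X0' e e0.
  have [K K0 uK] : exists2 K : R, 0 <= K & (NB u <= K%:E)%E.
    have N0 := norm_ge0 cphi s p1 q1 gu.1.
    by exists (fine (NB u)); rewrite ?fine_ge0// fineK// (ge0_fin_numE N0) gu.2.
  have P0 : 0 < pc s * K + 1 by rewrite ltr_wpDl// mulr_ge0 ?pc_ge0.
  exists (e / (pc s * K + 1)); first by rewrite divr_gt0.
  move=> v Xv vd; have [tv _] := goodX Xv; have [tv0 _] := goodX X0'.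
  rewrite -(pairing_subr gu (goodX Xv) (goodX X0')).
  apply: le_lt_trans (pairing_leK gu.1 (tempered_sub tv tv0) uK (ltW vd)) _.
  rewrite !mulrA ltr_pdivrMr// [ltLHS]mulrC ltr_pM2l//.
  by rewrite ltrDl.
(* Injectivity: the blocks of a test function are annular, so the pairings determine each
   [u (Delta_j v)], and these sum to [u v] because [u] lies in [Sh']. *)
- move=> u1 u2 h1 h2 e12 v Sv; have [hs1 _] := h1; have [hs2 _] := h2.
  apply/eqP; rewrite -subr_eq0; apply/eqP/normc_eq0/eqP.
  rewrite eq_le normc_ge0 andbT; apply/ler_addgt0Pr => e e0; rewrite add0r.
  have e20 : 0 < e / 2 by rewrite divr_gt0.
  have [N1 c1] := blocks_cvg cphi hs1 Sv e20; have [N2 c2] := blocks_cvg cphi hs2 Sv e20.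
  have {c1} := c1 (maxn N1 N2) (leq_maxl _ _); have {c2} := c2 (maxn N1 N2) (leq_maxr _ _).
  rewrite (eq_bigr (fun j => u1 (convol (kapj phi j) v))); last first.
    move=> j _; have aj : annular phi (convol (kapj phi j) v).
      by apply: annular_kap => //; [exact: ler_succz|exact: schwartz_wint].
    rewrite -(besov_pairing_schwartz cphi p1 q1 hs1 (gY _ h1) aj.1 (goodX (XAd aj))).
    rewrite -(besov_pairing_schwartz cphi p1 q1 hs2 (gY _ h2) aj.1 (goodX (XAd aj))).
    by rewrite e12//; exact: XAd.
  set S := \sum_(j <- _) _ => c2 c1.
  have -> : u1 v - u2 v = (S - u2 v) - (S - u1 v) by ring.
  by apply: le_trans (normcB _ _) _; rewrite [leRHS](splitr e) lerD// ltW.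
- move=> l hl; exists (representing l); first exact: representing_besov.
  exact: representing_pairing.
- have [c c0 hc] := norm_le_sup.
  have m0 : 0 < Num.max c (pc s) by rewrite lt_max c0.
  exists (Num.max c (pc s)) => // u hu; have gu := gY u hu; have [hs uy] := hu.
  have N0 := norm_ge0 cphi s p1 q1 gu.1.
  have D0 : (0 <= dual_norm X NB' (besov_pairing phi u))%E.
    apply: le_ereal_sup_tmp; exists 0%E => //; exists (distr_of (fun=> 0)); last by rewrite b0// normc0.
    by split=> //; apply: (norm_zeroD _ p1' q1') => // f Sf; exact: distr0.
  split.
    apply: (@le_trans _ _ (c%:E * dual_norm X NB' (besov_pairing phi u))%E); last first.
      by apply: lee_wpmul2r; rewrite ?lee_fin ?le_max ?lexx.
    apply: hc => //; first exact: gu.1.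
    move=> v av vn; apply: ereal_sup_ubound; exists (distr_of v).
      by split=> //; exact: XAd.
    by rewrite (besov_pairing_schwartz cphi p1 q1 hs gu av.1 (goodX (XAd av))).
  apply: (@le_trans _ _ ((pc s)%:E * NB u)%E); last first.
    by apply: lee_wpmul2r; rewrite ?lee_fin ?le_max ?lexx ?orbT.
  have Nf : NB u \is a fin_num by rewrite (ge0_fin_numE N0).
  have uK : (NB u <= (fine (NB u))%:E)%E by rewrite fineK.
  apply: ge_ereal_sup => _ [v [Xv vn] <-]; rewrite -(fineK Nf) -EFinM lee_fin.
  by have := pairing_leK gu.1 (goodX Xv).1 uK vn; rewrite mulr1.
Qed.

End dual_space.

End exponents.

End duality_proof.

(** * The four predual spaces *)

Section density.
Local Open Scope classical_set_scope.
Local Open Scope ring_scope.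
Local Open Scope complex_scope.
Context {R : realType} {n : nat}.
Local Notation E := ('rV[R]_n).
Local Notation C := (R[i]).
Local Notation mu := (@lebesgue_rV R n).
Local Notation conj := (@hoelder_conjugate R).
Variable phi : E -> R.
Hypothesis cphi : cutoff phi.
Implicit Types (f g w v : E -> C) (u T U : @distrib R n) (j : int).

Lemma lq_tail_fin r2 (a : int -> \bar R) (e : R) : (1 <= r2)%E -> r2 != +oo%E ->
  (forall j, (0 <= a j)%E) -> (lq_norm r2 a < +oo)%E -> 0 < e ->
  exists J : nat, (lq_norm r2 (fun j => if j \in zs J then 0 else a j) <= e%:E)%E.
Proof.
move=> r21 r2y a0; case: r2 r21 r2y => [r r1 _|//|//].
rewrite /lq_norm => ay e0; rewrite lee_fin in r1; have r0 := lt_le_trans ltr01 r1.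
have S0 : (0 <= \esum_(j in setT) (a j `^ r))%E by apply: esum_ge0 => j _; exact: poweR_ge0.
have Sy : (\esum_(j in setT) (a j `^ r) < +oo)%E.
  rewrite ltey; apply/eqP => h; move: ay; rewrite h poweRyr ?ltxx//.
  by rewrite invr_eq0 lt0r_neq0.
have er : 0 < e `^ r by exact: powR_gt0.
have [J hJ] := esum_tail (fun j => poweR_ge0 (a j) r) Sy er; exists J.
have -> : (e%:E = (e `^ r)%:E `^ r^-1)%E.
  by rewrite poweR_EFin -powRrM mulfV ?lt0r_neq0// powRr1// ltW.
apply: poweR_le; first by rewrite invr_ge0 ltW.
  by apply: esum_ge0 => j _; exact: poweR_ge0.
apply: le_trans hJ; rewrite le_eqVlt; apply/orP; left; apply/eqP; apply: eq_esum => j _.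
by case: ifP => // _; rewrite poweR_EFin powR0// lt0r_neq0.
Qed.

(** The approximant is the synthesis of the blocks of index at most [J] in modulus, each cut off to
    a ball. By [besov_approx] the error consists of the tail of the sequence of blocks and of the
    spatial tails of finitely many blocks, the two quantities that the hypotheses make small. *)
Lemma annular_dense t r1 r2 T (e : R) : (1 <= r1)%E -> (1 <= r2)%E -> tempered T ->
  (forall d : R, 0 < d -> exists J : nat,
     (lq_norm r2 (fun j => if j \in zs J then 0 else besov_coef phi t r1 T j) <= d%:E)%E) ->
  (forall j (d : R), 0 < d -> exists k : nat,
     (Lp r1 (fun x => (\1_[set y : E | (k%:R <= enorm y)%R] x : R)%:C * blk phi j T x)%R < d%:E)%E) ->
  0 < e ->
  exists2 g, annular phi g & (besov_norm phi t r1 r2 (distr_of g \- T)%R < e%:E)%E.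
Proof.
move=> h1 h2 tT tail1 tail2 e0.
have [A A0 hA] := besov_approx cphi t h1 h2.
(* [A] comes from [besov_approx] and 4 from adding the two kinds of error. *)
pose eta := e / (2 * (4 * A + 1)).
have D0 : 0 < 2 * (4 * A + 1) by rewrite mulr_gt0// ltr_wpDl// mulr_ge0.
have eta0 : 0 < eta by rewrite divr_gt0.
have [J hJ] := tail1 eta eta0.
(* The spatial error is shared out equally among the retained blocks. *)
pose m : R := (size (zs J))%:R + 1.
have m0 : 0 < m by rewrite ltr_wpDl.
have ex j : exists k : nat,
  (Lp r1 (fun x => (\1_[set y : E | (k%:R <= enorm y)%R] x : R)%:C * blk phi j T x)%R
    < (eta / m / wgt t j)%:E)%E.
  by apply: tail2; rewrite !divr_gt0// wgt_gt0.
have [k hk] := choice ex.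
pose I j := [set y : E | ((k j)%:R <= enorm y)%R].
have mI j : measurable (I j).
  have := @measurable_enorm R n measurableT _ (measurable_itv `[((k j)%:R : R), +oo[); rewrite setTI.
  by congr measurable; apply/seteqP; split=> y /=; rewrite in_itv/= andbT.
have cI j : cmfun (fun x : E => (\1_(I j) x : R)%:C * blk phi j T x).
  apply: cmfunM; last exact: blk_cmfun.
  by apply: cmfunR; exact: measurable_indic.
pose W j := if j \in zs J then (fun x : E => blk phi j T x - (\1_(I j) x : R)%:C * blk phi j T x)
            else (fun=> 0).
have wW j : wint (W j).
  rewrite /W; case: ifP => _; last exact: wint_cst0.
  have [k' [M' [M0 [bM _]]]] := ptconv_bound tT (schwartz_kapj cphi j).
  have Wb x : normc (blk phi j T x - (\1_(I j) x : R)%:C * blk phi j T x) <= M' * (1 + (k j)%:R) ^+ k'.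
    have b0 : 0 <= M' * (1 + (k j)%:R) ^+ k' by rewrite mulr_ge0// exprn_ge0// addr_ge0.
    rewrite indicE; have [h|h] := boolP (x \in I j); first by rewrite mul1r subrr normc0.
    rewrite mul0r subr0; apply: le_trans (bM x) _; rewrite ler_wpM2l//.
    move: h; rewrite notin_setE /I /= => /negP; rewrite -ltNge => h.
    by rewrite lerXn2r ?nnegrE ?(ltW (wt_gt0 x)) ?addr_ge0// /wt lerD2l ltW.
  apply: (wint_bounded cphi (r := (k j)%:R) (M := M' * (1 + (k j)%:R) ^+ k')) => //.
    by apply: cmfunB; [exact: blk_cmfun|exact: cI].
  move=> x; apply: contra_neqT; rewrite -leNgt => h.
  by rewrite indicE mem_set// mul1r subrr.
have W0 j : j \notin zs J -> W j = (fun=> 0) by rewrite /W => /negPf ->.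
have ag : annular phi (synth phi J W).
  apply: annular_bigsum => // j; exact: (annular_kap cphi (fat_index_le j) (wW j)).
exists (synth phi J W) => //; have tg := tempered_distr_of ag.1.
pose c j := if j \in zs J then 0%E else besov_coef phi t r1 T j.
pose b j : \bar R := if j \in zs J then ((wgt t j)%:E * Lp r1 (fun x => (\1_(I j) x : R)%:C * blk phi j T x)%R)%E else 0%E.
have cf0 j : (0 <= besov_coef phi t r1 T j)%E by exact: coef_ge0.
have c0 j : (0 <= c j)%E by rewrite /c; case: ifP.
have b0 j : (0 <= b j)%E by rewrite /b; case: ifP => // _; rewrite mule_ge0 ?Lp_ge0// lee_fin wgt_ge0.
have lb : (lq_norm r2 b <= eta%:E)%E.
  apply: (@lq_fin_le _ _ _ eta J) => // [j /negPf jN|]; first by rewrite /b jN.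
  apply: (@le_trans _ _ (\sum_(j <- zs J) (eta / m)%:E)%E).
    rewrite big_seq [leRHS]big_seq; apply: lee_sum => j jJ; rewrite /b jJ.
    apply: (@le_trans _ _ ((wgt t j)%:E * (eta / m / wgt t j)%:E)%E).
      by apply: lee_wpmul2l; [rewrite lee_fin wgt_ge0|exact/ltW/hk].
    by rewrite -EFinM lee_fin mulrC divfK// lt0r_neq0// wgt_gt0.
  rewrite sumEFin lee_fin big_const_seq count_predT iter_addr_0 -mulr_natr.
  by rewrite mulrAC ler_pdivrMr// ler_pM2l// lerDl.
have tD := tempered_sub tT tg.
have nD : (besov_norm phi t r1 r2 (T \- distr_of (synth phi J W))%R <= (A * (4 * eta))%:E)%E.
  apply: le_trans (hA _ T J W tD tT wW W0 _) _ => //.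
  rewrite (EFinM A); apply: lee_wpmul2l; first by rewrite lee_fin.
  rewrite (EFinM 4); apply: le_trans (lq_add h2 c0 b0 hJ lb).
  apply: lq_le => // j; first by rewrite mule_ge0 ?Lp_ge0// lee_fin wgt_ge0.
  rewrite /c /b /W; case: ifP => jJ.
    rewrite add0e le_eqVlt; apply/orP; left; apply/eqP; congr (_ * Lp r1 _)%E.
    by apply/funext => x; rewrite opprB addrC subrK.
  rewrite adde0 coefE//; apply: lee_wpmul2l; first by rewrite lee_fin wgt_ge0.
  by rewrite (_ : (fun x => _) = blk phi j T)//; apply/funext => x; rewrite subr0.
apply: le_lt_trans (norm_scaleD cphi (z := -1) t h1 h2 tD _) _.
  by move=> v Sv /=; rewrite mulN1r opprB.
rewrite normcN normc1 mul1e; apply: le_lt_trans nD _; rewrite lte_fin /eta.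
rewrite !mulrA ltr_pdivrMr// (mulrC _ e) ltr_pM2l//; lra.
Qed.

Lemma annular_besov s p q v T : (1 <= p)%E -> (1 <= q)%E -> annular phi v ->
  eqD T (distr_of v) -> besov phi s p q T.
Proof.
by move=> p1 q1 av TE; split; [exact: (annular_Sh' cphi av TE)|exact: (annular_norm cphi s p1 q1 av TE)].
Qed.

Lemma annular_besov_c s p v T : (1 <= p)%E -> annular phi v -> eqD T (distr_of v) ->
  besov_c phi s p T.
Proof.
move=> p1 av TE; split; first by apply: annular_besov av TE; rewrite ?leey.
move=> e e0; have [_ [N0 h]] := annular_blk cphi av TE; exists N0.+1 => j /h b0.
have tT := tempered_eqD TE (tempered_distr_of av.1).
by rewrite (coefE cphi s j p1 tT) b0 Lp_zero// mule0.
Qed.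

Lemma annular_besov_0 s q v T : (1 <= q)%E -> annular phi v -> eqD T (distr_of v) ->
  besov_0 phi s q T.
Proof.
move=> q1 av TE; split; first by apply: annular_besov av TE; rewrite ?leey.
move=> j; have [H _] := annular_blk cphi av TE.
have tT := tempered_eqD TE (tempered_distr_of av.1).
exists (blk phi j T); last exact: Delta_repr.
by rewrite H; apply/schwartz_C0/schwartz_kap_convol => //; exact/schwartz_wint/av.1.
Qed.

Lemma tail_besov s p q T : (1 <= p)%E -> (1 <= q)%E -> q != +oo%E -> besov phi s p q T ->
  forall d : R, 0 < d -> exists J : nat,
     (lq_norm q (fun j => if j \in zs J then 0 else besov_coef phi s p T j) <= d%:E)%E.
Proof.
move=> p1 q1 qy [[tT _] Ty] d d0; apply: lq_tail_fin => // j.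
exact: coef_ge0.
Qed.

Lemma tail_besov_c s p T : besov_c phi s p T ->
  forall d : R, 0 < d -> exists J : nat,
     (lq_norm +oo (fun j => if j \in zs J then 0 else besov_coef phi s p T j) <= d%:E)%E.
Proof.
move=> [_ h] d d0; have [N hN] := h d d0; exists N.
apply: ge_ereal_sup => _ [j _ <-]; case: ifPn; first by rewrite lee_fin ltW.
by rewrite mem_zs -ltnNge => jN; apply/ltW/hN/ltnW.
Qed.

Lemma space_tail s p q T : (1 <= p)%E -> (1 <= q)%E -> p != +oo%E -> besov phi s p q T ->
  forall j (d : R), 0 < d -> exists k : nat,
     (Lp p (fun x => (\1_[set y : E | (k%:R <= enorm y)%R] x : R)%:C * blk phi j T x)%R < d%:E)%E.
Proof.
move=> p1 q1 py [[tT _] Ty] j d d0; apply: Lp_tail => //; first exact: blk_cmfun.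
exact: (blk_lty cphi j p1 q1 tT Ty).
Qed.

Lemma space_tail_0 s q T : besov_0 phi s q T ->
  forall j (d : R), 0 < d -> exists k : nat,
     (Lp +oo (fun x => (\1_[set y : E | (k%:R <= enorm y)%R] x : R)%:C * blk phi j T x)%R < d%:E)%E.
Proof.
move=> [[[tT _] _] h] j d d0; have [f [_ _ f0] rf] := h j.
have d2 : 0 < d / 2 by rewrite divr_gt0.
have [M hM] := f0 _ d2; exists (Num.bound `|M|).
apply: (@le_lt_trans _ _ (d / 2)%:E); last by rewrite lte_fin ltr_pdivrMr// ltr_pMr// ltr1n.
rewrite /Lp Npy; last by move=> x; exact: normc_ge0.
apply/ess_supP; have := represents_unique cphi rf (Delta_repr cphi j tT).
apply: filterS => x fx; rewrite lee_fin -fx indicE.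
have [h1|h1] := boolP (x \in _); last by rewrite mul0r normc0 ltW.
rewrite mul1r; apply/ltW/hM; move: h1; rewrite inE /= => h1.
apply: le_trans h1; apply: le_trans (ler_norm M) _.
by rewrite ltW// archi_boundP.
Qed.

Lemma gap_pos (s : R) (p : \bar R) : (1 <= p)%E -> (s%:E < n%:R%:E / p)%E -> 0 < gap s p (n := n).
Proof.
move=> p1 h; rewrite /gap subr_gt0 -lte_fin EFinM.
suff -> : ((fine p^-1)%:E = p^-1)%E by [].
case/one_le_cases: (p1) => [->|[r -> r1]|->]; first by rewrite inve1.
  by rewrite inver gt_eqF// (lt_trans ltr01).
by rewrite invey.
Qed.

Lemma gap_ge0 (s : R) (p : \bar R) : (1 <= p)%E -> (s%:E <= n%:R%:E / p)%E -> 0 <= gap s p (n := n).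
Proof.
move=> p1 h; rewrite /gap subr_ge0 -lee_fin EFinM.
suff -> : ((fine p^-1)%:E = p^-1)%E by [].
case/one_le_cases: (p1) => [->|[r -> r1]|->]; first by rewrite inve1.
  by rewrite inver gt_eqF// (lt_trans ltr01).
by rewrite invey.
Qed.

Lemma hoelder_conj_neqy p : (1 < p)%E -> conj p != +oo%E.
Proof.
move=> p1; case/one_le_cases: (ltW p1) => [e|[r -> r1]|->].
- by move: p1; rewrite e ltxx.
- by have [t [-> _ _ _]] := conj_real r1.
- by rewrite hoelder_conjugatey.
Qed.

End density.

(** * The pairing, the supremum formula and the four identities *)

Section besov_duality.
Local Open Scope classical_set_scope.
Local Open Scope ring_scope.
Local Open Scope complex_scope.
Context {R : realType} {n : nat}.
Local Notation E := ('rV[R]_n).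
Local Notation C := (R[i]).
Local Notation mu := (@lebesgue_rV R n).
Local Notation conj := (@hoelder_conjugate R).
Variable phi : E -> R.
Hypothesis cphi : cutoff phi.
Implicit Types (u v T U : @distrib R n) (s : R) (p q : \bar R).

Lemma pairing_bicontinuous s p q : (1 <= p)%E -> (1 <= q)%E ->
  bicontinuous_on (besov phi s p q) (besov_norm phi s p q)
    (besov phi (- s) (conj p) (conj q)) (besov_norm phi (- s) (conj p) (conj q))
    (besov_pairing phi).
Proof.
move=> p1 q1 u0 v0 [[tu0 _] yu0] [[tv0 _] yv0] e e0.
have p1' := hoelder_conj_ge1 p1; have q1' := hoelder_conj_ge1 q1.
pose Ku := fine (besov_norm phi s p q u0).
pose Kv := fine (besov_norm phi (- s) (conj p) (conj q) v0).
have Nu := norm_ge0 cphi s p1 q1 tu0; have Nv := norm_ge0 cphi (- s) p1' q1' tv0.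
have fu : (besov_norm phi s p q u0 <= Ku%:E)%E by rewrite fineK// ge0_fin_numE.
have fv : (besov_norm phi (- s) (conj p) (conj q) v0 <= Kv%:E)%E by rewrite fineK// ge0_fin_numE.
have Ku0 : 0 <= Ku by exact: fine_ge0.
have Kv0 : 0 <= Kv by exact: fine_ge0.
(* The sum of the bounds for the three terms of the bilinear expansion around [(u0, v0)] is below
   [d * P] as soon as [d <= 1]. *)
pose P := pc s * (1 + Ku + Kv) + 1.
have c0 := pc_ge0 s.
have P0 : 0 < P by rewrite ltr_wpDl// mulr_ge0// !addr_ge0.
have d0 : 0 < Num.min 1 (e / P) by rewrite lt_min ltr01 divr_gt0.
exists (Num.min 1 (e / P)) => //; set d := Num.min 1 (e / P) in d0 *.
have d1 : d <= 1 by rewrite /d ge_min lexx.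
have dP : d * P <= e by rewrite -ler_pdivlMr// /d ge_min lexx orbT.
move=> u v [[tu _] yu] [[tv _] yv] /ltW ud /ltW vd.
have tU := tempered_sub tu tu0; have tV := tempered_sub tv tv0.
have gu : good phi s p q u by []. have gu0 : good phi s p q u0 by [].
have gv : good' phi s p q v by []. have gv0 : good' phi s p q v0 by [].
have gU : good phi s p q (u \- u0) by split=> //; exact: le_lt_trans ud (ltry _).
have subl w : good' phi s p q w ->
    besov_pairing phi (u \- u0) w = besov_pairing phi u w - besov_pairing phi u0 w.
  move=> gw; have eD : u \- u0 = -1 \*o u0 \+ u.
    by apply/funext => f /=; rewrite mulN1r addrC.
  by rewrite eD (pairing_linl cphi p1 q1 (-1) gu0 gu gw) mulN1r addrC.
have e1 := pairing_subr cphi p1 q1 gU gv gv0.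
have e2 := pairing_subr cphi p1 q1 gu0 gv gv0.
have e3 := subl v0 gv0.
have e4 := subl v gv.
have b1 := pairing_leK cphi p1 q1 tU tV ud vd.
have b2 := pairing_leK cphi p1 q1 tU tv0 ud fv.
have b3 := pairing_leK cphi p1 q1 tu0 tV fu vd.
have E4 (z1 z2 z3 z4 : C) : z1 - z4 = (z1 - z2) - (z3 - z4) + (z3 - z4) + (z2 - z4) by ring.
have -> : besov_pairing phi u v - besov_pairing phi u0 v0 =
    besov_pairing phi (u \- u0) (v \- v0) + besov_pairing phi (u \- u0) v0
    + besov_pairing phi u0 (v \- v0).
  by rewrite e1 e2 e3 e4; exact: E4.
apply: le_lt_trans (normcD _ _) _.
apply: le_lt_trans (lerD (normcD _ _) (lexx _)) _.
apply: le_lt_trans (lerD (lerD b1 b2) b3) _.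
apply: lt_le_trans dP.
apply: (@le_lt_trans _ _ (d * (pc s * (1 + Ku + Kv)))); last by rewrite ltr_pM2l// /P ltrDl.
have -> : pc s * (d * d) + pc s * (d * Kv) + pc s * (Ku * d) = d * (pc s * (d + Ku + Kv)) by ring.
apply: (ler_wpM2l (ltW d0)); apply: (ler_wpM2l c0).
by rewrite !lerD2r.
Qed.

(** Annular functions in the unit ball belong to [Qset], so [norm_le_sup] gives the first
    inequality; the second is the bound of the pairing, and is trivial when the norm of [u] is
    infinite. *)
Lemma pairing_sup s p q : (1 <= p)%E -> (1 <= q)%E ->
  exists2 c : R, 0 < c & forall u, Sh' u ->
    (besov_norm phi s p q u <= c%:E * ereal_sup
       [set (normc (u v))%:E | v in Qset phi (- s) (conj p) (conj q)])%E /\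
    (ereal_sup [set (normc (u v))%:E | v in Qset phi (- s) (conj p) (conj q)] <=
       c%:E * besov_norm phi s p q u)%E.
Proof.
move=> p1 q1; have p1' := hoelder_conj_ge1 p1; have q1' := hoelder_conj_ge1 q1.
have [c c0 h] := norm_le_sup cphi s p1 q1.
have m0 : 0 < Num.max c (pc s) by rewrite lt_max c0.
exists (Num.max c (pc s)) => // u hu; have [tu _] := hu.
set D := ereal_sup _; have N0 := norm_ge0 cphi s p1 q1 tu.
have Qann (v : E -> C) : annular phi v -> (besov_norm phi (- s) (conj p) (conj q) (distr_of v) <= 1)%E ->
    Qset phi (- s) (conj p) (conj q) v.
  by move=> av vn; split=> //; [exact: av.1|exact: (annular_besov cphi (- s) p1' q1' av)].
have D0 : (0 <= D)%E.
  apply: le_ereal_sup_tmp; exists 0%E => //; exists (fun=> 0); last by rewrite tempered0// normc0.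
  apply: (Qann _ (annular0 cphi)).
  by apply: (norm_zeroD cphi _ p1' q1') => // f Sf; exact: distr0.
split.
  apply: (@le_trans _ _ (c%:E * D)%E); last first.
    by apply: lee_wpmul2r; rewrite ?lee_fin ?le_max ?lexx.
  apply: h => // v av vn; apply: ereal_sup_ubound; exists v => //; exact: Qann.
apply: (@le_trans _ _ ((pc s)%:E * besov_norm phi s p q u)%E); last first.
  by apply: lee_wpmul2r; rewrite ?lee_fin ?le_max ?lexx ?orbT.
have [uy|] := ltP (besov_norm phi s p q u) +oo%E; last first.
  rewrite leye_eq => /eqP ->; rewrite gt0_muley ?leey// lte_fin /pc.
  by rewrite mulr_gt0// powR_gt0.
have gu : good phi s p q u by [].
have Nf : besov_norm phi s p q u \is a fin_num by rewrite (ge0_fin_numE N0).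
have uK : (besov_norm phi s p q u <= (fine (besov_norm phi s p q u))%:E)%E by rewrite fineK.
apply: ge_ereal_sup => _ [v [Sv [hv vy] vn] <-]; rewrite -(fineK Nf) -EFinM lee_fin.
have gv : good' phi s p q (distr_of v) by split=> //; exact: tempered_distr_of.
rewrite -(besov_pairing_schwartz cphi p1 q1 hu gu Sv gv).
by have := pairing_leK cphi p1 q1 tu gv.1 uK vn; rewrite mulr1.
Qed.

Lemma pairing_part s p q : (1 <= p)%E -> (1 <= q)%E ->
  [/\ forall u v, besov phi s p q u -> besov phi (- s) (conj p) (conj q) v -> pairable phi u v,
      bilinear_on (besov phi s p q) (besov phi (- s) (conj p) (conj q)) (besov_pairing phi),
      bicontinuous_on (besov phi s p q) (besov_norm phi s p q)
        (besov phi (- s) (conj p) (conj q)) (besov_norm phi (- s) (conj p) (conj q))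
        (besov_pairing phi) &
      exists2 c : R, 0 < c & forall u, Sh' u ->
        (besov_norm phi s p q u <= c%:E * ereal_sup
           [set (normc (u v))%:E | v in Qset phi (- s) (conj p) (conj q)])%E /\
        (ereal_sup [set (normc (u v))%:E | v in Qset phi (- s) (conj p) (conj q)] <=
           c%:E * besov_norm phi s p q u)%E].
Proof.
move=> p1 q1.
have gY u : besov phi s p q u -> good phi s p q u by move=> [[tu _] uy].
have gX v : besov phi (- s) (conj p) (conj q) v -> good' phi s p q v by move=> [[tv _] vy].
split; [|split|exact: pairing_bicontinuous|exact: pairing_sup].
- move=> u v /gY gu /gX gv; split; last by have [] := good_pairing cphi p1 q1 gu gv.
  by move=> k _; have [] := block_pairingE cphi p1 q1 k.1 k.2 gu gv.
- by move=> a u1 u2 v /gY g1 /gY g2 /gX gv; exact: (pairing_linl cphi p1 q1 a g1 g2 gv).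
- by move=> a u v1 v2 /gY gu /gX g1 /gX g2; exact: (pairing_linr cphi p1 q1 a gu g1 g2).
Qed.

(** Both conjugate exponents are finite, so spatial tails and tails in [j] vanish by dominated
    convergence and by summability; the strict bound on [s] makes the low-frequency factor
    geometric. *)
Lemma besov_dual s p q : (1 < p)%E -> (1 < q)%E -> (s%:E < n%:R%:E / p)%E ->
  is_dual_of (besov phi s p q) (besov_norm phi s p q)
    (besov phi (- s) (conj p) (conj q)) (besov_norm phi (- s) (conj p) (conj q))
    (besov_pairing phi).
Proof.
move=> lp lq sp; have p1 := ltW lp; have q1 := ltW lq.
have p1' := hoelder_conj_ge1 p1; have q1' := hoelder_conj_ge1 q1.
have py := hoelder_conj_neqy lp; have qy := hoelder_conj_neqy lq.
apply: (is_dual_of_space cphi p1 q1) => //.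
- by apply: neg_wgt_lty => //; left; exact: gap_pos.
- by move=> T v av TE; exact: (annular_besov cphi (- s) p1' q1' av TE).
- move=> T e XT e0; apply: (annular_dense cphi p1' q1' XT.1.1) e0.
    exact: (tail_besov cphi p1' q1' qy XT).
  exact: (space_tail cphi p1' q1' py XT).
Qed.

(** With [q = 1] the low-frequency factor has only to be bounded, which admits [s = n/p]; the decay
    of the coefficients required in [besov_c] provides the tails in [j]. *)
Lemma besov_c_dual s p : (1 < p)%E -> (s%:E <= n%:R%:E / p)%E ->
  is_dual_of (besov phi s p 1) (besov_norm phi s p 1)
    (besov_c phi (- s) (conj p)) (besov_norm phi (- s) (conj p) +oo)
    (besov_pairing phi).
Proof.
move=> lp sp; have p1 := ltW lp; have p1' := hoelder_conj_ge1 p1.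
have o1 : (1 <= 1 :> \bar R)%E by [].
have y1 : (1 <= +oo :> \bar R)%E by rewrite leey.
have py := hoelder_conj_neqy lp.
have := @is_dual_of_space R n phi cphi s p 1 p1 o1; rewrite hoelder_conjugate1; apply.
- have := @neg_wgt_lty R n s p 1; rewrite hoelder_conjugate1; apply=> //.
  by right; split=> //; exact: gap_ge0.
- by move=> T [[]].
- by move=> T v av TE; exact: (annular_besov_c cphi (- s) p1' av TE).
- move=> T e XT e0; apply: (annular_dense cphi p1' y1 XT.1.1.1) e0.
    exact: tail_besov_c.
  exact: (space_tail cphi p1' y1 py XT.1).
Qed.

(** With [p = 1] the conjugate exponent is infinite, and the vanishing of the blocks at infinity
    provides the spatial tails. *)
Lemma besov_0_dual s q : (1 < q)%E -> s < n%:R ->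
  is_dual_of (besov phi s 1 q) (besov_norm phi s 1 q)
    (besov_0 phi (- s) (conj q)) (besov_norm phi (- s) +oo (conj q))
    (besov_pairing phi).
Proof.
move=> lq sn; have q1 := ltW lq; have q1' := hoelder_conj_ge1 q1.
have o1 : (1 <= 1 :> \bar R)%E by [].
have y1 : (1 <= +oo :> \bar R)%E by rewrite leey.
have qy := hoelder_conj_neqy lq.
have := @is_dual_of_space R n phi cphi s 1 q o1 q1; rewrite hoelder_conjugate1; apply.
- by apply: neg_wgt_lty => //; left; rewrite /gap inve1 /= mulr1 subr_gt0.
- by move=> T [].
- by move=> T v av TE; exact: (annular_besov_0 cphi (- s) q1' av TE).
- move=> T e XT e0; apply: (annular_dense cphi y1 q1' XT.1.1.1) e0.
    exact: (tail_besov cphi y1 q1' qy XT.1).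
  exact: (space_tail_0 cphi XT).
Qed.

(** Both endpoint substitutes at once: [besov_c] for the tails in [j], [besov_0] for those in
    space. *)
Lemma besov_c0_dual s : s <= n%:R ->
  is_dual_of (besov phi s 1 1) (besov_norm phi s 1 1)
    (besov_c phi (- s) +oo `&` besov_0 phi (- s) +oo) (besov_norm phi (- s) +oo +oo)
    (besov_pairing phi).
Proof.
move=> sn; have o1 : (1 <= 1 :> \bar R)%E by [].
have y1 : (1 <= +oo :> \bar R)%E by rewrite leey.
have := @is_dual_of_space R n phi cphi s 1 1 o1 o1; rewrite hoelder_conjugate1; apply.
- have := @neg_wgt_lty R n s 1 1; rewrite hoelder_conjugate1; apply=> //.
  by right; split=> //; rewrite /gap inve1 /= mulr1 subr_ge0.
- by move=> T [[[]]].
- move=> T v av TE; split; first exact: (annular_besov_c cphi (- s) y1 av TE).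
  exact: (annular_besov_0 cphi (- s) y1 av TE).
- move=> T e [Xc X0] e0; apply: (annular_dense cphi y1 y1 Xc.1.1.1) e0.
    exact: tail_besov_c.
  exact: (space_tail_0 cphi X0).
Qed.

End besov_duality.

Local Open Scope classical_set_scope.
Local Open Scope ereal_scope.

Theorem proposition2p12 (R : realType) (n : nat) (phi : 'rV[R]_n -> R) :
  (2 <= n)%N -> cutoff phi ->
  [/\ forall (s : R) (p q : \bar R), 1 <= p -> 1 <= q ->
        let p' := hoelder_conjugate p in
        let q' := hoelder_conjugate q in
        let B := besov phi s p q in
        let B' := besov phi (- s)%R p' q' in
        let NB := besov_norm phi s p q in
        let NB' := besov_norm phi (- s)%R p' q' in
        [/\ forall u v, B u -> B' v -> pairable phi u v,
            bilinear_on B B' (besov_pairing phi),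
            bicontinuous_on B NB B' NB' (besov_pairing phi) &
            exists2 c : R, (0 < c)%R & forall u, Sh' u ->
              let sup := ereal_sup
                [set (normc (u v))%:E | v in Qset phi (- s)%R p' q'] in
              NB u <= c%:E * sup /\ sup <= c%:E * NB u],
      forall (s : R) (p q : \bar R), 1 < p -> 1 < q -> s%:E < n%:R%:E / p ->
        let p' := hoelder_conjugate p in
        let q' := hoelder_conjugate q in
        is_dual_of (besov phi s p q) (besov_norm phi s p q)
          (besov phi (- s)%R p' q') (besov_norm phi (- s)%R p' q')
          (besov_pairing phi),
      forall (s : R) (p : \bar R), 1 < p -> s%:E <= n%:R%:E / p ->
        let p' := hoelder_conjugate p in
        is_dual_of (besov phi s p 1) (besov_norm phi s p 1)
          (besov_c phi (- s)%R p') (besov_norm phi (- s)%R p' +oo)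
          (besov_pairing phi),
      forall (s : R) (q : \bar R), 1 < q -> (s < n%:R)%R ->
        let q' := hoelder_conjugate q in
        is_dual_of (besov phi s 1 q) (besov_norm phi s 1 q)
          (besov_0 phi (- s)%R q') (besov_norm phi (- s)%R +oo q')
          (besov_pairing phi) &
      forall s : R, (s <= n%:R)%R ->
        is_dual_of (besov phi s 1 1) (besov_norm phi s 1 1)
          (besov_c phi (- s)%R +oo `&` besov_0 phi (- s)%R +oo)
          (besov_norm phi (- s)%R +oo +oo)
          (besov_pairing phi)].
Proof.
move=> _ cphi; split.
- by move=> s p q p1 q1; exact: pairing_part.
- by move=> s p q p1 q1 sp; exact: besov_dual.
- by move=> s p p1 sp; exact: besov_c_dual.
- by move=> s q q1 sn; exact: besov_0_dual.
- by move=> s sn; exact: besov_c0_dual.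
Qed.
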